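(* Let $\mathcal H_{r,s}(m\omega_1;q,t,a)$ be the DAHA-superpolynomial of type $A$ of the torus knot $T(r,s)$ defined in the context, and let $(x;q)_n=(1-x)(1-xq)\cdots(1-xq^{n-1})$. For any $p\in\mathbb Z_+$ and $m\in\mathbb N$, $$\mathcal H_{2p+1,2}(m\omega_1;q,t,a)=\frac{(q;q)_m}{(-a;q)_m(1-t)}\sum_{k=0}^m(-1)^{m-k}(qt)^{\frac{m-k}2}\Big(q^{\frac{m(m+1)}2-\frac{k(k+1)}2}\Big(\frac tq\Big)^{\frac{m-k}2}\Big)^{2p+1}\frac{(t;q)_k(-a;q)_{m+k}(-a/t;q)_{m-k}(1-q^{2k}t)}{(q;q)_k(qt;q)_{m+k}(q;q)_{m-k}},$$ and for the trefoil, $$\mathcal H_{3,2}(m\omega_1;q,t,a)=\sum_{k=0}^mq^{mk}t^k\,\frac{(q;q)_m(-a/t;q)_k}{(q;q)_k(q;q)_{m-k}} .$$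
   Context: **DAHA of type $A_N$.** $R=A_N$ with $(\alpha,\alpha)=2$, simple roots $\alpha_i$, fundamental weights $\omega_i$, weight lattice $P$, $P_+=\oplus\mathbb Z_+\omega_i$, $Q_+=\oplus\mathbb Z_+\alpha_i$, $\rho=\sum\omega_i$, highest root $\vartheta$, $W=\mathbf S_{N+1}$, $\alpha_0=[-\vartheta,1]$. $\widehat W=W\ltimes P$ acts on $[z,\zeta]$ by $(wb)([z,\zeta])=[w(z),\zeta-(z,b)]$; $\widehat W=\langle s_0,\dots,s_N\rangle\rtimes\Pi$, $\Pi=\{\mathrm{id},\pi_r\}$, $\omega_r=\pi_ru_r$ with $u_r\in W$ of minimal length such that $u_r(\omega_r)\in-P_+$. The DAHA is generated over $\mathbb Z[q^{\pm1/(2N+2)},t^{\pm1/2}]$ by $T_0,\dots,T_N$, $\Pi$ and commuting $X_b$ ($b\in P$), $X_{b+c}=X_bX_c$, $X_{[b,j]}=X_bq^j$, with relations $(T_i-t^{1/2})(T_i+t^{-1/2})=0$, affine braid relations, $\pi_rT_i\pi_r^{-1}=T_j$ if $\pi_r(\alpha_i)=\alpha_j$, $T_iX_b=X_bX_{\alpha_i}^{-1}T_i^{-1}$ if $(b,\alpha_i)=1$, $T_iX_b=X_bT_i$ if $(b,\alpha_i)=0$ (with $(b,\alpha_0)=-(b,\vartheta)$), $\pi_rX_b\pi_r^{-1}=X_{\pi_r(b)}$. $T_{\hat w}=\pi_rT_{i_l}\cdots T_{i_1}$ for reduced $\hat w=\pi_rs_{i_l}\cdots s_{i_1}$; $Y_{\omega_i}=T_{\omega_i}$,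 $Y_b=\prod Y_{\omega_i}^{l_i}$ for $b=\sum l_i\omega_i$. Anti-involution $\varphi$: $X_b\leftrightarrow Y_b^{-1}$, $T_i\mapsto T_i$ ($i>0$). $\tau_+$ fixes $X_b,T_i$ ($i>0$), $q,t$ and sends $T_0\mapsto q^{-1}X_\vartheta T_0^{-1}$, $\pi_r\mapsto q^{-(\omega_r,\omega_r)/2}X_{\omega_r}\pi_r$; $\tau_-=\varphi\tau_+\varphi$. They project to $\begin{pmatrix}1&1\\0&1\end{pmatrix}$ and $\begin{pmatrix}1&0\\1&1\end{pmatrix}$ in $SL_2(\mathbb Z)$. The DAHA acts on Laurent polynomials: $X_b$ by multiplication, $T_i=t^{1/2}s_i+(t^{1/2}-t^{-1/2})(X_{\alpha_i}-1)^{-1}(s_i-1)$ ($0\le i\le N$), $\pi_r(X_b)=X_{\pi_r(b)}$; $\{H\}_{ev}$ is $H(1)$ evaluated at $X_a\mapsto t^{-(\rho,a)}$. The Macdonald polynomial $P_b$ ($b\in P_+$) is the $W$-invariant polynomial with $P_b-\sum_{b'\in W(b)}X_{b'}$ in the span of $X_c$ with dominant representative $c_+\in b-Q_+$, $c_+\ne b$, and with zero constant term of $P_bX_c^{-1}\mu$ for these $c$, $\mu=\prod_{\alpha>0}\prod_{j\ge0}\frac{(1-X_\alpha q^j)(1-X_\alpha^{-1}q^{j+1})}{(1-X_\alpha tq^j)(1-X_\alpha^{-1}tq^{j+1})}$. $\widetilde{JD}{}^{A_N}_{r,s}(b;q,t)$ is $\{\hat\gamma(P_b/P_b(t^{-\rho}))\}_{ev}$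 divided by its lowest $q,t$-monomial, where $\hat\gamma$ is a product of $\tau_\pm^{\pm1}$ whose image in $SL_2(\mathbb Z)$ has first column $(r,s)^{tr}$; it is $1$ for $A_0$. **Superpolynomial.** $\mathcal H_{r,s}(m\omega_1;q,t,a)$ is the (unique) polynomial in $a,q,t^{\pm1}$ such that its coefficient of $a^0$ has the form $\sum_{u,v\ge0}C_{u,v}q^ut^v$ with $C_{0,0}=1$ and $\mathcal H_{r,s}(m\omega_1;q,t,a=-t^{N+1})=\widetilde{JD}{}^{A_N}_{r,s}(m\omega_1;q,t)$ for all $N\ge0$; its existence is a known theorem. $\mathbb Z_+=\{0,1,\dots\}$, $\mathbb N=\{1,2,\dots\}$. *)

(* Defs.v *)
From HB Require Import structures.
From mathcomp Require Import all_boot all_order all_fingroup all_algebra.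
From mathcomp Require Import fraction finmap.
From mathcomp.multinomials Require Import monalg.

Set Implicit Arguments.
Unset Strict Implicit.
Unset Printing Implicit Defensive.

Import GRing.Theory Num.Theory.

Local Open Scope fset_scope.
Local Open Scope ring_scope.

(* The group algebra R[P] of an additive abelian group P.  The module is that *)
(* of [monalg]; the ring structure of [monalg] is not available here because  *)
(* it asks for exponents without non-trivial invertible elements.             *)
Section GroupAlgebra.
Variables (P : zmodType) (R : comNzRingType).

Definition galg : Type := {malg R[P]}.

HB.instance Definition _ := GRing.Lmodule.on galg.

Implicit Types (f g : galg) (b c : P).

Definition gX b : galg := << b >>.

Definition gmul f g : galg :=
  \sum_(b <- msupp f) \sum_(c <- msupp g) << f@_b * g@_c *g b + c >>.

Lemma gmulw (d1 d2 : {fset P}) f g :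
  msupp f `<=` d1 -> msupp g `<=` d2 ->
  gmul f g = \sum_(b <- d1) \sum_(c <- d2) << f@_b * g@_c *g b + c >>.
Proof.
move=> le1 le2; rewrite /gmul (big_fset_incl _ le1) /=.
  apply/eq_bigr=> b _; apply/big_fset_incl => // c _ /mcoeff_outdom ->.
  by rewrite mulr0 monalgU0.
move=> b _ /mcoeff_outdom fb.
by rewrite big1 // => c _; rewrite fb mul0r monalgU0.
Qed.

Lemma galgE f : f = \sum_(b <- msupp f) (<< f@_b *g b >> : galg).
Proof. exact: monalgE. Qed.

Lemma gmulC : commutative gmul.
Proof.
move=> f g; rewrite /gmul exchange_big /=.
by apply/eq_bigr=> b _; apply/eq_bigr=> c _; rewrite mulrC addrC.
Qed.

Lemma gmul0 : left_zero 0 gmul.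
Proof. by move=> g; rewrite /gmul msupp0 big_seq_fset0. Qed.

Lemma gmulUU (x y : R) b c :
  gmul << x *g b >> << y *g c >> = << x * y *g b + c >>.
Proof.
by rewrite (gmulw msuppU_le msuppU_le) !big_seq_fset1 !mcoeffUU.
Qed.

Lemma gmulDl : left_distributive gmul +%R.
Proof.
move=> f g h.
rewrite (gmulw (fsubsetUl (msupp f) (msupp g)) (fsubset_refl (msupp h))).
rewrite (gmulw (fsubsetUr (msupp f) (msupp g)) (fsubset_refl (msupp h))).
rewrite (gmulw (msuppD_le f g) (fsubset_refl (msupp h))) -big_split /=.
apply/eq_bigr=> b _; rewrite -big_split /=; apply/eq_bigr=> c _.
by rewrite mcoeffD mulrDl monalgUD.
Qed.

Lemma gmulDr : right_distributive gmul +%R.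
Proof. by move=> f g h; rewrite ![gmul f _]gmulC gmulDl. Qed.

Lemma gmul_suml (I : Type) (s : seq I) (F : I -> galg) g :
  gmul (\sum_(i <- s) F i) g = \sum_(i <- s) gmul (F i) g.
Proof. exact: (big_morph (gmul^~ g) (fun _ _ => gmulDl _ _ _) (gmul0 g)). Qed.

Lemma gmul_sumr (I : Type) (s : seq I) (F : I -> galg) g :
  gmul g (\sum_(i <- s) F i) = \sum_(i <- s) gmul g (F i).
Proof. by rewrite gmulC gmul_suml; apply/eq_bigr=> i _; rewrite gmulC. Qed.

Lemma gmulA : associative gmul.
Proof.
move=> f g h; rewrite [f]galgE !gmul_suml; apply/eq_bigr=> b _.
rewrite [g]galgE gmul_suml !gmul_sumr gmul_suml; apply/eq_bigr=> c _.
rewrite [h]galgE !gmul_sumr; apply/eq_bigr=> d _.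
by rewrite !gmulUU mulrA addrA.
Qed.

Lemma gmul1 : left_id (gX 0) gmul.
Proof.
move=> g; rewrite [g in LHS]galgE gmul_sumr [RHS]galgE.
by apply/eq_bigr=> b _; rewrite gmulUU mul1r add0r.
Qed.

Lemma gone_neq0 : gX 0 != 0.
Proof. by rewrite monalgU_eq0 oner_eq0. Qed.

HB.instance Definition _ := GRing.Zmodule_isComNzRing.Build galg
  gmulA gmulC gmul1 gmulDl gone_neq0.

Lemma gscaleAl (x : R) f g : x *: (f * g) = (x *: f) * g.
Proof.
have ZU y b : x *: (<< y *g b >> : galg) = << x * y *g b >>.
  by apply/malgP=> c; rewrite mcoeffZ !mcoeffU mulrnAr.
rewrite [f]galgE [(_ * g : galg)]gmul_suml !scaler_sumr.
rewrite [RHS]gmul_suml; apply/eq_bigr=> b _.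
rewrite [g]galgE !gmul_sumr !scaler_sumr; apply/eq_bigr=> c _.
by rewrite gmulUU !ZU gmulUU mulrA.
Qed.

HB.instance Definition _ := GRing.Lmodule_isLalgebra.Build R galg gscaleAl.

End GroupAlgebra.

Local Notation "x %:F" := (@FracField.tofrac _ x).

(* The field Q(u, v).  It contains q = u ^ (2 N + 2) and t = v ^ 2, so that u *)
(* and v stand for q ^ (1 / (2 N + 2)) and t ^ (1 / 2).  In p : coefRing the  *)
(* coefficient of u ^ i v ^ j is p`_i`_j.                                     *)
Notation coefRing := {poly {poly rat}}.
Notation coefField := {fraction coefRing}.

Definition u : coefField := ('X : coefRing)%:F.
Definition v : coefField := (('X : {poly rat})%:P : coefRing)%:F.

Section TypeA.
Variable N : nat.

(* b : wt is the weight \sum_i b_i omega_(i+1), with i from 0 to N - 1. *)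
Definition wt : Type := 'rV[int]_N.
HB.instance Definition _ := GRing.Zmodule.on wt.
Implicit Types (b c : wt).

(* b is the projection of \sum_k (eps b k) eps_k to the hyperplane orthogonal *)
(* to \sum_k eps_k in R^(N+1), with k from 0 to N.                            *)
Definition eps b (k : 'I_N.+1) : int := \sum_(i < N | (k <= i)%N) b 0 i.

Definition ip b c : rat :=
  (\sum_k eps b k * eps c k)%:~R
  - ((\sum_k eps b k) * (\sum_k eps c k))%:~R / N.+1%:R.

(* omega 0 and omega N.+1 are 0 *)
Definition omega (r : nat) : wt := \row_(j < N) (j.+1 == r)%:Z.
Definition alpha (i : nat) : wt := omega i *+ 2 - omega i.-1 - omega i.+1.
Definition theta : wt := \sum_(1 <= i < N.+1) alpha i.
Definition rho : wt := \sum_(1 <= i < N.+1) omega i.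

Definition dominant b : Prop := forall i, 0 <= b 0 i.

(* w sends eps_k to eps_(w k) *)
Definition wact (w : {perm 'I_N.+1}) b : wt :=
  \row_(i < N) (eps b ((w^-1)%g (widen_ord (leqnSn N) i))
                - eps b ((w^-1)%g (lift ord0 i))).

Definition len (w : {perm 'I_N.+1}) : nat :=
  #|[set ij : 'I_N.+1 * 'I_N.+1 | (ij.1 < ij.2)%N && (w ij.2 < w ij.1)%N]|.

(* Elements of the affine Weyl group are given by their action on [z, zeta]. *)
Definition awt : Type := (wt * rat)%type.
Implicit Types (z : awt).

Definition aroot (i : 'I_N.+1) : awt :=
  if i == ord0 then (- theta, 1) else (alpha i, 0).

(* (z, alpha_i) is an integer, hence it is its own numerator. *)
Definition srefl (i : 'I_N.+1) z : awt :=
  (z.1 - (aroot i).1 *~ numq (ip z.1 (aroot i).1),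
   z.2 - ip z.1 (aroot i).1 * (aroot i).2).

Definition transl b z : awt := (z.1, z.2 - ip z.1 b).

Definition umin (r : 'I_N.+1) : {perm 'I_N.+1} :=
  [arg min_(w < perm (@rev_ord_inj N.+1)
              | [forall i, (wact w (omega r) 0 i <= 0)%R]) len w]%N.

(* pi_r = omega_r u_r^-1; for r = 0 this is the identity. *)
Definition pi_act (r : 'I_N.+1) z : awt :=
  transl (omega r) (wact (umin r)^-1%g z.1, z.2).

Definition word_act (r : 'I_N.+1) (s : seq 'I_N.+1) z : awt :=
  pi_act r (foldr srefl z s).

Definition reduced (f : awt -> awt) (r : 'I_N.+1) (s : seq 'I_N.+1) : Prop :=
  word_act r s =1 f /\
  forall r' s', word_act r' s' =1 f -> (size s <= size s')%N.

Definition q : coefField := u ^+ (2 * N + 2).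
Definition t : coefField := v ^+ 2.
(* q ^ x for x in (1 / (2 N + 2)) Z, and t ^ x for x in (1 / 2) Z *)
Definition qpow (x : rat) : coefField := u ^ numq (x * (2 * N + 2)%:R).
Definition tpow (x : rat) : coefField := v ^ numq (x * 2%:R).

Definition laurent : Type := galg wt coefField.
HB.instance Definition _ := GRing.Lalgebra.on laurent.
HB.instance Definition _ := GRing.ComNzRing.on laurent.
Implicit Types (f : laurent).

Definition LX b : laurent := gX coefField b.
Definition LXa z : laurent := qpow z.2 *: LX z.1.

(* extension of X_b |-> X_(F b) to Laurent polynomials *)
Definition lact (F : awt -> awt) f : laurent :=
  \sum_(b <- msupp f) f@_b *: LXa (F (b, 0)).

Definition lev f : coefField := \sum_(b <- msupp f) f@_b * tpow (- ip rho b).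

Section Relations.
Variables (H : algType coefField).
Variables (T Pi : 'I_N.+1 -> H) (X : wt -> H).

Definition Xa z : H := qpow z.2 *: X z.1.

(* the inverse of T_i, by the quadratic relation *)
Definition Tinv i : H := T i - (v - v^-1)%:A.

Record daha_rels : Prop := DahaRels {
  rel_quad : forall i, (T i - v%:A) * (T i + v^-1%:A) = 0;
  (* the two nodes of the affine diagram of A_1 have scalar product -2, and  *)
  (* satisfy no relation                                                     *)
  rel_comm : forall i j, ip (aroot i).1 (aroot j).1 = 0 ->
    T i * T j = T j * T i;
  rel_braid : forall i j, ip (aroot i).1 (aroot j).1 = -1 ->
    T i * T j * T i = T j * T i * T j;
  rel_X0 : X 0 = 1;
  rel_XD : forall b c, X (b + c) = X b * X c;
  rel_pi1 : Pi ord0 = 1;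
  rel_piM : forall r r' r'', pi_act r \o pi_act r' =1 pi_act r'' ->
    Pi r * Pi r' = Pi r'';
  rel_piT : forall r i j, pi_act r (aroot i) = aroot j ->
    Pi r * T i = T j * Pi r;
  rel_piX : forall r b, Pi r * X b = Xa (pi_act r (b, 0)) * Pi r;
  rel_TX1 : forall i b, ip b (aroot i).1 = 1 ->
    T i * X b = X b * Xa (- (aroot i).1, - (aroot i).2) * Tinv i;
  rel_TX0 : forall i b, ip b (aroot i).1 = 0 -> T i * X b = X b * T i
}.

Definition Y_spec (Y : wt -> H) : Prop :=
  [/\ Y 0 = 1,
      forall b c, Y (b + c) = Y b * Y c &
      forall (i : 'I_N) r s, reduced (transl (omega i.+1)) r s ->
        Y (omega i.+1) = Pi r * \prod_(j <- s) T j].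

Definition phi_spec (Y : wt -> H) (phi : {linear H -> H}) : Prop :=
  [/\ forall x y, phi (x * y) = phi y * phi x,
      forall x, phi (phi x) = x,
      forall b, phi (X b) = Y (- b),
      forall b, phi (Y b) = X (- b) &
      forall i, i != ord0 -> phi (T i) = T i].

Definition tau_spec (tau tauV : {lrmorphism H -> H}) : Prop :=
  [/\ cancel tau tauV /\ cancel tauV tau,
      forall b, tau (X b) = X b,
      forall i, i != ord0 -> tau (T i) = T i,
      tau (T ord0) = q^-1 *: (X theta * Tinv ord0) &
      forall r, tau (Pi r) =
        qpow (- (ip (omega r) (omega r) / 2%:R)) *: (X (omega r) * Pi r)].

(* The operator of T_i is t^(1/2) s_i                                        *)
(*   + (t^(1/2) - t^(-1/2)) (X_(alpha_i) - 1)^-1 (s_i - 1).                  *)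
Record polrep_spec (act : H -> laurent -> laurent) : Prop := PolrepSpec {
  act_linear : forall h (k : coefField) f g,
    act h (k *: f + g) = k *: act h f + act h g;
  act_linearl : forall (k : coefField) h h' f,
    act (k *: h + h') f = k *: act h f + act h' f;
  act_1 : forall f, act 1 f = f;
  act_M : forall h h' f, act (h * h') f = act h (act h' f);
  act_X : forall b f, act (X b) f = LX b * f;
  act_T : forall i f,
    (LXa (aroot i) - 1) * (act (T i) f - v *: lact (srefl i) f)
    = (v - v^-1) *: (lact (srefl i) f - f);
  act_Pi : forall r f, act (Pi r) f = lact (pi_act r) f
}.

End Relations.

Definition gens_map (H H' : algType coefField)
    (T Pi : 'I_N.+1 -> H) (X : wt -> H)
    (T' Pi' : 'I_N.+1 -> H') (X' : wt -> H') (g : H -> H') : Prop :=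
  [/\ forall i, g (T i) = T' i, forall r, g (Pi r) = Pi' r &
      forall b, g (X b) = X' b].

(* The algebra over Q(u, v) presented by these generators and relations. *)
Definition is_daha (H : algType coefField)
    (T Pi : 'I_N.+1 -> H) (X : wt -> H) : Prop :=
  daha_rels T Pi X /\
  forall (H' : algType coefField) (T' Pi' : 'I_N.+1 -> H') (X' : wt -> H'),
    daha_rels T' Pi' X' ->
    exists2 g : {lrmorphism H -> H'}, gens_map T Pi X T' Pi' X' g &
      forall g' : {lrmorphism H -> H'}, gens_map T Pi X T' Pi' X' g' -> g' =1 g.

(* All the data below are determined by N, up to isomorphism. *)
Record daha := Daha {
  daha_alg : algType coefField;
  dT : 'I_N.+1 -> daha_alg;
  dPi : 'I_N.+1 -> daha_alg;
  dX : wt -> daha_alg;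
  dY : wt -> daha_alg;
  dphi : {linear daha_alg -> daha_alg};
  dtau : {lrmorphism daha_alg -> daha_alg};
  dtauV : {lrmorphism daha_alg -> daha_alg};
  dact : daha_alg -> laurent -> laurent;
  dahaP : is_daha dT dPi dX;
  dYP : Y_spec dT dPi dY;
  dphiP : phi_spec dT dX dY dphi;
  dtauP : tau_spec dT dPi dX dtau dtauV;
  dactP : polrep_spec dT dPi dX dact
}.

(* Macdonald polynomials *)

Definition geom (M : nat) f : laurent := \sum_(k < M) f ^+ k.

(* mu modulo (q ^ M, t ^ M), after expanding its denominators as geometric   *)
(* series: mu is a Laurent series in the X_alpha over Q[t][[q]].             *)
Definition mu (M : nat) : laurent :=
  \prod_(i < N.+1) \prod_(j < N.+1 | (i < j)%N)
    let a := \sum_(i.+1 <= k < j.+1) alpha k in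
    \prod_(k < M)
      ((1 - q ^+ k *: LX a) * (1 - q ^+ k.+1 *: LX (- a))
       * geom M (t * q ^+ k *: LX a) * geom M (t * q ^+ k.+1 *: LX (- a))).

(* The constant term of f mu vanishes: D clears the denominators of f, and   *)
(* the constant term of D f mu, a power series in u and v, is 0 modulo       *)
(* (u ^ M, v ^ M) for all M.                                                 *)
Definition ct_mu_eq0 f : Prop :=
  exists D : coefRing,
    [/\ D != 0,
        forall b, exists p : coefRing, D%:F * f@_b = p%:F &
        forall M : nat, exists2 p : coefRing, D%:F * (f * mu M)@_0 = p%:F &
          forall i j : nat, (i < M)%N -> (j < M)%N -> p`_i`_j = 0].

(* c_+ belongs to b - Q_+ and differs from b *)
Definition below c b : Prop :=
  exists w : {perm 'I_N.+1},
    [/\ dominant (wact w c), wact w c != b &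
        exists k : 'I_N -> nat, b - wact w c = \sum_(i < N) alpha i.+1 *+ k i].

Definition orbit_sum b : laurent :=
  \sum_(c <- undup [seq wact w b | w : {perm 'I_N.+1}]) LX c.

Definition is_macdonald b (P : laurent) : Prop :=
  [/\ forall (w : {perm 'I_N.+1}) c, P@_(wact w c) = P@_c,
      forall c, c \in msupp (P - orbit_sum b) -> below c b &
      forall c, below c b -> ct_mu_eq0 (P * LX (- c))].

End TypeA.

(* Products of tau_+, tau_- and their inverses *)

Variant letter := TauP | TauPV | TauM | TauMV.

Definition letter_mx (l : letter) : 'M[int]_2 :=
  \matrix_(i, j)
    if i == j then 1
    else match l with
         | TauP => (i < j)%N%:Z
         | TauPV => - (i < j)%N%:Z
         | TauM => (j < i)%N%:Z
         | TauMV => - (j < i)%N%:Z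
         end.

Definition word_mx (s : seq letter) : 'M[int]_2 :=
  \prod_(l <- s) letter_mx l.

Definition letter_map N (D : daha N) (l : letter) : daha_alg D -> daha_alg D :=
  match l with
  | TauP => dtau D
  | TauPV => dtauV D
  | TauM => dphi D \o dtau D \o dphi D
  | TauMV => dphi D \o dtauV D \o dphi D
  end.

Definition word_map N (D : daha N) (s : seq letter) (h : daha_alg D) :
    daha_alg D :=
  foldr (letter_map (D := D)) h s.

(* J is E divided by its lowest monomial. *)
Definition tilde_normalized (E J : coefField) : Prop :=
  exists (x y : int) (p : coefRing),
    [/\ E = u ^ x * v ^ y * J, J = p%:F & p`_0`_0 != 0].

(* J is the DAHA-Jones polynomial of type A_N of T(r,s) colored by m omega_1 *)
Definition is_JD (N r s m : nat) (J : coefField) : Prop :=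
  if N == 0%N then J = 1 else
  exists (D : daha N) (g : seq letter) (P : laurent N),
    [/\ word_mx g 0 0 = r%:Z /\ word_mx g 1 0 = s%:Z,
        is_macdonald (omega N 1 *+ m) P &
        tilde_normalized
          (lev (dact (word_map g
             ((lev P)^-1 *: \sum_(b <- msupp P) P@_b *: dX D b)) 1)) J].

(* H : superpoly is a polynomial in a, q, t^(+-1); the coefficient of        *)
(* a ^ i q ^ j t ^ k is H@_(i, j, k).                                        *)
Notation superpoly := {malg rat[(nat * nat * int)%type]}.

Definition sp_eval (F : fieldType) (a q t : F) (H : superpoly) : F :=
  \sum_(e <- msupp H) ratr H@_e * (a ^+ e.1.1 * q ^+ e.1.2 * t ^ e.2).

Definition is_superpoly (r s m : nat) (H : superpoly) : Prop :=
  [/\ forall j k, H@_(0%N, j, k) != 0 -> 0 <= k,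
      H@_(0%N, 0%N, 0) = 1 &
      forall N : nat, is_JD N r s m (sp_eval (- t ^+ N.+1) (q N) t H)].

Definition qpoch (F : fieldType) (x q : F) (n : nat) : F :=
  \prod_(i < n) (1 - x * q ^+ i).

(* Q(q^(1/2), t^(1/2), a), where u and v stand for q^(1/2) and t^(1/2) *)
Notation spField := {fraction {poly coefField}}.

Definition sp_a : spField := ('X : {poly coefField})%:F.
Definition sp_qh : spField := (u%:P : {poly coefField})%:F.
Definition sp_th : spField := (v%:P : {poly coefField})%:F.

(* Main.v *)
(* The Macdonald polynomial of m omega_1 is a multiple of the coefficient g_m of
   the generating series prod_(k, i) (1 - t q^i x_k z) / (1 - q^i x_k z), with
   x_k = X_(eps_k): the functional equations of this series under s_i and pi
   force the constant terms of g_m mu X_c^(-1) to vanish for all c below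
   m omega_1.

   Conjugation by phi turns an SL_2(Z)-word with first column (2p+1, 2) into
   tau_-^p tau_+ tau_-.  The vector tau_+ tau_- (g_m) 1 solves a pair of
   equations in the polynomial representation, whose solution is an alternating
   sum of the products g_a g_b with a + b = 2m.  Expanding these products in the
   two-row polynomials R_(2m, s), whose expansion coefficients are those of the
   Rogers polynomials, diagonalizes tau_-; evaluating at t^(-rho) gives the
   formula at a = -t^(N+1), up to a monomial in u and v.  That monomial is
   trivial since both sides have a nonzero constant term.

   The points (q^(1/2), t^(1/2), a) = (u^(N+1), v, -v^(2N+2)), for N large, lie on
   no fixed hypersurface, so the identities for all N give the formula.  The
   trefoil case is the formula with p = 1, rewritten by the q-Vandermonde sum and
   a terminating very-well-poised sum. *)
From HB Require Import structures.
Require Import Defs.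
From mathcomp Require Import all_boot all_order all_fingroup all_algebra fraction finmap.
From mathcomp.multinomials Require Import monalg.
From mathcomp Require Import zify ring lra.
From mathcomp Require boolp generic_quotient.
Set Implicit Arguments. Unset Strict Implicit. Unset Printing Implicit Defensive.
Import Order.TTheory GRing.Theory Num.Theory.
Local Open Scope ring_scope.

Module Weights.
Section Weights.
Variable N : nat.
Implicit Types (nu : 'I_N.+1 -> int) (b c : wt N) (k i j : 'I_N.+1).

Definition wtE nu : wt N :=
  \row_i (nu (widen_ord (leqnSn N) i) - nu (lift ord0 i)).

Lemma eps_wtE nu k : eps (wtE nu) k = nu k - nu ord_max.
Proof.
rewrite /eps.
pose nu' (j : nat) := nu (inord j).
have -> : nu k = nu' k by rewrite /nu' inord_val.
have -> : nu ord_max = nu' N.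
  by rewrite /nu'; congr nu; apply/val_inj; rewrite /= inordK.
have kN : (k <= N)%N by rewrite -ltnS.
transitivity (\sum_(k <= i < N) (nu' i - nu' i.+1)).
  rewrite big_geq_mkord; apply: eq_big => // i _; rewrite mxE /nu'.
  have -> : widen_ord (leqnSn N) i = inord i by apply/val_inj; rewrite /= inordK // ltnS ltnW.
  by have -> : lift ord0 i = inord i.+1 by apply/val_inj; rewrite /= inordK // ltnS.
rewrite -[RHS]opprB -(telescope_sumr nu' kN) -sumrN.
by apply: eq_bigr => i _; rewrite opprB.
Qed.

Lemma wtE_eps b : wtE (eps b) = b.
Proof.
apply/rowP=> i; rewrite mxE /eps /= (bigD1 i) //=.
rewrite [X in _ + X - _](_ : _ = \sum_(j < N | (bump 0 i <= j)%N) b 0 j) ?addrK //.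
by apply: eq_bigl => j; rewrite /bump /= add1n ltn_neqAle andbC eq_sym.
Qed.

Lemma wtE_ext nu nu' : nu =1 nu' -> wtE nu = wtE nu'.
Proof. by move=> E; apply/rowP=> i; rewrite !mxE !E. Qed.

Lemma wtED nu nu' : wtE nu + wtE nu' = wtE (fun k => nu k + nu' k).
Proof. by apply/rowP=> i; rewrite !mxE opprD addrACA. Qed.

Lemma wtEN nu : - wtE nu = wtE (fun k => - nu k).
Proof. by apply/rowP=> i; rewrite !mxE opprB opprK addrC. Qed.

Lemma wtEB nu nu' : wtE nu - wtE nu' = wtE (fun k => nu k - nu' k).
Proof. by rewrite wtEN wtED. Qed.

Lemma wtE0 : wtE (fun=> 0) = 0.
Proof. by apply/rowP=> i; rewrite !mxE subrr. Qed.

Lemma wtEMn nu m : wtE nu *+ m = wtE (fun k => nu k *+ m).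
Proof. by apply/rowP=> i; rewrite mulmxnE !mxE mulrnBl. Qed.

Lemma wtE_sum (I : Type) (r : seq I) (P : pred I) (F : I -> 'I_N.+1 -> int) :
  \sum_(i <- r | P i) wtE (F i) = wtE (fun k => \sum_(i <- r | P i) F i k).
Proof.
by apply/rowP=> i; rewrite summxE mxE -sumrB; apply: eq_bigr => j _; rewrite mxE.
Qed.

Lemma wtE_eq nu nu' : wtE nu = wtE nu' ->
  forall k, nu k - nu ord_max = nu' k - nu' ord_max.
Proof. by move=> E k; rewrite -!eps_wtE E. Qed.

Lemma wtE_inj nu nu' : \sum_k nu k = \sum_k nu' k -> wtE nu = wtE nu' -> nu =1 nu'.
Proof.
move=> S /wtE_eq E k; have: \sum_k (nu k - nu ord_max) = \sum_k (nu' k - nu' ord_max).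
  by apply: eq_bigr => j _; apply: E.
rewrite !sumrB S => /addrI/oppr_inj; rewrite !sumr_const !card_ord.
move=> H; have {}H : nu ord_max = nu' ord_max.
  by apply: (@mulIf _ (N.+1%:R : int)); rewrite ?mulr_natr ?pnatr_eq0.
by have := E k; rewrite H => /addIr.
Qed.

Lemma wact_wtE (w : {perm 'I_N.+1}) nu :
  wact w (wtE nu) = wtE (fun k => nu ((w^-1)%g k)).
Proof. by apply/rowP=> i; rewrite !mxE !eps_wtE opprB addrA subrK. Qed.

Lemma ip_wtE nu nu' : ip (wtE nu) (wtE nu') =
  (\sum_k nu k * nu' k)%:~R
  - ((\sum_k nu k) * (\sum_k nu' k))%:~R / N.+1%:R.
Proof.
rewrite /ip; under eq_bigr do rewrite !eps_wtE.
under [X in (X * _)%:~R]eq_bigr do rewrite eps_wtE.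
under [X in (_ * X)%:~R]eq_bigr do rewrite eps_wtE.
set a := nu ord_max; set b := nu' ord_max.
have -> : \sum_k (nu k - a) * (nu' k - b) =
  \sum_k nu k * nu' k - a * \sum_k nu' k - b * \sum_k nu k + a * b * N.+1%:R.
  rewrite !mulr_sumr -!sumrB mulr_natr -[X in _ *+ X]card_ord -sumr_const -big_split.
  by apply: eq_bigr => k _ /=; ring.
rewrite !sumrB !sumr_const !card_ord -[a *+ _]mulr_natr -[b *+ _]mulr_natr.
set A := \sum_k nu k; set B := \sum_k nu' k; set C := \sum_k _.
have n0 : N.+1%:R != 0 :> rat by rewrite pnatr_eq0.
have K (a' b' A' B' C' n : rat) : n != 0 -> C' - a' * B' - b' * A' + a' * b' * n
    - (A' - a' * n) * (B' - b' * n) / n = C' - A' * B' / n by move=> ?; field.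
by rewrite !(rmorphM, rmorphD, rmorphN, rmorphB) /= !rmorph_nat; exact: K.
Qed.

Definition ee k : 'I_N.+1 -> int := fun j => (j == k)%:Z.

Lemma sum_ee k nu : \sum_j ee k j * nu j = nu k.
Proof.
rewrite (bigD1 k) //= /ee eqxx mul1r big1 ?addr0 // => j /negPf ->.
by rewrite mul0r.
Qed.

Lemma sum_ee1 k : \sum_j ee k j = 1.
Proof. by rewrite (eq_bigr (fun j => ee k j * 1)) ?sum_ee // => j; rewrite mulr1. Qed.

Lemma omegaE r : omega N r = wtE (fun k => (k < r)%N%:Z).
Proof.
apply/rowP=> i; rewrite !mxE /= /bump /= add1n.
by case: (ltngtP i.+1 r) => [|//|]; rewrite ?ltnS; case: (ltngtP i r); lia.
Qed.

Lemma omega1 : omega N 1 = wtE (ee ord0).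
Proof. by rewrite omegaE; apply: wtE_ext => k; rewrite /ee ltnS leqn0 -val_eqE. Qed.

Lemma alphaE (i : nat) : (0 < i <= N)%N ->
  alpha N i = wtE (fun k => (k == i.-1 :> nat)%:Z - (k == i :> nat)%:Z).
Proof.
case/andP=> i0 iN; rewrite /alpha !omegaE wtEMn !wtEB; apply: wtE_ext => k.
rewrite !ltnS; case: i i0 iN => // i _ iN; rewrite /= !ltnS.
by case: (ltngtP k i); case: (ltngtP k i.+1); lia.
Qed.

Lemma thetaE : (0 < N)%N -> theta N = wtE (fun k => (k == ord0)%:Z - (k == ord_max)%:Z).
Proof.
move=> N0; rewrite /theta big_add1 /=.
rewrite (@eq_big_nat _ _ _ _ _ _ (fun i : nat => wtE (fun k => (k == i :> nat)%:Z - (k == i.+1 :> nat)%:Z))).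
  rewrite wtE_sum; apply: wtE_ext => k.
  have := telescope_sumr (fun i : nat => (k == i :> nat)%:Z) (leq0n N).
  move/(congr1 -%R); rewrite opprB -sumrN -!val_eqE => <-.
  by apply: eq_bigr => i _; rewrite opprB.
by move=> i /andP[_ iN]; rewrite alphaE.
Qed.

Lemma rhoE : rho N = wtE (fun k => (N - k)%N%:Z).
Proof.
rewrite /rho; under eq_bigr do rewrite omegaE; rewrite wtE_sum; apply: wtE_ext => k.
rewrite -(big_morph _ PoszD (erefl (Posz 0))); congr Posz.
rewrite big_add1 /= (eq_bigr (fun i : nat => nat_of_bool (k <= i)%N)) // big_mkord.
transitivity (\sum_(i < N | (k <= i)%N) 1)%N; first by rewrite [RHS]big_mkcond; apply: eq_bigr => i _; case: leqP.
by rewrite -(big_geq_mkord k N xpredT (fun=> 1%N)) sum_nat_const_nat muln1.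
Qed.

Lemma ip_wtE_alpha nu (i : nat) : (0 < i <= N)%N ->
  ip (wtE nu) (alpha N i) = (nu (inord i.-1) - nu (inord i))%:~R.
Proof.
move=> iN; rewrite alphaE // ip_wtE.
have E (j : nat) : (j <= N)%N -> forall nu, \sum_(k < N.+1) (k == j :> nat)%:Z * nu k = nu (inord j).
  move=> jN nu'; rewrite -[RHS]sum_ee; apply: eq_bigr => k _.
  by rewrite /ee -val_eqE /= inordK.
have -> : \sum_(k < N.+1) nu k * ((k == i.-1 :> nat)%:Z - (k == i :> nat)%:Z) = nu (inord i.-1) - nu (inord i).
  under eq_bigr do rewrite mulrBr ![nu _ * _]mulrC.
  by rewrite sumrB !E //; lia.
have -> : \sum_(k < N.+1) ((k == i.-1 :> nat)%:Z - (k == i :> nat)%:Z) = 0.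
  rewrite sumrB; have F (j : nat) (jN : (j <= N)%N) := E j jN (fun=> 1).
  by under eq_bigr do rewrite -[_%:Z]mulr1; under [X in _ - X]eq_bigr do rewrite -[_%:Z]mulr1; rewrite !F ?subrr //; lia.
by rewrite mulr0 mul0r subr0.
Qed.

Definition we k : wt N := wtE (ee k).

Lemma ip_we k nu : ip (wtE nu) (we k) = (nu k)%:~R - (\sum_j nu j)%:~R / N.+1%:R.
Proof.
rewrite /we ip_wtE sum_ee1 mulr1; under eq_bigr do rewrite mulrC.
by rewrite sum_ee.
Qed.

Lemma ip_we_we j k : ip (we j) (we k) = (j == k)%:R - N.+1%:R^-1.
Proof.
by rewrite ip_we sum_ee1 mul1r /ee eq_sym -pmulrn.
Qed.

Lemma wact_we (w : {perm 'I_N.+1}) k : wact w (we k) = we (w k).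
Proof.
rewrite /we wact_wtE; apply: wtE_ext => j; rewrite /ee.
by rewrite -(inj_eq (@perm_inj _ w)) permKV.
Qed.

Lemma wactD (w : {perm 'I_N.+1}) b c : wact w (b + c) = wact w b + wact w c.
Proof. by rewrite -(wtE_eps b) -(wtE_eps c) wtED !wact_wtE wtED. Qed.

Lemma ipC b c : ip b c = ip c b.
Proof.
rewrite /ip [X in X%:~R / _]mulrC; congr (_%:~R - _).
by apply: eq_bigr => k _; rewrite mulrC.
Qed.

Lemma wtE_we nu : wtE nu = \sum_k we k *~ nu k.
Proof.
rewrite (eq_bigr (fun k => wtE (fun j => ee k j * nu k))).
  rewrite wtE_sum; apply: wtE_ext => j; rewrite (bigD1 j) //= big1 ?addr0 /ee ?eqxx ?mul1r //.
  by move=> i ij; rewrite eq_sym (negPf ij) mul0r.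
move=> k _; rewrite /we; apply/rowP=> i; rewrite -[wtE _ *~ _]scaler_int !mxE.
by rewrite -mulrBl mulrC intz.
Qed.

Lemma rho_we k : ip (rho N) (we k) = N%:R / 2%:R - k%:R.
Proof.
rewrite rhoE ip_we.
have -> : \sum_(j < N.+1) (N - j)%N%:Z = (N * N.+1)./2%N%:Z.
  rewrite -(big_morph _ PoszD (erefl (Posz 0))); congr Posz.
  rewrite (reindex_inj rev_ord_inj) /= -[RHS]/((N.+1.-1 * N.+1)./2)%N mulnC -bin2 -bin2_sum big_mkord.
  by apply: eq_bigr => i _; have := ltn_ord i; lia.
have n0 : N.+1%:R != 0 :> rat by rewrite pnatr_eq0.
have -> : ((N * N.+1)./2%N%:Z%:~R : rat) = N%:R * N.+1%:R / 2%:R.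
  apply: (@mulIf _ 2%:R); first by rewrite pnatr_eq0.
  rewrite divfK ?pnatr_eq0 // -[_%:~R]/(_%:R) -!natrM; congr _%:R.
  by have := odd_double_half (N * N.+1); rewrite oddM /= andbN add0n -muln2.
have kN : (k <= N)%N by rewrite -ltnS.
rewrite -[(N - k)%N%:~R]/((N - k)%:R) natrB //.
have K (a b n : rat) : n != 0 -> a - b - a * n / 2%:R / n = a / 2%:R - b by move=> ?; field.
exact: K.
Qed.

End Weights.

Section SimpleReflections.
Variable N : nat.
Implicit Types (i : 'I_N.+1).

Definition swp i : {perm 'I_N.+1} := tperm (inord i.-1) i.

Lemma aroot_n0 i : i != ord0 -> aroot i = (alpha N i, 0).
Proof. by rewrite /aroot => /negPf ->. Qed.

Lemma n0_bnd i : i != ord0 -> (0 < i <= N)%N.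
Proof. by rewrite -val_eqE /= -lt0n => ->; rewrite -ltnS ltn_ord. Qed.

Lemma inordm1_neq i : i != ord0 -> inord i.-1 != i.
Proof.
move=> /n0_bnd /andP[i0 iN]; rewrite -val_eqE /= inordK; last by rewrite ltnS; lia.
by rewrite neq_ltn prednK ?leqnn.
Qed.

Lemma alpha_we i : i != ord0 -> alpha N i = we (inord i.-1) - we i.
Proof.
move=> /n0_bnd i0; rewrite alphaE // wtEB; apply: wtE_ext => k.
by rewrite /ee -!val_eqE /= inordK //; lia.
Qed.

Lemma ip_alpha i nu : i != ord0 ->
  ip (wtE nu) (alpha N i) = (nu (inord i.-1) - nu i)%:~R.
Proof. by move=> /n0_bnd i0; rewrite ip_wtE_alpha // inord_val. Qed.

Lemma wact_swp i nu : i != ord0 -> wact (swp i) (wtE nu) =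
  wtE nu - alpha N i *~ (nu (inord i.-1) - nu i).
Proof.
move=> i0; rewrite wact_wtE alpha_we // wtEB.
have -> (m : int) (f : 'I_N.+1 -> int) : wtE f *~ m = wtE (fun k => f k * m).
  by apply/rowP=> j; rewrite -scaler_int !mxE intz mulrBr ![m * _]mulrC.
rewrite wtEB; apply: wtE_ext => k; rewrite tpermV /ee.
have ne := inordm1_neq i0.
case: tpermP => [->|->|/eqP/negPf H1 /eqP/negPf H2].
- by rewrite eqxx (negPf ne) subr0 mul1r opprB addrC subrK.
- by rewrite eqxx eq_sym (negPf ne) sub0r mulN1r opprK addrC subrK.
- by rewrite H1 H2 subrr mul0r subr0.
Qed.

Lemma srefl_n0 i z : i != ord0 -> srefl i z = (wact (swp i) z.1, z.2).
Proof.
move=> i0; rewrite /srefl aroot_n0 //= mulr0 subr0 -{1 2}(wtE_eps z.1).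
rewrite ip_alpha // numq_int -[in RHS](wtE_eps z.1) wact_swp // !wtE_eps.
Qed.

End SimpleReflections.
End Weights.

Module GroupAlgebraTheory.
Import Weights.

Section GroupAlgebra.
Variables (P : zmodType) (K : fieldType).
Local Notation A := (galg P K).
Implicit Types (f g : A) (b c : P) (k : K).

#[export] HB.instance Definition _ := GRing.Lalgebra_isComAlgebra.Build K (galg P K).

Lemma gXM b c : gX K b * gX K c = gX K (b + c) :> A.
Proof. by rewrite [LHS](gmulUU 1 1) mulr1. Qed.

Lemma gXZ k b : k *: (gX K b : A) = << k *g b >>.
Proof. by apply/malgP=> c; rewrite mcoeffZ !mcoeffU mulrnAr mulr1. Qed.

Lemma gX_coef b c : (gX K b : A)@_c = (b == c)%:R.
Proof. by rewrite mcoeffU. Qed.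

Lemma galgEX f : f = \sum_(b <- msupp f) f@_b *: (gX K b : A).
Proof. by rewrite {1}[f]galgE; apply: eq_bigr => b _; rewrite gXZ. Qed.

Lemma galg_ind (Q : A -> Prop) : Q 0 -> (forall f g, Q f -> Q g -> Q (f + g)) ->
  (forall k b, Q (k *: (gX K b : A))) -> forall f, Q f.
Proof.
move=> Q0 QD QX f; rewrite [f]galgEX; elim: (enum_fset _) => [|b s IH]; first by rewrite big_nil.
by rewrite big_cons; apply: QD.
Qed.

Lemma coef_gXl b f c : (gX K b * f : A)@_c = f@_(c - b).
Proof.
elim/galg_ind: f => [|f g Hf Hg|k d]; first by rewrite mulr0 !mcoeff0.
  by rewrite mulrDr !mcoeffD Hf Hg.
rewrite -scalerAr gXM !mcoeffZ !gX_coef.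
by rewrite -(inj_eq (addrI (- b))) addKr [- b + c]addrC.
Qed.

Lemma sum_msupp_widen (V : nmodType) (F : P -> V) f (d : {fset P}) :
  (msupp f `<=` d)%fset -> (forall b, f@_b = 0 -> F b = 0) ->
  \sum_(b <- msupp f) F b = \sum_(b <- d) F b.
Proof.
move=> le H; apply: big_fset_incl => // b _ bf; apply: H.
exact: mcoeff_outdom.
Qed.

Lemma coefM f g c : (f * g : A)@_c = \sum_(b <- msupp f) f@_b * g@_(c - b).
Proof.
rewrite {1}[f]galgEX mulr_suml raddf_sum /=.
by apply: eq_bigr => b _; rewrite -scalerAl mcoeffZ coef_gXl.
Qed.

(* X_a - k is a nonzero divisor: multiplication by X_a makes the support of a
   nonzero element drift to infinity. *)
Lemma gX_sub_reg (a : P) k f : (forall n, (0 < n)%N -> a *+ n != 0) ->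
  (gX K a - k%:A) * f = 0 -> f = 0.
Proof.
move=> a0 /eqP; rewrite mulrBl subr_eq0 -scalerAl mul1r => /eqP E.
have H c : f@_(c - a) = k * f@_c.
  by rewrite -coef_gXl E mcoeffZ.
apply/eqP/negPn/negP => f0.
have [c cf] : exists c, c \in msupp f.
  case: (fset_0Vmem (msupp f)) => [E0|[c cf]]; last by exists c.
  by move: f0; rewrite [f]galgEX E0 big_seq_fset0 eqxx.
pose g (n : nat) := c + a *+ n.
have fg n : f@_(g n) != 0.
  elim: n => [|n IH]; first by rewrite /g mulr0n addr0 mcoeff_neq0.
  apply: contraNneq IH => E0; have := H (g n.+1).
  by rewrite E0 mulr0 /g mulrSr addrA addrK => ->.
have inj : injective g.
  move=> i j /addrI; wlog ij : i j / (i <= j)%N.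
    by move=> W; case/orP: (leq_total i j) => h e; [apply: W|apply/esym/W].
  move=> E2; apply/eqP; rewrite eqn_leq ij /=; rewrite leqNgt; apply/negP=> lt.
  have := a0 (j - i)%N; rewrite subn_gt0 lt mulrnBr // E2 subrr eqxx.
  by move=> /(_ isT).
have /uniq_leq_size : uniq [seq g i | i <- iota 0 (size (msupp f)).+1].
  by rewrite map_inj_uniq ?iota_uniq.
move/(_ (enum_fset (msupp f))); rewrite size_map size_iota ltnn => H1.
by apply: (notF (H1 _)) => _ /mapP[i _ ->]; rewrite -[_ \in _]mcoeff_neq0.
Qed.

Section Universal.
Variables (W : algType K) (M : P -> W).
Hypothesis M0 : M 0 = 1.
Hypothesis MD : forall b c, M (b + c) = M b * M c.

Definition gev f : W := \sum_(b <- msupp f) f@_b *: M b.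

Lemma gevw (d : {fset P}) f : (msupp f `<=` d)%fset -> gev f = \sum_(b <- d) f@_b *: M b.
Proof. by move=> le; apply: sum_msupp_widen => // b ->; rewrite scale0r. Qed.

Lemma gev_linear_subproof : linear gev.
Proof.
move=> k f g; pose d := (msupp f `|` msupp g)%fset.
rewrite (@gevw d) ?(@gevw d f) ?(@gevw d g) ?fsubsetUl ?fsubsetUr //; last first.
  by apply: fsubset_trans (msuppD_le _ _) _; rewrite fsetSU // msuppZ_le.
rewrite scaler_sumr -big_split /=; apply: eq_bigr => b _.
by rewrite mcoeffD mcoeffZ scalerDl scalerA.
Qed.

#[export] HB.instance Definition _ := GRing.isLinear.Build K A W *:%R gev gev_linear_subproof.

Lemma gev0 : gev 0 = 0. Proof. exact: linear0. Qed.
Lemma gevD f g : gev (f + g) = gev f + gev g. Proof. exact: linearD. Qed.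
Lemma gevZ k f : gev (k *: f) = k *: gev f. Proof. exact: linearZ. Qed.
Lemma gevN f : gev (- f) = - gev f. Proof. exact: linearN. Qed.

Lemma gevX b : gev (gX K b) = M b.
Proof. by rewrite (gevw msuppU_le) big_seq_fset1 gX_coef eqxx scale1r. Qed.

Lemma gevM f g : gev (f * g) = gev f * gev g.
Proof.
elim/galg_ind: f => [|f1 f2 H1 H2|k b]; first by rewrite mul0r gev0 mul0r.
  by rewrite mulrDl !gevD mulrDl H1 H2.
rewrite -scalerAl !gevZ -scalerAl; congr (_ *: _).
elim/galg_ind: g => [|f1 f2 H1 H2|l c]; first by rewrite mulr0 gev0 mulr0.
  by rewrite mulrDr !gevD mulrDr H1 H2.
by rewrite -scalerAr !gevZ gXM !gevX MD -scalerAr.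
Qed.

End Universal.

End GroupAlgebra.
End GroupAlgebraTheory.

Module MinimalElement.
Import Weights GroupAlgebraTheory.

Section PiAction.
Variable N : nat.
Hypothesis N0 : (0 < N)%N.
Implicit Types (w : {perm 'I_N.+1}) (b c : wt N).
Local Notation r1 := (inord 1 : 'I_N.+1).

Definition cyc : {perm 'I_N.+1} := perm (@ord_pred_inj N.+1).

Lemma cyc0 : cyc ord0 = ord_max.
Proof. by apply/val_inj; rewrite permE /= modn_small. Qed.

Lemma cycS (k : nat) : (k < N)%N -> cyc (inord k.+1) = inord k.
Proof.
move=> kN; have k1 : (k < N.+1)%N by lia.
by apply/val_inj; rewrite permE /= !inordK // addSn /= modnDr modn_small.
Qed.

Lemma antidom_we w : [forall i, (wact w (omega N 1) 0 i <= 0)%R] = (w ord0 == ord_max).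
Proof.
rewrite omega1 wact_we; apply/forallP/eqP => [H|-> i]; last first.
  rewrite !mxE /ee -!val_eqE /= /bump /= add1n (ltn_eqF (ltn_ord i)) sub0r oppr_le0.
  by case: eqP.
apply/val_inj => /=; apply/eqP; rewrite eqn_leq -ltnS ltn_ord /= leqNgt; apply/negP => lt.
have := H (Ordinal lt); rewrite !mxE /ee -!val_eqE /= /bump /= add1n eqxx.
by rewrite gtn_eqF.
Qed.

Lemma umin1 : umin r1 = cyc.
Proof.
rewrite /umin inordK ?ltnS //.
case: arg_minnP => [|w].
  by rewrite antidom_we permE; apply/eqP/val_inj; rewrite /= subn1.
rewrite antidom_we => /eqP w0 wmin.
have {wmin} := wmin cyc; rewrite antidom_we cyc0 eqxx => /(_ isT) le_len.
pose S := [set ij : 'I_N.+1 * 'I_N.+1 | (ij.1 == ord0) && (ij.2 != ord0)].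
have cS : #|S| = N.
  transitivity #|[set (ord0 : 'I_N.+1, lift ord0 k) | k : 'I_N]|; last first.
    by rewrite card_imset ?card_ord // => i j [] ij; apply/val_inj.
  apply: eq_card => -[i j]; rewrite inE /=; apply/andP/imsetP => [[/eqP-> j0]|[k _ [-> ->]]] //.
  by case: (unliftP ord0 j) j0 => [k ->|-> //] _; exists k.
have len_cyc : (len cyc <= N)%N.
  apply: leq_trans (_ : #|S| <= N)%N; last by rewrite cS.
  apply: subset_leq_card; apply/subsetP => -[i j]; rewrite !inE /=.
  case/andP=> ij; have j0 : j != ord0 by rewrite -val_eqE /= -lt0n (leq_ltn_trans _ ij).
  rewrite j0 andbT => lt; apply/negPn/negP => i0.
  have /andP[i1 i2] := n0_bnd i0; have /andP[j1 j2] := n0_bnd j0.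
  move: lt; have -> : i = inord i.-1.+1 by rewrite prednK // inord_val.
  have -> : j = inord j.-1.+1 by rewrite prednK // inord_val.
  rewrite !cycS ?prednK // !inordK ?prednK //; lia.
have wS : S = [set ij : 'I_N.+1 * 'I_N.+1 | (ij.1 < ij.2)%N && (w ij.2 < w ij.1)%N].
  apply/eqP; rewrite eqEcard cS (leq_trans le_len len_cyc) andbT.
  apply/subsetP => -[i j]; rewrite !inE /= => /andP[/eqP -> j0].
  rewrite w0 /= lt0n j0 /= ltn_neqAle -ltnS ltn_ord andbT.
  by rewrite (val_eqE _ (@ord_max N)) -w0 (inj_eq perm_inj).
have incr (i j : 'I_N.+1) : (0 < i)%N -> (i < j)%N -> (w i < w j)%N.
  move=> i0 ij; rewrite ltnNge leq_eqVlt negb_or.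
  have -> : (w j == w i :> nat) = false.
    by rewrite val_eqE (inj_eq perm_inj) -val_eqE /= gtn_eqF.
  have : (i, j) \notin S by rewrite inE /= -val_eqE /= (gtn_eqF i0).
  by rewrite wS inE /= ij.
have wlo (k : nat) : (k < N)%N -> (k <= w (inord k.+1))%N.
  elim: k => // k IH kN; apply: leq_ltn_trans (IH (ltnW kN)) _.
  by apply: incr; rewrite !inordK // !ltnS ltnW.
have whi (k : nat) : (k < N)%N -> (w (inord (N - k)) < N - k)%N.
  elim: k => [|k IH] kN.
    rewrite subn0 ltn_neqAle -ltnS ltn_ord andbT.
    rewrite (val_eqE _ (@ord_max N)) -w0 (inj_eq perm_inj).
    by rewrite -val_eqE /= inordK // -lt0n.
  have := IH (ltnW kN); have : (w (inord (N - k.+1)) < w (inord (N - k)))%N.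
    by apply: incr; rewrite !inordK; lia.
  lia.
apply/permP => i; case: (altP (i =P ord0)) => [->|i0]; first by rewrite cyc0 w0.
have /andP[i1 i2] := n0_bnd i0.
have -> : i = inord i.-1.+1 by rewrite prednK // inord_val.
rewrite cycS; last by rewrite prednK.
apply/val_inj; rewrite /= inordK; last by lia.
apply/eqP; rewrite eqn_leq wlo ?prednK // andbT.
have K : (N - i < N)%N by lia.
have := whi _ K; rewrite subKn // => H.
by rewrite -ltnS prednK.
Qed.

Lemma pi1E b : pi_act r1 (b, 0) = (wact cyc^-1%g b, - ip (wact cyc^-1%g b) (we ord0)).
Proof. by rewrite /pi_act umin1 /transl /= inordK ?ltnS // omega1 sub0r. Qed.

Lemma cycV_lt (k : nat) : (k < N)%N -> (cyc^-1)%g (inord k) = inord k.+1.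
Proof. by move=> kN; rewrite -(cycS kN) permK. Qed.

Lemma cycV_max : (cyc^-1)%g ord_max = ord0.
Proof. by rewrite -cyc0 permK. Qed.

End PiAction.
End MinimalElement.

Module ReducedWord.
Import Weights GroupAlgebraTheory MinimalElement.

Section ReducedWord.
Variable N : nat.
Hypothesis N0 : (0 < N)%N.
Local Notation r1 := (inord 1 : 'I_N.+1).

Lemma wact1 (b : wt N) : wact 1%g b = b.
Proof. by rewrite -(wtE_eps b) wact_wtE; apply: wtE_ext => k; rewrite invg1 perm1. Qed.

Lemma wactM (s s' : {perm 'I_N.+1}) (b : wt N) : wact (s * s')%g b = wact s' (wact s b).
Proof. by rewrite -(wtE_eps b) !wact_wtE; apply: wtE_ext => k; rewrite invMg permM. Qed.

Definition cword : seq 'I_N.+1 := rev [seq inord i | i <- iota 1 N].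

Lemma foldr_cword z : foldr (@srefl N) z cword = (wact (cyc N) z.1, z.2).
Proof.
pose w k : seq 'I_N.+1 := rev [seq inord i | i <- iota 1 k].
suff H k : (k <= N)%N -> exists2 s : {perm 'I_N.+1},
    forall z, foldr (@srefl N) z (w k) = (wact s z.1, z.2) &
    s ord0 = inord k /\ forall i : nat, (0 < i <= N)%N ->
      s (inord i) = if (i <= k)%N then inord i.-1 else inord i.
  have [s -> [s0 sS]] := H N (leqnn N); suff -> : s = cyc N by [].
  apply/permP => i; case: (altP (i =P ord0)) => [->|i0].
    by rewrite s0 cyc0; apply/val_inj; rewrite /= inordK.
  have iN := n0_bnd i0; case/andP: (iN) => i1 i2.
  rewrite -[i in LHS]inord_val sS // i2.
  have -> : i = inord i.-1.+1 by rewrite prednK // inord_val.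
  by rewrite cycS // prednK // inordK // ltnS.
elim: k => [|k IH] kN.
  exists 1%g; first by move=> [b x]; rewrite wact1.
  split; first by rewrite perm1; apply/val_inj; rewrite /= inordK.
  by move=> i /andP[i0 _]; rewrite perm1 leqNgt i0.
have [s sE [s0 sS]] := IH (ltnW kN).
have k0 : (inord k.+1 : 'I_N.+1) != ord0 by rewrite -val_eqE /= inordK.
have kE : (inord k.+1 : 'I_N.+1).-1 = k by rewrite inordK.
exists (s * swp (inord k.+1))%g.
  move=> z0; have iS : iota 1 k.+1 = rcons (iota 1 k) k.+1.
    by have := iotaD 1 k 1; rewrite addn1 cats1 add1n.
  rewrite /w iS map_rcons rev_rcons /=.
  by rewrite -/(w k) sE srefl_n0 //= wactM.
rewrite !permM s0 /swp kE; split; first by rewrite tpermL.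
move=> i iN; rewrite permM sS //.
case: (ltngtP i k.+1) => [lt|gt|->].
- rewrite -ltnS lt tpermD //; rewrite -val_eqE /= !inordK; lia.
- rewrite leqNgt (ltnW gt) /= tpermD //; rewrite -val_eqE /= !inordK; lia.
- by rewrite ltnn tpermR.
Qed.

Lemma we_inj : injective (@we N).
Proof.
move=> j k /wtE_inj H; have := H _ j; rewrite !sum_ee1 /ee eqxx => /(_ erefl).
by case: eqP.
Qed.

Lemma srefl_we (i k : 'I_N.+1) (m : int) : exists (k' : 'I_N.+1) (m' : int),
  srefl i (we k, m%:~R) = (we k', m'%:~R) /\
  `|(k' : nat)%:Z - N.+1%:Z * m'| <= `|(k : nat)%:Z - N.+1%:Z * m| + 1.
Proof.
case: (altP (i =P ord0)) => [->|i0]; last first.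
  rewrite srefl_n0 //= wact_we; exists (swp i k), m; split=> //.
  have /andP[i1 i2] := n0_bnd i0.
  have : `|(swp i k : nat)%:Z - (k : nat)%:Z| <= 1.
    by rewrite /swp; case: tpermP => [->|->|_ _]; rewrite ?inordK; lia.
  lia.
rewrite /srefl /aroot eqxx /=.
have -> : - theta N = wtE (fun k => (k == ord_max)%:Z - (k == ord0)%:Z).
  by rewrite thetaE // wtEN; apply: wtE_ext => j; rewrite opprB.
pose d := (k == ord_max)%:Z - (k == ord0)%:Z.
have -> : ip (we k) (wtE (fun k => (k == ord_max)%:Z - (k == ord0)%:Z)) = d%:~R.
  by rewrite ipC ip_we sumrB (sum_ee1 ord_max) (sum_ee1 ord0) subrr mul0r subr0.
rewrite numq_int mulr1.
have mx0 : (ord_max == ord0 :> 'I_N.+1) = false by rewrite -val_eqE /= gtn_eqF.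
have thE : wtE (fun k => (k == ord_max)%:Z - (k == ord0)%:Z) = we ord_max - we ord0.
  by symmetry; rewrite wtEB.
rewrite thE /d; case: (altP (k =P ord_max)) => [->|kN].
  exists ord0, (m - 1); split; last by rewrite /=; lia.
  by rewrite mx0 subr0 mulr1z opprB addrC subrK rmorphB.
case: (altP (k =P ord0)) => [->|k0].
  exists ord_max, (m + 1); split; last by rewrite /=; lia.
  by rewrite sub0r mulrNz mulr1z opprK addrC subrK rmorphN opprK rmorphD.
by exists k, m; rewrite subrr mulr0z !subr0; split=> //; lia.
Qed.

Lemma foldr_we (s : seq 'I_N.+1) : exists (k' : 'I_N.+1) (m' : int),
  foldr (@srefl N) (we ord0, 0) s = (we k', m'%:~R) /\
  `|(k' : nat)%:Z - N.+1%:Z * m'| <= (size s)%:Z.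
Proof.
elim: s => [|i s [k [m [E B]]]] /=.
  by exists ord0, 0; rewrite mulr0.
have [k' [m' [E' B']]] := srefl_we i k m.
by exists k', m'; rewrite E E'; split=> //; lia.
Qed.

Lemma reduced_cword : reduced (transl (omega N 1)) r1 cword.
Proof.
split=> [z|r s H].
  rewrite /word_act foldr_cword /pi_act umin1 // -wactM mulgV wact1.
  by rewrite inordK ?ltnS //; case: z.
have [k [m [E B]]] := foldr_we s.
rewrite /cword size_rev size_map size_iota.
have n0 : N.+1%:R != 0 :> rat by rewrite pnatr_eq0.
have sumr : \sum_(j < N.+1) ((j < r)%N)%:Z = (r : nat)%:Z.
  rewrite -(big_morph _ PoszD (erefl (Posz 0))); congr Posz.
  transitivity (\sum_(j < N.+1 | (j < r)%N) 1)%N.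
    by rewrite [RHS]big_mkcond; apply: eq_bigr => j _; case: ltnP.
  rewrite -(big_ord_widen N.+1 (fun=> 1%N)); last by have := ltn_ord r; lia.
  by rewrite sum_nat_const card_ord muln1.
have E0 := H (we ord0, 0); move: (E0); rewrite /word_act E /pi_act /transl /= wact_we omega1.
rewrite -/(we _) ip_we_we eqxx omegaE ipC ip_we sumr => -[_].
set k1 := (_ k) => E1.
have r_1 : r = r1.
  have : ((r : nat)%:Z - 1)%:~R = ((k1 < r)%N%:Z - 1 - m)%:~R * N.+1%:R :> rat.
    have K (M b x n : rat) : n != 0 -> M - (b - x / n) = 0 - (1 - n^-1) -> x - 1 = (b - 1 - M) * n.
      move=> nn EE; have -> : b = M + x / n + (1 - n^-1) by rewrite -[LHS](subrK (x / n)) -[b - _](subrK M) -opprB EE; ring.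
      by field.
    by move/(K _ _ _ _ n0): E1; rewrite !rmorphB.
  rewrite -[N.+1%:R]/(N.+1%:Z%:~R) -rmorphM => /intr_inj H1.
  apply/val_inj; rewrite /= inordK ?ltnS //; have r_lt := ltn_ord r.
  move: H1; set z := (_ - m); move: z => z H1.
  have z0 : z = 0 by nia.
  by move: H1; rewrite z0; lia.
move: E0; rewrite r_1 /word_act E /pi_act umin1 // /transl /= wact_we omega1.
rewrite inordK ?ltnS // omega1 -/(we _) => -[/we_inj k0].
have kN : k = ord_max by rewrite -[k](permKV (cyc N)) k0 cyc0.
rewrite k0 !ip_we_we eqxx sub0r -[RHS]add0r => /addIr /eqP; rewrite intr_eq0 => /eqP m0.
by move: B; rewrite kN m0 /=; lia.
Qed.

End ReducedWord.
End ReducedWord.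

Module Generators.
Import Weights GroupAlgebraTheory MinimalElement ReducedWord.

Lemma u_neq0 : u != 0.
Proof. by rewrite /u tofrac_eq0 polyX_eq0. Qed.

Lemma v_neq0 : v != 0.
Proof. by rewrite /v tofrac_eq0 polyC_eq0 polyX_eq0. Qed.

Section Constants.
Variable N : nat.
Hypothesis N0 : (0 < N)%N.

Lemma qpowE (x : rat) (z : int) : x * (2 * N + 2)%:R = z%:~R -> qpow N x = u ^ z.
Proof. by rewrite /qpow => ->; rewrite numq_int. Qed.

Lemma tpowE (x : rat) (z : int) : x * 2%:R = z%:~R -> tpow x = v ^ z.
Proof. by rewrite /tpow => ->; rewrite numq_int. Qed.

Lemma qpow0 : qpow N 0 = 1.
Proof. by rewrite (@qpowE _ 0) ?expr0z // mul0r. Qed.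

Lemma q_neq0 : q N != 0. Proof. exact: expf_neq0 u_neq0. Qed.

Lemma n1_neq0 : N.+1%:R != 0 :> rat. Proof. by rewrite pnatr_eq0. Qed.

Lemma dbl : (2 * N + 2)%:R = 2%:R * N.+1%:R :> rat.
Proof. by rewrite -natrM mulnS addnC. Qed.

Lemma qpow_e : qpow N (N.+1%:R^-1) = u ^+ 2.
Proof. by rewrite (@qpowE _ 2) // dbl mulrCA mulVf ?n1_neq0 ?mulr1. Qed.

Lemma qpow_max : qpow N (- (1 - N.+1%:R^-1)) = u ^- (2 * N).
Proof.
rewrite (@qpowE _ (- (2 * N)%N%:Z)) ?exprnN // dbl.
have K (n N' : rat) : n != 0 -> n = N' + 1 -> - (1 - n^-1) * (2%:R * n) = - (2%:R * N').
  by move=> n0 E; rewrite -[N'](addrK 1) -E; field.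
by rewrite (K _ N%:R) ?n1_neq0 ?natr1 // rmorphN /= [(_ * _)%N%:~R]natrM.
Qed.

Lemma qpow_c : qpow N (- ((1 - N.+1%:R^-1) / 2%:R)) = u ^- N.
Proof.
rewrite (@qpowE _ (- N%:Z)) ?exprnN // dbl.
have K (n N' : rat) : n != 0 -> n = N' + 1 -> - ((1 - n^-1) / 2%:R) * (2%:R * n) = - N'.
  by move=> n0 E; rewrite -[N'](addrK 1) -E; field.
by rewrite (K _ N%:R) ?n1_neq0 ?natr1 // rmorphN.
Qed.

Lemma tpow_rho (k : 'I_N.+1) : tpow (- ip (rho N) (we k)) = v ^ (2 * k%:Z - N%:Z).
Proof.
apply: tpowE; rewrite rho_we.
have K (a b : rat) : - (a / 2%:R - b) * 2%:R = 2%:R * b - a by field.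
by rewrite K rmorphB rmorphM.
Qed.

End Constants.

Lemma quad_expand (K : fieldType) (A : algType K) (T : A) (a b : K) :
  (T - a%:A) * (T + b%:A) = T * (T - (a - b)%:A) - (a * b)%:A.
Proof.
rewrite mulrBl !mulrDr mulrN -!scalerAl !mul1r -!scalerAr !mulr1.
by rewrite scalerBl opprB scalerA opprD !addrA; congr (_ - _); rewrite addrAC.
Qed.

Section DahaAlgebra.
Variable N : nat.
Hypothesis N0 : (0 < N)%N.
Variable D : daha N.
Local Notation H := (daha_alg D).
Local Notation r1 := (inord 1 : 'I_N.+1).
Local Notation T := (@dT N D).

Definition hT : 'I_N.+1 -> H := @dT N D.
Definition hTi (i : 'I_N.+1) : H := Tinv T i.
Definition hx (k : 'I_N.+1) : H := dX D (we k).
Definition hxi (k : 'I_N.+1) : H := dX D (- we k).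
Definition hY : H := dY D (omega N 1).
Definition hYi : H := dY D (- omega N 1).
Definition hpi : H := dPi D r1.

Let rels : daha_rels (@dT N D) (@dPi N D) (@dX N D) := (dahaP D).1.

Lemma hT_Ti i : hT i * hTi i = 1.
Proof.
have := rel_quad rels i; rewrite quad_expand => /eqP.
by rewrite subr_eq0 mulfV ?v_neq0 // scale1r => /eqP.
Qed.

Lemma hTi_T i : hTi i * hT i = 1.
Proof.
rewrite -(hT_Ti i) /hTi /Tinv mulrBl mulrBr; congr (_ - _).
by rewrite -scalerAl -scalerAr mul1r mulr1.
Qed.

Lemma hx_xi k : hx k * hxi k = 1.
Proof. by rewrite /hx /hxi -(rel_XD rels) subrr (rel_X0 rels). Qed.

Lemma hxi_x k : hxi k * hx k = 1.
Proof. by rewrite /hx /hxi -(rel_XD rels) addNr (rel_X0 rels). Qed.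

Lemma hY_Yi : hY * hYi = 1.
Proof. by have [Y0 YD _] := dYP D; rewrite /hY /hYi -YD subrr Y0. Qed.

Lemma hYi_Y : hYi * hY = 1.
Proof. by have [Y0 YD _] := dYP D; rewrite /hY /hYi -YD addNr Y0. Qed.

Lemma hTx1 (i : 'I_N.+1) : i != ord0 -> hT i * hx (inord i.-1) = hx i * hTi i.
Proof.
move=> i0; have ne := inordm1_neq i0.
have := rel_TX1 rels (i := i) (b := we (inord i.-1)).
rewrite aroot_n0 //= {1}/we ip_alpha // /ee eqxx eq_sym (negPf ne) => -> //.
rewrite /Xa /= oppr0 qpow0 scale1r -(rel_XD rels) alpha_we // opprB addrC subrK.
by [].
Qed.

Lemma hTx0 (i k : 'I_N.+1) : i != ord0 -> k != i -> k != inord i.-1 ->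
  hT i * hx k = hx k * hT i.
Proof.
move=> i0 k1 k2; rewrite /hx (rel_TX0 rels) // aroot_n0 //= /we ip_alpha // /ee.
by rewrite ![_ == k]eq_sym (negPf k1) (negPf k2).
Qed.

Lemma Xa_pi k : Xa (dX D) (pi_act r1 (we k, 0)) =
  if k == ord_max then u ^- (2 * N) *: hx ord0 else u ^+ 2 *: hx (inord k.+1).
Proof.
rewrite pi1E // /Xa wact_we; case: eqP => [->|/eqP kN].
  by rewrite cycV_max /= ip_we_we eqxx qpow_max.
have kN' : (k < N)%N.
  by rewrite ltn_neqAle -ltnS ltn_ord andbT -[N in _ != N]/(nat_of_ord (@ord_max N)) val_eqE.
rewrite -[k in (cyc N)^-1%g k]inord_val cycV_lt //=.
rewrite ip_we_we -val_eqE /= inordK ?ltnS // sub0r opprK qpow_e //.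
Qed.

Lemma hpix k : hpi * hx k =
  (if k == ord_max then u ^- (2 * N) *: hx ord0 else u ^+ 2 *: hx (inord k.+1)) * hpi.
Proof. by rewrite /hpi (rel_piX rels) Xa_pi. Qed.

End DahaAlgebra.
End Generators.

Module DahaRelations.
Import Weights GroupAlgebraTheory MinimalElement ReducedWord Generators.

Section DahaAlgebra2.
Variable N : nat.
Hypothesis N0 : (0 < N)%N.
Variable D : daha N.
Local Notation H := (daha_alg D).
Local Notation hT := (hT D).
Local Notation hTi := (hTi D).
Local Notation x := (hx D ord0).
Local Notation xi := (hxi D ord0).
Local Notation Y := (hY D).
Local Notation Yi := (hYi D).
Local Notation pi := (hpi D).
Let r1 := (inord 1 : 'I_N.+1).
Let rels : daha_rels (@dT N D) (@dPi N D) (@dX N D) := (dahaP D).1.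

Definition pT (s : seq 'I_N.+1) : H := \prod_(j <- s) hT j.
Definition pTi (s : seq 'I_N.+1) : H := \prod_(j <- s) hTi j.

Lemma pT_cons i s : pT (i :: s) = hT i * pT s.
Proof. exact: big_cons. Qed.

Lemma pTi_cons i s : pTi (i :: s) = hTi i * pTi s.
Proof. exact: big_cons. Qed.

Lemma pT_pTi s : pT s * pTi (rev s) = 1.
Proof.
elim: s => [|i s IH]; first by rewrite /pT /pTi !big_nil mulr1.
rewrite /pT /pTi rev_cons -cats1 big_cat big_seq1 big_cons /=.
by rewrite -mulrA [X in _ * X]mulrA -/(pT s) -/(pTi (rev s)) IH mul1r hT_Ti.
Qed.

Lemma pTi_pT s : pTi (rev s) * pT s = 1.
Proof.
elim: s => [|i s IH]; first by rewrite /pT /pTi !big_nil mulr1.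
rewrite /pT /pTi rev_cons -cats1 big_cat big_seq1 big_cons /=.
by rewrite -mulrA [X in _ * X]mulrA hTi_T mul1r.
Qed.

Definition hU := pT (cword N).
Definition hUi := pTi (rev (cword N)).
Definition hV := pT (rev (cword N)).
Definition hVi := pTi (cword N).
Definition hJ := hV * hU.
Definition hJi := hUi * hVi.

Lemma hU_Ui : hU * hUi = 1. Proof. exact: pT_pTi. Qed.
Lemma hV_Vi : hV * hVi = 1. Proof. by have := pT_pTi (rev (cword N)); rewrite revK. Qed.
Lemma hVi_V : hVi * hV = 1. Proof. by have := pTi_pT (rev (cword N)); rewrite revK. Qed.

Lemma hJ_Ji : hJ * hJi = 1.
Proof. by rewrite /hJ /hJi -mulrA [hU * _]mulrA hU_Ui mul1r hV_Vi. Qed.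

Lemma hU_x : hU * x = hx D ord_max * hVi.
Proof.
pose w k : seq 'I_N.+1 := rev [seq inord i | i <- iota 1 k].
suff E k : (k <= N)%N -> pT (w k) * x = hx D (inord k) * pTi (w k).
  have := E N (leqnn N); have -> : inord N = ord_max :> 'I_N.+1 by apply/val_inj; rewrite /= inordK.
  by [].
elim: k => [|k IH] kN.
  have -> : inord 0 = ord0 :> 'I_N.+1 by apply/val_inj; rewrite /= inordK.
  by rewrite /pT /pTi /w !big_nil mul1r mulr1.
have iS : iota 1 k.+1 = rcons (iota 1 k) k.+1 by have := iotaD 1 k 1; rewrite addn1 cats1 add1n.
have wS : w k.+1 = inord k.+1 :: w k by rewrite /w iS map_rcons rev_rcons.
rewrite wS pT_cons pTi_cons -mulrA (IH (ltnW kN)) !mulrA; congr (_ * _).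
have k0 : inord k.+1 != ord0 :> 'I_N.+1 by rewrite -val_eqE /= inordK.
by have := hTx1 D k0; rewrite inordK //= ltnS ltnW.
Qed.

Lemma hY_piU : Y = pi * hU.
Proof.
have [_ _ Ys] := dYP D.
exact: (Ys (Ordinal N0) _ _ (reduced_cword N0)).
Qed.

Lemma hpi_YUi : pi = Y * hUi.
Proof. by rewrite hY_piU -mulrA hU_Ui mulr1. Qed.

Lemma YxJ : Y * x * hJ = u ^- (2 * N) *: (x * Y).
Proof.
rewrite hY_piU /hJ -(mulrA pi) hU_x -!mulrA [hVi * (hV * hU)]mulrA hVi_V mul1r.
by rewrite mulrA hpix // eqxx -!scalerAl -!mulrA.
Qed.

Lemma cword_n0 : all (fun j : 'I_N.+1 => j != ord0) (cword N).
Proof.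
apply/allP => j; rewrite mem_rev => /mapP[i]; rewrite mem_iota => /andP[i0 iN] ->.
by rewrite -val_eqE /= inordK ?gtn_eqF // -add1n.
Qed.

Lemma rcword_n0 : all (fun j : 'I_N.+1 => j != ord0) (rev (cword N)).
Proof. by rewrite all_rev cword_n0. Qed.

Lemma tau_x k : dtau D (hx D k) = hx D k.
Proof. by have [_ ->] := dtauP D. Qed.

Lemma tau_T i : i != ord0 -> dtau D (hT i) = hT i.
Proof. by have [_ _ E _ _] := dtauP D; exact: E. Qed.

Lemma tau_pT s : all (fun j => j != ord0) s -> dtau D (pT s) = pT s.
Proof.
elim: s => [|i s IH] /=; first by rewrite /pT big_nil rmorph1.
by case/andP=> i0 sn; rewrite pT_cons rmorphM /= tau_T // IH.
Qed.

Lemma tau_pi : dtau D pi = u ^- N *: (x * pi).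
Proof.
have [_ _ _ _ ->] := dtauP D.
by rewrite inordK ?ltnS // omega1 -/(we _) ip_we_we eqxx qpow_c.
Qed.

Lemma tau_Y : dtau D Y = u ^- N *: (x * Y).
Proof.
by rewrite hY_piU rmorphM /= tau_pi tau_pT ?cword_n0 // -scalerAl mulrA.
Qed.

Lemma phiM a b : dphi D (a * b) = dphi D b * dphi D a.
Proof. by have [E _ _ _ _] := dphiP D; exact: E. Qed.

Lemma phiK a : dphi D (dphi D a) = a.
Proof. by have [_ E _ _ _] := dphiP D; exact: E. Qed.

Lemma phi1 : dphi D 1 = 1.
Proof.
have [_ _ E _ _] := dphiP D; rewrite -(rel_X0 rels) E oppr0.
by have [-> _ _] := dYP D; rewrite (rel_X0 rels).
Qed.

Lemma phi_x : dphi D x = Yi.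
Proof. by have [_ _ E _ _] := dphiP D; rewrite /hx E /hYi omega1. Qed.

Lemma phi_xi : dphi D xi = Y.
Proof. by have [_ _ E _ _] := dphiP D; rewrite /hxi E /hY omega1 opprK. Qed.

Lemma phi_Y : dphi D Y = xi. Proof. by rewrite -phi_xi phiK. Qed.
Lemma phi_Yi : dphi D Yi = x. Proof. by rewrite -phi_x phiK. Qed.

Lemma phi_T i : i != ord0 -> dphi D (hT i) = hT i.
Proof. by have [_ _ _ _ E] := dphiP D; exact: E. Qed.

Inductive inS : H -> Prop :=
| inS_sc k : inS k%:A
| inS_x : inS x
| inS_xi : inS xi
| inS_Y : inS Y
| inS_Yi : inS Yi
| inS_T i : i != ord0 -> inS (hT i)
| inS_add a b : inS a -> inS b -> inS (a + b)
| inS_mul a b : inS a -> inS b -> inS (a * b).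

Lemma inS_scale k a : inS a -> inS (k *: a).
Proof. by move=> Sa; rewrite -[a]mul1r scalerAl; apply: inS_mul (inS_sc _) Sa. Qed.

Lemma inS0 : inS 0. Proof. by rewrite -(scale0r (1 : H)); exact: inS_sc. Qed.
Lemma inS1 : inS 1. Proof. by rewrite -(scale1r (1 : H)); exact: inS_sc. Qed.

Lemma inS_opp a : inS a -> inS (- a).
Proof. by rewrite -scaleN1r; apply: inS_scale. Qed.

Lemma inS_Ti i : i != ord0 -> inS (hTi i).
Proof. by move=> i0; apply: inS_add (inS_T i0) (inS_opp (inS_sc _)). Qed.

Record hom (f : H -> H) : Prop := Hom {
  hom_lin : forall k a b, f (k *: a + b) = k *: f a + f b;
  hom_mul : forall a b, f (a * b) = f a * f b;
  hom_1 : f 1 = 1;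
  hom_T : forall i, i != ord0 -> f (hT i) = hT i;
  hom_Sx : inS (f x);
  hom_Sxi : inS (f xi);
  hom_SY : inS (f Y);
  hom_SYi : inS (f Yi)
}.

Section HomTheory.
Variable f : H -> H.
Hypothesis hf : hom f.

Lemma hom_0 : f 0 = 0.
Proof. by have := hom_lin hf (-1) 0 0; rewrite scaler0 addr0 scaleN1r addNr. Qed.

Lemma hom_add a b : f (a + b) = f a + f b.
Proof. by rewrite -[a]scale1r (hom_lin hf) !scale1r. Qed.

Lemma hom_scale k a : f (k *: a) = k *: f a.
Proof. by rewrite -[_ *: a]addr0 (hom_lin hf) hom_0 addr0. Qed.

Lemma hom_sc k : f k%:A = k%:A.
Proof. by rewrite hom_scale (hom_1 hf). Qed.

Lemma hom_opp a : f (- a) = - f a.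
Proof. by rewrite -scaleN1r hom_scale scaleN1r. Qed.

Lemma hom_sub a b : f (a - b) = f a - f b.
Proof. by rewrite hom_add hom_opp. Qed.

Lemma hom_Ti i : i != ord0 -> f (hTi i) = hTi i.
Proof. by move=> i0; rewrite /Generators.hTi /Tinv hom_sub hom_sc -/(Generators.hT D i) (hom_T hf). Qed.

Lemma hom_pT s : all (fun j => j != ord0) s -> f (pT s) = pT s.
Proof.
elim: s => [|i s IH] /=; first by rewrite /pT big_nil (hom_1 hf).
by case/andP=> i0 sn; rewrite pT_cons (hom_mul hf) (hom_T hf) // IH.
Qed.

Lemma hom_inS a : inS a -> inS (f a).
Proof.
elim=> {a} [k|||||i i0|a b _ Sa _ Sb|a b _ Sa _ Sb].
- by rewrite hom_sc; exact: inS_sc.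
- exact: hom_Sx.
- exact: hom_Sxi.
- exact: hom_SY.
- exact: hom_SYi.
- by rewrite (hom_T hf) //; exact: inS_T.
- by rewrite hom_add; exact: inS_add.
- by rewrite (hom_mul hf); exact: inS_mul.
Qed.

Lemma hom_hJ : f hJ = hJ.
Proof. by rewrite (hom_mul hf) (hom_pT rcword_n0) (hom_pT cword_n0). Qed.

Lemma hom_x_xi : f x * f xi = 1. Proof. by rewrite -(hom_mul hf) hx_xi (hom_1 hf). Qed.
Lemma hom_xi_x : f xi * f x = 1. Proof. by rewrite -(hom_mul hf) hxi_x (hom_1 hf). Qed.
Lemma hom_Y_Yi : f Y * f Yi = 1. Proof. by rewrite -(hom_mul hf) hY_Yi (hom_1 hf). Qed.
Lemma hom_Yi_Y : f Yi * f Y = 1. Proof. by rewrite -(hom_mul hf) hYi_Y (hom_1 hf). Qed.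

End HomTheory.

Lemma inv_uniq (a b c : H) : b * a = 1 -> a * c = 1 -> b = c.
Proof. by move=> ba ac; rewrite -[b]mulr1 -ac mulrA ba mul1r. Qed.

Lemma hom_eq f g : hom f -> hom g -> f x = g x -> f Y = g Y ->
  forall a, inS a -> f a = g a.
Proof.
move=> hf hg ex eY a; elim=> {a} [k|||||i i0|a b _ Sa _ Sb|a b _ Sa _ Sb].
- by rewrite !hom_sc.
- by [].
- by apply: (@inv_uniq (g x)); [rewrite -ex hom_xi_x | rewrite hom_x_xi].
- by [].
- by apply: (@inv_uniq (g Y)); [rewrite -eY hom_Yi_Y | rewrite hom_Y_Yi].
- by rewrite (hom_T hf) // (hom_T hg).
- by rewrite !hom_add // Sa Sb.
- by rewrite (hom_mul hf) (hom_mul hg) Sa Sb.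
Qed.

Lemma hom_id : hom id.
Proof. by split=> //; constructor. Qed.

Lemma hom_comp f g : hom f -> hom g -> hom (f \o g).
Proof.
move=> hf hg; split=> [k a b|a b||i i0||||] /=.
- by rewrite (hom_lin hg) (hom_lin hf).
- by rewrite (hom_mul hg) (hom_mul hf).
- by rewrite (hom_1 hg) (hom_1 hf).
- by rewrite (hom_T hg) // (hom_T hf).
- by apply: (hom_inS hf); apply: hom_Sx.
- by apply: (hom_inS hf); apply: hom_Sxi.
- by apply: (hom_inS hf); apply: hom_SY.
- by apply: (hom_inS hf); apply: hom_SYi.
Qed.

End DahaAlgebra2.
End DahaRelations.

Module BraidWords.
Import Weights GroupAlgebraTheory MinimalElement ReducedWord Generators DahaRelations.

Record bstruct := BStruct {
  bT : Type;
  bA : bT -> bT; bAi : bT -> bT; bB : bT -> bT; bBi : bT -> bT;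
  bAK : cancel bA bAi; bAiK : cancel bAi bA;
  bBK : cancel bB bBi; bBiK : cancel bBi bB;
  bbraid : forall h, bA (bB (bA h)) = bB (bA (bB h))
}.

Section Words.

Definition blet (b : bstruct) (l : letter) : bT b -> bT b :=
  match l with
  | TauP => @bA b | TauPV => @bAi b | TauM => @bBi b | TauMV => @bB b
  end.

Definition brun (b : bstruct) (s : seq letter) (h : bT b) : bT b :=
  foldr (@blet b) h s.

Section OneStruct.
Variable b : bstruct.
Local Notation A := (@bA b).
Local Notation Ai := (@bAi b).
Local Notation B := (@bB b).
Local Notation Bi := (@bBi b).
Implicit Types (h : bT b) (k l : int).

Definition bS h := A (B (A h)).
Definition bSi h := Ai (Bi (Ai h)).
Definition bZ h := bS (bS h).
Definition bZi h := bSi (bSi h).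

Lemma bSK : cancel bS bSi.
Proof. by move=> h; rewrite /bS /bSi bAK bBK bAK. Qed.
Lemma bSiK : cancel bSi bS.
Proof. by move=> h; rewrite /bS /bSi bAiK bBiK bAiK. Qed.
Lemma bZK : cancel bZ bZi.
Proof. by move=> h; rewrite /bZ /bZi !bSK. Qed.
Lemma bZiK : cancel bZi bZ.
Proof. by move=> h; rewrite /bZ /bZi !bSiK. Qed.

Lemma bSA h : bS (A h) = B (bS h).
Proof. by rewrite /bS bbraid. Qed.
Lemma bSB h : bS (B h) = A (bS h).
Proof. by rewrite /bS -bbraid. Qed.
Lemma bZA h : bZ (A h) = A (bZ h).
Proof. by rewrite /bZ bSA bSB. Qed.
Lemma bZB h : bZ (B h) = B (bZ h).
Proof. by rewrite /bZ bSB bSA. Qed.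
Lemma bZAi h : bZ (Ai h) = Ai (bZ h).
Proof. by rewrite -{2}[h]bAiK bZA bAK. Qed.
Lemma bZBi h : bZ (Bi h) = Bi (bZ h).
Proof. by rewrite -{2}[h]bBiK bZB bBK. Qed.
Lemma bZS h : bZ (bS h) = bS (bZ h). Proof. by []. Qed.

Definition itn (f g : bT b -> bT b) (k : int) h :=
  match k with Posz n => iter n f h | Negz n => iter n.+1 g h end.

Lemma itnS f g k h : cancel f g -> cancel g f -> itn f g (k + 1) h = f (itn f g k h).
Proof.
move=> fK gK; case: k => [n|[|n]]; first by rewrite /= addn1.
  by rewrite /= gK.
have -> : Negz n.+1 + 1 = Negz n by lia.
by rewrite /= gK.
Qed.

Lemma itnP f g k h : cancel f g -> cancel g f -> itn f g (k - 1) h = g (itn f g k h).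
Proof. by move=> fK gK; rewrite -{2}[k](subrK 1) itnS // fK. Qed.

Lemma itnC f g (F : bT b -> bT b) k h :
  (forall h, F (f h) = f (F h)) -> (forall h, F (g h) = g (F h)) ->
  F (itn f g k h) = itn f g k (F h).
Proof.
move=> Ff Fg; case: k => n; rewrite /itn.
  by elim: n => //= n IH; rewrite Ff IH.
by elim: n.+1 => //= m IH; rewrite Fg IH.
Qed.

Lemma itn_add f g k l h : cancel f g -> cancel g f ->
  itn f g (k + l) h = itn f g k (itn f g l h).
Proof.
move=> fK gK; elim/int_ind: k => [|n IH|n IH]; first by rewrite add0r.
  by rewrite -addn1 PoszD addrAC !itnS // IH.
by rewrite -addn1 PoszD opprD addrAC !itnP // IH.
Qed.

Definition Ap := itn A Ai.
Definition Zp := itn bZ bZi.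

Lemma ApS k h : A (Ap k h) = Ap (k + 1) h.
Proof. by rewrite /Ap itnS; [|exact: bAK|exact: bAiK]. Qed.
Lemma ApP k h : Ai (Ap k h) = Ap (k - 1) h.
Proof. by rewrite /Ap itnP; [|exact: bAK|exact: bAiK]. Qed.
Lemma ZpD k l h : Zp (k + l) h = Zp k (Zp l h).
Proof. by apply: itn_add; [exact: bZK|exact: bZiK]. Qed.
Lemma Zp1 h : Zp 1 h = bZ h. Proof. by []. Qed.

Lemma Zi_comm (F : bT b -> bT b) : (forall h, bZ (F h) = F (bZ h)) ->
  forall h, bZi (F h) = F (bZi h).
Proof. by move=> H h; rewrite -{1}[h]bZiK -H bZK. Qed.

Lemma ZpC (F : bT b -> bT b) l h : (forall h, bZ (F h) = F (bZ h)) ->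
  F (Zp l h) = Zp l (F h).
Proof. by move=> H; apply: itnC => // h'; rewrite ?H // (Zi_comm H). Qed.

Definition nf (l k0 : int) (ks : seq int) h :=
  Zp l (Ap k0 (foldr (fun k h => bS (Ap k h)) h ks)).

Lemma A_nf l k ks h : A (nf l k ks h) = nf l (k + 1) ks h.
Proof. by rewrite /nf ZpC ?ApS //; exact: bZA. Qed.
Lemma Ai_nf l k ks h : Ai (nf l k ks h) = nf l (k - 1) ks h.
Proof. by rewrite /nf ZpC ?ApP //; exact: bZAi. Qed.
Lemma S_nf l k ks h : bS (nf l k ks h) = Zp l (bS (nf 0 k ks h)).
Proof. by rewrite /nf ZpC //; exact: bZS. Qed.
Lemma Zp_nf l' l k ks h : Zp l' (nf l k ks h) = nf (l' + l) k ks h.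
Proof. by rewrite /nf -ZpD. Qed.

Lemma SAiS h : bS (Ai (bS h)) = A (bS (A h)).
Proof. by rewrite {2}/bS bAK -bSB. Qed.

Lemma Bi_SA h : Bi h = A (bSi (A h)).
Proof. by rewrite /bSi bAiK bAK. Qed.
Lemma B_SA h : B h = Ai (bS (Ai h)).
Proof. by rewrite /bS bAiK bAK. Qed.

Lemma SAS h : bS (A (bS h)) = bZ (Ai (bS (Ai h))).
Proof. by rewrite bSA -B_SA -bZB. Qed.

End OneStruct.

Fixpoint good (ks : seq int) : bool :=
  if ks is k :: ks' then (if ks' is [::] then true else 2 <= `|k|) && good ks' else true.

Lemma S_nf_ex (ks : seq int) (k0 : int) : good ks -> exists l k0' ks', good ks' /\
  forall b (h : bT b), bS (nf 0 k0 ks h) = nf l k0' ks' h.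
Proof.
elim: ks k0 => [|k1 ks IH] k0 gks.
  by exists 0, 0, [:: k0]; split.
have [big|small] := boolP (2 <= `|k0|).
  exists 0, 0, [:: k0, k1 & ks]; split=> //.
  by rewrite /= big; exact: gks.
have gks' : good ks by case/andP: gks.
have : k0 = 0 \/ k0 = -1 \/ k0 = 1 by lia.
case=> [->|[->|->]].
- by exists 1, k1, ks; split.
- have [l [k0' [ks' [g E]]]] := IH (k1 + 1) gks'.
  exists l, (k0' + 1), ks'; split=> // b h.
  rewrite [LHS](_ : _ = bS (bAi (bS (nf 0 k1 ks h)))) //.
  by rewrite SAiS A_nf E A_nf.
- have [l [k0' [ks' [g E]]]] := IH (k1 - 1) gks'.
  exists (1 + l), (k0' - 1), ks'; split=> // b h.
  rewrite [LHS](_ : _ = bS (bA (bS (nf 0 k1 ks h)))) //.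
  by rewrite SAS Ai_nf E Ai_nf -Zp1 Zp_nf.
Qed.

Lemma Si_S b (h : bT b) : bSi h = bZi (bS h).
Proof. by rewrite /bZi bSK. Qed.

Lemma run_nf (s : seq letter) : exists l k0 ks, good ks /\
  forall b (h : bT b), brun s h = nf l k0 ks h.
Proof.
elim: s => [|a s [l [k0 [ks [g E]]]]]; first by exists 0, 0, [::]; split.
case: a => /=.
- by exists l, (k0 + 1), ks; split=> // b h; rewrite -A_nf -E.
- by exists l, (k0 - 1), ks; split=> // b h; rewrite -Ai_nf -E.
- have [l' [k' [ks' [g' E']]]] := S_nf_ex (k0 + 1) g.
  exists (-1 + l + l'), (k' + 1), ks'; split=> // b h; rewrite E.
  rewrite [LHS]Bi_SA A_nf Si_S S_nf E' Zp_nf.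
  by rewrite -[bZi _]/(Zp (-1) _) Zp_nf A_nf addrA.
- have [l' [k' [ks' [g' E']]]] := S_nf_ex (k0 - 1) g.
  exists (l + l'), (k' - 1), ks'; split=> // b h; rewrite E.
  by rewrite [LHS]B_SA Ai_nf S_nf E' Zp_nf Ai_nf.
Qed.

Definition colA (c : int * int) := (c.1 + c.2, c.2).
Definition colAi (c : int * int) := (c.1 - c.2, c.2).
Definition colB (c : int * int) := (c.1, c.2 - c.1).
Definition colBi (c : int * int) := (c.1, c.2 + c.1).

Definition colstruct : bstruct.
refine (@BStruct (int * int)%type colA colAi colB colBi _ _ _ _ _).
- by case=> a c; rewrite /colA /colAi /= addrK.
- by case=> a c; rewrite /colA /colAi /= subrK.
- by case=> a c; rewrite /colB /colBi /= subrK.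
- by case=> a c; rewrite /colB /colBi /= addrK.
- by case=> a c; rewrite /colA /colB /=; congr (_, _); ring.
Defined.

Lemma word_mx_col (s : seq letter) :
  (word_mx s 0%R 0%R, word_mx s 1%R 0%R) = @brun colstruct s (1, 0) :> (int * int)%type.
Proof.
elim: s => [|a s IH]; first by rewrite /word_mx big_nil !mxE.
have -> : word_mx (a :: s) = letter_mx a *m word_mx s by rewrite /word_mx big_cons.
rewrite /= -IH !mxE !big_ord_recl !big_ord0 !mxE /=.
move: (word_mx s) => M; have -> : lift ord0 ord0 = 1 :> 'I_2 by apply/val_inj.
have -> : ord0 = 0 :> 'I_2 by apply/val_inj.
by case: a; rewrite /= /colA /colAi /colB /colBi /=; congr (_, _); ring.
Qed.

Lemma Ap_col k (c : int * int) : @Ap colstruct k c = (c.1 + k * c.2, c.2).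
Proof.
rewrite /Ap; elim/int_ind: k => [|n IH|n IH].
- by rewrite /= mul0r addr0; case: c.
- rewrite -addn1 PoszD itnS; [|exact: (@bAK colstruct)|exact: (@bAiK colstruct)].
  by rewrite IH /= /colA /=; congr (_, _); ring.
- rewrite -addn1 PoszD opprD itnP; [|exact: (@bAK colstruct)|exact: (@bAiK colstruct)].
  by rewrite IH /= /colAi /=; congr (_, _); ring.
Qed.

Lemma S_col (c : int * int) : @bS colstruct c = (c.2, - c.1).
Proof. by case: c => a c; rewrite /bS /= /colA /colB /=; congr (_, _); ring. Qed.

Lemma Zp_col l (c : int * int) : @Zp colstruct l c = c \/ @Zp colstruct l c = (- c.1, - c.2).
Proof.
have Z1 (d : int * int) : @bZ colstruct d = (- d.1, - d.2) by rewrite /bZ !S_col.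
rewrite /Zp; elim/int_ind: l => [|n IH|n IH]; first by left.
- rewrite -addn1 PoszD itnS; [|exact: bZK|exact: bZiK].
  by rewrite Z1; case: IH => ->; rewrite /= ?opprK; [right|left; case: c].
- rewrite -addn1 PoszD opprD itnP; [|exact: bZK|exact: bZiK].
  apply/or_comm.
  have Zi (d : bT colstruct) : bZi d = (- d.1, - d.2).
    by apply: (can_inj (@bZK colstruct)); rewrite bZiK Z1 /= !opprK; case: d.
  by rewrite Zi; case: IH => ->; rewrite /= ?opprK; [left|right; case: c].
Qed.

(* The entries of the column grow, as in a continued fraction whose partial
   quotients have absolute value at least 2. *)
Lemma nf_col l k0 ks : good ks -> (@nf colstruct l k0 ks (1, 0)).2 = 0 -> ks = [::].
Proof.
case: ks => // k ks gk; rewrite /nf.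
pose F ks : bT colstruct := foldr (fun k h => bS (Ap k h)) ((1, 0) : bT colstruct) ks.
have FE j js : F (j :: js) = ((F js).2, - ((F js).1 + j * (F js).2)).
  by rewrite -[LHS]/(bS (Ap j (F js))) Ap_col S_col.
have : `|(F (k :: ks)).2| > `|(F (k :: ks)).1|.
  elim: ks k gk => [|k1 ks IH] k; first by rewrite FE /= mulr0 addr0.
  case/andP=> k2 g; have := IH k1 g; rewrite (FE k).
  by move: k2; case: (F (k1 :: ks)) => a c /=; nia.
rewrite -/(F (k :: ks)); move: (F (k :: ks)) => c lt; rewrite Ap_col.
by case: (Zp_col l (c.1 + k0 * c.2, c.2)) => -> /= E; move: lt; lia.
Qed.

Theorem word_col_stab (s : seq letter) : @brun colstruct s (1, 0) = (1, 0) ->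
  exists l k, forall b (h : bT b), brun s h = Zp l (Ap k h).
Proof.
move=> E; have [l [k0 [ks [g R]]]] := run_nf s.
exists l, k0 => b h; rewrite R.
by have -> : ks = [::] by apply: (nf_col g (l := l) (k0 := k0)); rewrite -R E.
Qed.

End Words.
End BraidWords.

Module LaurentOperators.
Import Weights GroupAlgebraTheory MinimalElement ReducedWord Generators DahaRelations BraidWords.

Section Laurent.
Variable N : nat.
Hypothesis N0 : (0 < N)%N.
Local Notation L := (laurent N).
Local Notation r1 := (inord 1 : 'I_N.+1).
Implicit Types (b c : wt N) (f g : L) (i k : 'I_N.+1).

Lemma LXD b c : LX (b + c) = LX b * LX c.
Proof. by rewrite /LX -[LHS](gXM coefField b c). Qed.

Lemma LX0 : LX (0 : wt N) = 1. Proof. by []. Qed.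

Lemma LX_VX b : LX (- b) * LX b = 1.
Proof. by rewrite -LXD addNr. Qed.

Lemma laurent_ind (Q : L -> Prop) : Q 0 -> (forall f g, Q f -> Q g -> Q (f + g)) ->
  (forall (a : coefField) b, Q (a *: LX b)) -> forall f, Q f.
Proof. exact: galg_ind. Qed.

Definition sv i f : L := gev (fun b => LX (wact (swp i) b)) f.

Lemma wact0 (w : {perm 'I_N.+1}) : wact w 0 = 0.
Proof. by rewrite -wtE0 wact_wtE. Qed.

Lemma sv_lact i f : i != ord0 -> lact (srefl i) f = sv i f.
Proof.
move=> i0; rewrite /lact /sv /gev; apply: eq_bigr => b _; congr (_ *: _).
by rewrite srefl_n0 //= /LXa /= qpow0 scale1r.
Qed.

Lemma svM i f g : sv i (f * g) = sv i f * sv i g.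
Proof. by apply: gevM => b c; rewrite -?LXD -?wactD. Qed.
Lemma svD i f g : sv i (f + g) = sv i f + sv i g.
Proof. exact: gevD. Qed.
Lemma svZ i a f : sv i (a *: f) = a *: sv i f.
Proof. exact: gevZ. Qed.
Lemma svN i f : sv i (- f) = - sv i f.
Proof. exact: gevN. Qed.
Lemma svX i b : sv i (LX b) = LX (wact (swp i) b).
Proof. exact: gevX. Qed.
Lemma sv1 i : sv i 1 = 1.
Proof. by rewrite -LX0 svX wact0. Qed.

Lemma ipDl b c e : ip (b + c) e = ip b e + ip c e.
Proof.
rewrite -(wtE_eps b) -(wtE_eps c) -(wtE_eps e) wtED !ip_wtE.
have K (a b' s s' e' n : rat) : (a + b') - (s + s') * e' * n = a - s * e' * n + (b' - s' * e' * n) by ring.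
rewrite ![(_ * _)%:~R]rmorphM -K -!rmorphD /=; congr (_%:~R - _%:~R * _ * _).
  by rewrite -big_split; apply: eq_bigr => j _; rewrite /= mulrDl.
by rewrite -big_split.
Qed.

Lemma ip0 (e : wt N) : ip 0 e = 0.
Proof. by have := ipDl 0 0 e; rewrite addr0 -{1}[ip 0 e]addr0 => /addrI. Qed.

Definition qpi b : coefField := qpow N (- ip (wact (cyc N)^-1%g b) (we ord0)).

Lemma qpiD b c : qpi (b + c) = qpi b * qpi c.
Proof.
have E (d : wt N) : exists z : int, - ip d (we ord0) * (2 * N + 2)%:R = z%:~R.
  rewrite -(wtE_eps d) ip_we dbl.
  exists ((\sum_j eps d j - eps d ord0 * N.+1%:Z) * 2).
  have K (a s n : rat) : n != 0 -> - (a - s / n) * (2%:R * n) = (s - a * n) * 2%:R.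
    by move=> n0; field.
  by rewrite K ?n1_neq0 // rmorphM rmorphB /= rmorphM.
rewrite /qpi wactD ipDl; set d := wact _ b; set d' := wact _ c.
have [z zE] := E d; have [z' zE'] := E d'.
rewrite (qpowE zE) (qpowE zE') (@qpowE _ _ (z + z')) ?expfzDr ?u_neq0 //.
by rewrite opprD mulrDl zE zE' rmorphD.
Qed.

Definition pv f : L := gev (fun b => qpi b *: LX (wact (cyc N)^-1%g b)) f.

Lemma pv_lact f : lact (pi_act r1) f = pv f.
Proof.
rewrite /lact /pv /gev; apply: eq_bigr => b _.
by apply: (congr1 (fun g : L => f@_b *: g)); rewrite (pi1E N0) /LXa /qpi.
Qed.

Lemma pvM f g : pv (f * g) = pv f * pv g.
Proof.
by apply: gevM => b c; rewrite qpiD wactD LXD -scalerAl -scalerAr scalerA.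
Qed.
Lemma pvD f g : pv (f + g) = pv f + pv g.
Proof. exact: gevD. Qed.
Lemma pvZ a f : pv (a *: f) = a *: pv f.
Proof. exact: gevZ. Qed.
Lemma pvX b : pv (LX b) = qpi b *: LX (wact (cyc N)^-1%g b).
Proof. exact: gevX. Qed.
Lemma pv1 : pv 1 = 1.
Proof. by rewrite -LX0 pvX wact0 /qpi wact0 ip0 oppr0 qpow0 scale1r. Qed.

Lemma levE f : lev f = gev (W := coefField^o) (fun b => tpow (- ip (rho N) b)) f.
Proof. by []. Qed.

Definition trho b := tpow (- ip (rho N) b).

Lemma trho_int b : exists z : int, - ip (rho N) b * 2%:R = z%:~R.
Proof.
have n0 := n1_neq0 N; have : (\sum_(j < N.+1) (N - j)%N%:Z)%:~R = N%:R * N.+1%:R / 2%:R :> rat.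
  have := rho_we (N := N) ord0; rewrite rhoE ip_we subn0 /= subr0 => E1.
  have K (a s n : rat) : n != 0 -> a - s / n = a / 2%:R -> s = a * n / 2%:R.
    move=> nn EE; have -> : s = (a - (a - s / n)) * n by field.
    by rewrite EE; field.
  exact: K.
set S := \sum_j _ => SE.
rewrite -[b]wtE_eps rhoE ip_wtE -/S.
exists (N%:Z * \sum_k eps b k - \sum_(k < N.+1) (N - k)%N%:Z * eps b k * 2).
have K (a s n S' m : rat) : n != 0 -> S' = m * n / 2%:R ->
  - (a - S' * s / n) * 2%:R = m * s - a * 2%:R by move=> nn ->; field.
by rewrite [(S * _)%:~R]rmorphM (K _ _ _ _ N%:R) // rmorphB -mulr_suml !rmorphM.
Qed.

Lemma trhoD b c : trho (b + c) = trho b * trho c.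
Proof.
rewrite /trho ipC ipDl ![ip _ (rho N)]ipC.
have [z zE] := trho_int b; have [z' zE'] := trho_int c.
rewrite (tpowE zE) (tpowE zE') (@tpowE _ (z + z')) ?expfzDr ?v_neq0 //.
by rewrite opprD mulrDl zE zE' rmorphD.
Qed.

Lemma levM f g : lev (f * g) = lev f * lev g.
Proof. by rewrite !levE gevM // => b c; exact: trhoD. Qed.
Lemma levD f g : lev (f + g) = lev f + lev g.
Proof. by rewrite !levE gevD. Qed.
Lemma levZ a f : lev (a *: f) = a * lev f.
Proof. by rewrite !levE gevZ. Qed.
Lemma levX b : lev (LX b) = trho b.
Proof. by rewrite levE gevX. Qed.
Lemma trho0 : trho 0 = 1.
Proof. by rewrite /trho ipC ip0 oppr0 /tpow mul0r. Qed.
Lemma lev_we k : trho (we k) = v ^ (2 * k%:Z - N%:Z).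
Proof. exact: tpow_rho. Qed.

Lemma alpha_mulrn i (n : nat) : i != ord0 -> (0 < n)%N -> alpha N i *+ n != 0.
Proof.
move=> i0 n0; have ne := inordm1_neq i0; apply/eqP => E.
have : ip (wtE (ee (inord i.-1))) (alpha N i *+ n) = 0.
  by rewrite E ipC ip0.
have -> : ip (wtE (ee (inord i.-1))) (alpha N i *+ n) = n%:R.
  elim: n {n0 E} => [|n IH].
    by rewrite mulr0n ipC ip0.
  by rewrite mulrSr ipC ipDl ![ip _ (wtE _)]ipC IH ip_alpha // /ee eqxx eq_sym (negPf ne) subr0 natr1.
by move/eqP; rewrite pnatr_eq0 gtn_eqF.
Qed.

Lemma LX_reg i a f : i != ord0 -> (LX (alpha N i) - a%:A) * f = 0 -> f = 0.
Proof. by move=> i0; apply: gX_sub_reg => n n0; apply: alpha_mulrn. Qed.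

End Laurent.
End LaurentOperators.

Module PolynomialRep.
Import Weights GroupAlgebraTheory MinimalElement ReducedWord Generators DahaRelations BraidWords LaurentOperators.

Lemma quad_eigen (F : fieldType) (A : comAlgType F) (w : F) (X f s : A) : w != 0 ->
  (X - 1) * (w *: f - w *: s) = (w - w^-1) *: (s - f) ->
  (X - (w^-1 * w^-1)%:A) * (s - f) = 0.
Proof.
move=> w0 E; apply: (scalerI w0); rewrite scaler0.
have {}E : w *: ((X - 1) * (s - f)) = - ((w - w^-1) *: (s - f)).
  by rewrite -E -scalerBr -scalerAr -scalerN -mulrN opprB.
have -> : X - (w^-1 * w^-1)%:A = (X - 1) + (1 - (w^-1 * w^-1)%:A) by rewrite addrA subrK.
rewrite mulrDl scalerDr E; move: (s - f) => d.
have -> : (1 - (w^-1 * w^-1)%:A) * d = d - (w^-1 * w^-1) *: d.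
  by rewrite mulrBl mul1r -scalerAl mul1r.
by rewrite scalerBr scalerA mulVKf // -scalerBl addNr.
Qed.

Section DemazureAlgebra.
Variables (F : fieldType) (A : comAlgType F).
Implicit Types (c a : F) (X f g s r : A).

Lemma dem_D X c f f' g g' s r : X * f' = c *: (s - f) -> X * g' = c *: (r - g) ->
  X * (f' + g') = c *: ((s + r) - (f + g)).
Proof. by move=> E1 E2; rewrite mulrDr E1 E2 -scalerDr opprD addrACA. Qed.

Lemma dem_Z X c a f f' s : X * f' = c *: (s - f) -> X * (a *: f') = c *: (a *: s - a *: f).
Proof. by move=> E; rewrite -scalerAr E -scalerBr !scalerA mulrC. Qed.

Lemma dem_M X c f f' g g' s r : X * f' = c *: (s - f) -> X * g' = c *: (r - g) ->
  X * (s * g' + f' * g) = c *: (s * r - f * g).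
Proof.
move=> E1 E2; rewrite mulrDr mulrCA E2 mulrA E1 -scalerAr -scalerAl -scalerDr.
by rewrite mulrBr mulrBl addrA subrK.
Qed.

Lemma dem_V X c f f' g s r : X * f' = c *: (s - f) -> f * g = 1 -> s * r = 1 ->
  X * (- (r * f' * g)) = c *: (r - g).
Proof.
move=> E fg sr; have -> : X * (- (r * f' * g)) = - ((X * f') * (r * g)) by ring.
rewrite E -scalerAl -scalerN; congr (_ *: _).
have -> : - ((s - f) * (r * g)) = r * (f * g) - g * (s * r) by ring.
by rewrite fg sr !mulr1.
Qed.
End DemazureAlgebra.

Lemma v2_neq0 : v - v^-1 != 0.
Proof.
rewrite subr_eq0; apply/eqP => E; have := congr1 (fun z => v * z) E.
rewrite /= mulfV ?v_neq0 // /v -expr2 -tofracXn -tofrac1 => /eqP.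
rewrite tofrac_eq -polyC_exp => /eqP /(congr1 (fun p : coefRing => p`_0)).
by rewrite coefC coef1 /= => /(congr1 (fun p : {poly rat} => p`_2)); rewrite coefXn coef1.
Qed.

Lemma wt_ind N (Q : wt N -> Prop) : Q 0 -> (forall b c, Q b -> Q c -> Q (b + c)) ->
  (forall k, Q (we k)) -> (forall k, Q (- we k)) -> forall b, Q b.
Proof.
move=> Q0 QD Qp Qm b; rewrite -[b]wtE_eps wtE_we; elim/big_rec: _ => [|k c _ IH] //.
apply: (QD) => //; case: (eps b k) => n.
  by rewrite -pmulrn; elim: n => [|n IHn] //; rewrite mulrS; apply: (QD).
rewrite NegzE mulrNz -pmulrn; elim: n => [|n IHn]; first by rewrite mulr1n.
by rewrite mulrS opprD; apply: (QD).
Qed.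

Section RepSpec.
Variables (N : nat) (D : daha N).
Local Notation H := (daha_alg D).
Variable L : comAlgType coefField.
Variables (X : wt N -> L) (sv : 'I_N.+1 -> L -> L) (pv : L -> L).
Variables (lv : L -> coefField) (emb : L -> H) (act : H -> L -> L).

(* Abstract presentation of the polynomial representation: L stands for the
   Laurent polynomials, whose concrete construction is expensive to unfold. *)
Record rep_spec : Prop := RepSpec {
  rX0 : X 0 = 1;
  rXD : forall b c, X (b + c) = X b * X c;
  rLind : forall Q : L -> Prop, Q 0 -> (forall f g, Q f -> Q g -> Q (f + g)) ->
    (forall a b, Q (a *: X b)) -> forall f, Q f;
  rXreg : forall (i : 'I_N.+1) a f, i != ord0 -> (X (alpha N i) - a%:A) * f = 0 -> f = 0;
  rsvL : forall i a f g, sv i (a *: f + g) = a *: sv i f + sv i g;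
  rsvM : forall i f g, sv i (f * g) = sv i f * sv i g;
  rsvX : forall i b, sv i (X b) = X (wact (swp i) b);
  rpvL : forall a f g, pv (a *: f + g) = a *: pv f + pv g;
  rpvM : forall f g, pv (f * g) = pv f * pv g;
  rpvX : forall b, pv (X b) = qpi b *: X (wact (cyc N)^-1%g b);
  rlvL : forall a f g, lv (a *: f + g) = a * lv f + lv g;
  rlvM : forall f g, lv (f * g) = lv f * lv g;
  rlvX : forall b, lv (X b) = trho b;
  rembL : forall a f g, emb (a *: f + g) = a *: emb f + emb g;
  rembX : forall b, emb (X b) = dX D b;
  ractL : forall h a f g, act h (a *: f + g) = a *: act h f + act h g;
  ractZ : forall a h k f, act (a *: h + k) f = a *: act h f + act k f;
  ract1 : forall f, act 1 f = f;
  ractM : forall h k f, act (h * k) f = act h (act k f);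
  ractX : forall b f, act (dX D b) f = X b * f;
  ractT : forall (i : 'I_N.+1) f, i != ord0 ->
    (X (alpha N i) - 1) * (act (hT D i) f - v *: sv i f) = (v - v^-1) *: (sv i f - f);
  ractPi : forall f, act (hpi D) f = pv f
}.

End RepSpec.

Section LaurentRep.
Variables (N : nat) (D : daha N).
Hypothesis N0 : (0 < N)%N.

#[export] HB.instance Definition _ := GRing.Lalgebra_isComAlgebra.Build coefField (laurent N).

Lemma laurent_rep : rep_spec (@LX N : wt N -> laurent N) (@sv N) (@pv N) (@lev N)
  (fun f : laurent N => gev (dX D) f : daha_alg D) (@dact N D).
Proof.
have rels := (dahaP D).1; have aP := dactP D.
split.
- exact: LX0.
- exact: LXD.
- exact: laurent_ind.
- exact: LX_reg.
- by move=> i a f g; rewrite svD svZ.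
- exact: svM.
- exact: svX.
- by move=> a f g; rewrite pvD pvZ.
- exact: pvM.
- exact: pvX.
- by move=> a f g; rewrite levD levZ.
- exact: levM.
- exact: levX.
- by move=> a f g; rewrite gevD gevZ.
- exact: gevX.
- exact: (act_linear aP).
- exact: (act_linearl aP).
- exact: (act_1 aP).
- exact: (act_M aP).
- exact: (act_X aP).
- move=> i f i0; have := act_T aP i f; rewrite (aroot_n0 i0) (sv_lact f i0).
  have -> : LXa (alpha N i, 0) = LX (alpha N i) by rewrite /LXa qpow0 scale1r.
  exact: id.
- by move=> f; rewrite /hpi (act_Pi aP) (pv_lact N0).
Qed.

End LaurentRep.

Opaque u v.
Lemma lin0 (K : fieldType) (V W : lmodType K) (F : V -> W) :
  (forall a (f g : V), F (a *: f + g) = a *: F f + F g) -> F 0 = 0.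
Proof. by move=> FL; have := FL (-1) 0 0; rewrite scaler0 addr0 scaleN1r addNr. Qed.
Lemma linD (K : fieldType) (V W : lmodType K) (F : V -> W) :
  (forall a (f g : V), F (a *: f + g) = a *: F f + F g) -> forall f g : V, F (f + g) = F f + F g.
Proof. by move=> FL f g; rewrite -[f]scale1r FL !scale1r. Qed.
Lemma linZ (K : fieldType) (V W : lmodType K) (F : V -> W) :
  (forall a (f g : V), F (a *: f + g) = a *: F f + F g) -> forall a (f : V), F (a *: f) = a *: F f.
Proof. by move=> FL a f; rewrite -[_ *: f]addr0 FL (lin0 FL) addr0. Qed.
Lemma linN (K : fieldType) (V W : lmodType K) (F : V -> W) :
  (forall a (f g : V), F (a *: f + g) = a *: F f + F g) -> forall f : V, F (- f) = - F f.
Proof. by move=> FL f; rewrite -scaleN1r (linZ FL) scaleN1r. Qed.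

Section Action.
Variable N : nat.
Hypothesis N0 : (0 < N)%N.
Variable D : daha N.
Local Notation H := (daha_alg D).
Variable L : comAlgType coefField.
Variables (X : wt N -> L) (sv : 'I_N.+1 -> L -> L) (pv : L -> L).
Variables (lv : L -> coefField) (emb : L -> daha_alg D) (act : daha_alg D -> L -> L).
Hypothesis rep : rep_spec X sv pv lv emb act.
Local Notation hT := (hT D).
Local Notation hTi := (hTi D).
Local Notation x := (hx D ord0).
Local Notation xi := (hxi D ord0).
Local Notation Y := (hY D).
Local Notation Yi := (hYi D).
Local Notation pi := (hpi D).
Local Notation r1 := (inord 1 : 'I_N.+1).
Let rels : daha_rels (@dT N D) (@dPi N D) (@dX N D) := (dahaP D).1.
Implicit Types (f g : L) (h k : H) (a : coefField) (i : 'I_N.+1) (b : wt N).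

Lemma embD f g : emb (f + g) = emb f + emb g. Proof. exact: linD (rembL rep) f g. Qed.
Lemma embZ a f : emb (a *: f) = a *: emb f. Proof. exact: linZ (rembL rep) a f. Qed.
Lemma embX b : emb (X b) = dX D b. Proof. exact: rembX rep b. Qed.
Lemma emb1 : emb 1 = 1. Proof. by rewrite -(rX0 rep) embX (rel_X0 rels). Qed.
Lemma emb0 : emb 0 = 0. Proof. exact: lin0 (rembL rep). Qed.
Lemma embN f : emb (- f) = - emb f. Proof. exact: linN (rembL rep) f. Qed.
Lemma embB f g : emb (f - g) = emb f - emb g. Proof. by rewrite embD embN. Qed.
Lemma embM f g : emb (f * g) = emb f * emb g.
Proof.
elim/(rLind rep): f => [|f1 f2 H1 H2|a b]; first by rewrite mul0r emb0 mul0r.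
  by rewrite mulrDl !embD mulrDl H1 H2.
rewrite -scalerAl !embZ -scalerAl; congr (_ *: _).
elim/(rLind rep): g => [|f1 f2 H1 H2|a' c]; first by rewrite mulr0 emb0 mulr0.
  by rewrite mulrDr !embD mulrDr H1 H2.
by rewrite -scalerAr !embZ -scalerAr -(rXD rep) !embX (rel_XD rels).
Qed.

Lemma svD i f g : sv i (f + g) = sv i f + sv i g. Proof. exact: linD (rsvL rep i) f g. Qed.
Lemma svZ i a f : sv i (a *: f) = a *: sv i f. Proof. exact: linZ (rsvL rep i) a f. Qed.
Lemma svN i f : sv i (- f) = - sv i f. Proof. exact: linN (rsvL rep i) f. Qed.
Lemma svM i f g : sv i (f * g) = sv i f * sv i g. Proof. exact: rsvM rep i f g. Qed.
Lemma svX i b : sv i (X b) = X (wact (swp i) b). Proof. exact: rsvX rep i b. Qed.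
Lemma sv1 i : sv i 1 = 1. Proof. by rewrite -(rX0 rep) svX wact0. Qed.
Lemma pvD f g : pv (f + g) = pv f + pv g. Proof. exact: linD (rpvL rep) f g. Qed.
Lemma pvZ a f : pv (a *: f) = a *: pv f. Proof. exact: linZ (rpvL rep) a f. Qed.
Lemma pvX b : pv (X b) = qpi b *: X (wact (cyc N)^-1%g b). Proof. exact: rpvX rep b. Qed.
Lemma pv1 : pv 1 = 1.
Proof. by rewrite -(rX0 rep) pvX wact0 /qpi wact0 ip0 oppr0 qpow0 scale1r. Qed.

Lemma act_r0 h : act h 0 = 0. Proof. exact: lin0 (ractL rep h). Qed.
Lemma act_rD h f g : act h (f + g) = act h f + act h g. Proof. exact: linD (ractL rep h) f g. Qed.
Lemma act_rZ h a f : act h (a *: f) = a *: act h f. Proof. exact: linZ (ractL rep h) a f. Qed.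
Lemma act_l0 f : act 0 f = 0. Proof. exact: (lin0 (F := act^~ f) (fun a h k => ractZ rep a h k f)). Qed.
Lemma act_lD h k f : act (h + k) f = act h f + act k f.
Proof. exact: (linD (F := act^~ f) (fun a h k => ractZ rep a h k f)). Qed.
Lemma act_lZ a h f : act (a *: h) f = a *: act h f.
Proof. exact: (linZ (F := act^~ f) (fun a h k => ractZ rep a h k f)). Qed.
Lemma act_one f : act 1 f = f. Proof. exact: ract1 rep f. Qed.
Lemma actM h k f : act (h * k) f = act h (act k f). Proof. exact: ractM rep h k f. Qed.

Lemma act_emb f g : act (emb f) g = f * g.
Proof.
elim/(rLind rep): f => [|f1 f2 H1 H2|a b]; first by rewrite emb0 act_l0 mul0r.
  by rewrite embD act_lD H1 H2 mulrDl.
by rewrite embZ act_lZ embX (ractX rep) scalerAl.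
Qed.

Lemma act_hT i f : i != ord0 ->
  (X (alpha N i) - 1) * (act (hT i) f - v *: sv i f) = (v - v^-1) *: (sv i f - f).
Proof. exact: (ractT rep). Qed.

Lemma Xreg i a f : i != ord0 -> (X (alpha N i) - a%:A) * f = 0 -> f = 0.
Proof. exact: (rXreg rep). Qed.

Lemma Xreg1 i f : i != ord0 -> (X (alpha N i) - 1) * f = 0 -> f = 0.
Proof. by move=> i0; rewrite -(scale1r (1 : L)); exact: Xreg. Qed.

Lemma act_hpi f : act pi f = pv f.
Proof. exact: (ractPi rep). Qed.

Lemma act_hT_inv i f : i != ord0 -> (act (hT i) f == v *: f) = (sv i f == f).
Proof.
move=> i0; have E := act_hT f i0; apply/eqP/eqP => [E1|E1].
  move: E; rewrite E1 => /(quad_eigen v_neq0) /(Xreg i0) /eqP.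
  by rewrite subr_eq0 => /eqP.
move: E; rewrite E1 [f - f]subrr scaler0 => /(Xreg1 i0) /eqP.
by rewrite subr_eq0 => /eqP.
Qed.

Lemma act_hT1 i : i != ord0 -> act (hT i) 1 = v *: 1.
Proof. by move=> i0; apply/eqP; rewrite act_hT_inv // sv1. Qed.

Lemma act_pi1 : act pi 1 = 1.
Proof. by rewrite act_hpi pv1. Qed.

(* Demazure-Lusztig form of the relations between T_i and X_b. *)
Definition DL i f := exists2 f', hT i * emb f = emb (sv i f) * hT i + emb f' &
  (X (alpha N i) - 1) * f' = (v - v^-1) *: (sv i f - f).

Lemma DL_D i f g : DL i f -> DL i g -> DL i (f + g).
Proof.
case=> f' E1 E2 [g' E3 E4]; exists (f' + g').
  by rewrite embD mulrDr E1 E3 svD !embD mulrDl addrACA.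
by rewrite svD; exact: dem_D E2 E4.
Qed.

Lemma DL_Z i a f : DL i f -> DL i (a *: f).
Proof.
case=> f' E1 E2; exists (a *: f').
  by rewrite embZ -scalerAr E1 svZ !embZ scalerDr scalerAl.
by rewrite svZ; exact: dem_Z.
Qed.

Lemma DL_M i f g : DL i f -> DL i g -> DL i (f * g).
Proof.
case=> f' E1 E2 [g' E3 E4]; exists (sv i f * g' + f' * g).
  rewrite svM !embM embD !embM.
  by rewrite mulrA E1 mulrDl -(mulrA _ (hT i)) E3 mulrDr -addrA -mulrA.
by rewrite svM; exact: dem_M E2 E4.
Qed.

Lemma DL_1 i : DL i 1.
Proof.
by exists 0; rewrite ?sv1 ?emb1 ?emb0 ?mulr1 ?mul1r ?addr0 ?subrr ?scaler0 ?mulr0.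
Qed.

Lemma DL_V i f g : f * g = 1 -> DL i f -> DL i g.
Proof.
move=> fg [f' E1 E2]; exists (- (sv i g * f' * g)).
  have gf : emb (sv i g) * emb (sv i f) = 1 by rewrite -embM -svM mulrC fg sv1 emb1.
  have E3 : emb (sv i g) * hT i = hT i * emb g + emb (sv i g) * emb f' * emb g.
    transitivity (emb (sv i g) * (hT i * emb f) * emb g).
      by rewrite -!mulrA -embM fg emb1 mulr1.
    by rewrite E1 mulrDr mulrDl !mulrA gf mul1r.
  by rewrite E3 embN !embM addrK.
by apply: (dem_V E2 fg); rewrite -svM fg sv1.
Qed.

Lemma hTT i : hT i * hT i = (v - v^-1) *: hT i + 1.
Proof.
have := hT_Ti D i; rewrite /Generators.hTi /Tinv -/(Generators.hT D i) mulrBr -scalerAr mulr1 => /eqP.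
by rewrite subr_eq => /eqP ->; rewrite addrC.
Qed.

Lemma DL_we i b : i != ord0 -> DL i (X b).
Proof.
move=> i0; have ne := inordm1_neq i0.
suff Hk (k : 'I_N.+1) : DL i (X (we k)).
  have HV (k : 'I_N.+1) : DL i (X (- we k)).
    by apply: DL_V (Hk k); rewrite -(rXD rep) subrr (rX0 rep).
  elim/wt_ind: b => [|b c Hb Hc|k|k] //; first by rewrite (rX0 rep); exact: DL_1.
  by rewrite (rXD rep); apply: DL_M.
have al : X (alpha N i) * X (we i) = X (we (inord i.-1)).
  by rewrite -(rXD rep) alpha_we // subrK.
case: (altP (k =P inord i.-1)) => [->|k1].
  exists (- (v - v^-1) *: X (we i)).
    rewrite svX wact_we /swp tpermL !embZ !embX.
    rewrite (hTx1 D i0) /Generators.hTi /Tinv mulrBr -scalerAr mulr1 scaleNr.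
    by [].
  rewrite svX wact_we /swp tpermL -scalerAr mulrBl mul1r al scaleNr -scalerN opprB.
  by [].
case: (altP (k =P i)) => [->|k2].
  exists ((v - v^-1) *: X (we i)).
    rewrite svX wact_we /swp tpermR !embZ !embX -/(hx D i) -/(hx D _).
    have E : hT i * hx D (inord i.-1) * hT i = hx D i.
      by rewrite (hTx1 D i0) -mulrA hTi_T mulr1.
    have -> : hT i * hx D i = (hT i * hT i) * (hx D (inord i.-1) * hT i).
      by rewrite -{1}E !mulrA.
    by rewrite hTT mulrDl mul1r -scalerAl mulrA E addrC.
  rewrite svX wact_we /swp tpermR -scalerAr mulrBl mul1r al.
  by [].
exists 0; rewrite svX wact_we /swp tpermD 1?eq_sym // ?emb0 ?addr0 ?mulr0 ?subrr ?scaler0 //.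
by rewrite embX; apply: hTx0.
Qed.

Lemma hT_emb i f : i != ord0 -> DL i f.
Proof.
move=> i0; elim/(rLind rep): f => [|f g|a b]; last by apply/DL_Z/DL_we.
  by rewrite -(scale0r (1 : L)); apply/DL_Z/DL_1.
exact: DL_D.
Qed.

Lemma DL_act i f f' : i != ord0 -> (X (alpha N i) - 1) * f' = (v - v^-1) *: (sv i f - f) ->
  act (hT i) f = v *: sv i f + f'.
Proof.
move=> i0 E; apply/eqP; rewrite -subr_eq0; apply/eqP.
by apply: (Xreg1 i0); rewrite opprD addrA mulrBr act_hT // E subrr.
Qed.

Lemma hT_emb_sym i f : i != ord0 -> sv i f = f -> hT i * emb f = emb f * hT i.
Proof.
move=> i0 sf; have [f' -> E] := hT_emb f i0.
move: E; rewrite sf subrr scaler0 => /(Xreg1 i0) ->.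
by rewrite emb0 addr0.
Qed.

Lemma pi_emb f : pi * emb f = emb (pv f) * pi.
Proof.
elim/(rLind rep): f => [|f g Hf Hg|a b].
- by rewrite -(scale0r (1 : L)) pvZ !embZ !scale0r mulr0 mul0r.
- by rewrite pvD !embD mulrDr mulrDl Hf Hg.
rewrite pvZ !embZ -scalerAr -scalerAl embX pvX embZ embX; congr (_ *: _).
by rewrite /hpi (rel_piX rels) /Xa pi1E.
Qed.

End Action.
End PolynomialRep.

Module Evaluation.
Import Weights GroupAlgebraTheory MinimalElement ReducedWord Generators DahaRelations BraidWords LaurentOperators PolynomialRep.

Lemma expz_shift2 (F : fieldType) (w : F) (z : int) : w != 0 ->
  w ^ (2 + z) = w * w * w ^ z.
Proof. by move=> w0; rewrite expfzDr. Qed.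

Lemma expz_shift2V (F : fieldType) (w : F) (z : int) : w != 0 ->
  w ^ z = w^-1 * w^-1 * w ^ (z + 2).
Proof. by move=> w0; rewrite addrC expz_shift2 // -!mulrA !mulKf. Qed.

Section Evaluation.
Variable N : nat.
Hypothesis N0 : (0 < N)%N.
Variable D : daha N.
Local Notation H := (daha_alg D).
Variable L : comAlgType coefField.
Variables (X : wt N -> L) (sv : 'I_N.+1 -> L -> L) (pv : L -> L).
Variables (lv : L -> coefField) (emb : L -> daha_alg D) (act : daha_alg D -> L -> L).
Hypothesis rep : rep_spec X sv pv lv emb act.
Local Notation hT := (hT D).
Local Notation hTi := (hTi D).
Local Notation x := (hx D ord0).
Local Notation xi := (hxi D ord0).
Local Notation Y := (hY D).
Local Notation Yi := (hYi D).
Local Notation pi := (hpi D).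
Let rels : daha_rels (@dT N D) (@dPi N D) (@dX N D) := (dahaP D).1.
Implicit Types (f g : L) (h k : H) (a : coefField) (i : 'I_N.+1) (b : wt N).

Lemma size_cword : size (cword N) = N.
Proof. by rewrite size_rev size_map size_iota. Qed.

Section RightInvariant.
Variables (W : lmodType coefField) (E : H -> W).
Hypothesis EL : forall a h k, E (a *: h + k) = a *: E h + E k.
Hypothesis ET : forall h i, i != ord0 -> E (h * hT i) = v *: E h.
Hypothesis EY : forall h, E (h * Y) = v ^+ N *: E h.

Lemma ETi h i : i != ord0 -> E (h * hTi i) = v^-1 *: E h.
Proof.
move=> i0; apply: (scalerI v_neq0); rewrite -(ET _ i0) -mulrA hTi_T mulr1 scalerA.
by rewrite mulfV ?v_neq0 // scale1r.
Qed.

Lemma EpTi h s : all (fun j => j != ord0) s -> E (h * pTi D s) = v ^- size s *: E h.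
Proof.
elim: s h => [|i s IH] h /=; first by rewrite /pTi big_nil mulr1 invr1 scale1r.
by case/andP=> i0 sn; rewrite pTi_cons mulrA IH // ETi // scalerA exprSr invfM mulrC.
Qed.

Lemma Epi h : E (h * pi) = E h.
Proof.
rewrite (hpi_YUi N0) mulrA EpTi ?rcword_n0 // EY size_rev size_cword scalerA mulVf ?scale1r //.
by rewrite expf_neq0 ?v_neq0.
Qed.

Lemma E_add h k : E (h + k) = E h + E k. Proof. exact: linD EL h k. Qed.
Lemma E_scale a h : E (a *: h) = a *: E h. Proof. exact: linZ EL a h. Qed.

Lemma E_emb_act h : inS h -> forall k f, E (k * h * emb f) = E (k * emb (act h f)).
Proof.
have EM h1 h2 : (forall k f, E (k * h1 * emb f) = E (k * emb (act h1 f))) ->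
  (forall k f, E (k * h2 * emb f) = E (k * emb (act h2 f))) ->
  forall k f, E (k * (h1 * h2) * emb f) = E (k * emb (act (h1 * h2) f)).
  by move=> H1 H2 k f; rewrite mulrA H2 H1 (actM rep).
have Esc a k f : E (k * a%:A * emb f) = E (k * emb (act a%:A f)).
  rewrite -scalerAr mulr1 (act_lZ rep) (act_one rep) (embZ rep) -scalerAl -scalerAr.
  by [].
have EX b k f : E (k * dX D b * emb f) = E (k * emb (act (dX D b) f)).
  by rewrite (ractX rep) (embM rep) (embX rep) mulrA.
have ETT i : i != ord0 -> forall k f, E (k * hT i * emb f) = E (k * emb (act (hT i) f)).
  move=> i0 k f; have [f' E1 E2] := hT_emb rep f i0.
  rewrite -mulrA E1 mulrDr E_add mulrA ET // (DL_act rep i0 E2) (embD rep) (embZ rep).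
  by rewrite mulrDr E_add -scalerAr E_scale.
have Epp k f : E (k * pi * emb f) = E (k * emb (act pi f)).
  by rewrite -mulrA (pi_emb N0 rep) mulrA Epi (act_hpi rep).
have EpT s : all (fun j => j != ord0) s ->
    forall k f, E (k * pT D s * emb f) = E (k * emb (act (pT D s) f)).
  elim: s => [|i s IH] /=.
    move=> _ k f; rewrite /pT big_nil -(scale1r (1 : H)); exact: Esc.
  by case/andP=> i0 sn; rewrite pT_cons; apply: EM; [exact: ETT | exact: IH].
have EYY k f : E (k * Y * emb f) = E (k * emb (act Y f)).
  by rewrite (hY_piU N0); apply: EM => //; apply: EpT; exact: cword_n0.
elim=> {h} [a|||||i i0|h1 h2 _ S1 _ S2|h1 h2 _ S1 _ S2] k f.
- exact: Esc.
- exact: EX.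
- exact: EX.
- exact: EYY.
- have -> : f = act Y (act Yi f) by rewrite -(actM rep) hY_Yi (act_one rep).
  rewrite -(EYY _ (act Yi f)) -[k * Yi * Y]mulrA hYi_Y mulr1.
  by rewrite -[act Y (act Yi f)](actM rep) hY_Yi (act_one rep).
- exact: ETT.
- by rewrite mulrDr mulrDl E_add S1 S2 -E_add -mulrDr -(embD rep) (act_lD rep).
- exact: EM.
Qed.

Lemma E_act1 h : inS h -> E h = E (emb (act h 1)).
Proof.
by move=> Sh; have := E_emb_act Sh 1 1; rewrite (emb1 rep) mulr1 !mul1r.
Qed.

End RightInvariant.

Lemma lv1 : lv 1 = 1. Proof. by rewrite -(rX0 rep) (rlvX rep) trho0. Qed.
Lemma lvD f g : lv (f + g) = lv f + lv g.
Proof. by rewrite -[f]scale1r (rlvL rep) !mul1r scale1r. Qed.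
Lemma lv0 : lv 0 = 0.
Proof. by have := lvD 0 0; rewrite addr0 -{1}[lv 0]addr0 => /addrI. Qed.
Lemma lvZ a f : lv (a *: f) = a * lv f.
Proof. by rewrite -[_ *: f]addr0 (rlvL rep) lv0 addr0. Qed.
Lemma lvN f : lv (- f) = - lv f.
Proof. by rewrite -scaleN1r lvZ mulN1r. Qed.
Lemma lvB f g : lv (f - g) = lv f - lv g.
Proof. by rewrite lvD lvN. Qed.
Lemma lvM f g : lv (f * g) = lv f * lv g. Proof. exact: (rlvM rep). Qed.

Lemma lv_hT i f : i != ord0 -> lv (act (hT i) f) = v * lv f.
Proof.
move=> i0; have := congr1 lv (act_hT rep f i0).
rewrite lvM !lvB !lvZ lvB lv1 (rlvX rep).
have -> : trho (alpha N i) = v^-1 * v^-1.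
  have /andP[i1 i2] := n0_bnd i0.
  have E : trho (alpha N i) * trho (we i) = trho (we (inord i.-1 : 'I_N.+1)).
    by rewrite -trhoD alpha_we // subrK.
  have u0 : trho (we i) != 0 by rewrite lev_we expfz_neq0 ?v_neq0.
  apply: (mulIf u0); rewrite E !lev_we inordK; last by lia.
  have -> : 2 * (i : nat)%:Z - N%:Z = 2 * (i.-1)%:Z - N%:Z + 2 by lia.
  exact: expz_shift2V v_neq0.
have K (F : fieldType) (w A s l : F) : w != 0 -> w - w^-1 != 0 ->
    (w^-1 * w^-1 - 1) * (A - w * s) = (w - w^-1) * (s - l) -> A = w * l.
  move=> w0 w2 EE; apply: (mulfI w2); apply: (mulfI (invr_neq0 w0)).
  have -> : w^-1 * ((w - w^-1) * A) = - ((w^-1 * w^-1 - 1) * (A - w * s)) + w^-1 * (w - w^-1) * w * s.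
    by field.
  by rewrite EE; field.
exact: K v_neq0 v2_neq0.
Qed.

Definition ev h : coefField := lv (act h 1).

Lemma act_hT1 i : i != ord0 -> act (hT i) 1 = v *: 1.
Proof. exact: (PolynomialRep.act_hT1 rep). Qed.

Lemma act_pT1 s : all (fun j => j != ord0) s -> act (pT D s) 1 = v ^+ size s *: 1.
Proof.
elim: s => [|i s IH] /=; first by rewrite /pT big_nil (act_one rep) scale1r.
case/andP=> i0 sn; rewrite pT_cons (actM rep) IH // (act_rZ rep) act_hT1 //.
by rewrite scalerA exprSr.
Qed.

Lemma act_Y1 : act Y 1 = v ^+ N *: 1.
Proof.
rewrite (hY_piU N0) (actM rep) act_pT1 ?cword_n0 // (act_rZ rep) (act_pi1 rep).
by rewrite size_cword.
Qed.

Lemma act_Yi1 : act Yi 1 = v ^- N *: 1.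
Proof.
have v0 : v ^+ N != 0 by rewrite expf_neq0 ?v_neq0.
apply: (scalerI v0); rewrite -(act_rZ rep) -act_Y1 -(actM rep) hYi_Y (act_one rep).
by rewrite scalerA mulfV // scale1r.
Qed.

Lemma act_hJ1 : act (hJ D) 1 = v ^+ N *: (v ^+ N *: 1).
Proof.
rewrite (actM rep) (act_pT1 (cword_n0 _)) (act_rZ rep) (act_pT1 (rcword_n0 _)).
by rewrite [size (rev (cword N))]size_rev !size_cword.
Qed.

Lemma ev_lin a h k : ev (a *: h + k) = a * ev h + ev k.
Proof. by rewrite /ev (ractZ rep) (rlvL rep). Qed.

Lemma ev_Tl i h : i != ord0 -> ev (hT i * h) = v * ev h.
Proof. by move=> i0; rewrite /ev (actM rep) lv_hT. Qed.
Lemma ev_Tr i h : i != ord0 -> ev (h * hT i) = v * ev h.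
Proof. by move=> i0; rewrite /ev (actM rep) act_hT1 // (act_rZ rep) lvZ. Qed.
Lemma ev_xl h : ev (x * h) = v ^- N * ev h.
Proof.
by rewrite /ev (actM rep) (ractX rep) lvM (rlvX rep) lev_we mulr0 sub0r exprnN.
Qed.
Lemma ev_xil h : ev (xi * h) = v ^+ N * ev h.
Proof.
have v0 : v ^+ N != 0 by rewrite expf_neq0 ?v_neq0.
by rewrite -{2}[h]mul1r -(hx_xi D ord0) -mulrA ev_xl mulrA mulfV // mul1r.
Qed.
Lemma ev_1 : ev 1 = 1. Proof. by rewrite /ev (act_one rep) lv1. Qed.

Lemma ev_pTl s h : all (fun j => j != ord0) s -> ev (pT D s * h) = v ^+ size s * ev h.
Proof.
elim: s => [|i s IH] /=; first by rewrite /pT big_nil !mul1r.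
by case/andP=> i0 sn; rewrite pT_cons -mulrA ev_Tl // IH // exprS mulrA.
Qed.
Lemma ev_Jl h : ev (hJ D * h) = v ^+ N * (v ^+ N * ev h).
Proof.
rewrite -mulrA (ev_pTl _ (rcword_n0 _)) (ev_pTl _ (cword_n0 _)).
by rewrite [size (rev (cword N))]size_rev !size_cword.
Qed.
Lemma ev_Jil h : ev (hJi D * h) = v ^- N * (v ^- N * ev h).
Proof.
have v0 : v ^+ N != 0 by rewrite expf_neq0 ?v_neq0.
rewrite -{2}[h]mul1r -(hJ_Ji D) -mulrA ev_Jl; move: (ev _) => z.
by rewrite !mulKf.
Qed.

Lemma ev_unique (E : H -> coefField) :
  (forall a h k, E (a *: h + k) = a * E h + E k) ->
  (forall h i, i != ord0 -> E (hT i * h) = v * E h) ->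
  (forall h i, i != ord0 -> E (h * hT i) = v * E h) ->
  (forall h, E (x * h) = v ^- N * E h) ->
  (forall h, E (h * Y) = v ^+ N * E h) -> E 1 = 1 ->
  forall h, inS h -> E h = ev h.
Proof.
move=> EL ETl ETr Ex EY E1 h Sh.
rewrite (@E_act1 coefField^o E) //; rewrite /ev; move: (act h 1) => f {h Sh}.
have EXk (k : 'I_N.+1) h : E (hx D k * h) = trho (we k) * E h.
  suff Hk (n : nat) (k' : 'I_N.+1) : k' = n :> nat -> E (hx D k' * h) = trho (we k') * E h by exact: Hk.
  elim: n k' h {k} => [|n IH] k h kn.
    by have -> : k = ord0 by [apply/val_inj]; rewrite Ex lev_we mulr0 sub0r exprnN.
  have k0 : k != ord0 by rewrite -val_eqE /= kn.
  have -> : hx D k = hT k * hx D (inord k.-1) * hT k.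
    by rewrite (hTx1 D k0) -mulrA hTi_T mulr1.
  have kE : (inord k.-1 : 'I_N.+1) = n :> nat by rewrite kn inordK // -kn ltnW.
  rewrite -!mulrA ETl // (IH _ _ kE) ETl // !lev_we kE kn.
  have -> : 2 * n.+1%:Z - N%:Z = 2 + (2 * n%:Z - N%:Z) by lia.
  rewrite (expz_shift2 _ v_neq0).
  have C (F : comPzRingType) (w a e : F) : w * (a * (w * e)) = w * w * a * e.
    by rewrite mulrA mulrCA !mulrA.
  exact: C.
have tV b : trho b * trho (- b) = 1 by rewrite -trhoD subrr trho0.
have EXb b h : E (dX D b * h) = trho b * E h.
  elim/wt_ind: b h => [|b c Hb Hc|k|k] h.
  - by rewrite (rel_X0 rels) trho0 !mul1r.
  - by rewrite (rel_XD rels) -mulrA Hb Hc trhoD mulrA.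
  - exact: EXk.
  - have -> : h = hx D k * (hxi D k * h) by rewrite mulrA hx_xi mul1r.
    rewrite [dX D _ * (_ * _)]mulrA -[dX D _]/(hxi D k) hxi_x mul1r EXk mulrA.
    by rewrite [trho (- _) * _]mulrC tV mul1r.
have E0 : E 0 = 0.
  have := EL 0 0 0; rewrite scale0r addr0 mul0r add0r => EE.
  by have := EL (-1) 0 0; rewrite scaler0 addr0 mulN1r addNr.
elim/(rLind rep): f => [|f g Hf Hg|a b].
- by rewrite (emb0 rep) lv0.
- by rewrite (embD rep) lvD -[emb f]scale1r EL mul1r Hf Hg.
- rewrite (embZ rep) lvZ (embX rep) (rlvX rep) -[_ *: _]addr0 EL E0 addr0.
  by rewrite -[dX D b]mulr1 EXb E1 mulr1.
Qed.

End Evaluation.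
End Evaluation.

Module ModularAction.
Import Weights GroupAlgebraTheory MinimalElement ReducedWord Generators DahaRelations BraidWords LaurentOperators PolynomialRep Evaluation.

Section Letters.
Variable N : nat.
Hypothesis N0 : (0 < N)%N.
Variable D : daha N.
Local Notation H := (daha_alg D).
Local Notation hT := (hT D).
Local Notation hTi := (hTi D).
Local Notation x := (hx D ord0).
Local Notation xi := (hxi D ord0).
Local Notation Y := (hY D).
Local Notation Yi := (hYi D).
Local Notation J := (hJ D).
Local Notation Ji := (hJi D).
Let rels : daha_rels (@dT N D) (@dPi N D) (@dX N D) := (dahaP D).1.
Local Notation A := (dtau D).
Local Notation Ai := (dtauV D).
Local Notation B := (dphi D \o dtauV D \o dphi D).
Local Notation Bi := (dphi D \o dtau D \o dphi D).

Lemma tauK a : Ai (A a) = a. Proof. by have [[E _] _ _ _ _] := dtauP D; exact: E. Qed.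
Lemma tauVK a : A (Ai a) = a. Proof. by have [[_ E] _ _ _ _] := dtauP D; exact: E. Qed.

Lemma tau_xi : A xi = xi.
Proof. by have [_ E _ _ _] := dtauP D; rewrite /hxi E. Qed.
Lemma tau_Yi : A Yi = u ^+ N *: (Yi * xi).
Proof.
have uN0 : u ^+ N != 0 by rewrite expf_neq0 ?u_neq0.
apply: (@inv_uniq _ D (A Y)).
  by rewrite -rmorphM hYi_Y rmorph1.
rewrite (tau_Y N0) -scalerAl -scalerAr scalerA mulVf // scale1r.
by rewrite -mulrA [Y * _]mulrA hY_Yi mul1r hx_xi.
Qed.
Lemma tauV_x : Ai x = x. Proof. by rewrite -{1}(tau_x D ord0) tauK. Qed.
Lemma tauV_xi : Ai xi = xi. Proof. by rewrite -{1}tau_xi tauK. Qed.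
Lemma tauV_Y : Ai Y = u ^+ N *: (xi * Y).
Proof.
rewrite -[RHS]tauK linearZ /= rmorphM /= tau_xi (tau_Y N0) -scalerAr scalerA.
by rewrite mulfV ?expf_neq0 ?u_neq0 // scale1r mulrA hxi_x mul1r.
Qed.
Lemma tauV_Yi : Ai Yi = u ^- N *: (Yi * x).
Proof.
rewrite -[RHS]tauK linearZ /= rmorphM /= tau_x tau_Yi -scalerAl scalerA.
by rewrite mulVf ?expf_neq0 ?u_neq0 // scale1r -mulrA hxi_x mulr1.
Qed.
Lemma tauV_T i : i != ord0 -> Ai (hT i) = hT i.
Proof. by move=> i0; rewrite -{1}(tau_T D i0) tauK. Qed.

Lemma hom_tau : hom A.
Proof.
split=> [k a b|a b||i i0||||].
- by rewrite linearP.
- exact: rmorphM.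
- exact: rmorph1.
- exact: tau_T.
- by rewrite tau_x; constructor.
- by rewrite tau_xi; constructor.
- by rewrite (tau_Y N0); apply/inS_scale/inS_mul; constructor.
- by rewrite tau_Yi; apply/inS_scale/inS_mul; constructor.
Qed.

Lemma hom_tauV : hom Ai.
Proof.
split=> [k a b|a b||i i0||||].
- by rewrite linearP.
- exact: rmorphM.
- exact: rmorph1.
- exact: tauV_T.
- by rewrite tauV_x; constructor.
- by rewrite tauV_xi; constructor.
- by rewrite tauV_Y; apply/inS_scale/inS_mul; constructor.
- by rewrite tauV_Yi; apply/inS_scale/inS_mul; constructor.
Qed.

Lemma phi_inS a : inS a -> inS (dphi D a).
Proof.
elim=> {a} [k|||||i i0|a b _ Sa _ Sb|a b _ Sa _ Sb].
- by rewrite linearZ /= phi1; constructor.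
- by rewrite phi_x; constructor.
- by rewrite phi_xi; constructor.
- by rewrite phi_Y; constructor.
- by rewrite phi_Yi; constructor.
- by rewrite phi_T //; constructor.
- by rewrite linearD; apply: inS_add.
- by rewrite phiM; apply: inS_mul.
Qed.

Lemma hom_phi f : hom f -> hom (dphi D \o f \o dphi D).
Proof.
move=> hf; have S a : inS a -> inS (dphi D (f (dphi D a))).
  by move=> Sa; apply/phi_inS/(hom_inS hf)/phi_inS.
split=> [k a b|a b||i i0||||] /=; try by apply: S; constructor.
- by rewrite linearP (hom_lin hf) linearP.
- by rewrite phiM (hom_mul hf) phiM.
- by rewrite phi1 (hom_1 hf) phi1.
- by rewrite phi_T // (hom_T hf) // phi_T.
Qed.

Lemma hom_B : hom B. Proof. exact: hom_phi hom_tauV. Qed.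
Lemma hom_Bi : hom Bi. Proof. exact: hom_phi hom_tau. Qed.

Lemma BK a : Bi (B a) = a. Proof. by rewrite /= phiK tauVK phiK. Qed.
Lemma BiK a : B (Bi a) = a. Proof. by rewrite /= phiK tauK phiK. Qed.

Lemma B_x : B x = u ^- N *: (Yi * x).
Proof. by rewrite /= phi_x tauV_Yi linearZ /= phiM phi_x phi_Yi. Qed.
Lemma B_Y : B Y = Y.
Proof. by rewrite /= phi_Y tauV_xi phi_xi. Qed.
Lemma B_Yi : B Yi = Yi.
Proof. by rewrite /= phi_Yi tauV_x phi_x. Qed.
Lemma Bi_x : Bi x = u ^+ N *: (Y * x).
Proof. by rewrite /= phi_x tau_Yi linearZ /= phiM phi_xi phi_Yi. Qed.
Lemma Bi_Y : Bi Y = Y.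
Proof. by rewrite /= phi_Y tau_xi phi_xi. Qed.

Definition sig (h : H) : H := A (B (A h)).

Lemma hom_sig : hom sig.
Proof. exact: (hom_comp hom_tau (hom_comp hom_B hom_tau)). Qed.

Lemma sig_x : sig x = Yi.
Proof.
rewrite /sig tau_x B_x linearZ /= rmorphM /= tau_x tau_Yi -scalerAl scalerA.
by rewrite mulVf ?expf_neq0 ?u_neq0 // scale1r -mulrA hxi_x mulr1.
Qed.

Lemma YixY : u ^- (2 * N) *: (Yi * x * Y) = x * J.
Proof. by rewrite -mulrA scalerAr -(YxJ N0) !mulrA hYi_Y mul1r. Qed.

Lemma BxY : B (x * Y) = u ^- N *: (Yi * x * Y).
Proof. by rewrite (hom_mul hom_B) B_x B_Y -scalerAl. Qed.

Lemma sig_Y : sig Y = x * J.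
Proof.
have uN0 : u ^+ N != 0 by rewrite expf_neq0 ?u_neq0.
rewrite /sig (tau_Y N0) (hom_scale hom_B) BxY !linearZ /= !rmorphM /= tau_x (tau_Y N0) tau_Yi.
rewrite -!scalerAl -!scalerAr !scalerA -[Yi * xi * x]mulrA hxi_x mulr1 mulrA.
by rewrite -YixY mul2n -addnn exprD invfM mulfK.
Qed.

Lemma braid_S a : inS a -> A (B (A a)) = B (A (B a)).
Proof.
apply: (hom_eq hom_sig (hom_comp hom_B (hom_comp hom_tau hom_B))).
  rewrite sig_x -[RHS]/(B (A (B x))) B_x (hom_scale hom_tau) (hom_mul hom_tau) tau_x tau_Yi.
  rewrite -scalerAl scalerA mulVf ?expf_neq0 ?u_neq0 // scale1r -mulrA hxi_x mulr1.
  by rewrite B_Yi.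
rewrite sig_Y -[RHS]/(B (A (B Y))) B_Y (tau_Y N0) (hom_scale hom_B) BxY scalerA.
by rewrite -YixY mul2n -addnn exprD invfM.
Qed.

Definition inSt := {h : H | inS h}.

Lemma inSt_eq (a b : inSt) : sval a = sval b -> a = b.
Proof. by case: a b => a Sa [b Sb] /= E; subst b; congr exist; exact: boolp.Prop_irrelevance. Qed.

Definition homS f (hf : hom f) (a : inSt) : inSt := exist _ (f (sval a)) (hom_inS hf (svalP a)).

Definition dstruct : bstruct.
refine (@BStruct inSt (homS hom_tau) (homS hom_tauV) (homS hom_B) (homS hom_Bi) _ _ _ _ _).
- by move=> a; apply: inSt_eq; exact: tauK.
- by move=> a; apply: inSt_eq; exact: tauVK.
- by move=> a; apply: inSt_eq; exact: BK.
- by move=> a; apply: inSt_eq; exact: BiK.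
- by move=> a; apply: inSt_eq; exact: braid_S (svalP a).
Defined.

Lemma sval_brun s (a : inSt) : sval (@brun dstruct s a) = word_map s (sval a).
Proof. by elim: s => //= -[] s IH; rewrite /= -IH. Qed.

Definition hZ h := sig (sig h).
Lemma hom_Z : hom hZ. Proof. exact: (hom_comp hom_sig hom_sig). Qed.

Lemma sig_Yi : sig Yi = Ji * xi.
Proof.
apply: (@inv_uniq _ D (sig Y)); first exact: hom_Yi_Y hom_sig.
by rewrite sig_Y -mulrA [J * _]mulrA hJ_Ji mul1r hx_xi.
Qed.

Lemma Z_x : hZ x = Ji * xi. Proof. by rewrite /hZ sig_x sig_Yi. Qed.
Lemma Z_Y : hZ Y = Yi * J.
Proof. by rewrite /hZ sig_Y (hom_mul hom_sig) sig_x (hom_hJ hom_sig). Qed.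

Variable L : comAlgType coefField.
Variables (X : wt N -> L) (sv : 'I_N.+1 -> L -> L) (pv : L -> L).
Variables (lv : L -> coefField) (emb : L -> daha_alg D) (act : daha_alg D -> L -> L).
Hypothesis rep : rep_spec X sv pv lv emb act.
Local Notation ev := (ev lv act).

Lemma ev_Z h : inS h -> ev (hZ h) = ev h.
Proof.
have hZm := hom_Z; have v0 : v ^+ N != 0 by rewrite expf_neq0 ?v_neq0.
apply: (ev_unique N0 rep (E := fun h => ev (hZ h))) => [a h1 k|h1 i i0|h1 i i0|h1|h1|].
- by rewrite (hom_lin hZm) (ev_lin rep).
- by rewrite (hom_mul hZm) (hom_T hZm) // (ev_Tl N0 rep).
- by rewrite (hom_mul hZm) (hom_T hZm) // (ev_Tr rep).
- by rewrite (hom_mul hZm) Z_x -mulrA (ev_Jil N0 rep) (ev_xil rep) mulKf.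
- rewrite (hom_mul hZm) Z_Y mulrA /Evaluation.ev 2!(ractM rep) (act_hJ1 rep) !(act_rZ rep).
  by rewrite (act_Yi1 N0 rep) !(act_rZ rep) !(lvZ rep) mulrCA [_ * (v ^- N * _)]mulrA mulfV // mul1r.
- by rewrite (hom_1 hZm) (ev_1 rep).
Qed.

Lemma ev_phi h : inS h -> ev (dphi D h) = ev h.
Proof.
have v0 : v ^+ N != 0 by rewrite expf_neq0 ?v_neq0.
apply: (ev_unique N0 rep (E := fun h => ev (dphi D h))) => [a h1 k|h1 i i0|h1 i i0|h1|h1|].
- by rewrite linearP (ev_lin rep).
- by rewrite phiM phi_T // (ev_Tr rep).
- by rewrite phiM phi_T // (ev_Tl N0 rep).
- rewrite phiM phi_x /Evaluation.ev !(ractM rep) (act_Yi1 N0 rep) !(act_rZ rep) (lvZ rep).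
  by [].
- by rewrite phiM phi_Y (ev_xil rep).
- by rewrite phi1 (ev_1 rep).
Qed.

Lemma hx_rec (k : 'I_N.+1) : k != ord0 -> hx D k = hT k * hx D (inord k.-1) * hT k.
Proof. by move=> k0; rewrite (hTx1 D k0) -mulrA hTi_T mulr1. Qed.

Lemma hx_ind (Q : H -> Prop) : Q x ->
  (forall (i : 'I_N.+1) h, i != ord0 -> Q h -> Q (hT i * h * hT i)) -> forall k, Q (hx D k).
Proof.
move=> Q0 QS k; suff Hk (n : nat) (k' : 'I_N.+1) : k' = n :> nat -> Q (hx D k') by exact: Hk.
elim: n k' {k} => [|n IH] k kn; first by have -> : k = ord0 by exact/val_inj.
have k0 : k != ord0 by rewrite -val_eqE /= kn.
rewrite hx_rec //; apply: QS => //; apply: IH.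
have /andP[_ kN] := n0_bnd k0.
by rewrite inordK kn // -kn ltnW.
Qed.

Lemma hxi_rec (k : 'I_N.+1) : k != ord0 -> hxi D k = hTi k * hxi D (inord k.-1) * hTi k.
Proof.
move=> k0; apply: (@inv_uniq _ D (hx D k)); first exact: hxi_x.
rewrite {1}hx_rec // -!mulrA [hT k * (hTi k * _)]mulrA hT_Ti mul1r.
by rewrite [hx D _ * (hxi D _ * _)]mulrA hx_xi mul1r hT_Ti.
Qed.

Lemma hxi_ind (Q : H -> Prop) : Q xi ->
  (forall (i : 'I_N.+1) h, i != ord0 -> Q h -> Q (hTi i * h * hTi i)) -> forall k, Q (hxi D k).
Proof.
move=> Q0 QS k; suff Hk (n : nat) (k' : 'I_N.+1) : k' = n :> nat -> Q (hxi D k') by exact: Hk.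
elim: n k' {k} => [|n IH] k kn; first by have -> : k = ord0 by exact/val_inj.
have k0 : k != ord0 by rewrite -val_eqE /= kn.
rewrite hxi_rec //; apply: QS => //; apply: IH.
have /andP[_ kN] := n0_bnd k0.
by rewrite inordK kn // -kn ltnW.
Qed.

Lemma dX_ind (Q : H -> Prop) : Q 1 -> Q x -> Q xi ->
  (forall (i : 'I_N.+1) h, i != ord0 -> Q h -> Q (hT i * h * hT i)) ->
  (forall (i : 'I_N.+1) h, i != ord0 -> Q h -> Q (hTi i * h * hTi i)) ->
  (forall b c, Q (dX D b) -> Q (dX D c) -> Q (dX D b * dX D c)) -> forall b, Q (dX D b).
Proof.
move=> Q1 Qx Qxi QT QTi QM b; elim/wt_ind: b => [|b c Hb Hc|k|k].
- by rewrite (rel_X0 rels).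
- by rewrite (rel_XD rels); exact: QM.
- exact: hx_ind.
- exact: hxi_ind.
Qed.

Lemma inS_emb f : inS (emb f).
Proof.
elim/(rLind rep): f => [|f g Sf Sg|a b].
- by rewrite (emb0 rep); exact: inS0.
- by rewrite (embD rep); exact: inS_add.
rewrite (embZ rep); apply: inS_scale; rewrite (embX rep).
move: b; apply: dX_ind => [|||i h i0 Sh|i h i0 Sh|b c Sb Sc]; try by constructor.
- exact: inS1.
- by apply: inS_mul; [apply: inS_mul|] => //; apply: inS_T.
- by apply: inS_mul; [apply: inS_mul|] => //; apply: inS_Ti.
Qed.

Lemma tau_emb f : A (emb f) = emb f.
Proof.
elim/(rLind rep): f => [|f g Sf Sg|a b].
- by rewrite (emb0 rep) (hom_0 hom_tau).
- by rewrite (embD rep) (hom_add hom_tau) Sf Sg.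
by rewrite (embZ rep) (embX rep) (hom_scale hom_tau); have [_ -> _ _ _] := dtauP D.
Qed.

Lemma phi_Ti i : i != ord0 -> dphi D (hTi i) = hTi i.
Proof. by move=> i0; rewrite /Generators.hTi /Tinv linearB linearZ /= phi1 -/(Generators.hT D i) phi_T. Qed.

Lemma phi_emb f : dphi D (emb f) = sig (emb f).
Proof.
have hs := hom_sig.
elim/(rLind rep): f => [|f g Sf Sg|a b].
- by rewrite (emb0 rep) linear0 (hom_0 hs).
- by rewrite (embD rep) linearD (hom_add hs) Sf Sg.
rewrite (embZ rep) (embX rep) linearZ /= (hom_scale hs); congr (_ *: _).
move: b; apply: (dX_ind (Q := fun h => dphi D h = sig h)) => [|||i h i0 Sh|i h i0 Sh|b c Sb Sc].
- by rewrite phi1 (hom_1 hs).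
- by rewrite phi_x sig_x.
- rewrite phi_xi; apply: (@inv_uniq _ D Yi); first exact: hY_Yi.
  by rewrite -sig_x; exact: hom_x_xi hs.
- by rewrite !phiM phi_T // Sh !(hom_mul hs) !(hom_T hs) // mulrA.
- by rewrite !phiM phi_Ti // Sh !(hom_mul hs) !(hom_Ti hs) // mulrA.
- by rewrite -(rel_XD rels) addrC (rel_XD rels) phiM Sb Sc -(hom_mul hs) -(rel_XD rels) addrC (rel_XD rels).
Qed.

Lemma hom_iter (f : H -> H) k : hom f -> hom (iter k f).
Proof.
move=> hf; elim: k => [|k IH]; first exact: hom_id.
exact: (hom_comp hf IH).
Qed.

Definition dval (a : bT dstruct) : H := sval (a : inSt).
Lemma dvalP a : inS (dval a). Proof. exact: (svalP (a : inSt)). Qed.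
Lemma dval_brun s a : dval (brun s a) = word_map s (dval a).
Proof. exact: sval_brun. Qed.

Lemma ev_hZi a : ev (dval (bZi a)) = ev (dval a).
Proof. by rewrite -(ev_Z (dvalP (bZi a))) -{2}[a]bZiK. Qed.

Lemma ev_Zp l a : ev (dval (Zp l a)) = ev (dval a).
Proof.
rewrite /Zp; elim/int_ind: l => [|n IH|n IH] //.
- rewrite -addn1 PoszD itnS; [|exact: bZK|exact: bZiK].
  by rewrite -IH -(ev_Z (dvalP (itn (@bZ dstruct) (@bZi dstruct) n%:Z a))).
- rewrite -addn1 PoszD opprD itnP; [|exact: bZK|exact: bZiK].
  by rewrite ev_hZi IH.
Qed.

Definition letV (l : letter) := match l with
  | TauP => TauPV | TauPV => TauP | TauM => TauMV | TauMV => TauM end.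
Definition wordV (s : seq letter) := rev (map letV s).

Lemma brun_cat b s1 s2 (h : bT b) : brun (s1 ++ s2) h = brun s1 (brun s2 h).
Proof. exact: foldr_cat. Qed.

Lemma bZ_blet b l (h : bT b) : bZ (blet l h) = blet l (bZ h).
Proof. by case: l => /=; rewrite ?bZA ?bZAi ?bZB ?bZBi. Qed.

Lemma wordV_cons l s : wordV (l :: s) = wordV s ++ [:: letV l].
Proof. by rewrite /wordV /= rev_cons cats1. Qed.

Lemma wordVK b s (h : bT b) : brun (wordV s) (brun s h) = h.
Proof.
elim: s h => [|l s IH] h //; rewrite wordV_cons brun_cat -[RHS]IH; congr brun.
by case: l => /=; rewrite ?bAK ?bAiK ?bBK ?bBiK.
Qed.

Lemma wordKV b s (h : bT b) : brun s (brun (wordV s) h) = h.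
Proof.
elim: s h => [|l s IH] h //; rewrite wordV_cons brun_cat.
rewrite -[brun (l :: s) _]/(blet l (brun s _)) IH.
by case: l => /=; rewrite ?bAK ?bAiK ?bBK ?bBiK.
Qed.

Lemma phi_iterA p h : dphi D (iter p A h) = iter p Bi (dphi D h).
Proof. by elim: p => // p IH; rewrite !iterS -IH /= phiK. Qed.

(* Conjugation by phi exchanges the letters tau_+ and tau_-, which replaces the
   word of column (2p+1,2) by one of column (2,2p+1). *)
Lemma word_value p (s : seq letter) f :
  word_mx s 0%R 0%R = (2 * p + 1)%N%:Z -> word_mx s 1%R 0%R = 2%:Z ->
  ev (word_map s (emb f)) = ev (iter p Bi (A (Bi (emb f)))).
Proof.
move=> s0 s1; pose g0 := nseq p TauP ++ [:: TauM; TauM].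
have colg0 : @brun colstruct g0 (1, 0) = ((2 * p + 1)%N%:Z, 2%:Z).
  rewrite /brun /g0 foldr_cat; elim: (p) => [|k IH] //=.
  by rewrite IH /colA /=; congr (_, _); lia.
have st : @brun colstruct (wordV g0 ++ s) (1, 0) = (1, 0).
  rewrite brun_cat -word_mx_col s0 s1 -colg0.
  exact: wordVK.
have [l [k E]] := word_col_stab st.
pose F : bT dstruct := (exist _ (emb f) (inS_emb f) : inSt).
have AF : bA F = F by apply: inSt_eq; exact: tau_emb.
have ApF : Ap k F = F.
  rewrite /Ap; elim/int_ind: (k) => [|n IH|n IH] //.
  - rewrite -addn1 PoszD itnS; [|exact: bAK|exact: bAiK].
    by rewrite IH.
  - rewrite -addn1 PoszD opprD itnP; [|exact: bAK|exact: bAiK].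
    by rewrite IH -{1}AF bAK.
have Es : brun s F = brun g0 (Zp l F).
  by rewrite -[LHS](wordKV g0) -(brun_cat (wordV g0)) E ApF.
have ZC g1 (h : bT dstruct) : brun g1 (Zp l h) = Zp l (brun g1 h).
  elim: g1 => // a g1 IH; rewrite /= IH ZpC //.
  exact: bZ_blet.
rewrite -[emb f]/(dval F) -dval_brun Es ZC ev_Zp dval_brun.
have -> : word_map g0 (dval F) = iter p A (Bi (Bi (dval F))).
  by rewrite /word_map /g0 foldr_cat; elim: (p) => //= n ->.
have hp : hom (iter p Bi) by exact: hom_iter hom_Bi.
have hpA : hom (iter p A) by exact: hom_iter hom_tau.
have SF : inS (emb f) := dvalP F.
rewrite -ev_phi; last by do 3![apply: hom_inS; first by [exact: hpA|exact: hom_Bi]].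
rewrite phi_iterA.
have -> : dphi D (Bi (Bi (dval F))) = A (A (sig (emb f))) by rewrite /= !phiK phi_emb.
have -> : A (A (sig (emb f))) = hZ (A (Bi (emb f))).
  have ZF : bZ F = bB (bA (bS F)) by rewrite -{2}AF bSA -bbraid.
  have ZE : bZ (bA (bBi F)) = bA (bA (bS F)) by rewrite bZA bZBi ZF bBK.
  exact: (esym (congr1 dval ZE)).
have -> : iter p Bi (hZ (A (Bi (emb f)))) = hZ (iter p Bi (A (Bi (emb f)))).
  elim: (p) => // n IH; rewrite iterS IH.
  pose G : bT dstruct := (exist _ _ (hom_inS (hom_iter n hom_Bi) (hom_inS hom_tau (hom_inS hom_Bi SF))) : inSt).
  by have := congr1 dval (bZBi G).
apply: ev_Z; apply: (hom_inS hp); apply: (hom_inS hom_tau); exact: (hom_inS hom_Bi).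
Qed.

Definition tb f : L := act (Bi (emb f)) 1.

Lemma tb_lin a f g : tb (a *: f + g) = a *: tb f + tb g.
Proof. by rewrite /tb (rembL rep) (hom_lin hom_Bi) (ractZ rep). Qed.

Lemma act_Bi1 h : inS h -> act (Bi h) 1 = tb (act h 1).
Proof.
move=> Sh.
have := E_act1 N0 rep (E := fun h => act (Bi h) 1).
apply=> // [a h1 k|h1 i i0|h1].
- by rewrite (hom_lin hom_Bi) (ractZ rep).
- by rewrite (hom_mul hom_Bi) (hom_T hom_Bi) // (ractM rep) (act_hT1 rep) // (act_rZ rep).
- by rewrite (hom_mul hom_Bi) Bi_Y (ractM rep) (act_Y1 N0 rep) (act_rZ rep).
Qed.

Lemma tb_act h f : inS h -> tb (act h f) = act (Bi h) (tb f).
Proof.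
move=> Sh; rewrite /tb -(ractM rep) -(hom_mul hom_Bi) (act_Bi1 (inS_mul Sh (inS_emb f))).
by rewrite (ractM rep) (act_emb rep) mulr1.
Qed.

Lemma word_value_tb p (s : seq letter) f :
  word_mx s 0%R 0%R = (2 * p + 1)%N%:Z -> word_mx s 1%R 0%R = 2%:Z ->
  lv (act (word_map s (emb f)) 1) = lv (iter p tb (act (A (Bi (emb f))) 1)).
Proof.
move=> s0 s1; rewrite -/(ev _) (word_value f s0 s1) /Evaluation.ev; congr lv.
elim: p {s0 s1} => // p IH; rewrite !iterS -IH; apply: act_Bi1.
apply: (hom_inS (hom_iter p hom_Bi)); apply: (hom_inS hom_tau); apply: (hom_inS hom_Bi).
exact: inS_emb.
Qed.

End Letters.
End ModularAction.

Module PowerSeries.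
Section Seq.
Variables (K : fieldType) (L : comAlgType K).
Hypothesis K0 : forall n, n.+1%:R != 0 :> K.
Implicit Types (F : int -> L) (E : nat -> L) (y z : L) (m : int) (n j : nat).

Definition nn F := forall n, F (Negz n) = 0.
Definition DD y F m := F m - y * F (m - 1).
Definition II y F m :=
  if m is Posz n then \sum_(j < n.+1) y ^+ j * F (n%:Z - j%:Z) else 0.
Definition sc (c : K) F m := c ^ m *: F m.

Lemma NegzB1 n : Negz n - 1 = Negz n.+1. Proof. by lia. Qed.
Lemma PoszB1 n : n.+1%:Z - 1 = n%:Z. Proof. by lia. Qed.

Lemma nn_DD y F : nn F -> nn (DD y F).
Proof. by move=> nF n; rewrite /DD NegzB1 !nF mulr0 subrr. Qed.
Lemma nn_sc c F : nn F -> nn (sc c F).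
Proof. by move=> nF n; rewrite /sc nF scaler0. Qed.

Lemma DD_II y F : nn F -> DD y (II y F) = F.
Proof.
move=> nF; apply: boolp.funext => -[[|n]|n].
- by rewrite /DD /= mulr0 subr0 big_ord1 expr0 mul1r subrr.
- rewrite /DD PoszB1 /= big_ord_recl expr0 mul1r subr0 mulr_sumr -[RHS]addr0 -addrA.
  congr (_ + _); apply/eqP; rewrite subr_eq0; apply/eqP/eq_bigr => i _.
  by rewrite exprS mulrA /=; congr (_ * F _); rewrite /bump /=; lia.
- by rewrite nF /DD NegzB1 /= mulr0 subr0.
Qed.

Lemma DD_inj y F F' : nn F -> nn F' -> DD y F = DD y F' -> F = F'.
Proof.
move=> nF nF' E; apply: boolp.funext; case=> n; last by rewrite nF nF'.
have E1 m : DD y F m = DD y F' m by rewrite E.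
elim: n => [|n IH].
  by have := E1 0; rewrite /DD (nF 0) (nF' 0) mulr0 !subr0.
by have := E1 n.+1; rewrite /DD PoszB1 IH => /addIr.
Qed.

Lemma II_DD y F : nn F -> II y (DD y F) = F.
Proof. by move=> nF; apply: (@DD_inj y) => //; rewrite DD_II //; exact: nn_DD. Qed.

Lemma DDC y z F : DD y (DD z F) = DD z (DD y F).
Proof. by apply: boolp.funext => m; rewrite /DD; ring. Qed.

Lemma IDC y z F : nn F -> II y (DD z F) = DD z (II y F).
Proof.
move=> nF; apply: (@DD_inj y) => //; first exact: nn_DD.
by rewrite DDC !DD_II //; exact: nn_DD.
Qed.

Lemma IIC y z F : nn F -> II y (II z F) = II z (II y F).
Proof.
move=> nF; apply: (@DD_inj y) => //; rewrite DD_II // -IDC // DD_II //.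
Qed.

Lemma sc_DD c y F : c != 0 -> sc c (DD y F) = DD (c *: y) (sc c F).
Proof.
move=> c0; apply: boolp.funext => m; rewrite /sc /DD scalerBr; congr (_ - _).
have -> : c ^ m = c * c ^ (m - 1).
  by rewrite -{2}[c]expr1z -expfzDr //; congr (_ ^ _); ring.
by rewrite -scalerAl -scalerAr scalerA.
Qed.

Lemma sc_II c y F : c != 0 -> nn F -> sc c (II y F) = II (c *: y) (sc c F).
Proof.
move=> c0 nF; apply: (@DD_inj (c *: y)) => //; first exact: nn_sc.
by rewrite -sc_DD // !DD_II //; exact: nn_sc.
Qed.

Record rm (f : L -> L) : Prop := Rm {
  rmD : forall a b, f (a + b) = f a + f b;
  rmM : forall a b, f (a * b) = f a * f b;
  rm1 : f 1 = 1
}.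

Section Morph.
Variable f : L -> L.
Hypothesis hf : rm f.
Lemma rm0 : f 0 = 0.
Proof. by have := rmD hf 0 0; rewrite addr0 -{1}[f 0]addr0 => /addrI. Qed.
Lemma rmN a : f (- a) = - f a.
Proof. by apply/eqP; rewrite -subr_eq0 opprK -(rmD hf) addNr rm0. Qed.
Lemma rmB a b : f (a - b) = f a - f b. Proof. by rewrite (rmD hf) rmN. Qed.
Lemma rmX a n : f (a ^+ n) = f a ^+ n.
Proof. by elim: n => [|n IH]; rewrite ?(rm1 hf) // !exprS (rmM hf) IH. Qed.
Lemma rm_sum n (G : 'I_n -> L) : f (\sum_i G i) = \sum_i f (G i).
Proof. by rewrite (big_morph f (rmD hf) rm0). Qed.
Lemma rm_mulrn a n : f (a *+ n) = f a *+ n.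
Proof. by elim: n => [|n IH]; rewrite ?rm0 // !mulrS (rmD hf) IH. Qed.
Lemma nn_rm F : nn F -> nn (f \o F).
Proof. by move=> nF n; rewrite /= nF rm0. Qed.
Lemma rm_DD y F : f \o DD y F = DD (f y) (f \o F).
Proof. by apply: boolp.funext => m; rewrite /= /DD rmB (rmM hf). Qed.
Lemma rm_II y F : nn F -> f \o II y F = II (f y) (f \o F).
Proof.
move=> nF; apply: (@DD_inj (f y)) => //; first exact: nn_rm.
by rewrite -rm_DD !DD_II //; exact: nn_rm.
Qed.
End Morph.

(* F is a power series whose logarithmic derivative has the coefficients E. *)
Record ld E F : Prop := Ld {
  ld_nn : nn F;
  ld_0 : F 0 = 1;
  ld_rec : forall n, F n%:Z *+ n = \sum_(j < n) E j.+1 * F (n%:Z - j.+1%:Z)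
}.

Lemma mulrnI_K (a : L) n : a *+ n.+1 = 0 -> a = 0.
Proof.
by rewrite -scaler_nat => /(canRL (scalerK (K0 n))) ->; rewrite scaler0.
Qed.

Lemma ld_uniq E E' F F' : ld E F -> ld E' F' -> (forall j, E j.+1 = E' j.+1) -> F = F'.
Proof.
move=> dF dF' EE; apply: boolp.funext; case=> n; last by rewrite (ld_nn dF) (ld_nn dF').
elim/ltn_ind: n => -[|n] IH; first by rewrite (ld_0 dF) (ld_0 dF').
apply/eqP; rewrite -subr_eq0; apply/eqP; apply: (@mulrnI_K _ n).
rewrite mulrnBl (ld_rec dF) (ld_rec dF') -sumrB big1 // => j _.
have -> : n.+1%:Z - j.+1%:Z = (n - j)%N%:Z by have := ltn_ord j; lia.
by rewrite EE IH ?subrr // ltnS leq_subr.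
Qed.

Lemma ld_DD E F y : ld E F -> ld (fun j => E j - y ^+ j) (DD y F).
Proof.
move=> dF; split; first exact: nn_DD (ld_nn dF).
  by rewrite /DD (ld_0 dF) (ld_nn dF 0) mulr0 subr0.
case=> [|n]; first by rewrite mulr0n big_ord0.
rewrite /DD mulrnBl (ld_rec dF) PoszB1.
rewrite -mulrnAr mulrSr (ld_rec dF).
have -> : \sum_(j < n.+1) (E j.+1 - y ^+ j.+1) *
    (F (n.+1%:Z - j.+1%:Z) - y * F (n.+1%:Z - j.+1%:Z - 1)) =
  \sum_(j < n.+1) E j.+1 * F (n.+1%:Z - j.+1%:Z) -
  (y * \sum_(j < n.+1) E j.+1 * F (n%:Z - j.+1%:Z) +
  \sum_(j < n.+1) (y ^+ j.+1 * F (n%:Z - j%:Z) - y ^+ j.+2 * F (n%:Z - j.+1%:Z))).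
  rewrite mulr_sumr -big_split /= -sumrB; apply: eq_bigr => j _.
  have -> : n.+1%:Z - j.+1%:Z = n%:Z - j%:Z by lia.
  have -> : n%:Z - j%:Z - 1 = n%:Z - j.+1%:Z by lia.
  by rewrite !exprS; ring.
congr (_ - _); rewrite mulrDr; congr (_ + _).
  rewrite big_ord_recr /= (_ : n%:Z - n.+1%:Z = Negz 0) ?(ld_nn dF) ?mulr0 ?addr0 //; lia.
pose G j := - (y ^+ j.+1 * F (n%:Z - j%:Z)).
rewrite (eq_bigr (fun j : 'I_n.+1 => G j.+1 - G j)); last first.
  by move=> j _; rewrite /G opprK addrC.
rewrite -(big_mkord xpredT (fun j => G j.+1 - G j)) telescope_sumr // /G.
rewrite (_ : n%:Z - n.+1%:Z = Negz 0); last by lia.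
by rewrite (ld_nn dF) mulr0 oppr0 sub0r opprK expr1 subr0.
Qed.

Lemma ld_sc E F (c : K) : c != 0 -> ld E F -> ld (fun j => c ^+ j *: E j) (sc c F).
Proof.
move=> c0 dF; split; first exact: nn_sc (ld_nn dF).
  by rewrite /sc expr0z scale1r (ld_0 dF).
move=> n; rewrite /sc scalerMnr (ld_rec dF) scaler_sumr; apply: eq_bigr => j _.
have -> : c ^ n%:Z = c ^+ j.+1 * c ^ (n%:Z - j.+1%:Z).
  by rewrite exprnP -expfzDr //; congr (_ ^ _); ring.
by rewrite -scalerAl -scalerAr scalerA.
Qed.

Lemma ld_rm E F f : rm f -> ld E F -> ld (f \o E) (f \o F).
Proof.
move=> hf dF; split; first exact: nn_rm (ld_nn dF).
  by rewrite /= (ld_0 dF) (rm1 hf).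
move=> n; rewrite /= -rm_mulrn // (ld_rec dF) rm_sum //; apply: eq_bigr => j _.
by rewrite (rmM hf).
Qed.

Fixpoint ldl E n : seq L :=
  if n is n'.+1 then
    (n%:R^-1 *: \sum_(j < n) E j.+1 * nth 0 (ldl E n') j) :: ldl E n'
  else [:: 1].
Definition lds E m : L := if m is Posz n then head 0 (ldl E n) else 0.

Lemma ldlP E n j : (j <= n)%N -> nth 0 (ldl E n) j = lds E (n%:Z - j%:Z).
Proof.
elim: n j => [|n IH] [|j] // jn; rewrite ?subr0 //.
by rewrite /= IH //; congr (lds E _); lia.
Qed.

Lemma ld_lds E : ld E (lds E).
Proof.
split=> // -[|n]; first by rewrite big_ord0 mulr0n.
rewrite [lds E n.+1]/= -scaler_nat scalerA mulfV ?K0 // scale1r.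
apply: eq_bigr => j _; rewrite ldlP; last by have := ltn_ord j; lia.
by congr (_ * lds E _); lia.
Qed.

Lemma ld_II E F y : ld E F -> ld (fun j => E j + y ^+ j) (II y F).
Proof.
move=> dF; have d' := ld_lds (fun j => E j + y ^+ j).
suff -> : II y F = lds (fun j => E j + y ^+ j) by [].
have := ld_uniq (ld_DD y d') dF; rewrite /= => <-; last by move=> j; rewrite addrK.
by rewrite II_DD //; exact: ld_nn d'.
Qed.

End Seq.
End PowerSeries.

Module OneRow.
Import Weights GroupAlgebraTheory MinimalElement ReducedWord Generators DahaRelations BraidWords LaurentOperators PolynomialRep Evaluation ModularAction PowerSeries.

Lemma coefField_char0 n : n.+1%:R != 0 :> coefField.
Proof.
rewrite -(rmorph_nat (@tofrac _)) tofrac_eq0.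
by rewrite -!polyC_natr !polyC_eq0 pnatr_eq0.
Qed.

Lemma uv_injn (a b c d : nat) : u ^+ a * v ^+ b = u ^+ c * v ^+ d -> a = c /\ b = d.
Proof.
rewrite /u /v -!rmorphXn -!rmorphM /= => /eqP; rewrite tofrac_eq => /eqP.
move=> /(congr1 (fun p : coefRing => p`_a)).
rewrite !coefMC !coefXn eqxx mul1r; case: eqP => [->|_]; rewrite ?mul1r ?mul0r.
  move=> /(congr1 (fun p : {poly rat} => p`_b)); rewrite !coefXn eqxx.
  by case: eqP => // _ /eqP; rewrite oner_eq0.
by move=> /(congr1 (fun p : {poly rat} => p`_b))/eqP; rewrite coefXn eqxx coef0 oner_eq0.
Qed.

Lemma exprz_split (F : fieldType) (U V : F) (i j k l : nat) : U != 0 -> V != 0 ->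
  U ^ (i%:Z - j%:Z) * V ^ (k%:Z - l%:Z) = 1 -> U ^+ i * V ^+ k = U ^+ j * V ^+ l.
Proof.
move=> U0 V0; rewrite !expfzDr // -!exprnN -!exprnP.
move/(congr1 (fun z => z * (U ^+ j * V ^+ l))); rewrite mul1r => <-.
by rewrite mulf_div divfK // mulf_neq0 // expf_neq0.
Qed.

Lemma expzNK (F : fieldType) (a : F) (m : int) : a != 0 -> a ^ (- m) * a ^ m = 1.
Proof. by move=> a0; rewrite -expfzDr // addNr. Qed.

Lemma uv_inj (a b : int) : u ^ a * v ^ b = 1 -> a = 0 /\ b = 0.
Proof.
have sp (c : int) : exists i j : nat, c = i%:Z - j%:Z.
  by case: c => n; [exists n, 0%N; rewrite subr0|exists 0%N, n.+1; lia].
have [i [j ->]] := sp a; have [k [l ->]] := sp b.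
move=> E; suff [-> ->] : i = j /\ k = l by rewrite !subrr.
by apply: uv_injn; exact: exprz_split u_neq0 v_neq0 E.
Qed.

Lemma exprz_qt (F : fieldType) (U V : F) (n : nat) (a b : int) :
  (U ^+ n) ^ a * (V ^+ 2) ^ b = U ^ (n%:Z * a) * V ^ (2%:Z * b).
Proof. by rewrite !exprnP !exprz_exp. Qed.

Lemma subrX1_geom (F : comPzRingType) (a : F) n : 1 - a ^+ n = (1 - a) * \sum_(k < n) a ^+ k.
Proof.
by rewrite -opprB subrX1 -mulNr opprB.
Qed.

Section Chain.
Variable N : nat.
Hypothesis N0 : (0 < N)%N.
Variable D : daha N.
Local Notation H := (daha_alg D).
Variable L : comAlgType coefField.
Variables (X : wt N -> L) (sv : 'I_N.+1 -> L -> L) (pv : L -> L).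
Variables (lv : L -> coefField) (emb : L -> daha_alg D) (act : daha_alg D -> L -> L).
Hypothesis rep : rep_spec X sv pv lv emb act.
Local Notation hT := (hT D).
Local Notation hTi := (hTi D).
Local Notation Y := (hY D).
Local Notation q := (q N).
Local Notation K0 := coefField_char0.
Local Notation DD := (@DD coefField L).
Local Notation II := (@II coefField L).
Local Notation sc := (@sc coefField L).

Lemma qt_neq1 (a b : int) : a != 0 \/ b != 0 -> q ^ a * t ^ b != 1.
Proof.
move=> ab; apply/negP => /eqP; rewrite /Defs.q /t exprz_qt => /uv_inj[E1 E2]; case: ab; lia.
Qed.

Lemma qn_neq1 n : 1 - q ^+ n.+1 != 0.
Proof.
rewrite subr_eq0 eq_sym; have := @qt_neq1 n.+1%:Z 0; rewrite expr0z mulr1 => -> //.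
by left.
Qed.

Definition eN := u ^- 2.
Lemma eN_u2 : eN * u ^+ 2 = 1.
Proof. by rewrite /eN mulVf // expf_neq0 // u_neq0. Qed.
Lemma t_v2 : t = v * v. Proof. by rewrite /t expr2. Qed.
Lemma qN_e0 : q^-1 = eN * u ^- (2 * N).
Proof. by rewrite /Defs.q /eN -invfM -exprD addnC. Qed.
Lemma eN_neq0 : eN != 0. Proof. by rewrite invr_neq0 // expf_neq0 // u_neq0. Qed.

Local Opaque eN Defs.q Defs.t.

Definition x := X (we ord0).
Definition xn (k : nat) := X (we (inord k : 'I_N.+1)).
(* Locked, so that the rewriting of scalars does not look into it. *)
Definition x0 := locked (q^-1 *: x).
Lemma x0E : x0 = q^-1 *: x. Proof. by rewrite /x0 -lock. Qed.
Definition psum j : L := \sum_(k < N.+1) X (we k) ^+ j.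
Definition Eg (j : nat) : L := ((1 - t ^+ j) / (1 - q ^+ j)) *: psum j.
Definition g : int -> L := lds Eg.
Definition gh (m : int) : L := eN ^ m *: pv (g m).
Definition hh : int -> L := II x0 g.
Definition kk (a : int) : L := x0 * hh (a - 1).

Lemma ld_g : ld Eg g. Proof. exact: ld_lds K0 _. Qed.
Lemma nn_g : nn g. Proof. exact: ld_nn ld_g. Qed.

Lemma rm_sv i : rm (sv i).
Proof. by split=> [a b|a b|]; [exact: svD rep i a b|exact: rsvM rep i a b|exact: sv1 rep i]. Qed.
Lemma rm_pv : rm pv.
Proof. by split=> [a b|a b|]; [exact: pvD rep a b|exact: rpvM rep a b|exact: pv1 rep]. Qed.

Lemma sv_xk i k : sv i (X (we k)) = X (we (swp i k)).
Proof. by rewrite (svX rep) wact_we. Qed.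

Lemma sv_psum i j : sv i (psum j) = psum j.
Proof.
rewrite (rm_sum (rm_sv i)) /psum [RHS](reindex_inj (@perm_inj _ (swp i))).
by apply: eq_bigr => k _; rewrite (rmX (rm_sv i)) sv_xk.
Qed.

Lemma svg_fun i : sv i \o g = g.
Proof.
apply: (ld_uniq K0 (ld_rm (rm_sv i) ld_g) ld_g) => j /=.
by rewrite (svZ rep) sv_psum.
Qed.
Lemma sv_g i m : sv i (g m) = g m.
Proof. by rewrite -[in RHS](svg_fun i). Qed.

Lemma qpi_we k : qpi (we k : wt N) = if k == ord_max then u ^- (2 * N) else u ^+ 2.
Proof.
rewrite /qpi wact_we ip_we_we.
have -> : ((cyc N)^-1%g k == ord0) = (k == ord_max).
  by rewrite -(inj_eq (@perm_inj _ (cyc N))) permKV cyc0.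
by case: eqP => _; [exact: qpow_max|rewrite opprB subr0 qpow_e].
Qed.

Lemma pv_xmax : pv (X (we ord_max)) = u ^- (2 * N) *: x.
Proof. by rewrite (pvX rep) qpi_we eqxx wact_we cycV_max. Qed.

Lemma pv_xk (k : nat) : (k < N)%N -> pv (xn k) = u ^+ 2 *: xn k.+1.
Proof.
move=> kN; rewrite (pvX rep) qpi_we wact_we cycV_lt //.
by rewrite -val_eqE /= inordK ?(ltn_eqF kN) // ltnS ltnW.
Qed.

Lemma qN_e : q^-1 = eN * u ^- (2 * N).
Proof. exact: qN_e0. Qed.

Lemma psum_xn j : psum j = \sum_(k < N.+1) xn k ^+ j.
Proof. by apply: eq_bigr => k _; rewrite /xn inord_val. Qed.

Lemma pv_psum j : eN ^+ j *: pv (psum j) = psum j - x ^+ j + x0 ^+ j.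
Proof.
rewrite psum_xn {1}big_ord_recr /= (rmD rm_pv) scalerDr big_ord_recl /=.
have -> : xn 0 = x by rewrite /xn /x; congr (X (we _)); apply/val_inj; rewrite /= inordK.
rewrite [x ^+ j + _]addrC addrK; congr (_ + _); last first.
  have -> : xn N = X (we ord_max) by congr (X (we _)); apply/val_inj; rewrite /= inordK.
  by rewrite (rmX rm_pv) pv_xmax -exprZn scalerA -qN_e x0E.
rewrite (rm_sum rm_pv) scaler_sumr; apply: eq_bigr => k _.
by rewrite (rmX rm_pv) pv_xk // -exprZn scalerA eN_u2 scale1r.
Qed.

Lemma ld_gh : ld (fun j => eN ^+ j *: pv (Eg j)) gh.
Proof. exact: (ld_sc eN_neq0 (ld_rm rm_pv ld_g)). Qed.
Lemma nn_gh : nn gh. Proof. exact: ld_nn ld_gh. Qed.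

Lemma gh_star : DD x0 gh = DD (t *: x0) g.
Proof.
apply: (ld_uniq K0 (ld_DD x0 ld_gh) (ld_DD (t *: x0) ld_g)) => j /=.
rewrite {1}/Eg (pvZ rep) scalerA [X in X *: _]mulrC -scalerA pv_psum scalerDr scalerBr /Eg.
rewrite [(t *: x0) ^+ _]exprZn.
have xE : x ^+ j.+1 = q ^+ j.+1 *: x0 ^+ j.+1.
  by rewrite -exprZn x0E scalerA mulfV ?q_neq0 // scale1r.
rewrite xE scalerA; set y := x0 ^+ _; set c := _ / _.
have -> : c = (1 - t ^+ j.+1) / (1 - q ^+ j.+1) by [].
rewrite -!addrA; congr (_ + _).
have Kl (a b d : coefField) (z : L) : - a + (b - 1) = - d -> - (a *: z) + (b *: z - z) = - (d *: z).
  by move=> E; rewrite -[RHS]scaleNr -E scalerDl scaleNr scalerBl scale1r.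
apply: Kl.
have Kf (F : fieldType) (T Q : F) : 1 - Q != 0 -> - ((1 - T) / (1 - Q) * Q) + ((1 - T) / (1 - Q) - 1) = - T.
  by move=> Q0; field.
exact: Kf (qn_neq1 j).
Qed.

Lemma nn_hh : nn hh. Proof. by []. Qed.
Lemma hh_g : DD x0 hh = g. Proof. by rewrite DD_II //; exact: nn_g. Qed.
Lemma gh_h : gh = DD (t *: x0) hh.
Proof.
apply: (@DD_inj _ _ x0); [exact: nn_gh|exact: nn_DD|].
by rewrite gh_star -{1}hh_g DDC.
Qed.

Lemma hh_kk a : hh a = g a + kk a.
Proof. by rewrite -hh_g /DD subrK. Qed.
Lemma gh_kk a : gh a = g a + (1 - t) *: kk a.
Proof.
by rewrite gh_h /DD hh_kk -addrA -/(kk a) -scalerAl -/(kk a) scalerBl scale1r.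
Qed.

Definition gq := sc q g.
Fixpoint PP (k : nat) : int -> L :=
  if k is k'.+1 then DD (t *: xn k') (II (xn k') (PP k')) else gq.
Definition RR k := II (xn k) (PP k).

Lemma ld_PP k : ld (fun j => q ^+ j *: Eg j + \sum_(i < k) (xn i ^+ j - (t *: xn i) ^+ j)) (PP k).
Proof.
elim: k => [|k IH].
  have := ld_sc (q_neq0 N) ld_g; rewrite -/gq => -[n1 z1 r1]; split=> // n.
  by rewrite r1; apply: eq_bigr => j _; rewrite big_ord0 addr0.
have := ld_DD (t *: xn k) (ld_II K0 (xn k) IH); rewrite -/(PP k.+1) => -[n1 z1 r1]; split=> // n.
by rewrite r1; apply: eq_bigr => j _; rewrite big_ord_recr /= !addrA.
Qed.

Lemma nn_PP k : nn (PP k). Proof. exact: ld_nn (ld_PP k). Qed.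

Lemma PP_top : PP N.+1 = g.
Proof.
apply: (ld_uniq K0 (ld_PP N.+1) ld_g) => j.
have -> : \sum_(i < N.+1) (xn i ^+ j.+1 - (t *: xn i) ^+ j.+1) = (1 - t ^+ j.+1) *: psum j.+1.
  rewrite psum_xn scaler_sumr; apply: eq_bigr => i _.
  by rewrite exprZn scalerBl scale1r.
rewrite /Eg scalerA -scalerDl; congr (_ *: _).
have Kf (F : fieldType) (T Q : F) : 1 - Q != 0 -> Q * ((1 - T) / (1 - Q)) + (1 - T) = (1 - T) / (1 - Q).
  by move=> Q0; field.
exact: Kf (qn_neq1 j).
Qed.

Lemma sv_xn_far (i : 'I_N.+1) (k : nat) : (k.+1 < i)%N -> sv i (xn k) = xn k.
Proof.
move=> ki; rewrite sv_xk /swp tpermD //; rewrite -val_eqE /= !inordK //;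
  have := ltn_ord i; lia.
Qed.

Lemma sv_PP (i : 'I_N.+1) k : (k < i)%N -> sv i \o PP k = PP k.
Proof.
elim: k => [|k IH] ki.
  apply: boolp.funext => m; rewrite /= /gq /PowerSeries.sc (svZ rep) sv_g //.
rewrite [PP k.+1]/= rm_DD; last exact: rm_sv.
rewrite rm_II; [|exact: rm_sv|exact: nn_PP].
by rewrite IH ?(ltnW ki) // (svZ rep) sv_xn_far.
Qed.

Definition SS k := II (xn k.+1) (RR k).

Lemma RR_SS k : RR k = DD (xn k.+1) (SS k).
Proof. by rewrite DD_II. Qed.

Lemma RRS_SS k : RR k.+1 = DD (t *: xn k) (SS k).
Proof. by rewrite /RR [PP k.+1]/= IDC. Qed.

Lemma sv_SS (i : 'I_N.+1) k : i = k.+1 :> nat -> sv i \o SS k = SS k.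
Proof.
move=> ik; have nR : nn (RR k) by [].
have i1 : xn k.+1 = X (we i) by rewrite /xn -ik inord_val.
have i2 : sv i (xn k) = xn k.+1.
  by rewrite sv_xk i1 /xn /swp (_ : inord k = inord i.-1) ?tpermL // ik.
have i3 : sv i (xn k.+1) = xn k.
  by rewrite i1 sv_xk /xn /swp tpermR ik.
rewrite /SS rm_II //; last exact: rm_sv.
rewrite /RR rm_II; [|exact: rm_sv|exact: nn_PP].
by rewrite sv_PP ?ik // i2 i3 IIC //; exact: nn_PP.
Qed.

Lemma act_T_symM i F f : i != ord0 -> sv i f = f -> act (hT i) (F * f) = act (hT i) F * f.
Proof.
move=> i0 sf; have := congr1 (fun h => act h F) (hT_emb_sym rep i0 sf).
by rewrite !(actM rep) !(act_emb rep) [f * F]mulrC [f * act _ _]mulrC.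
Qed.

Lemma act_T_sym i f : i != ord0 -> sv i f = f -> act (hT i) f = v *: f.
Proof. by move=> i0 sf; apply/eqP; rewrite (act_hT_inv rep) // sf. Qed.

Lemma act_Ti_sym i f : i != ord0 -> sv i f = f -> act (hTi i) f = v^-1 *: f.
Proof.
move=> i0 sf; apply: (scalerI v_neq0); rewrite -(act_rZ rep) scalerA mulfV ?v_neq0 // scale1r.
by rewrite -[v *: f](act_T_sym i0 sf) -(actM rep) hTi_T (act_one rep).
Qed.

Lemma act_T_x i f : i != ord0 -> sv i f = f ->
  act (hT i) (X (we (inord i.-1 : 'I_N.+1)) * f) = v^-1 *: (X (we i) * f).
Proof.
move=> i0 sf; have := congr1 (fun h => act h f) (hTx1 D i0).
rewrite !(actM rep) (act_Ti_sym i0 sf) (act_rZ rep) !(ractX rep).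
by [].
Qed.

Fixpoint Tc (k : nat) (f : L) : L :=
  if k is k'.+1 then act (hT (inord k)) (Tc k' f) else f.

Definition symm f := forall i : 'I_N.+1, i != ord0 -> sv i f = f.

Lemma inord_neq0 k : (k < N)%N -> (inord k.+1 : 'I_N.+1) != ord0.
Proof. by move=> kN; rewrite -val_eqE /= inordK. Qed.

Lemma Tc_symM k F f : (k <= N)%N -> symm f -> Tc k (F * f) = Tc k F * f.
Proof.
move=> kN sf; elim: k kN => //= k IH kN; rewrite IH ?(ltnW kN) // act_T_symM //.
  exact: inord_neq0.
by apply: sf; exact: inord_neq0.
Qed.

Lemma Tc_sym k f : (k <= N)%N -> symm f -> Tc k f = v ^+ k *: f.
Proof.
move=> kN sf; elim: k kN => [|k IH] kN /=; first by rewrite scale1r.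
rewrite IH ?(ltnW kN) // (act_rZ rep) act_T_sym ?scalerA -?exprSr ?inord_neq0 //.
by apply: sf; exact: inord_neq0.
Qed.

Lemma act_rB h f f' : act h (f - f') = act h f - act h f'.
Proof. by rewrite (act_rD rep) -scaleN1r (act_rZ rep) scaleN1r. Qed.

Lemma act_T_RR k a : (k < N)%N ->
  act (hT (inord k.+1)) (xn k * RR k a) = v^-1 *: (xn k.+1 * RR k.+1 a).
Proof.
move=> kN; have i0 := inord_neq0 kN; set i := inord k.+1.
have iE : i = k.+1 :> nat by rewrite inordK.
have sS m : sv i (SS k m) = SS k m by rewrite -[in RHS](sv_SS iE).
have xk : xn k = X (we (inord i.-1 : 'I_N.+1)) by rewrite iE.
have xk1 : xn k.+1 = X (we i) by [].
rewrite RR_SS RRS_SS /PowerSeries.DD !mulrBr act_rB {1}xk act_T_x // -xk1 scalerBr; congr (_ - _).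
rewrite mulrA act_T_sym //; last first.
  rewrite (rmM (rm_sv i)) sS (rmM (rm_sv i)) xk1 {1}xk !sv_xk /swp tpermL tpermR -xk -xk1.
  by rewrite [xn k.+1 * _]mulrC.
have vt : v^-1 * t = v by rewrite t_v2 mulKf ?v_neq0.
by rewrite -scalerAl -scalerAr scalerA vt !mulrA [xn k.+1 * _]mulrC.
Qed.

Lemma Tc_RR k a : (k <= N)%N -> Tc k (x * RR 0 a) = v^-1 ^+ k *: (xn k * RR k a).
Proof.
elim: k => [|k IH] kN.
  by rewrite /= scale1r /xn /x; congr (X (we _) * _); apply/val_inj; rewrite /= inordK.
by rewrite [LHS]/= IH ?(ltnW kN) // (act_rZ rep) act_T_RR // scalerA exprSr.
Qed.

Lemma xn0 : xn 0 = x.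
Proof. by rewrite /xn /x; congr (X (we _)); apply/val_inj; rewrite /= inordK. Qed.

Lemma RR0 a : RR 0 a = q ^ a *: hh a.
Proof.
rewrite -[RHS]/(sc q hh a) /hh (sc_II _ (q_neq0 N) nn_g).
by rewrite x0E scalerA mulfV ?q_neq0 // scale1r /RR xn0.
Qed.

Lemma act_pT_Tc k f : act (pT D (rev [seq inord i | i <- iota 1 k])) f = Tc k f.
Proof.
elim: k => [|k IH]; first by rewrite /pT big_nil (act_one rep).
have -> : iota 1 k.+1 = iota 1 k ++ [:: k.+1] by rewrite -[in LHS](addn1 k) iotaD.
by rewrite map_cat rev_cat /= pT_cons (actM rep) IH.
Qed.

Lemma act_Y_Tc f : act Y f = pv (Tc N f).
Proof. by rewrite (hY_piU N0) (actM rep) (act_hpi rep) act_pT_Tc. Qed.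

Lemma act_Y_symM F f : symm f -> act Y (F * f) = act Y F * pv f.
Proof. by move=> sf; rewrite !act_Y_Tc Tc_symM // (rmM rm_pv). Qed.

Lemma act_Y_sym f : symm f -> act Y f = v ^+ N *: pv f.
Proof. by move=> sf; rewrite act_Y_Tc Tc_sym // (pvZ rep). Qed.

Lemma xnN : xn N = X (we ord_max).
Proof. by congr (X (we _)); apply/val_inj; rewrite /= inordK. Qed.

Lemma pv_RR a : eN ^ a *: pv (RR N a) = hh a.
Proof.
have e0 := eN_neq0.
suff E : sc eN (pv \o RR N) = hh by rewrite -[in RHS]E.
apply: (@DD_inj _ _ (t *: x0)) => //.
  exact: nn_sc (nn_rm rm_pv _).
rewrite -gh_h.
have <- : sc eN (pv \o PP N.+1) = gh by rewrite PP_top.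
rewrite [PP N.+1]/= -/(RR N) (rm_DD rm_pv) sc_DD // (pvZ rep) xnN pv_xmax.
congr (PowerSeries.DD _ _); rewrite x0E qN_e !scalerA; congr (_ *: _).
by rewrite [eN * t]mulrC mulrA.
Qed.

Lemma act_Y_xh a : act Y (x * hh a) = (v^-1 ^+ N * u ^- (2 * N) * q ^ (- a) * eN ^ (- a)) *: (x * hh a).
Proof.
have hE : hh a = q ^ (- a) *: RR 0 a.
  by rewrite RR0 scalerA expzNK ?scale1r // q_neq0.
rewrite {1}hE -scalerAr (act_rZ rep) act_Y_Tc Tc_RR // (pvZ rep) (rmM rm_pv) xnN pv_xmax.
have -> : pv (RR N a) = eN ^ (- a) *: hh a.
  by rewrite -pv_RR scalerA expzNK ?scale1r // eN_neq0.
rewrite -scalerAl -scalerAr !scalerA; congr (_ *: _).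
have Kf (F : comPzRingType) (p r s w : F) : p * r * s * w = r * s * p * w by ring.
exact: Kf.
Qed.

Lemma act_Y_xhf a f : symm f ->
  act Y (x * hh a * f) = (v^-1 ^+ N * u ^- (2 * N) * q ^ (- a) * eN ^ (- a)) *: (x * hh a * pv f).
Proof. by move=> sf; rewrite act_Y_symM // act_Y_xh -scalerAl. Qed.

Definition Sop f : L := \sum_(k < N.+1) v ^+ k *: Tc k f.

Lemma Sop_symM F f : symm f -> Sop (F * f) = Sop F * f.
Proof.
move=> sf; rewrite /Sop mulr_suml; apply: eq_bigr => k _.
by rewrite Tc_symM ?scalerAl // -ltnS.
Qed.

Lemma Tc_lin k a f f' : Tc k (a *: f + f') = a *: Tc k f + Tc k f'.
Proof. by elim: k => //= k ->; rewrite (ractL rep). Qed.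

Lemma Sop_lin a f f' : Sop (a *: f + f') = a *: Sop f + Sop f'.
Proof.
rewrite /Sop scaler_sumr -big_split /=; apply: eq_bigr => k _.
by rewrite Tc_lin scalerDr !scalerA mulrC.
Qed.

Lemma Sop_xh a : (1 - t) *: Sop (x * hh a) = (q ^ (- a) * (1 - q ^ (a + 1))) *: g (a + 1).
Proof.
have hE : hh a = q ^ (- a) *: RR 0 a.
  by rewrite RR0 scalerA expzNK ?scale1r // q_neq0.
rewrite hE -scalerAr -[q ^ (- a) *: _]addr0 Sop_lin.
have -> : Sop 0 = 0.
  by have := Sop_lin (-1) 0 0; rewrite scaler0 addr0 scaleN1r addNr.
rewrite addr0 scalerA mulrC -!scalerA; congr (_ *: _).
have -> : Sop (x * RR 0 a) = \sum_(k < N.+1) xn k * RR k a.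
  apply: eq_bigr => k _; rewrite Tc_RR -1?ltnS // scalerA exprVn mulfV ?scale1r //.
  by rewrite expf_neq0 ?v_neq0.
rewrite scaler_sumr (eq_bigr (fun k : 'I_N.+1 => PP k.+1 (a + 1) - PP k (a + 1))).
  rewrite -(big_mkord xpredT (fun k => PP k.+1 (a + 1) - PP k (a + 1))) telescope_sumr //.
  by rewrite PP_top /= /gq /PowerSeries.sc scalerBl scale1r.
move=> k _; rewrite [PP k.+1]/= -/(RR k).
have -> : PP k (a + 1) = DD (xn k) (RR k) (a + 1) by rewrite DD_II //; exact: nn_PP.
have Kr (r p s : L) : (r - p) - (r - s) = s - p by ring.
by rewrite /PowerSeries.DD addrK Kr -scalerAl scalerBl scale1r.
Qed.

Lemma Sop_kk a : (1 - t) *: Sop (kk a) = (q ^ (- a) - 1) *: g a.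
Proof.
have := Sop_xh (a - 1); rewrite subrK => E.
rewrite /kk x0E -scalerAl -[q^-1 *: _]addr0 Sop_lin.
have -> : Sop 0 = 0.
  by have := Sop_lin (-1) 0 0; rewrite scaler0 addr0 scaleN1r addNr.
rewrite addr0 scalerA mulrC -scalerA E scalerA; congr (_ *: _).
have Kf (F : fieldType) (Q : F) : Q != 0 -> Q^-1 * (Q ^ (- (a - 1)) * (1 - Q ^ a)) = Q ^ (- a) - 1.
  move=> Q0; rewrite mulrA -{1}[Q^-1]expr1z exprz_inv -expfzDr // mulrBr mulr1 -expfzDr //.
  congr (_ ^ _ - _); first by ring.
  by rewrite (_ : _ + a = 0) //; ring.
exact: Kf (q_neq0 N).
Qed.

Lemma Sop_sym f : symm f -> (1 - t) *: Sop f = (1 - t ^+ N.+1) *: f.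
Proof.
move=> sf; rewrite /Sop (eq_bigr (fun k : 'I_N.+1 => t ^+ k *: f)); last first.
  by move=> k _; rewrite Tc_sym -1?ltnS // scalerA t_v2 -exprMn.
by rewrite -scaler_suml scalerA -subrX1_geom.
Qed.

End Chain.
End OneRow.

Module WeightedSums.
Import PowerSeries.

Section Sums.
Variables (K : fieldType) (L : comAlgType K).
Hypothesis two0 : 2%:R != 0 :> K.
Implicit Types (w : int -> K) (d n : nat) (F : int -> int -> L).

Definition wsum d w F : L := \sum_(a < d.+1) w a%:Z *: F a%:Z (d%:Z - a%:Z).

Lemma eq_wsum d w w' F F' :
  (forall a : int, w a *: F a (d%:Z - a) = w' a *: F' a (d%:Z - a)) ->
  wsum d w F = wsum d w' F'.
Proof. by move=> E; apply: eq_bigr => a _; rewrite E. Qed.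

Lemma wsumZ c d w F : c *: wsum d w F = wsum d (fun a => c * w a) F.
Proof. by rewrite /wsum scaler_sumr; apply: eq_bigr => a _; rewrite scalerA. Qed.

Lemma wsumM y d w F : y * wsum d w F = wsum d w (fun a b => y * F a b).
Proof. by rewrite /wsum mulr_sumr; apply: eq_bigr => a _; rewrite scalerAr. Qed.

Lemma wsumB d w F F' : wsum d w F - wsum d w F' = wsum d w (fun a b => F a b - F' a b).
Proof. by rewrite /wsum -sumrB; apply: eq_bigr => a _; rewrite scalerBr. Qed.

Lemma wsum_rev d w F : wsum d w F = wsum d (fun a => w (d%:Z - a)) (fun a b => F b a).
Proof.
rewrite /wsum (reindex_inj rev_ord_inj) /=; apply: eq_bigr => a _.
have ad := ltn_ord a.
have -> : (d.+1 - a.+1)%N%:Z = d%:Z - a%:Z by lia.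
by have -> : d%:Z - (d%:Z - a%:Z) = a%:Z by lia.
Qed.

Lemma half_eq (s s' : L) : s + s = s' + s' -> s = s'.
Proof.
move=> E; apply: (scalerI two0); rewrite !scaler_nat !mulr2n; exact: E.
Qed.

Lemma wsum_symm d w w' F : (forall a b, F a b = F b a) ->
  (forall a : int, w a + w (d%:Z - a) = w' a + w' (d%:Z - a)) -> wsum d w F = wsum d w' F.
Proof.
move=> FC E; apply: half_eq; rewrite {2}wsum_rev {2}(wsum_rev d w').
rewrite /wsum -!big_split /=; apply: eq_bigr => a _.
by rewrite (FC (d%:Z - a%:Z)) -!scalerDl E.
Qed.

Lemma wsum_anti d w F : (forall a b, F a b = F b a) ->
  (forall a : int, w (d%:Z - a) = - w a) -> wsum d w F = 0.
Proof.
move=> FC E; have -> : 0 = wsum d (fun=> 0) F.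
  by rewrite /wsum big1 // => a _; rewrite scale0r.
by apply: wsum_symm => // a; rewrite E subrr addr0.
Qed.

Variable h : int -> L.
Hypothesis nh : nn h.
Variables (y : L) (t eta : K).
Hypothesis eta0 : eta != 0.
Local Notation hh := (fun a b => h a * h b).

Lemma wsum_last d w : wsum d.+1 w (fun a b => h a * h (b - 1)) = wsum d w hh.
Proof.
rewrite /wsum big_ord_recr /= [X in _ + X](_ : _ = 0) ?addr0.
  apply: eq_bigr => a _; congr (_ *: (_ * h _)); lia.
by rewrite (_ : d.+1%:Z - d.+1%:Z - 1 = Negz 0) ?nh ?mulr0 ?scaler0 //; lia.
Qed.

Lemma wsum_first d w : wsum d.+1 w (fun a b => h (a - 1) * h b) = wsum d (fun a => w (a + 1)) hh.
Proof.
transitivity (wsum d.+1 (fun a => w (d.+1%:Z - a)) (fun a b => h a * h (b - 1))).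
  by rewrite wsum_rev; apply: eq_wsum => a; rewrite mulrC.
rewrite wsum_last wsum_rev; apply: eq_wsum => a; rewrite [h _ * _]mulrC; congr (w _ *: _); lia.
Qed.

Lemma wsum_both d w : wsum d.+2 w (fun a b => h (a - 1) * h (b - 1)) = wsum d (fun a => w (a + 1)) hh.
Proof.
rewrite /wsum big_ord_recr big_ord_recl /= (_ : 0%:Z - 1 = Negz 0) // nh mul0r scaler0 add0r.
rewrite [X in _ + X](_ : _ = 0) ?addr0; last first.
  by rewrite (_ : d.+2%:Z - d.+2%:Z - 1 = Negz 0) ?nh ?mulr0 ?scaler0 //; lia.
apply: eq_bigr => a _; rewrite /bump /=; congr (w _ *: (h _ * h _)); lia.
Qed.

Lemma signZ (a : int) : (-1 : K) ^ (a + 1) = - (-1) ^ a.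
Proof. by rewrite expfzDr ?oppr_eq0 ?oner_eq0 // expr1z mulrN1. Qed.
Lemma signZ2 (d : nat) (a : int) : (-1 : K) ^ ((2 * d)%N%:Z - a) = (-1) ^ a.
Proof.
have n1 : -1 != 0 :> K by rewrite oppr_eq0 oner_eq0.
rewrite expfzDr // -exprnP exprM sqrrN expr1n expr1n mul1r -exprz_inv.
by congr (_ ^ _); apply/eqP; rewrite invrN1.
Qed.
Lemma signZ21 (d : nat) (a : int) : (-1 : K) ^ ((2 * d).+1%:Z - a) = - (-1) ^ a.
Proof. by rewrite -(signZ2 d) -signZ; congr (_ ^ _); lia. Qed.

Definition wt0 d (a : int) : K := (-1) ^ a * eta ^ ((d%:Z - a) * (a + 1)).

Lemma etaD (a b c : int) : a + b = c -> eta ^ a * eta ^ b = eta ^ c.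
Proof. by move=> <-; rewrite expfzDr. Qed.

Lemma sum3 n :
  wsum (2 * n).+2 (wt0 (2 * n).+2) (fun a b => DD y h a * (y * h (b - 1))) =
  eta ^+ (4 * n + 2) *: (y * y *
  wsum (2 * n) (fun a => wt0 (2 * n) a * eta ^ (- (2 * ((2 * n)%N%:Z - a))))
    (fun a b => h b * DD (t *: y) h a)).
Proof.
set d := (2 * n)%N.
have -> : wsum d.+2 (wt0 d.+2) (fun a b => DD y h a * (y * h (b - 1))) =
   y * wsum d.+2 (wt0 d.+2) (fun a b => h a * h (b - 1)) -
   y * y * wsum d.+2 (wt0 d.+2) (fun a b => h (a - 1) * h (b - 1)).
  rewrite !wsumM wsumB; apply: eq_wsum => a; congr (_ *: _); rewrite /DD; ring.
rewrite wsum_last (wsum_anti (d := d.+1)) ?mulr0 ?sub0r; last 2 first.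
- by move=> a b; rewrite mulrC.
- move=> a; rewrite /wt0 signZ21 mulNr; congr (- (_ * _ ^ _)); ring.
rewrite wsum_both.
have -> : wsum d (fun a => wt0 d a * eta ^ (- (2 * (d%:Z - a)))) (fun a b => h b * DD (t *: y) h a) =
  wsum d (fun a => wt0 d a * eta ^ (- (2 * (d%:Z - a)))) hh.
  set w := fun a => _.
  have -> : wsum d w (fun a b => h b * DD (t *: y) h a) =
    wsum d w hh - (t *: y) * wsum d w (fun a b => h (a - 1) * h b).
    rewrite wsumM wsumB; apply: eq_wsum => a; congr (_ *: _); rewrite /DD; ring.
  case: (posnP n) => [n0|n0].
    rewrite [X in _ - _ * X](_ : _ = 0) ?mulr0 ?subr0 //.
    by rewrite /wsum /d n0 muln0 big_ord1 (_ : 0%:Z - 1 = Negz 0) // nh mul0r scaler0.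
  have [d' dd'] : exists d', d = d'.+1 by exists d.-1; rewrite prednK // /d muln_gt0.
  suff E0 : wsum d w (fun a b => h (a - 1) * h b) = 0 by rewrite E0 mulr0 subr0.
  rewrite {1}dd' wsum_first; apply: wsum_anti => [a b|a]; first by rewrite mulrC.
  rewrite /w /wt0.
  have -> : d'%:Z - a + 1 = d%:Z - a by rewrite dd'; lia.
  rewrite signZ2 signZ !mulNr opprK -!mulrA; congr (_ * _).
  rewrite -!expfzDr //; congr (_ ^ _); rewrite dd'; ring.
rewrite scalerAr -mulrN; congr (_ * _); rewrite wsumZ -scaleN1r wsumZ.
apply: wsum_symm => [a b|a]; first by rewrite mulrC.
rewrite /wt0 !signZ signZ2 !mulNr !mul1r !opprK.
rewrite -!mulrA ![eta ^+ _ * (_ * _)]mulrCA -!mulrDr; congr (_ * _).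
rewrite [RHS]addrC exprnP !(etaD erefl).
by congr (_ ^ _ + _ ^ _); rewrite /d; lia || ring.
Qed.

Lemma sum1 n :
  wsum (2 * n).+2 (fun a => wt0 (2 * n).+2 a * eta ^ (2 * a)) (fun a b => y * h (a - 1) * DD y h b) =
  eta ^+ (4 * n + 4) *: (y * y *
  wsum (2 * n) (wt0 (2 * n)) (fun a b => h a * DD (t *: y) h b)).
Proof.
set d := (2 * n)%N; set w := fun a => _.
have -> : wsum d.+2 w (fun a b => y * h (a - 1) * DD y h b) =
   y * wsum d.+2 w (fun a b => h (a - 1) * h b) -
   y * y * wsum d.+2 w (fun a b => h (a - 1) * h (b - 1)).
  rewrite !wsumM wsumB; apply: eq_wsum => a; congr (_ *: _); rewrite /DD; ring.
rewrite wsum_first (wsum_anti (d := d.+1)) ?mulr0 ?sub0r; last 2 first.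
- by move=> a b; rewrite mulrC.
- move=> a; rewrite /w /wt0 !signZ signZ21 !mulNr; congr (- (- _)).
  by rewrite -!mulrA; congr (_ * _); rewrite -!expfzDr //; congr (_ ^ _); ring.
rewrite wsum_both.
have -> : wsum d (wt0 d) (fun a b => h a * DD (t *: y) h b) = wsum d (wt0 d) hh.
  have -> : wsum d (wt0 d) (fun a b => h a * DD (t *: y) h b) =
    wsum d (wt0 d) hh - (t *: y) * wsum d (wt0 d) (fun a b => h a * h (b - 1)).
    rewrite wsumM wsumB; apply: eq_wsum => a; congr (_ *: _); rewrite /DD; ring.
  case: (posnP n) => [n0|n0].
    rewrite [X in _ - _ * X](_ : _ = 0) ?mulr0 ?subr0 //.
    by rewrite /wsum /d n0 muln0 big_ord1 (_ : 0%:Z - 0%:Z - 1 = Negz 0) // nh mulr0 scaler0.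
  have [d' dd'] : exists d', d = d'.+1 by exists d.-1; rewrite prednK // /d muln_gt0.
  suff E0 : wsum d (wt0 d) (fun a b => h a * h (b - 1)) = 0 by rewrite E0 mulr0 subr0.
  rewrite {1}dd' wsum_last; apply: wsum_anti => [a b|a]; first by rewrite mulrC.
  rewrite /wt0.
  have -> : d'%:Z - a = d%:Z - (a + 1) by rewrite dd'; lia.
  rewrite signZ2 signZ !mulNr; congr (- (_ * _)).
  congr (_ ^ _); rewrite dd'; ring.
rewrite scalerAr -mulrN; congr (_ * _); rewrite wsumZ -scaleN1r wsumZ.
apply: wsum_symm => [a b|a]; first by rewrite mulrC.
rewrite /w /wt0 !signZ signZ2 !mulNr !mul1r !opprK.
rewrite -!mulrA ![eta ^+ _ * (_ * _)]mulrCA -!mulrDr; congr (_ * _).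
rewrite [in RHS]mulrDr [RHS]addrC exprnP !(etaD erefl).
by congr (_ ^ _ + _ ^ _); rewrite /d; lia || ring.
Qed.

End Sums.
End WeightedSums.

Module KnotVector.
Import Weights GroupAlgebraTheory MinimalElement ReducedWord Generators DahaRelations BraidWords LaurentOperators PolynomialRep Evaluation ModularAction PowerSeries OneRow WeightedSums.

Lemma powV (F : fieldType) (a : F) (n : nat) : a^-1 ^+ n = a ^ (- n%:Z).
Proof. by rewrite exprVn exprnN. Qed.

Lemma pow2z (F : fieldType) (a : F) (m : int) : (a ^+ 2) ^ m = a ^ (2 * m).
Proof. by rewrite exprnP exprz_exp. Qed.

Lemma candE3_scal (F : fieldType) (C w eta e q V : F) (n : nat) (b a : int) :
  eta != 0 -> e != 0 -> q = eta ^+ 2 -> b = (2 * n)%N%:Z - a ->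
  C * (V * (e * q)^-1 ^+ (2 * n).+1) * eta ^+ (4 * n + 2) * (w * eta ^ (- (2 * b))) =
  q^-1 * C * w * (V * (e * q)^-1 * q ^ (- b) * e ^ (- b) * e ^ (- a)) * (q * q).
Proof.
move=> h0 E0 -> bE; rewrite powV expfzMl !pow2z.
have p1 : eta ^ (2 * - (2 * n).+1%:Z) * eta ^+ (4 * n + 2) = 1.
  by rewrite exprnP -expfzDr // (_ : _ + _ = 0) //; lia.
have -> : e ^ (- (2 * n).+1%:Z) = e^-1 * e ^ (- b) * e ^ (- a).
  by rewrite -exprN1 -!expfzDr //; congr (_ ^ _); lia.
have -> : - (2 * b) = 2 * - b by ring.
move: p1; move: (eta ^ (2 * - (2 * n).+1%:Z)) (eta ^+ (4 * n + 2)) (eta ^ (2 * - b)) (e ^ (- b)) (e ^ (- a)) => p1 p2 z1 z2 z3 p12.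
have -> : C * (V * (e^-1 * z2 * z3 * p1)) * p2 * (w * z1) = C * (V * (e^-1 * z2 * z3)) * (p1 * p2) * (w * z1) by ring.
by rewrite p12; field; rewrite h0 E0.
Qed.

Lemma candE1_scal (F : fieldType) (C w eta e q V : F) (n : nat) (b a : int) :
  eta != 0 -> e != 0 -> q = eta ^+ 2 -> b = (2 * n).+2%:Z - a ->
  C * (V * (e * q)^-1 ^+ (2 * n).+1) * w * q^-1 =
  e / q * (C * (q * q) / eta ^+ (4 * n + 4)) * (w * eta ^ (2 * a)) * q^-1 *
  (V * (e * q)^-1 * q ^ (- (a - 1)) * e ^ (- (a - 1))) * e ^ (- b).
Proof.
move=> h0 E0 -> bE; rewrite powV expfzMl !pow2z.
have p1 : eta ^ (2 * - (2 * n).+1%:Z) = (eta ^+ (4 * n + 4))^-1 * eta ^ (2 * a) * eta ^ (2 * - (a - 1)).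
  by rewrite exprnN -!expfzDr //; congr (_ ^ _); lia.
have -> : e ^ (- (2 * n).+1%:Z) = e ^ (- (a - 1)) * e ^ (- b).
  by rewrite -!expfzDr //; congr (_ ^ _); lia.
rewrite p1; have h4 : eta ^+ (4 * n + 4) != 0 by rewrite expf_neq0.
move: h4; move: (eta ^ _) (eta ^+ (4 * n + 4)) (eta ^ _) (e ^ _) (e ^ _) => p3 p2 z1 z2 z3 h4.
by field; rewrite h0 E0 h4.
Qed.

Section Trefoil.
Variable N : nat.
Hypothesis N0 : (0 < N)%N.
Variable D : daha N.
Local Notation H := (daha_alg D).
Variable L : comAlgType coefField.
Variables (X : wt N -> L) (sv : 'I_N.+1 -> L -> L) (pv : L -> L).
Variables (lv : L -> coefField) (emb : L -> daha_alg D) (act : daha_alg D -> L -> L).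
Hypothesis rep : rep_spec X sv pv lv emb act.
Local Notation symm := (@symm N L sv).
Hypothesis Hpi : forall m f, (0 < m)%N -> symm f -> eN ^+ (2 * m) *: pv f = f -> f = 0.
Local Notation hT := (hT D).
Local Notation hTi := (hTi D).
Local Notation hx0 := (hx D ord0).
Local Notation hxi0 := (hxi D ord0).
Local Notation Y := (hY D).
Local Notation Ji := (hJi D).
Local Notation q := (q N).
Local Notation A := (dtau D).
Local Notation Bi := (dphi D \o dtau D \o dphi D).
Local Notation g := (g X).
Local Notation x := (x X).
Local Notation x0 := (x0 X).

Local Notation hh := (hh X).

Local Notation e := eN.
Let rels : daha_rels (@dT N D) (@dPi N D) (@dX N D) := (dahaP D).1.
Opaque eN Defs.q Defs.t.

(* Locking prevents the rewriting of scalars from looking into these terms. *)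
Definition gh m := locked (OneRow.gh X pv m).
Definition kk a := locked (OneRow.kk X a).
Lemma ghE m : gh m = e ^ m *: pv (g m). Proof. by rewrite /gh -lock. Qed.
Lemma kkE a : kk a = x0 * hh (a - 1). Proof. by rewrite /kk -lock. Qed.

Lemma symm_g m : symm (g m). Proof. by move=> i _; exact: (sv_g rep). Qed.

Lemma Y_emb_sym f : symm f -> Y * emb f = emb (pv f) * Y.
Proof.
move=> sf; have C s : all (fun j : 'I_N.+1 => j != ord0) s -> pT D s * emb f = emb f * pT D s.
  elim: s => [|i s IH] /=; first by rewrite /pT big_nil mulr1 mul1r.
  case/andP=> i0 sn; rewrite pT_cons -mulrA (IH sn) mulrA.
  by rewrite (hT_emb_sym rep i0 (sf i i0)) mulrA.
by rewrite (hY_piU N0) -mulrA (C _ (cword_n0 _)) mulrA (pi_emb N0 rep) mulrA.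
Qed.

Lemma emb_x : emb x = hx0. Proof. exact: embX rep _. Qed.

Lemma emb_star m : e ^ m *: (Y * emb (g m)) - (e ^ (m - 1) * q^-1) *: (hx0 * Y * emb (g (m - 1)))
  = emb (g m) * Y - (t * q^-1) *: (hx0 * emb (g (m - 1)) * Y).
Proof.
rewrite -mulrA !(Y_emb_sym (symm_g _)) mulrA -emb_x -!(embM rep) !scalerAl -mulrBl -mulrBl.
rewrite -!(embZ rep) -!(embB rep); congr (emb _ * _).
have := congr1 (fun F => F m) (gh_star N0 rep); rewrite /PowerSeries.DD /OneRow.gh (x0E X).
by rewrite scalerA -!scalerAl -scalerAr scalerA [q^-1 * _]mulrC.
Qed.

Definition Th h := A (Bi h).
Lemma hom_Th : hom Th. Proof. by apply: hom_comp; [exact: hom_tau|exact: hom_Bi]. Qed.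

Lemma Th_Y : Th Y = u ^- N *: (hx0 * Y).
Proof. by rewrite /Th Bi_Y (tau_Y N0). Qed.
Lemma Th_x : Th hx0 = hx0 * Y * hx0.
Proof.
rewrite /Th Bi_x // linearZ /= rmorphM /= (tau_Y N0) tau_x -scalerAl scalerA.
by rewrite mulfV ?expf_neq0 ?u_neq0 // scale1r.
Qed.

Definition Gc m := Th (emb (g m)).
Local Notation M := (hx0 * Y * hx0).

Lemma Gc_star m : e ^ m *: (hx0 * Y * Gc m) - (e ^ (m - 1) * q^-1) *: (M * (hx0 * Y) * Gc (m - 1))
  = Gc m * (hx0 * Y) - (t * q^-1) *: (M * Gc (m - 1) * (hx0 * Y)).
Proof.
have uN : u ^- N != 0 by rewrite invr_neq0 // expf_neq0 ?u_neq0.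
have hTh := hom_Th; apply: (scalerI uN).
have := congr1 Th (emb_star m).
rewrite !(hom_sub hTh) !(hom_scale hTh) !(hom_mul hTh) Th_Y Th_x -/(Gc m) -/(Gc (m - 1)).
rewrite -!(scalerAl (u ^- N)) -!(scalerAr (u ^- N)) -!(scalerAl (u ^- N)).
have Z (V : lmodType coefField) (a b : coefField) (z1 z2 : V) : u ^- N *: (a *: z1 - b *: z2) =
   a *: (u ^- N *: z1) - b *: (u ^- N *: z2) by rewrite scalerBr !scalerA ![u ^- N * _]mulrC.
rewrite Z => ->.
by rewrite scalerBr !scalerA [u ^- N * _]mulrC.
Qed.

Definition Ma f : L := x * act Y (x * f).

Lemma act_hx f : act hx0 f = x * f. Proof. exact: ractX rep _ f. Qed.
Lemma act_M f : act M f = Ma f.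
Proof. by rewrite !(actM rep) !act_hx. Qed.

Lemma Gc_Mcomm m : Gc m * M = M * Gc m.
Proof.
have hTh := hom_Th.
by rewrite -Th_x -!(hom_mul hTh) -emb_x -!(embM rep) mulrC.
Qed.

Lemma Gc_Tcomm m i : i != ord0 -> hT i * Gc m = Gc m * hT i.
Proof.
move=> i0; have hTh := hom_Th; rewrite -(hom_T hTh i0) -!(hom_mul hTh).
by rewrite (hT_emb_sym rep i0 (symm_g m i0)).
Qed.

Lemma Gc_Ticomm m i : i != ord0 -> hTi i * Gc m = Gc m * hTi i.
Proof.
move=> i0; rewrite -[LHS]mulr1 -(hT_Ti D i) -mulrA [Gc m * (_ * _)]mulrA -Gc_Tcomm //.
by rewrite !mulrA hTi_T mul1r.
Qed.

Lemma Gc_Jicomm m : Ji * Gc m = Gc m * Ji.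
Proof.
have C s : all (fun j : 'I_N.+1 => j != ord0) s -> pTi D s * Gc m = Gc m * pTi D s.
  elim: s => [|i s IH] /=; first by rewrite /pTi big_nil mulr1 mul1r.
  by case/andP=> i0 sn; rewrite pTi_cons -mulrA (IH sn) mulrA Gc_Ticomm // mulrA.
by rewrite /hJi -mulrA (C _ (cword_n0 _)) mulrA (C _ (rcword_n0 _)) mulrA.
Qed.

Definition xV := X (- we ord0).
Lemma x_xV : x * xV = 1. Proof. by rewrite -(rXD rep) subrr (rX0 rep). Qed.

Definition vv m := locked (act (Gc m) 1).
Lemma vvE m : vv m = act (Gc m) 1. Proof. by rewrite /vv -lock. Qed.
Definition ph m := locked (e ^ m *: (xV * act (Gc m) x)).
Lemma phE m : ph m = e ^ m *: (xV * act (Gc m) x). Proof. by rewrite /ph -lock. Qed.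
Definition vh (m : int) := locked ((e ^ (2 * m) * v ^- N) *: act Y (vv m)).
Lemma vhE m : vh m = (e ^ (2 * m) * v ^- N) *: act Y (vv m). Proof. by rewrite /vh -lock. Qed.

Lemma symm_vv m : symm (vv m).
Proof.
move=> i i0; apply/eqP; rewrite -(act_hT_inv rep) // vvE -(actM rep) Gc_Tcomm //.
by rewrite (actM rep) (PolynomialRep.act_hT1 rep i0) (act_rZ rep).
Qed.

Lemma act_Gc_x m : act (Gc m) x = e ^ (- m) *: (x * ph m).
Proof.
by rewrite phE -scalerAr scalerA expzNK ?eN_neq0 // scale1r mulrA x_xV mul1r.
Qed.

Lemma act_Y_vv m : act Y (vv m) = (e ^ (- (2 * m)) * v ^+ N) *: vh m.
Proof.
rewrite vhE scalerA mulrACA expzNK ?eN_neq0 // mul1r mulfV ?scale1r //.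
by rewrite expf_neq0 ?v_neq0.
Qed.

Lemma x_inj f f' : x * f = x * f' -> f = f'.
Proof.
by move=> /(congr1 (fun z => xV * z)); rewrite !mulrA [xV * _]mulrC x_xV !mul1r.
Qed.

Lemma Ma_lin a f f' : Ma (a *: f + f') = a *: Ma f + Ma f'.
Proof. by rewrite /Ma mulrDr -scalerAr (ractL rep) mulrDr -scalerAr. Qed.
Lemma MaB f f' : Ma (f - f') = Ma f - Ma f'.
Proof. by rewrite addrC -scaleN1r Ma_lin scaleN1r addrC. Qed.
Lemma MaZ a f : Ma (a *: f) = a *: Ma f.
Proof.
have M0 : Ma 0 = 0 by have := MaB 0 0; rewrite !subrr.
by rewrite -[_ *: f]addr0 Ma_lin M0 addr0.
Qed.

Lemma actB h h' f : act (h - h') f = act h f - act h' f.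
Proof. by rewrite (act_lD rep) -scaleN1r (act_lZ rep) scaleN1r. Qed.

Lemma Gc_star_act m f :
  e ^ m *: (x * act Y (act (Gc m) f)) - (e ^ (m - 1) * q^-1) *: Ma (x * act Y (act (Gc (m - 1)) f))
  = act (Gc m) (x * act Y f) - (t * q^-1) *: Ma (act (Gc (m - 1)) (x * act Y f)).
Proof.
have := congr1 (fun h => act h f) (Gc_star m).
by rewrite !actB !(act_lZ rep) !(ractM rep) !act_hx.
Qed.

Lemma scal1 (F : fieldType) (E V Q T : F) (m : int) : E != 0 ->
  [/\ E ^ m * (E ^ (- (2 * m)) * V) = V * E ^ (- m),
      E ^ (m - 1) * Q * (E ^ (- (2 * (m - 1))) * V) = V * E ^ (- m) * (E * Q) &
      T * Q * (V * E ^ (- (m - 1))) = V * E ^ (- m) * (T * (E * Q))].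
Proof.
move=> E0; split.
- by rewrite mulrA -expfzDr // mulrC; congr (_ * _ ^ _); ring.
- rewrite mulrACA -expfzDr //.
  have -> : m - 1 + - (2 * (m - 1)) = - m + 1 by ring.
  by rewrite expfzDr // expr1z; ring.
- have -> : - (m - 1) = - m + 1 by ring.
  by rewrite expfzDr // expr1z; ring.
Qed.

Lemma E1 m : vh m - ph m = (e * q^-1) *: act Y (x * (x * (vh (m - 1) - t *: ph (m - 1)))).
Proof.
apply: x_inj; rewrite -scalerAr -/(Ma _) [x * (_ - _)]mulrBr [x * (_ - _ *: _)]mulrBr -[x * (t *: _)]scalerAr MaB MaZ.
have s0 : v ^+ N * e ^ (- m) != 0 := mulf_neq0 (expf_neq0 N v_neq0) (expfz_neq0 _ eN_neq0).
have := Gc_star_act m 1; rewrite -!vvE !act_Y_vv (act_Y1 N0 rep) -!scalerAr mulr1.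
rewrite !MaZ !(act_rZ rep) !act_Gc_x !MaZ !scalerA.
have [-> -> c3] := scal1 (v ^+ N) q^-1 t m eN_neq0.
rewrite c3 -!(scalerA (v ^+ N * e ^ (- m))) -!scalerBr => /(scalerI s0) E.
rewrite scalerBr scalerA [e / q * t]mulrC.
have K (V : zmodType) (a b c d : V) : a - b = c - d -> a - c = b - d.
  by move=> EE; apply/eqP; rewrite subr_eq -[a](subrK b) EE addrC addrA addrAC.
exact: K E.
Qed.

Lemma xYJixi : hx0 * Y * Ji = u ^+ (2 * N) *: (Y * hx0).
Proof.
have uN : u ^+ (2 * N) != 0 by rewrite expf_neq0 ?u_neq0.
have -> : hx0 * Y = u ^+ (2 * N) *: (Y * hx0 * hJ D).
  by rewrite (YxJ N0) scalerA mulfV // scale1r.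
by rewrite -scalerAl -[_ * hJ D * _]mulrA hJ_Ji mulr1.
Qed.

Lemma act_xYJi z : x * act Y (act Ji z) = u ^+ (2 * N) *: act Y (x * z).
Proof.
by have := congr1 (fun h => act h z) xYJixi; rewrite (act_lZ rep) (ractM rep) (ractM rep hx0) (ractM rep Y) !act_hx.
Qed.

Lemma act_Gc_Ji m z : act (Gc m) (act Ji z) = act Ji (act (Gc m) z).
Proof. by rewrite -!(ractM rep) Gc_Jicomm. Qed.

Lemma act_Gc_Ma m z : act (Gc m) (Ma z) = Ma (act (Gc m) z).
Proof. by rewrite -!act_M -!(ractM rep) Gc_Mcomm. Qed.

Lemma ph_alt m : act Y (x * act (Gc m) xV) = (v ^+ N * e ^ (- m)) *: ph m.
Proof.
apply: x_inj; rewrite -/(Ma _) -act_Gc_Ma /Ma x_xV (act_Y1 N0 rep) -scalerAr mulr1.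
by rewrite (act_rZ rep) act_Gc_x scalerA scalerAr.
Qed.

Lemma E3 m : ph m - vv m = q^-1 *: Ma (ph (m - 1) - t *: vv (m - 1)).
Proof.
have s0 := mulf_neq0 (expf_neq0 (2 * N) u_neq0) (expf_neq0 N v_neq0).
have := Gc_star_act m (act Ji xV).
rewrite !act_Gc_Ji !act_xYJi x_xV !ph_alt (act_Y1 N0 rep) !(act_rZ rep) !MaZ -!vvE !scalerA.
have K (F : fieldType) (U E V Q : F) (n : int) : E != 0 ->
    E ^ n * Q * U * (V * E ^ (- n)) = U * V * Q.
  move=> E0; have -> : E ^ n * Q * U * (V * E ^ (- n)) = U * V * Q * (E ^ (- n) * E ^ n) by ring.
  by rewrite expzNK // mulr1.
have := K _ (u ^+ (2 * N)) e (v ^+ N) 1 m eN_neq0; rewrite !mulr1 => ->.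
have K' (F : fieldType) (U E V Q : F) (n : int) : E != 0 -> E ^ n * Q * (U * (V * E ^ (- n))) = U * V * Q.
  by move=> E0; rewrite [E ^ n * Q * (U * _)]mulrA; exact: K.
rewrite (K' _ _ _ _ _ _ eN_neq0) [t / q * _]mulrC -!(scalerA (u ^+ (2 * N) * v ^+ N)) -!scalerBr.
move=> /(scalerI s0) E; rewrite MaB MaZ scalerBr scalerA [q^-1 * t]mulrC.
have K2 (V : zmodType) (a b c d : V) : a - b = c - d -> a - c = b - d.
  by move=> EE; apply/eqP; rewrite subr_eq -[a](subrK b) EE addrC addrA addrAC.
exact: K2 E.
Qed.

Definition eta := u ^+ N.+1.
Lemma eta_neq0 : eta != 0. Proof. by rewrite expf_neq0 ?u_neq0. Qed.
Lemma q_eta : q = eta ^+ 2.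
Proof. by rewrite /eta -exprM mulnC mulnS addnC. Qed.
Local Opaque eta.

Definition Cm (n : nat) : coefField := v ^- N ^+ n * (e * q)^-1 ^+ (n * n).
Definition cs n F : L := locked (Cm n *: wsum (2 * n) (wt0 eta (2 * n)) F).
Lemma csE n F : cs n F = Cm n *: wsum (2 * n) (wt0 eta (2 * n)) F.
Proof. by rewrite /cs -lock. Qed.
Definition cv n := cs n (fun a b => g a * g b).
Definition cp n := cs n (fun a b => g a * gh b).
Definition ch n := cs n (fun a b => gh a * gh b).

Lemma act_wsum h d w F : act h (wsum d w F) = wsum d w (fun a b => act h (F a b)).
Proof.
rewrite /wsum (big_morph (act h) (act_rD rep h) (act_r0 rep h)).
by apply: eq_bigr => a _; rewrite (act_rZ rep).
Qed.

Lemma pv_g a : pv (g a) = e ^ (- a) *: gh a.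
Proof. by rewrite ghE scalerA expzNK ?eN_neq0 // scale1r. Qed.

Lemma symmM f f' : symm f -> symm f' -> symm (f * f').
Proof. by move=> s1 s2 i i0; rewrite (rsvM rep) s1 // s2. Qed.

Lemma csB n F F' : cs n F - cs n F' = cs n (fun a b => F a b - F' a b).
Proof. by rewrite !csE -scalerBr wsumB. Qed.
Lemma csZ n c F : c *: cs n F = cs n (fun a b => c *: F a b).
Proof.
rewrite !csE scalerA mulrC -scalerA; congr (_ *: _); rewrite /wsum scaler_sumr.
by apply: eq_bigr => a _; rewrite !scalerA mulrC.
Qed.
Lemma cs_ext n F F' : (forall a, F a ((2 * n)%N%:Z - a) = F' a ((2 * n)%N%:Z - a)) -> cs n F = cs n F'.
Proof. by move=> E; rewrite !csE; congr (_ *: _); apply: eq_wsum => a; rewrite E. Qed.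

Lemma cand3 n : ch n = (e ^ (2 * n%:Z) * v ^- N) *: act Y (cv n).
Proof.
rewrite /cv csE (act_rZ rep) act_wsum -csE csZ; apply: cs_ext => a.
rewrite (act_Y_sym N0 rep); last by apply: symmM; exact: symm_g.
rewrite (rmM (rm_pv rep)) !pv_g -scalerAl -scalerAr !scalerA.
have vN : v ^+ N != 0 by rewrite expf_neq0 ?v_neq0.
have K (F : fieldType) (E V : F) (a0 b d : int) : V != 0 -> E != 0 -> d = a0 + b ->
   E ^ d / V * V * E ^ (- a0) * E ^ (- b) = 1.
  by move=> V0 E0 ->; rewrite divfK // -!expfzDr //; rewrite (_ : _ + _ = 0) //; ring.
by rewrite (K _ e (v ^+ N) a _ _ vN eN_neq0) ?scale1r //; lia.
Qed.

Lemma CmS n : Cm n.+1 = Cm n * (v ^- N * (e * q)^-1 ^+ (2 * n).+1).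
Proof.
rewrite /Cm exprSr -mulrA -mulrA; congr (_ * _).
have -> : (n.+1 * n.+1 = n * n + (2 * n).+1)%N by lia.
by rewrite exprD mulrCA.
Qed.

Local Notation kap := (v^-1 ^+ N * u ^- (2 * N)).

Lemma kapE : kap = v ^- N * (e * q)^-1.
Proof. by rewrite exprVn invfM qN_e mulKf // eN_neq0. Qed.

Lemma gh_g b : gh b - g b = (1 - t) *: kk b.
Proof. by rewrite /gh /kk -!lock (gh_kk N0 rep) addrC addKr. Qed.
Lemma gh_tg b : gh b - t *: g b = (1 - t) *: hh b.
Proof. by rewrite /gh -lock (gh_kk N0 rep) (hh_kk X) scalerDr [in RHS]scalerBl scale1r addrAC. Qed.

Lemma hh_gh m : gh m = DD (t *: x0) hh m.
Proof. by rewrite /gh -lock (gh_h N0 rep). Qed.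
Lemma hh_g' m : g m = DD x0 hh m.
Proof. by rewrite (hh_g X). Qed.

Lemma two_neq0 : 2%:R != 0 :> coefField. Proof. exact: coefField_char0 1. Qed.

Lemma xx : x * x = (q * q) *: (x0 * x0).
Proof.
have qx : q *: x0 = x by rewrite (x0E X) scalerA mulfV ?scale1r // q_neq0.
by rewrite -{1 2}qx -scalerAl -scalerAr scalerA.
Qed.

Lemma candE3 n : cp n.+1 - cv n.+1 = q^-1 *: Ma (cp n - t *: cv n).
Proof.
have -> : cp n.+1 - cv n.+1 = (1 - t) *: cs n.+1 (fun a b => DD x0 hh a * (x0 * hh (b - 1))).
  rewrite csB csZ; apply: cs_ext => a.
  by rewrite -mulrBr gh_g -scalerAr -hh_g' kkE.
have -> : cp n - t *: cv n = (1 - t) *: cs n (fun a b => hh b * g a).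
  rewrite !csZ csB; apply: cs_ext => a.
  by rewrite scalerAr -mulrBr gh_tg -scalerAr mulrC.
rewrite MaZ scalerA [q^-1 * _]mulrC -scalerA; congr (_ *: _).
rewrite /Ma !csE -[x * (_ *: _)]scalerAr wsumM (act_rZ rep) act_wsum -scalerAr wsumM.
have -> : (2 * n.+1 = (2 * n).+2)%N by lia.
rewrite (sum3 two_neq0 (nn_hh X) x0 t eta_neq0) wsumM !scalerA !wsumZ.
apply: eq_wsum => a; set b := _ - a; rewrite [x * (hh b * _)]mulrA (act_Y_xhf N0 rep); last exact: symm_g.
rewrite pv_g -!scalerAr.
have -> : x * (x * hh b * gh a) = (q * q) *: (x0 * x0 * (hh b * gh a)).
  by rewrite -(mulrA x) (mulrA x x) xx -scalerAl.
rewrite -hh_gh CmS -[v^-1 ^+ N / _]/kap kapE; move: (wt0 eta _ a) (Cm n) => w C.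
rewrite !scalerA; congr (_ *: _).
exact: candE3_scal eta_neq0 eN_neq0 q_eta _.
Qed.

Lemma candE1 n : ch n.+1 - cp n.+1 = (e * q^-1) *: act Y (x * (x * (ch n - t *: cp n))).
Proof.
have -> : ch n - t *: cp n = (1 - t) *: cs n (fun a b => hh a * gh b).
  rewrite !csZ csB; apply: cs_ext => a.
  by rewrite scalerAl -mulrBl gh_tg -scalerAl.
have -> : ch n.+1 - cp n.+1 = (1 - t) *: cs n.+1 (fun a b => kk a * gh b).
  rewrite csB csZ; apply: cs_ext => a.
  by rewrite -mulrBl gh_g -scalerAl.
rewrite -!scalerAr (act_rZ rep) scalerA [e / q * _]mulrC -scalerA; congr (_ *: _).
rewrite !csE -!scalerAr (act_rZ rep) mulrA.
rewrite xx -scalerAl (act_rZ rep).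
have eta4 : eta ^+ (4 * n + 4) != 0 := expf_neq0 _ eta_neq0.
have := sum1 two_neq0 (nn_hh X) x0 t eta_neq0 n.
move/(congr1 (fun z => (eta ^+ (4 * n + 4))^-1 *: z)); rewrite [in RHS]scalerA mulVf // scale1r.
have -> : wsum (2 * n) (wt0 eta (2 * n)) (fun a b => hh a * DD (t *: x0) hh b) =
          wsum (2 * n) (wt0 eta (2 * n)) (fun a b => hh a * gh b).
  by apply: eq_wsum => a; rewrite hh_gh.
move=> <-; rewrite !(act_rZ rep) act_wsum !scalerA.
have -> : (2 * n.+1 = (2 * n).+2)%N by lia.
rewrite !wsumZ; apply: eq_wsum => a; set d := (2 * n)%N.
rewrite -hh_g' {1}(x0E X) -!scalerAl (act_rZ rep) (act_Y_xhf N0 rep); last exact: symm_g.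
rewrite pv_g CmS -[v^-1 ^+ N / _]/kap kapE; move: (wt0 eta _ a) (Cm n) => w C.
rewrite -!scalerAr !scalerA kkE (x0E X) -!scalerAl scalerA; congr (_ *: _).
exact: candE1_scal eta_neq0 eN_neq0 q_eta _.
Qed.

Lemma g_0 : g 0 = 1. Proof. exact: ld_0 (ld_g X). Qed.

Lemma solution0 : [/\ vv 0 = cv 0, ph 0 = cp 0 & vh 0 = ch 0].
Proof.
have e1 : emb 1 = 1 by exact: emb1 rep.
have gh0 : gh 0 = 1 by rewrite ghE expr0z scale1r g_0 (pv1 rep).
have cs0 F : cs 0 F = F 0 0.
  rewrite csE /Cm muln0 !expr0 mulr1 scale1r /wsum big_ord1; by rewrite /wt0 expr0z mul0r expr0z mulr1 scale1r.
have Gc0 f : act (Gc 0) f = f by rewrite /Gc g_0 e1 (hom_1 hom_Th) (act_one rep).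
rewrite /cv /cp /ch !cs0 g_0 gh0 mulr1 vhE phE !vvE !Gc0 mulr0 expr0z mul1r scale1r.
rewrite (act_Y1 N0 rep) scalerA mulVf ?expf_neq0 ?v_neq0 // scale1r mulrC x_xV.
by split.
Qed.

Lemma symm_cv n : symm (cv n).
Proof.
move=> i i0; rewrite /cv csE (svZ rep); congr (_ *: _); rewrite /wsum (rm_sum (rm_sv rep i)).
by apply: eq_bigr => a _; rewrite (svZ rep) (rsvM rep) !(sv_g rep).
Qed.

Lemma symmB f f' : symm f -> symm f' -> symm (f - f').
Proof. by move=> s1 s2 i i0; rewrite (rmB (rm_sv rep i)) s1 // s2. Qed.

Lemma solution n : [/\ vv n%:Z = cv n, ph n%:Z = cp n & vh n%:Z = ch n].
Proof.
elim: n => [|n [IHv IHp IHh]]; first exact: solution0.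
have F1 := E1 n.+1%:Z; have F3 := E3 n.+1%:Z.
have sn : n.+1%:Z - 1 = n%:Z by lia.
rewrite sn IHp IHh -candE1 in F1; rewrite sn IHp IHv -candE3 in F3.
have dif : vh n.+1 - ch n.+1 = vv n.+1 - cv n.+1.
  have K (V : zmodType) (a b c a' b' c' : V) : a - b = a' - b' -> b - c = b' - c' -> a - a' = c - c'.
    move=> EE1 EE2; have := congr2 +%R EE1 EE2; rewrite !addrA !subrK => EE.
    apply/eqP; rewrite subr_eq -[a](subrK c) EE addrAC.
    by rewrite [X in _ == X]addrAC [c + a']addrC.
  exact: K F1 F3.
have sd := symmB (symm_vv n.+1) (symm_cv n.+1).
have E0 : vv n.+1 - cv n.+1 = 0.
  apply: (Hpi (m := n.+1)) => //.
  rewrite -[RHS]dif vhE cand3 -scalerBr -(act_rB rep) (act_Y_sym N0 rep sd) scalerA.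
  by rewrite mulfVK ?expf_neq0 ?v_neq0.
have Ev : vv n.+1 = cv n.+1 by apply/eqP; rewrite -subr_eq0 E0.
have Eh : vh n.+1 = ch n.+1 by apply/eqP; rewrite -subr_eq0 dif E0.
split=> //; have := F3; rewrite Ev => /addIr.
by [].
Qed.

End Trefoil.
End KnotVector.

Module RogersPairing.
Import PowerSeries WeightedSums.

Section Phi.
Variables (K : fieldType) (q t : K).
Hypothesis q0 : q != 0.
Hypothesis q1 : forall n : nat, 1 - q ^+ n.+1 != 0.
Hypothesis tq1 : forall k : int, 1 - t * q ^ k != 0.

(* The coefficients of prod_i (1 - t q^i z) / (1 - q^i z). *)
Definition phi (i : int) : K :=
  if i is Posz n then \prod_(j < n) ((1 - t * q ^+ j) / (1 - q ^+ j.+1)) else 0.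

Lemma phi_lt0 (i : int) : i < 0 -> phi i = 0. Proof. by case: i. Qed.
Lemma phi_0 : phi 0 = 1. Proof. by rewrite /= big_ord0. Qed.

Lemma phi_rec (i : int) : phi i * (1 - q ^ i) = phi (i - 1) * (1 - t * q ^ (i - 1)).
Proof.
case: i => [[|n]|n].
- by rewrite expr0z subrr mulr0 mul0r.
- rewrite PoszB1 /= big_ord_recr /= -exprnP mulrA divfK //; exact: q1.
- by rewrite NegzB1 /= !mul0r.
Qed.

Lemma phi_neq0 n : phi n%:Z != 0.
Proof.
rewrite /=; apply/prodf_neq0 => j _; rewrite mulf_neq0 ?invr_neq0 //.
exact: (tq1 (j : nat)%:Z).
Qed.

Lemma qz (a b : int) : q ^ a * q ^ b = q ^ (a + b). Proof. by rewrite expfzDr. Qed.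

Lemma phi_recV (i : int) : phi i * (1 - q ^ (- i)) = - q^-1 * phi (i - 1) * (q ^ (1 - i) - t).
Proof.
have qi : q ^ i != 0 by rewrite expfz_neq0.
have E1 : q ^ (- i) = (q ^ i)^-1 by rewrite -invr_expz.
have E2 : q ^ (1 - i) = q * (q ^ i)^-1 by rewrite -E1 expfzDr.
have E3 : q ^ (i - 1) = q ^ i * q^-1 by rewrite expfzDr.
have := phi_rec i; rewrite E1 E2 E3; move: (phi i) (phi (i - 1)) (q ^ i) qi => a b c c0 E.
apply: (mulIf c0).
have -> : a * (1 - c^-1) * c = - (a * (1 - c)) by field.
by rewrite E; field; rewrite q0 c0.
Qed.

(* The two identities that express that the pairing of phi with itself is an
   eigenfunction: Rogers polynomials are eigenfunctions of q-difference operators. *)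
Lemma phi_eigen (i j k : int) : i + j = k + 1 ->
  (q ^ (1 - i) + t * q ^ (- j) - q ^ (- k) - t) * (phi (i - 1) * phi j) =
  (q ^ (1 - j) + t * q ^ (- i) - q ^ (- k) - t) * (phi i * phi (j - 1)).
Proof.
move=> ij; have E1 : q ^ (- k) = q ^ (1 - i) * q ^ (- j).
  by rewrite qz; congr (_ ^ _); lia.
have E2 : q ^ (- k) = q ^ (1 - j) * q ^ (- i).
  by rewrite qz; congr (_ ^ _); lia.
have ri := phi_recV i; have rj := phi_recV j.
rewrite {1}E1 E2; move: (q ^ (1 - i)) (q ^ (1 - j)) (q ^ (- i)) (q ^ (- j)) ri rj => a b c d ri rj.
have -> : (a + t * d - a * d - t) * (phi (i - 1) * phi j) = (a - t) * phi (i - 1) * (phi j * (1 - d)) by ring.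
have -> : (b + t * c - b * c - t) * (phi i * phi (j - 1)) = (b - t) * phi (j - 1) * (phi i * (1 - c)) by ring.
by rewrite ri rj; ring.
Qed.

Definition beta1 (s : K) (k : int) := (1 - t ^+ 2 * q ^ (k - 1)) * (s * q ^ (- k) - t) / (1 - t * q ^ k).
Definition beta2 (s : K) (k : int) := t * (s - 1) * (1 - q ^ (k + 1)) / (1 - t * q ^ k).

Lemma phi_pieri (s : K) (i j k : int) : i + j = k ->
  s * (q ^ (- i) - q ^ (- j)) * (phi i * phi j)
  + t * (s * q ^ (- j - 1) - 1) * (phi (i - 1) * phi (j + 1))
  - t * (s * q ^ (- i - 1) - 1) * (phi (i + 1) * phi (j - 1)) =
  beta1 s k * (phi (i - 1) * phi j - phi i * phi (j - 1)) +
  beta2 s k * (phi i * phi (j + 1) - phi (i + 1) * phi j).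
Proof.
move=> ij.
have qi : q ^ i != 0 by rewrite expfz_neq0.
have qj : q ^ j != 0 by rewrite expfz_neq0.
have Ei (a : int) : q ^ (- a) = (q ^ a)^-1 by rewrite -invr_expz.
have Ek : q ^ k = q ^ i * q ^ j by rewrite qz ij.
have Em (a : int) : q ^ (a - 1) = q ^ a / q by rewrite expfzDr.
have Ep (a : int) : q ^ (a + 1) = q ^ a * q by rewrite expfzDr.
have edge (a : int) : phi a * beta2 s (a - 1) = t * (s - 1) * phi (a - 1).
  have ta := tq1 (a - 1).
  rewrite /beta2 subrK; apply: (mulIf ta); rewrite mulrA divfK //.
  by rewrite mulrCA phi_rec; ring.
have [i0|i0] := ltrP i 0.
  rewrite (phi_lt0 i0) (@phi_lt0 (i - 1)); last by lia.
  have [i1|i1] := eqVneq i (-1); last by rewrite (@phi_lt0 (i + 1)); [ring|lia].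
  have k1 : k = j - 1 by lia.
  have -> : i + 1 = 0 by lia.
  have -> : - i - 1 = 0 by lia.
  have := edge j; rewrite phi_0 expr0z k1 mulr1; move: (beta1 _ _) (beta2 _ _) => b1 b2 E.
  transitivity (- (t * (s - 1) * phi (j - 1))); first by ring.
  by rewrite -E; ring.
have [j0|j0] := ltrP j 0.
  rewrite (phi_lt0 j0) (@phi_lt0 (j - 1)); last by lia.
  have [j1|j1] := eqVneq j (-1); last by rewrite (@phi_lt0 (j + 1)); [ring|lia].
  have k1 : k = i - 1 by lia.
  have -> : j + 1 = 0 by lia.
  have -> : - j - 1 = 0 by lia.
  have := edge i; rewrite phi_0 expr0z k1 mulr1; move: (beta1 _ _) (beta2 _ _) => b1 b2 E.
  transitivity (t * (s - 1) * phi (i - 1)); first by ring.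
  by rewrite -E; ring.
have ti := tq1 (i - 1); have tj := tq1 (j - 1); have tk := tq1 k.
have ri := phi_rec i; have rj := phi_rec j.
have ri1 := phi_rec (i + 1); have rj1 := phi_rec (j + 1).
rewrite !addrK in ri1 rj1.
have qi1 : 1 - q ^ (i + 1) != 0 by case: (i) i0 => // n _; rewrite -PoszD addn1; exact: q1.
have qj1 : 1 - q ^ (j + 1) != 0 by case: (j) j0 => // n _; rewrite -PoszD addn1; exact: q1.
have Fi : phi (i - 1) = phi i * (1 - q ^ i) / (1 - t * q ^ (i - 1)) by rewrite ri mulfK.
have Fj : phi (j - 1) = phi j * (1 - q ^ j) / (1 - t * q ^ (j - 1)) by rewrite rj mulfK.
have Gi : phi (i + 1) = phi i * (1 - t * q ^ i) / (1 - q ^ (i + 1)).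
  by rewrite -ri1 mulfK.
have Gj : phi (j + 1) = phi j * (1 - t * q ^ j) / (1 - q ^ (j + 1)).
  by rewrite -rj1 mulfK.
rewrite Fi Fj Gi Gj /beta1 /beta2 !Em !Ep !Ei Ek in ti tj tk qi1 qj1 *.
move: (q ^ i) (q ^ j) (phi i) (phi j) qi qj ti tj tk qi1 qj1 => P Q f g {Ei Ek Em Ep edge ri rj ri1 rj1 Fi Fj Gi Gj} P0 Q0 h1 h2 h3 h4 h5.
have h1' : q - t * P != 0 by apply: contra_neq h1 => E; rewrite mulrA; apply: (mulIf q0); rewrite mulrBl mul1r divfK // E mul0r.
have h2' : q - t * Q != 0 by apply: contra_neq h2 => E; rewrite mulrA; apply: (mulIf q0); rewrite mulrBl mul1r divfK // E mul0r.
by field; rewrite P0 Q0 q0 h3 h4 h5 h1' h2'.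
Qed.

Section Expansion.
Variable V : lmodType K.
Implicit Types (Z : nat -> V) (G : int -> V) (d : nat) (a : int).

Definition EX d Z a : V :=
  \sum_(s < d.+1) (phi (a - s%:Z) * phi (d%:Z - a - s%:Z)) *: Z s.

Lemma phi2_0 (i j : int) : i + j < 0 -> phi i * phi j = 0.
Proof.
move=> ij; have [i0|i0] := ltrP i 0; first by rewrite phi_lt0 // mul0r.
by rewrite (@phi_lt0 j) ?mulr0 //; lia.
Qed.

Lemma EX_neg d Z n : EX d Z (Negz n) = 0.
Proof.
by rewrite /EX big1 // => s _; rewrite (@phi_lt0 (_ - _)) ?mul0r ?scale0r //; lia.
Qed.

Lemma EX_flip d Z a : EX d Z (d%:Z - a) = EX d Z a.
Proof.
by apply: eq_bigr => s _; rewrite mulrC; congr (phi _ * phi _ *: _); lia.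
Qed.

Lemma EX_at d Z (s : nat) : (2 * s <= d)%N ->
  EX d Z s%:Z = \sum_(s' < s) (phi (s%:Z - s'%:Z) * phi (d%:Z - s%:Z - s'%:Z)) *: Z s'
    + phi (d%:Z - (2 * s)%N%:Z) *: Z s.
Proof.
move=> sd; rewrite /EX.
pose F (s' : nat) := (phi (s%:Z - s'%:Z) * phi (d%:Z - s%:Z - s'%:Z)) *: Z s'.
rewrite -(big_mkord xpredT F) (@big_cat_nat _ _ _ s.+1) //=; last by lia.
rewrite [X in _ + X]big_nat_cond [X in _ + X]big1 ?addr0; last first.
  by move=> s' /andP[/andP[s1 _] _]; rewrite /F (@phi_lt0 (_ - _)) ?mul0r ?scale0r //; lia.
rewrite big_mkord big_ord_recr /= /F subrr phi_0 mul1r; congr (_ + phi _ *: _); lia.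
Qed.

Lemma phi_top d s : (2 * s <= d)%N -> phi (d%:Z - (2 * s)%N%:Z) != 0.
Proof. by move=> sd; rewrite subzn //; exact: phi_neq0. Qed.

Lemma EX_inj d Z Z' : (forall s : nat, (2 * s <= d)%N -> EX d Z s%:Z = EX d Z' s%:Z) ->
  forall s, (2 * s <= d)%N -> Z s = Z' s.
Proof.
move=> E; elim/ltn_ind => s IH sd; have := E s sd; rewrite !EX_at //.
rewrite (eq_bigr (fun s' : 'I_s => (phi (s%:Z - s'%:Z) * phi (d%:Z - s%:Z - s'%:Z)) *: Z' s')).
  by move/addrI/(scalerI (phi_top sd)).
by move=> s' _; rewrite IH //; have := ltn_ord s'; lia.
Qed.

Fixpoint exl d G n : seq V :=
  if n is n'.+1 then
    rcons (exl d G n') ((phi (d%:Z - (2 * n')%N%:Z))^-1 *: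
      (G n'%:Z - \sum_(s' < n') (phi (n'%:Z - s'%:Z) * phi (d%:Z - n'%:Z - s'%:Z)) *: nth 0 (exl d G n') s'))
  else [::].

Definition exs d G s : V := nth 0 (exl d G s.+1) s.

Lemma size_exl d G n : size (exl d G n) = n.
Proof. by elim: n => //= n IH; rewrite size_rcons IH. Qed.

Lemma nth_exl d G n s : (s < n)%N -> nth 0 (exl d G n) s = exs d G s.
Proof.
elim: n => // n IH; rewrite ltnS leq_eqVlt => /orP[/eqP ->|sn] //.
by rewrite /= nth_rcons size_exl sn IH.
Qed.

Lemma EX_exs d G : (forall n, G (Negz n) = 0) -> (forall a, G (d%:Z - a) = G a) ->
  forall a, EX d (exs d G) a = G a.
Proof.
move=> Gn Gf; suff H (s : nat) : (2 * s <= d)%N -> EX d (exs d G) s%:Z = G s%:Z.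
  move=> a; have [a0|a0] := ltrP a 0.
    by case: a a0 => // n _; rewrite EX_neg Gn.
  have [ad|ad] := lerP (2 * a) d%:Z.
    by case: a a0 ad => // n _ nd; apply: H; lia.
  rewrite -EX_flip -Gf; case E: (d%:Z - a) => [n|n]; last by rewrite EX_neg Gn.
  by apply: H; lia.
move=> sd; rewrite EX_at // {2}/exs /= nth_rcons size_exl ltnn eqxx scalerA.
rewrite mulfV ?phi_top // scale1r [X in X + _](eq_bigr (fun s' : 'I_s =>
  (phi (s%:Z - s'%:Z) * phi (d%:Z - s%:Z - s'%:Z)) *: nth 0 (exl d G s) s')).
  by rewrite addrC subrK.
by move=> s' _; rewrite nth_exl.
Qed.

(* The coefficient form of a division by u - w. *)
Lemma const_zero (F : int -> V) : (forall a, F (a - 1) = F a) -> (forall n, F (Negz n) = 0) ->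
  forall a, F a = 0.
Proof.
move=> E Fn; case=> n //; elim: n => [|n IH]; first by rewrite -E -(Fn 0).
by rewrite -E PoszB1.
Qed.

End Expansion.

Lemma EX_lin (V W : lmodType K) (f : V -> W) d Z a :
  (forall c x y, f (c *: x + y) = c *: f x + f y) -> f (EX d Z a) = EX d (f \o Z) a.
Proof.
move=> fl; have f0 : f 0 = 0 by have := fl (-1) 0 0; rewrite scaler0 addr0 scaleN1r addNr.
have fD x y : f (x + y) = f x + f y by rewrite -[x]scale1r fl !scale1r.
have fZ c x : f (c *: x) = c *: f x by rewrite -[c *: x]addr0 fl f0 addr0.
by rewrite /EX (big_morph f fD f0); apply: eq_bigr => s _; rewrite fZ.
Qed.

End Phi.
End RogersPairing.

Module Symmetrizer.
Import Weights GroupAlgebraTheory MinimalElement ReducedWord Generators DahaRelations BraidWords LaurentOperators PolynomialRep Evaluation ModularAction PowerSeries OneRow WeightedSums KnotVector RogersPairing.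

Section Algebra.
Variables (K : fieldType) (L : comAlgType K).

Lemma scaleE (c : K) (z : L) : c *: z = in_alg L c * z.
Proof. by rewrite mulr_algl. Qed.

Lemma alg_gg (t : K) (X g1 g2 k1 k2 G1 G2 K1 K2 : L) :
  K1 = X * (g1 + k1) -> K2 = X * (g2 + k2) ->
  (g1 + (1 - t) *: k1) * (G2 + (1 - t) *: K2) - (G1 + (1 - t) *: K1) * (g2 + (1 - t) *: k2) =
  g1 * G2 - G1 * g2 + (1 - t) *: (k1 * G2 - t *: (K1 * g2) - k2 * G1 + t *: (K2 * g1)).
Proof. by move=> -> ->; rewrite !scaleE; ring. Qed.

Lemma alg_xgg (t : K) (X g1 g2 k1 k2 G1 G2 K1 K2 K1' K2' : L) :
  K1 = X * (g1 + k1) -> K2 = X * (g2 + k2) ->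
  K1' = X * (G1 + K1) -> K2' = X * (G2 + K2) ->
  X * ((g1 + (1 - t) *: k1) * (G2 + (1 - t) *: K2)) - X * ((G1 + (1 - t) *: K1) * (g2 + (1 - t) *: k2)) =
  (t * t) *: (X * (g1 * G2) - X * (G1 * g2)) +
  (1 - t) *: (K1 * G2 - t *: (K1' * g2) - K2 * G1 + t *: (K2' * g1)).
Proof. by move=> -> -> -> ->; rewrite !scaleE; ring. Qed.

Lemma comb1 (c1 c2 c3 c4 a b t : K) (P Q : L) :
  a *: P - a *: Q + b *: (c1 *: P - t *: (c2 *: Q) - c3 *: Q + t *: (c4 *: P)) =
  (a + b * (c1 + t * c4)) *: P - (a + b * (t * c2 + c3)) *: Q.
Proof. by rewrite !scaleE; ring. Qed.

End Algebra.

Section Eigen.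
Variable N : nat.
Hypothesis N0 : (0 < N)%N.
Variable D : daha N.
Local Notation H := (daha_alg D).
Variable L : comAlgType coefField.
Variables (X : wt N -> L) (sv : 'I_N.+1 -> L -> L) (pv : L -> L).
Variables (lv : L -> coefField) (emb : L -> daha_alg D) (act : daha_alg D -> L -> L).
Hypothesis rep : rep_spec X sv pv lv emb act.
Local Notation symm := (@symm N L sv).
Local Notation Y := (hY D).
Local Notation q := (q N).
Local Notation g := (g X).
Local Notation x := (x X).
Local Notation x0 := (x0 X).
Local Notation gh := (OneRow.gh X pv).
Local Notation hh := (hh X).
Local Notation kk := (OneRow.kk X).
Local Notation Sop := (Sop act).
Local Notation e := eN.
Local Notation phi := (phi q t).
Local Notation EX := (@EX coefField q t L).
Local Notation A := (t ^+ N.+1).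

Lemma tq_neq1 (k : int) : 1 - t * q ^ k != 0.
Proof.
rewrite subr_eq0 eq_sym mulrC; have := qt_neq1 N0 (a := k) (b := 1); rewrite expr1z; apply.
by right.
Qed.
Local Notation qn1 := (qn_neq1 N0).
Local Notation qn0 := (q_neq0 N).

Definition Rds d s : L := exs q t d (fun a => g a * g (d%:Z - a)) s.

Lemma g_neg n : g (Negz n) = 0. Proof. exact: nn_g. Qed.

Lemma g_exp d a : g a * g (d%:Z - a) = EX d (Rds d) a.
Proof.
rewrite /Rds; set G := fun a => _; rewrite (EX_exs qn0 qn1 tq_neq1) // => [n|b]; rewrite /G.
  by rewrite g_neg mul0r.
have -> : d%:Z - (d%:Z - b) = b by ring.
exact: mulrC.
Qed.

Lemma symm_exs d G s : (forall a, symm (G a)) -> symm (exs q t d G s).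
Proof.
move=> sG i i0.
suff H n s' : (s' < n)%N -> sv i (exs q t d G s') = exs q t d G s' by exact: (H s.+1).
elim: n s' => // n IH s' sn; rewrite /exs /= nth_rcons size_exl ltnn eqxx (svZ rep).
congr (_ *: _); rewrite (rmB (rm_sv rep i)) sG // (rm_sum (rm_sv rep i)); congr (_ - _).
apply: eq_bigr => s'' _; rewrite (svZ rep) nth_exl // IH //.
exact: leq_trans (ltn_ord s'') sn.
Qed.

Lemma symm_R d s : symm (Rds d s).
Proof. by apply: symm_exs => a i i0; rewrite (rsvM rep) !(sv_g rep). Qed.

Definition S1 f := (1 - t) *: Sop f.

Lemma S1_lin c f f' : S1 (c *: f + f') = c *: S1 f + S1 f'.
Proof. by rewrite /S1 (Sop_lin rep) scalerDr !scalerA mulrC. Qed.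
Lemma S1_0 : S1 0 = 0.
Proof. by have := S1_lin (-1) 0 0; rewrite scaler0 addr0 scaleN1r addNr. Qed.
Lemma S1D f f' : S1 (f + f') = S1 f + S1 f'.
Proof. by rewrite -[f]scale1r S1_lin !scale1r. Qed.
Lemma S1Z c f : S1 (c *: f) = c *: S1 f.
Proof. by rewrite -[_ *: f]addr0 S1_lin S1_0 addr0. Qed.
Lemma S1B f f' : S1 (f - f') = S1 f - S1 f'.
Proof. by rewrite S1D -scaleN1r S1Z scaleN1r. Qed.

Lemma S1_symM F f : symm f -> S1 (F * f) = S1 F * f.
Proof. by move=> sf; rewrite /S1 (Sop_symM rep) // scalerAl. Qed.
Lemma S1_sym f : symm f -> S1 f = (1 - A) *: f.
Proof. by move=> sf; rewrite /S1 (Sop_sym rep). Qed.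
Lemma S1_kk a f : symm f -> S1 (kk a * f) = (q ^ (- a) - 1) *: (g a * f).
Proof. by move=> sf; rewrite S1_symM // /S1 (Sop_kk N0 rep) scalerAl. Qed.

Lemma kk_rec a : kk a = x0 * (g (a - 1) + kk (a - 1)).
Proof. by rewrite -(hh_kk X). Qed.

Lemma kk_1 : kk 1 = x0.
Proof.
by rewrite kk_rec subrr /OneRow.kk (_ : 0 - 1 = Negz 0) // mulr0 addr0 (ld_0 (ld_g X)) mulr1.
Qed.

Lemma S1_x0 f : symm f -> S1 (x0 * f) = (q^-1 - 1) *: (g 1 * f).
Proof. by move=> sf; rewrite -kk_1 S1_kk // exprN1. Qed.

Lemma symm_gf m : symm (g m). Proof. by move=> i i0; exact: (sv_g rep). Qed.
Lemma symm_gg a b : symm (g a * g b).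
Proof. by move=> i i0; rewrite (rsvM rep) !(sv_g rep). Qed.

Lemma gh_kk' a : gh a = g a + (1 - t) *: kk a. Proof. exact: (gh_kk N0 rep). Qed.

Definition mm (i j : int) := (1 - A) + (1 - t) * ((q ^ (- i) - 1) + t * (q ^ (- j) - 1)).

Lemma S1_gg_delta a b :
  S1 (gh (a - 1) * gh b) - S1 (gh a * gh (b - 1)) =
  mm (a - 1) b *: (g (a - 1) * g b) - mm (b - 1) a *: (g a * g (b - 1)).
Proof.
rewrite -S1B !gh_kk' (alg_gg t _ _ (kk_rec a) (kk_rec b)).
rewrite !(S1B, S1D, S1Z) !S1_kk; try exact: symm_gf.
rewrite !S1_sym; try exact: symm_gg.
rewrite [g (b - 1) * g a]mulrC [g b * g (a - 1)]mulrC comb1.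
by rewrite /mm [t * _ + (q ^ (- (b - 1)) - 1)]addrC.
Qed.

Lemma S1_xgg_delta a b :
  S1 (x0 * (gh (a - 1) * gh b)) - S1 (x0 * (gh a * gh (b - 1))) =
  (t * t * (q^-1 - 1)) *: (g 1 * (g (a - 1) * g b) - g 1 * (g a * g (b - 1))) +
  (1 - t) *: ((q ^ (- a) - 1) *: (g a * g b) - (t * (q ^ (- (a + 1)) - 1)) *: (g (a + 1) * g (b - 1))
    - (q ^ (- b) - 1) *: (g a * g b) + (t * (q ^ (- (b + 1)) - 1)) *: (g (a - 1) * g (b + 1))).
Proof.
have k1 := kk_rec (a + 1); have k2 := kk_rec (b + 1); rewrite addrK in k1; rewrite addrK in k2.
rewrite -S1B !gh_kk' (alg_xgg t (kk_rec a) (kk_rec b) k1 k2).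
rewrite !(S1B, S1D, S1Z) !S1_kk; try exact: symm_gf.
rewrite !S1_x0; try exact: symm_gg.
rewrite [g b * g a]mulrC [g (b + 1) * _]mulrC; move: (g _ * _) (g _ * _) (g _ * _) => z1 z2 z3.
rewrite -scalerBr !scalerA.
by [].
Qed.

Definition lam d (s : nat) := (1 - A) + (1 - t) * ((q ^ (s%:Z - d%:Z) - 1) + t * (q ^ (- s%:Z) - 1)).

Lemma lam_scal (F : fieldType) (Q T A0 f1 f2 f3 f4 : F) (a b d s : int) : Q != 0 -> a + b = d + 1 ->
  (forall i j k : int, i + j = k + 1 -> i = a - s -> j = b - s ->
   (Q ^ (1 - i) + T * Q ^ (- j) - Q ^ (- k) - T) * (f1 * f2) =
   (Q ^ (1 - j) + T * Q ^ (- i) - Q ^ (- k) - T) * (f3 * f4)) ->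
  f1 * f2 * ((1 - A0) + (1 - T) * ((Q ^ (- (a - 1)) - 1) + T * (Q ^ (- b) - 1)))
  - f3 * f4 * ((1 - A0) + (1 - T) * ((Q ^ (- (b - 1)) - 1) + T * (Q ^ (- a) - 1))) =
  (f1 * f2 - f3 * f4) * ((1 - A0) + (1 - T) * ((Q ^ (s - d) - 1) + T * (Q ^ (- s) - 1))).
Proof.
move=> Q0 ab /(_ (a - s) (b - s) (d - 2 * s)) E.
have {E} := E _ erefl erefl; have -> : a - s + (b - s) = d - 2 * s + 1 by rewrite -[d](addrK 1) -ab; ring.
move=> /(_ erefl) E.
have P (c c' : int) : c + (- s) = c' -> Q ^ c' = Q ^ c * Q ^ (- s) by move=> <-; rewrite expfzDr.
rewrite (P (1 - (a - s)) (- (a - 1))); last by ring.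
rewrite (P (1 - (b - s)) (- (b - 1))); last by ring.
rewrite (P (- (b - s)) (- b)); last by ring.
rewrite (P (- (a - s)) (- a)); last by ring.
rewrite (P (- (d - 2 * s)) (s - d)); last by ring.
move: E; move: (Q ^ _) (Q ^ (1 - (b - s))) (Q ^ (- (b - s))) (Q ^ (- (a - s))) (Q ^ (- (d - 2 * s))) (Q ^ (- s)).
move=> z1 z2 z3 z4 z5 w E.
apply/eqP; rewrite -subr_eq0; apply/eqP.
transitivity ((1 - T) * w * ((z1 + T * z3 - z5 - T) * (f1 * f2) - (z2 + T * z4 - z5 - T) * (f3 * f4))).
  by ring.
by rewrite E subrr mulr0.
Qed.

Lemma EXZ c d (Z : nat -> L) a : c *: EX d Z a = EX d (fun s => c *: Z s) a.
Proof. by rewrite /RogersPairing.EX scaler_sumr; apply: eq_bigr => s _; rewrite !scalerA mulrC. Qed.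

Lemma eq_sub (V : zmodType) (a b c d : V) : a - b = c - d -> a - c = b - d.
Proof. by move=> EE; apply/eqP; rewrite subr_eq -[a](subrK b) EE addrC addrA addrAC. Qed.

Lemma gh_neg n : gh (Negz n) = 0. Proof. exact: (nn_gh rep). Qed.

Lemma S1_gg d a : S1 (gh a * gh (d%:Z - a)) = EX d (fun s => lam d s *: Rds d s) a.
Proof.
apply/eqP; rewrite -subr_eq0; apply/eqP; move: a.
apply: const_zero => [a|n]; last by rewrite gh_neg mul0r S1_0 (EX_neg t qn0) subrr.
apply: eq_sub; have := S1_gg_delta a (d%:Z - a + 1); rewrite addrK.
have -> : d%:Z - (a - 1) = d%:Z - a + 1 by ring.
move=> ->.
have -> : d%:Z - a + 1 = d%:Z - (a - 1) by ring.
rewrite !g_exp !EXZ /RogersPairing.EX -!sumrB; apply: eq_bigr => s _.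
rewrite !scalerA -!scalerBl -mulrBl; congr (_ *: _).
have -> : mm (d%:Z - a) a = mm (d%:Z - (a - 1) - 1) a by congr mm; ring.
apply: (lam_scal A (a := a) (b := d%:Z - (a - 1)) (d := d) (s := s) qn0); first by ring.
move=> i j k ij iE jE; have := phi_eigen t qn0 qn1 ij.
rewrite iE jE.
have -> : a - s%:Z - 1 = a - 1 - s%:Z by ring.
by have -> : d%:Z - (a - 1) - s%:Z - 1 = d%:Z - a - s%:Z by ring.
Qed.

Definition Rh d s := e ^+ d *: pv (Rds d s).

Lemma gh_exp d a : gh a * gh (d%:Z - a) = EX d (Rh d) a.
Proof.
have -> : gh a * gh (d%:Z - a) = e ^+ d *: pv (g a * g (d%:Z - a)).
  rewrite (rpvM rep) /OneRow.gh -scalerAl -scalerAr scalerA -expfzDr ?eN_neq0 //.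
  by rewrite (_ : a + (d%:Z - a) = d%:Z) //; ring.
rewrite g_exp; apply: (EX_lin q t (f := fun f => e ^+ d *: pv f)) => c y y'.
by rewrite (rpvL rep) scalerDr !scalerA mulrC.
Qed.

Lemma S1_Rh d s : (2 * s <= d)%N -> S1 (Rh d s) = lam d s *: Rds d s.
Proof.
move: s; apply: (EX_inj qn0 qn1 tq_neq1 (d := d) (Z := fun s => S1 (Rh d s)) (Z' := fun s => lam d s *: Rds d s)) => s sd.
rewrite -S1_gg gh_exp (EX_lin q t _ _ _ S1_lin).
by [].
Qed.

(* The Pieri rule for the product by g_1, up to a multiple of g_1 R. *)
Definition piR d s : L := (t * t * (q^-1 - 1)) *: (g 1 * Rds d s) + (1 - t) *:
  (beta1 q t (q ^ (- s%:Z)) (d.+1%:Z - 2 * s%:Z) *: Rds d.+1 s +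
   beta2 q t (q ^ (- s.+1%:Z)) (d.+1%:Z - 2 * s.+1%:Z) *: Rds d.+1 s.+1).

Lemma beta2_1 k : beta2 q t 1 k = 0.
Proof. by rewrite /beta2 subrr mulr0 mul0r mul0r. Qed.

Lemma EX_piR d a b : a + b = d.+1%:Z ->
  EX d (piR d) (a - 1) - EX d (piR d) a =
  (t * t * (q^-1 - 1)) *: (g 1 * (g (a - 1) * g b) - g 1 * (g a * g (b - 1))) +
  (1 - t) *: \sum_(s < d.+2)
    (beta1 q t (q ^ (- s%:Z)) (d.+1%:Z - 2 * s%:Z) *
       (phi (a - s%:Z - 1) * phi (b - s%:Z) - phi (a - s%:Z) * phi (b - s%:Z - 1)) +
     beta2 q t (q ^ (- s%:Z)) (d.+1%:Z - 2 * s%:Z) *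
       (phi (a - s%:Z) * phi (b - s%:Z + 1) - phi (a - s%:Z + 1) * phi (b - s%:Z)))
    *: Rds d.+1 s.
Proof.
move=> ab.
have EXp c : EX d (piR d) c = (t * t * (q^-1 - 1)) *: (g 1 * EX d (Rds d) c) + (1 - t) *:
   (EX d (fun s => beta1 q t (q ^ (- s%:Z)) (d.+1%:Z - 2 * s%:Z) *: Rds d.+1 s) c +
    EX d (fun s => beta2 q t (q ^ (- s.+1%:Z)) (d.+1%:Z - 2 * s.+1%:Z) *: Rds d.+1 s.+1) c).
  have -> : g 1 * EX d (Rds d) c = EX d (fun s => g 1 * Rds d s) c.
    by apply: (EX_lin q t (f := fun z => g 1 * z)) => k y y'; rewrite mulrDr scalerAr.
  have EXD (Z Z' : nat -> L) : EX d Z c + EX d Z' c = EX d (fun s => Z s + Z' s) c.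
    by rewrite /RogersPairing.EX -big_split; apply: eq_bigr => s _; rewrite scalerDr.
  by rewrite EXD !EXZ EXD.
have -> : g (a - 1) * g b = EX d (Rds d) (a - 1) by rewrite -g_exp; congr (_ * g _); lia.
have -> : g a * g (b - 1) = EX d (Rds d) a by rewrite -g_exp; congr (_ * g _); lia.
rewrite !EXp; move: (EX d (Rds d) (a - 1)) (EX d (Rds d) a) => z1 z2.
have C (V : lmodType coefField) (c1 c2 : coefField) (y1 y2 w1 w2 w3 w4 : V) :
    c1 *: y1 + c2 *: (w1 + w2) - (c1 *: y2 + c2 *: (w3 + w4)) =
    c1 *: (y1 - y2) + c2 *: ((w1 - w3) + (w2 - w4)).
  by rewrite opprD addrACA -!scalerBr opprD addrACA.
rewrite C; congr (_ + _ *: _).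
have sgn (i j : int) : i + j < 0 -> phi i * phi j = 0 by exact: (phi2_0 t qn0).
transitivity (\sum_(s < d.+2) (beta1 q t (q ^ (- s%:Z)) (d.+1%:Z - 2 * s%:Z) *
       (phi (a - s%:Z - 1) * phi (b - s%:Z) - phi (a - s%:Z) * phi (b - s%:Z - 1))) *: Rds d.+1 s +
  \sum_(s < d.+2) (beta2 q t (q ^ (- s%:Z)) (d.+1%:Z - 2 * s%:Z) *
       (phi (a - s%:Z) * phi (b - s%:Z + 1) - phi (a - s%:Z + 1) * phi (b - s%:Z))) *: Rds d.+1 s); last first.
  by rewrite -big_split /=; apply: eq_bigr => s _; rewrite -scalerDl.
congr (_ + _).
  rewrite [RHS]big_ord_recr /= [X in _ = _ + X](_ : _ = 0) ?addr0; last first.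
    by rewrite !sgn ?subrr ?mulr0 ?scale0r //; lia.
  rewrite /RogersPairing.EX -sumrB; apply: eq_bigr => s _; rewrite !scalerA -scalerBl.
  rewrite -mulrBl mulrC; congr ((_ * (phi _ * phi _ - phi _ * phi _)) *: _); lia.
rewrite [RHS]big_ord_recl /= oppr0 expr0z beta2_1 mul0r scale0r add0r.
rewrite /RogersPairing.EX -sumrB; apply: eq_bigr => s _; rewrite !scalerA -scalerBl -mulrBl mulrC.
congr ((_ * (phi _ * phi _ - phi _ * phi _)) *: _); rewrite /bump /=; lia.
Qed.

Lemma S1_xgg d a : S1 (x0 * (gh a * gh (d%:Z - a))) = EX d (piR d) a.
Proof.
apply/eqP; rewrite -subr_eq0; apply/eqP; move: a.
apply: const_zero => [a|n]; last by rewrite gh_neg mul0r mulr0 S1_0 (EX_neg t qn0) subrr.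
apply: eq_sub; have := S1_xgg_delta a (d%:Z - a + 1); rewrite addrK.
have -> : d%:Z - (a - 1) = d%:Z - a + 1 by ring.
move=> ->; set b := d%:Z - a + 1.
have ab : a + b = d.+1%:Z by rewrite /b; lia.
have bE : d%:Z - a = b - 1 by rewrite /b addrK.
rewrite bE (EX_piR ab); congr (_ + _ *: _).
have E1 : g a * g b = EX d.+1 (Rds d.+1) a by rewrite -g_exp; congr (_ * g _); lia.
have E2 : g (a + 1) * g (b - 1) = EX d.+1 (Rds d.+1) (a + 1) by rewrite -g_exp; congr (_ * g _); lia.
have E3 : g (a - 1) * g (b + 1) = EX d.+1 (Rds d.+1) (a - 1) by rewrite -g_exp; congr (_ * g _); lia.
rewrite E1 E2 E3 !EXZ /RogersPairing.EX -!sumrB -big_split /=; apply: eq_bigr => s _.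
rewrite !scalerA -!scalerBl -scalerDl; congr (_ *: _).
have P := phi_pieri qn0 qn1 tq_neq1 (q ^ (- s%:Z)) (i := a - s%:Z) (j := b - s%:Z) (k := d.+1%:Z - 2 * s%:Z).
rewrite -P; last by rewrite -ab; ring.
have -> : d.+1%:Z - a - s%:Z = b - s%:Z by lia.
have -> : d.+1%:Z - (a + 1) - s%:Z = b - s%:Z - 1 by lia.
have -> : d.+1%:Z - (a - 1) - s%:Z = b - s%:Z + 1 by lia.
have -> : a + 1 - s%:Z = a - s%:Z + 1 by lia.
have -> : a - 1 - s%:Z = a - s%:Z - 1 by lia.
have Q (i : int) : q ^ (- s%:Z) * q ^ (- (i - s%:Z)) = q ^ (- i).
  by rewrite -expfzDr ?qn0 //; congr (_ ^ _); lia.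
have Q1 (i : int) : q ^ (- s%:Z) * q ^ (- (i - s%:Z) - 1) = q ^ (- (i + 1)).
  by rewrite -expfzDr ?qn0 //; congr (_ ^ _); lia.
rewrite [q ^ (- s%:Z) * (_ - _)]mulrBr (Q a) (Q b) (Q1 a) (Q1 b).
have F (K : comPzRingType) (p1 p2 p3 c1 c2 c3 c4 T : K) :
  p1 * (c1 - 1) - p2 * (T * (c2 - 1)) - p1 * (c3 - 1) + p3 * (T * (c4 - 1)) =
  (c1 - c3) * p1 + T * (c4 - 1) * p3 - T * (c2 - 1) * p2 by ring.
exact: F.
Qed.

Lemma S1_xRh d s : (2 * s <= d)%N -> S1 (x0 * Rh d s) = piR d s.
Proof.
move: s; apply: (EX_inj qn0 qn1 tq_neq1 (d := d) (Z := fun s => S1 (x0 * Rh d s)) (Z' := piR d)) => s sd.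
rewrite -S1_xgg gh_exp (EX_lin q t (f := fun z => S1 (x0 * z))) // => k y y'.
by rewrite mulrDr -scalerAr S1_lin.
Qed.

End Eigen.
End Symmetrizer.

Module TwoRow.
Import Weights GroupAlgebraTheory MinimalElement ReducedWord Generators DahaRelations BraidWords LaurentOperators PolynomialRep Evaluation ModularAction PowerSeries OneRow WeightedSums KnotVector RogersPairing Symmetrizer.

Section Separation.
Variables (K : fieldType) (V : lmodType K) (D : V -> V).
Hypothesis Dlin : forall c y z, D (c *: y + z) = c *: D y + D z.

Lemma separate (b1 b2 l1 l2 : K) (y1 y2 : V) :
  b1 *: y1 + b2 *: y2 = 0 -> D y1 = l1 *: y1 -> D y2 = l2 *: y2 ->
  b1 != 0 -> b2 != 0 -> l1 != l2 -> y1 = 0 /\ y2 = 0.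
Proof.
move=> E D1 D2 h1 h2 l12.
have D0 : D 0 = 0 by have := Dlin (-1) 0 0; rewrite scaler0 addr0 scaleN1r addNr.
have DZ c z : D (c *: z) = c *: D z by rewrite -[c *: z]addr0 Dlin D0 addr0.
have := congr1 D E; rewrite Dlin DZ D0 D1 D2 => E'.
have y10 : y1 = 0.
  have EE : (b1 * (l1 - l2)) *: y1 = 0.
    have := congr1 (fun z => l2 *: z) E; rewrite scaler0 scalerDr => E2.
    have : b1 *: (l1 *: y1) + b2 *: (l2 *: y2) - (l2 *: (b1 *: y1) + l2 *: (b2 *: y2)) = 0 by rewrite E' E2 subrr.
    rewrite !scalerA [l2 * b2]mulrC opprD addrACA subrr addr0 -scalerBl => <-.
    by congr (_ *: _); ring.
  apply/eqP; move/eqP: EE; rewrite scaler_eq0 mulf_eq0 (negPf h1) subr_eq0 (negPf l12).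
  by [].
split=> //; apply/eqP; move/eqP: E; rewrite y10 scaler0 add0r scaler_eq0 (negPf h2).
by [].
Qed.

End Separation.

Lemma transport (K : fieldType) (V : comAlgType K) (D T : V -> V) (g w z : V) (m l b c k : K) :
  (forall c y z, D (c *: y + z) = c *: D y + D z) ->
  (forall c y z, T (c *: y + z) = c *: T y + T z) -> (forall y, T (D y) = D (T y)) -> b != 0 ->
  D g = m *: (l *: g + b *: w) -> w = c *: g + b *: z -> T g = k *: w ->
  (m * b) *: T z = k *: (D z - (m * l) *: z).
Proof.
move=> Dlin Tlin TD b0 Dg wE Tg.
have linZ (F : V -> V) c' y : (forall c y z, F (c *: y + z) = c *: F y + F z) -> F (c' *: y) = c' *: F y.
  move=> Fl; have F0 : F 0 = 0 by have := Fl (-1) 0 0; rewrite scaler0 addr0 scaleN1r addNr.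
  by rewrite -[c' *: y]addr0 Fl F0 addr0.
have Dw : D w = c *: (m *: (l *: g + b *: w)) + b *: D z by rewrite {1}wE Dlin linZ // Dg.
have Tw : T w = c *: (k *: w) + b *: T z by rewrite {1}wE Tlin linZ // Tg.
have E1 : D (T g) = m *: (l *: (k *: w) + b *: T w) by rewrite -TD Dg linZ // Tlin linZ // Tg.
have E2 : D (T g) = k *: (c *: (m *: (l *: g + b *: w)) + b *: D z) by rewrite Tg linZ // Dw.
have {E1 E2} E : m *: (l *: (k *: w) + b *: T w) = k *: (c *: (m *: (l *: g + b *: w)) + b *: D z) by rewrite -E1 -E2.
apply: (scalerI b0).
have -> : b *: ((m * b) *: T z) = m *: (l *: (k *: w) + b *: T w) - (m * l * k + m * b * c * k) *: w.
  by rewrite Tw !scaleE; ring.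
by rewrite E wE !scaleE; ring.
Qed.

Lemma step_scal1 (F : comPzRingType) (k m b l1 l2 E T : F) : k * (l1 - l2) = T * E ->
  k * (b * (m * l1) - m * l2 * b) = m * T * b * E.
Proof. by move=> H; transitivity (m * b * (k * (l1 - l2))); [ring|rewrite H; ring]. Qed.

Lemma step_comb (K : fieldType) (V : comAlgType K) (M b1 b2 E1 E2 : K) (t1 t2 r1 r2 : V) :
  M *: (b1 *: (t1 - E1 *: r1) + b2 *: (t2 - E2 *: r2)) =
  M *: (b1 *: t1 + b2 *: t2) - M *: (b1 *: (E1 *: r1) + b2 *: (E2 *: r2)).
Proof. by rewrite !scaleE; ring. Qed.

Lemma step_comb0 (K : fieldType) (V : comAlgType K) (M T b1 b2 E1 E2 k l1 l2 l0 : K) (r1 r2 : V) :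
  k * (l1 - l0) = T * E1 -> k * (l2 - l0) = T * E2 ->
  k *: (b1 *: ((M * l1) *: r1) + b2 *: ((M * l2) *: r2) - (M * l0) *: (b1 *: r1 + b2 *: r2)) -
  (M * T) *: (b1 *: (E1 *: r1) + b2 *: (E2 *: r2)) = 0.
Proof.
move=> h1 h2.
have -> : (M * T) *: (b1 *: (E1 *: r1) + b2 *: (E2 *: r2)) =
  (M * b1 * (T * E1)) *: r1 + (M * b2 * (T * E2)) *: r2 by rewrite !scaleE; ring.
by rewrite -h1 -h2 !scaleE; ring.
Qed.

Section TauMinus.
Variable N : nat.
Hypothesis N0 : (0 < N)%N.
Variable D : daha N.
Local Notation H := (daha_alg D).
Variable L : comAlgType coefField.
Variables (X : wt N -> L) (sv : 'I_N.+1 -> L -> L) (pv : L -> L).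
Variables (lv : L -> coefField) (emb : L -> daha_alg D) (act : daha_alg D -> L -> L).
Hypothesis rep : rep_spec X sv pv lv emb act.
Local Notation symm := (@symm N L sv).
Local Notation Y := (hY D).
Local Notation q := (q N).
Local Notation g := (g X).
Local Notation x := (x X).
Local Notation x0 := (x0 X).
Local Notation gh := (OneRow.gh X pv).
Local Notation hh := (hh X).
Local Notation Sop := (Sop act).
Local Notation S1 := (S1 act).
Local Notation e := eN.
Local Notation Rds := (Rds X).
Local Notation Rh := (Rh X pv).
Local Notation piR := (piR X).
Local Notation tb := (tb emb act).
Local Notation Bi := (dphi D \o dtau D \o dphi D).

Lemma tbZ c f : tb (c *: f) = c *: tb f.
Proof.
have tl := tb_lin N0 rep.
have t0 : tb 0 = 0 by have := tl (-1) 0 0; rewrite scaler0 addr0 scaleN1r addNr.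
by rewrite -[c *: f]addr0 tl t0 addr0.
Qed.

Lemma tb_T i f : i != ord0 -> tb (act (hT D i) f) = act (hT D i) (tb f).
Proof.
by move=> i0; rewrite (tb_act N0 rep) ?(hom_T (hom_Bi N0 D)) //; exact: inS_T.
Qed.

Lemma tb_Y f : tb (act Y f) = act Y (tb f).
Proof. by rewrite (tb_act N0 rep); [rewrite Bi_Y|exact: inS_Y]. Qed.

Lemma tb_x f : tb (x * f) = u ^+ N *: act Y (x * tb f).
Proof.
have -> : x * f = act (hx D ord0) f by rewrite (act_hx rep).
rewrite (tb_act N0 rep); last exact: inS_x.
by rewrite (Bi_x N0) (act_lZ rep) (ractM rep) (act_hx rep).
Qed.

Lemma tb_1 : tb 1 = 1.
Proof. by rewrite /ModularAction.tb (emb1 rep) (hom_1 (hom_Bi N0 D)) (act_one rep). Qed.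

Lemma tb_Tc k f : (k <= N)%N -> tb (Tc act k f) = Tc act k (tb f).
Proof.
by elim: k => //= k IH kN; rewrite tb_T ?IH ?(ltnW kN) //; exact: inord_neq0.
Qed.

Lemma tb_Sop f : tb (Sop f) = Sop (tb f).
Proof.
have tl := tb_lin N0 rep.
have t0 : tb 0 = 0 by have := tl (-1) 0 0; rewrite scaler0 addr0 scaleN1r addNr.
have tD y z : tb (y + z) = tb y + tb z by rewrite -[y]scale1r tl !scale1r.
rewrite /OneRow.Sop (big_morph tb tD t0); apply: eq_bigr => k _.
by rewrite tbZ tb_Tc // -ltnS.
Qed.

Lemma tb_S1 f : tb (S1 f) = S1 (tb f).
Proof. by rewrite /Symmetrizer.S1 tbZ tb_Sop. Qed.

Definition Dop f := S1 (act Y f).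

Lemma Dop_lin c y z : Dop (c *: y + z) = c *: Dop y + Dop z.
Proof. by rewrite /Dop (ractL rep) (S1_lin rep). Qed.
Lemma tb_Dop f : tb (Dop f) = Dop (tb f).
Proof. by rewrite /Dop tb_S1 tb_Y. Qed.

Lemma ed0 (d : nat) : e ^+ d != 0. Proof. exact: (expf_neq0 d eN_neq0). Qed.

Lemma pv_R d s : pv (Rds d s) = e ^- d *: Rh d s.
Proof. by rewrite /Symmetrizer.Rh scalerA mulVf ?ed0 // scale1r. Qed.

Lemma Dop_R d s : (2 * s <= d)%N -> Dop (Rds d s) = (v ^+ N * e ^- d * lam N d s) *: Rds d s.
Proof.
move=> sd; rewrite /Dop (act_Y_sym N0 rep); last exact: (symm_R rep).
by rewrite pv_R scalerA (S1Z rep) (S1_Rh N0 rep sd) scalerA.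
Qed.

Lemma hh_0 : hh 0 = 1.
Proof.
rewrite (hh_kk X) /OneRow.kk (_ : 0 - 1 = Negz 0) // (nn_hh X) mulr0 addr0.
exact: ld_0 (ld_g X).
Qed.

Local Notation kap := (v^-1 ^+ N * u ^- (2 * N)).

Lemma act_Y_xR d s : act Y (x * Rds d s) = (kap * e ^- d) *: (x * Rh d s).
Proof.
have := act_Y_xhf N0 rep 0 (symm_R rep d s); rewrite hh_0 mulr1 oppr0 !expr0z !mulr1 => ->.
by rewrite pv_R -scalerAr scalerA.
Qed.

Lemma tb_g1R d s E : (2 * s <= d)%N -> tb (Rds d s) = E *: Rds d s ->
  tb (g 1 * Rds d s) = (E * u ^+ N * (kap * e ^- d) / (q^-1 - 1)) *: piR d s.
Proof.
move=> sd tE; have q10 : q^-1 - 1 != 0.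
  rewrite subr_eq0; apply: contra_neq (qn_neq1 N0 0) => E1.
  by rewrite expr1 -[q]invrK E1 invr1 subrr.
have := S1_x0 N0 rep (symm_R rep d s) => E1.
have E2 : g 1 * Rds d s = (q^-1 - 1)^-1 *: S1 (x0 * Rds d s).
  by rewrite E1 scalerA mulVf // scale1r.
rewrite E2 tbZ tb_S1 (x0E X) -scalerAl tbZ tb_x tE -scalerAr (act_rZ rep) act_Y_xR.
have -> : q^-1 *: (u ^+ N *: (E *: ((kap * e ^- d) *: (x * Rh d s)))) =
    (E * u ^+ N * (kap * e ^- d)) *: (x0 * Rh d s).
  have C (K : comPzRingType) (c1 c2 c3 c4 : K) : c1 * c2 * c3 * c4 = c3 * c2 * c4 * c1 by ring.
  by rewrite (x0E X) -scalerAl; move: (x * _) => z; rewrite !scalerA C.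
by rewrite (S1Z rep) (S1_xRh N0 rep sd) !scalerA mulrC.
Qed.

Lemma Dop_g1R d s : (2 * s <= d)%N ->
  Dop (g 1 * Rds d s) = (v ^+ N * e ^- d.+1) *: (lam N d s *: (g 1 * Rds d s) + (1 - t) *: piR d s).
Proof.
move=> sd; rewrite /Dop (act_Y_sym N0 rep); last first.
  by move=> i i0; rewrite (rsvM rep) (sv_g rep) (symm_R rep).
have -> : pv (g 1 * Rds d s) = e ^- d.+1 *: (gh 1 * Rh d s).
  have -> : e ^- d.+1 = e^-1 * e ^- d by rewrite exprS invfM.
  have pg : pv (g 1) = e^-1 *: gh 1 by rewrite /OneRow.gh expr1z scalerA mulVf ?eN_neq0 // scale1r.
  rewrite (rpvM rep) pv_R pg; move: (gh 1) (Rh d s) => y z.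
  by rewrite -scalerAl -scalerAr scalerA.
rewrite scalerA (S1Z rep); congr (_ *: _).
rewrite (gh_kk N0 rep) (kk_1 X); move: (Rh d s) (S1_Rh N0 rep sd) (S1_xRh N0 rep sd) => z h1 h2.
rewrite mulrDl -[(1 - t) *: x0 * z]scalerAl (S1D rep) (S1Z rep) h2 [g 1 * z]mulrC (S1_symM rep) ?h1.
  by rewrite -scalerAl [Rds d s * _]mulrC.
by move=> i i0; exact: (sv_g rep).
Qed.

Definition Etb d s : coefField :=
  (v ^- N * u ^- N) ^+ d * e ^- 'C(d, 2) * q ^- ('C(d - s, 2) + 'C(s, 2)) * t ^+ s.

Local Notation kc d := (u ^+ N * (kap * e ^- d)).

Lemma kapuE : u ^+ N * kap = v ^- N * u ^- N.
Proof.
have C (F : fieldType) (U V : F) (n : nat) : U != 0 -> U ^+ n * (V^-1 ^+ n * U ^- (2 * n)) = V ^- n * U ^- n.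
  move=> U0; rewrite mul2n -addnn exprD invfM exprVn.
  by have := expf_neq0 n U0; move: (U ^+ n) (V ^- n) => a b a0; field.
exact: C u_neq0.
Qed.

Lemma Etb_row1 d s : (2 * s <= d)%N -> Etb d.+1 s = Etb d s * kc d * q ^ (s%:Z - d%:Z).
Proof.
move=> sd; rewrite [kc d]mulrA kapuE /Etb.
have -> : q ^ (s%:Z - d%:Z) = q ^- (d - s) by rewrite exprnN; congr (_ ^ _); lia.
rewrite subSn; last by lia.
rewrite !binS !bin1 exprS.
have -> : e ^- ('C(d, 2) + d) = e ^- 'C(d, 2) * e ^- d by rewrite exprD invfM.
have -> : q ^- ('C(d - s, 2) + (d - s) + 'C(s, 2)) = q ^- ('C(d - s, 2) + 'C(s, 2)) * q ^- (d - s).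
  by rewrite -invfM -exprD; congr (_ ^- _); lia.
have C (F : comPzRingType) (a b c1 c2 d1 d2 f : F) : a * b * (c1 * c2) * (d1 * d2) * f =
   b * c1 * d1 * f * (a * c2) * d2 by ring.
exact: C.
Qed.

Lemma Etb_row2 d s : (2 * s <= d)%N -> Etb d.+1 s.+1 = Etb d s * kc d * (t * q ^ (- s%:Z)).
Proof.
move=> sd; rewrite [kc d]mulrA kapuE /Etb.
have -> : q ^ (- s%:Z) = q ^- s by rewrite exprnN.
rewrite subSS (binS d) (binS s) !bin1 !exprS.
have -> : e ^- ('C(d, 2) + d) = e ^- 'C(d, 2) * e ^- d by rewrite exprD invfM.
have -> : q ^- ('C(d - s, 2) + ('C(s, 2) + s)) = q ^- ('C(d - s, 2) + 'C(s, 2)) * q ^- s.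
  by rewrite -invfM -exprD; congr (_ ^- _); lia.
have C (F : comPzRingType) (a b c1 c2 d1 d2 f T : F) : a * b * (c1 * c2) * (d1 * d2) * (T * f) =
   b * c1 * d1 * f * (a * c2) * (T * d2) by ring.
exact: C.
Qed.

Lemma lam_row1 d s : lam N d.+1 s = lam N d s + (1 - t) * (q ^ (s%:Z - d%:Z) * (q^-1 - 1)).
Proof.
rewrite /lam; have -> : q ^ (s%:Z - d.+1%:Z) = q ^ (s%:Z - d%:Z) * q^-1.
  by rewrite -exprN1 -expfzDr ?q_neq0 //; congr (_ ^ _); lia.
have C (F : comPzRingType) (a T z w q1 : F) : a + (1 - T) * ((z * q1 - 1) + w) =
  a + (1 - T) * ((z - 1) + w) + (1 - T) * (z * (q1 - 1)) by ring.
exact: C.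
Qed.

Lemma lam_row2 d s : lam N d.+1 s.+1 = lam N d s + (1 - t) * (t * q ^ (- s%:Z) * (q^-1 - 1)).
Proof.
rewrite /lam; have -> : q ^ (- s.+1%:Z) = q ^ (- s%:Z) * q^-1.
  by rewrite -exprN1 -expfzDr ?q_neq0 //; congr (_ ^ _); lia.
have -> : s.+1%:Z - d.+1%:Z = s%:Z - d%:Z by lia.
have C (F : comPzRingType) (a T z w q1 : F) : a + (1 - T) * (w + T * (z * q1 - 1)) =
  a + (1 - T) * (w + T * (z - 1)) + (1 - T) * (T * z * (q1 - 1)) by ring.
exact: C.
Qed.

Lemma t1_neq0 : 1 - t != 0.
Proof. by have := tq_neq1 N0 0; rewrite expr0z mulr1. Qed.

Lemma q1_neq0 : q^-1 - 1 != 0.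
Proof.
rewrite subr_eq0; apply: contra_neq (qn_neq1 N0 0) => E1.
by rewrite expr1 -[q]invrK E1 invr1 subrr.
Qed.

Lemma beta1_neq0 d (s : nat) : beta1 q t (q ^ (- s%:Z)) (d.+1%:Z - 2 * s%:Z) != 0.
Proof.
apply: mulf_neq0; last by rewrite invr_neq0 // (tq_neq1 N0).
apply: mulf_neq0.
  rewrite subr_eq0 eq_sym mulrC; apply: (qt_neq1 N0 (b := 2)); by right.
rewrite -expfzDr ?q_neq0 // subr_eq0; apply/negP => /eqP E.
have := qt_neq1 N0 (a := - s%:Z - (d.+1%:Z - 2 * s%:Z)) (b := -1); rewrite E => /(_ (or_intror isT)).
by rewrite exprN1 mulfV ?eqxx // t_v2 mulf_neq0 ?v_neq0.
Qed.

Lemma beta2_neq0 d (s : nat) : (2 * s.+1 <= d.+1)%N -> beta2 q t (q ^ (- s.+1%:Z)) (d.+1%:Z - 2 * s.+1%:Z) != 0.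
Proof.
move=> sd; apply: mulf_neq0; last by rewrite invr_neq0 // (tq_neq1 N0).
apply: mulf_neq0; first apply: mulf_neq0.
- by rewrite t_v2 mulf_neq0 ?v_neq0.
- rewrite subr_eq0; have := qt_neq1 N0 (a := - s.+1%:Z) (b := 0); rewrite expr0z mulr1; apply.
  by left.
- have -> : d.+1%:Z - 2 * s.+1%:Z + 1 = (d.+1 - 2 * s.+1).+1%:Z by lia.
  exact: qn_neq1.
Qed.

Lemma beta2_eq0 (s : nat) z : beta2 q t z ((2 * s).+1%:Z - 2 * s.+1%:Z) = 0.
Proof.
rewrite /beta2 (_ : (2 * s).+1%:Z - 2 * s.+1%:Z + 1 = 0); last by lia.
by rewrite expr0z subrr mulr0 mul0r.
Qed.

Lemma qt_quot (F : fieldType) (Q T : F) (a b : int) : Q != 0 -> T != 0 ->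
  Q ^ a = T * Q ^ b -> Q ^ (a - b) * T ^ (-1) = 1.
Proof.
by move=> Q0 T0 E; rewrite expfzDr // E exprN1 -[T * _ * _]mulrA -expfzDr // subrr expr0z mulr1 mulfV.
Qed.

Lemma t_neq0 : t != 0.
Proof. by rewrite t_v2 mulf_neq0 ?v_neq0. Qed.

Lemma row_distinct (a b : int) : q ^ a = t * q ^ b -> False.
Proof.
move=> /(qt_quot (q_neq0 N) t_neq0)/eqP; apply/negP.
by apply: (qt_neq1 N0); right.
Qed.

Lemma tb_R_step d s : (2 * s <= d)%N -> tb (Rds d s) = Etb d s *: Rds d s ->
  tb (Rds d.+1 s) = Etb d.+1 s *: Rds d.+1 s /\
  ((2 * s.+1 <= d.+1)%N -> tb (Rds d.+1 s.+1) = Etb d.+1 s.+1 *: Rds d.+1 s.+1).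
Proof.
move=> sd tE.
have m0 : v ^+ N * e ^- d.+1 != 0 := mulf_neq0 (expf_neq0 N v_neq0) (invr_neq0 (ed0 d.+1)).
have sd1 : (2 * s <= d.+1)%N by lia.
have b10 := beta1_neq0 d s.
have := transport Dop_lin (tb_lin N0 rep) tb_Dop t1_neq0 (Dop_g1R sd) (erefl (piR d s)) (tb_g1R sd tE).
set b1 := beta1 _ _ _ _ in b10 *; set b2 := beta2 _ _ _ _.
set m := v ^+ N * _ in m0 *; set k := _ / _.
have kE : k = Etb d s * kc d / (q^-1 - 1) by rewrite /k; congr (_ / _); exact: esym (mulrA _ _ _).
set R1 := Rds d.+1 s; set R2 := Rds d.+1 s.+1.
have D1 : Dop R1 = (m * lam N d.+1 s) *: R1 by rewrite (Dop_R sd1).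
have D2' : (2 * s.+1 <= d.+1)%N -> Dop R2 = (m * lam N d.+1 s.+1) *: R2 by exact: Dop_R.
have tZ := tbZ; have tl := tb_lin N0 rep.
have DZ c y : Dop (c *: y) = c *: Dop y.
  have D0 : Dop 0 = 0 by have := Dop_lin (-1) 0 0; rewrite scaler0 addr0 scaleN1r addNr.
  by rewrite -[c *: y]addr0 Dop_lin D0 addr0.
have [e1 sc1] : Etb d.+1 s = Etb d s * kc d * q ^ (s%:Z - d%:Z) /\
    k * (lam N d.+1 s - lam N d s) = (1 - t) * Etb d.+1 s.
  rewrite (Etb_row1 sd) lam_row1 kE; split=> //.
  have C (F : fieldType) (a c T z q1 : F) : q1 != 0 -> a / q1 * (c + T * (z * q1) - c) = T * (a * z).
    by move=> h; field.
  by rewrite (C _ _ _ _ _ _ q1_neq0).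
have [e2 sc2] : Etb d.+1 s.+1 = Etb d s * kc d * (t * q ^ (- s%:Z)) /\
    k * (lam N d.+1 s.+1 - lam N d s) = (1 - t) * Etb d.+1 s.+1.
  rewrite (Etb_row2 sd) lam_row2 kE; split=> //.
  have C (F : fieldType) (a c T z q1 : F) : q1 != 0 -> a / q1 * (c + T * (z * q1) - c) = T * (a * z).
    by move=> h; field.
  by rewrite (C _ _ _ _ _ _ q1_neq0).
have mt0 : m * (1 - t) != 0 := mulf_neq0 m0 t1_neq0.
clear kE e1 e2; clearbody m k R1 R2.
have [sd2|sd2] := leqP (2 * s.+1) d.+1; last first.
  have b20 : b2 = 0.
    have dE : d = (2 * s)%N by lia.
    by rewrite /b2 dE beta2_eq0.
  rewrite b20 scale0r addr0 tZ DZ D1 => E; split=> //.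
  apply: (scalerI b10); apply: (scalerI mt0); rewrite E.
  rewrite !scalerA -scalerBl scalerA; congr (_ *: _).
  exact: step_scal1 sc1.
have D2 := D2' sd2.
have b20 := beta2_neq0 sd2; rewrite -/b2 in b20.
clearbody b1 b2.
rewrite tl tZ Dop_lin DZ D1 D2 => E.
have F1 : tb R1 - Etb d.+1 s *: R1 = 0 /\ tb R2 - Etb d.+1 s.+1 *: R2 = 0.
  have s1 : b1 *: (tb R1 - Etb d.+1 s *: R1) + b2 *: (tb R2 - Etb d.+1 s.+1 *: R2) = 0.
    apply: (scalerI mt0); rewrite scaler0 step_comb E.
    exact: step_comb0 sc1 sc2.
  have eig (E' l : coefField) (R : L) : Dop R = l *: R -> Dop (tb R - E' *: R) = l *: (tb R - E' *: R).
    move=> DR; rewrite -scaleNr addrC Dop_lin -tb_Dop DR tZ [in RHS]scalerDr !scalerA.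
    by rewrite [l * _]mulrC.
  have s4 : m * lam N d.+1 s != m * lam N d.+1 s.+1.
    rewrite (inj_eq (mulfI m0)) lam_row1 lam_row2 (inj_eq (addrI _)) (inj_eq (mulfI t1_neq0)).
    rewrite (inj_eq (mulIf q1_neq0)); apply/negP => /eqP EE.
    exact: row_distinct EE.
  exact: (separate Dop_lin s1 (eig _ _ _ D1) (eig _ _ _ D2) b10 b20 s4).
by case: F1 => F1 F2; split=> [|_]; apply/eqP; rewrite -subr_eq0 ?F1 ?F2.
Qed.

Lemma R00 : Rds 0 0 = 1.
Proof.
have := g_exp N0 X 0 0; rewrite subr0 (ld_0 (ld_g X)) mulr1 /RogersPairing.EX big_ord1 !subr0.
by rewrite (phi_0 q t) mulr1 scale1r => <-.
Qed.

Lemma tb_R d s : (2 * s <= d)%N -> tb (Rds d s) = Etb d s *: Rds d s.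
Proof.
elim: d s => [|d IH] s sd.
  have -> : s = 0%N by lia.
  by rewrite R00 tb_1 /Etb /= !expr0 invr1 !mulr1 scale1r.
have [sd'|sd'] := leqP (2 * s) d; first by have [] := tb_R_step sd' (IH s sd').
case: s sd sd' => [|s] sd sd'; first by [].
have s2 : (2 * s <= d)%N by lia.
by have [_] := tb_R_step s2 (IH s s2); apply.
Qed.

End TauMinus.
End TwoRow.

Module ScalarSums.
Import PowerSeries WeightedSums RogersPairing.

Lemma G_fin (F : fieldType) (q t e e' Q Q' g g' : F) : q != 0 -> 1 - t != 0 -> e * e' = 1 ->
  (1 - t)^-1 * (Q' * g) + - (1 - t)^-1 * g = e * q * (q^-1 * q^-1 * (e' * ((1 - t)^-1 * (Q * g') + - t / (1 - t) * g'))) ->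
  (Q' - 1) * g = q^-1 * (Q - t) * g'.
Proof.
move=> q0 t1 ee E; apply: (mulfI (invr_neq0 t1)).
transitivity ((1 - t)^-1 * (Q' * g) + - (1 - t)^-1 * g); first by ring.
rewrite E.
transitivity ((e * e') * (q * (q^-1 * (q^-1 * ((1 - t)^-1 * (Q * g') + - t / (1 - t) * g'))))); first by ring.
rewrite ee mul1r mulVKf //; ring.
Qed.

Section Scalars.
Variables (K : fieldType) (q t : K).
Hypothesis q0 : q != 0.
Hypothesis t0 : t != 0.
Hypothesis q1 : forall n : nat, 1 - q ^+ n.+1 != 0.
Hypothesis tq1 : forall k : int, 1 - t * q ^ k != 0.

Lemma phi_pieri1 (T : K) (a b d : int) : a + b = d ->
  (1 - q ^ d) * (phi q T a * phi q T b) =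
  (1 - T * q ^ (d - 1)) * (phi q T (a - 1) * phi q T b + phi q T a * phi q T (b - 1))
  - (1 - T ^+ 2 * q ^ (d - 2)) * (phi q T (a - 1) * phi q T (b - 1)).
Proof.
move=> <-; have ra := phi_rec T q1 a; have rb := phi_rec T q1 b.
have Em (c : int) : q ^ (c - 1) = q ^ c / q by rewrite expfzDr.
have Em2 (c : int) : q ^ (c - 2) = q ^ c / q / q.
  by rewrite -!Em; congr (_ ^ _); ring.
rewrite !Em in ra rb; rewrite Em Em2 expfzDr //.
move: (phi q T a) (phi q T (a - 1)) (phi q T b) (phi q T (b - 1)) (q ^ a) (q ^ b) ra rb => f f' g g' P Q ra rb.
have -> : (1 - P * Q) * (f * g) = (f * (1 - P)) * g + P * f * (g * (1 - Q)) by ring.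
rewrite ra rb; apply/eqP; rewrite -subr_eq0; apply/eqP.
transitivity (- (T * P / q) * f' * (g * (1 - Q)) - (f * (1 - P)) * g' + (1 - T ^+ 2 * (P * Q / q / q)) * (f' * g')).
  by field.
by rewrite ra rb; field.
Qed.

Section Eps.
Variable A : K.
Local Notation qp x n := (qpoch x q n).

Definition epsk (k s : nat) : K :=
  t ^+ s * qp A (k + s) * qp (A / t) s * (1 - t * q ^+ k) / (qp q s * qp t (k + s).+1).
Definition eps (d s : nat) := epsk (d - 2 * s) s.

Lemma qpS x n : qp x n.+1 = qp x n * (1 - x * q ^+ n).
Proof. by rewrite /qpoch big_ord_recr. Qed.
Lemma qp0 x : qp x 0 = 1. Proof. by rewrite /qpoch big_ord0. Qed.

Lemma qpq_neq0 n : qp q n != 0.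
Proof. by apply/prodf_neq0 => i _; rewrite -exprS. Qed.
Lemma qpt_neq0 n : qp t n != 0.
Proof. by apply/prodf_neq0 => i _; exact: (tq1 (i : nat)%:Z). Qed.

Lemma tqn1 n : 1 - t * q ^+ n != 0. Proof. exact: (tq1 n%:Z). Qed.

Lemma epsk_rec0 k : (1 - q ^+ k.+1) * epsk k.+1 0 =
  (1 - A * q ^+ k) * (epsk k 0 / (1 - t * q ^+ k)) * (1 - q ^+ k.+1).
Proof.
rewrite /epsk !addn0 !qp0 !(qpS _ k.+1) !(qpS _ k) !expr0 !mul1r !mulr1.
have h1 := qpt_neq0 k; have h2 := tqn1 k; have h3 := tqn1 k.+1.
move: h1 h2 h3; move: (qp t k) (qp A k) => a b h1 h2 h3.
by field; rewrite h1 h2 h3.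
Qed.

Lemma eps_alg (S Q F G H I : K) (c t' : K) : H != 0 -> I != 0 ->
  t' != 0 -> 1 - t' * (Q / q) != 0 -> 1 - t' * (Q * q) != 0 -> 1 - t' * Q != 0 -> 1 - t' * (Q * S) != 0 -> 1 - S != 0 ->
  (1 - Q * S * S) * (t' * c * (F * (1 - A * (Q * S / q))) * (G * (1 - A / t' * (S / q))) * (1 - t' * Q) / (H * (1 - S) * (I * (1 - t' * (Q * S))))) =
  (1 - A * (Q * S * S / q)) *
    ((t' * c * F * (G * (1 - A / t' * (S / q))) * (1 - t' * (Q / q)) / (H * (1 - S) * I)) / (1 - t' * (Q / q)) * (1 - Q)
     + (c * (F * (1 - A * (Q * S / q))) * G * (1 - t' * (Q * q)) / (H * (I * (1 - t' * (Q * S))))) / (1 - t' * (Q * q)) * (1 - t' ^+ 2 * Q))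
  - (1 - A ^+ 2 * (Q * S * S / q / q)) * (c * F * G * (1 - t' * Q) / (H * I)).
Proof.
move=> h1 h2 h3 h4 h5 h6 h7 h8.
have h4' : q - t' * Q != 0 by apply: contra_neq h4 => E; apply: (mulIf q0); rewrite mul0r -E; field.
by field; rewrite h1 h2 h3 h4' h5 h7 h8 q0.
Qed.

Lemma epsk_recS k s : (1 - q ^+ (k.+1 + 2 * s.+1)) * epsk k.+1 s.+1 =
  (1 - A * q ^+ (k.+1 + 2 * s).+1) *
   (epsk k s.+1 / (1 - t * q ^+ k) * (1 - q ^+ k.+1) + epsk k.+2 s / (1 - t * q ^+ k.+2) * (1 - t ^+ 2 * q ^+ k.+1))
  - (1 - A ^+ 2 * q ^+ (k.+1 + 2 * s)) * epsk k.+1 s.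
Proof.
rewrite /epsk.
have -> : (k.+1 + s.+1 = (k + s).+2)%N by lia.
have -> : (k + s.+1 = (k + s).+1)%N by lia.
have -> : (k.+1 + s = (k + s).+1)%N by lia.
have -> : (k.+2 + s = (k + s).+2)%N by lia.
set Q := q ^+ k.+1; set S := q ^+ s.+1.
have Ek : q ^+ k = Q / q by rewrite /Q exprSr mulfK.
have Ek2 : q ^+ k.+2 = Q * q by rewrite /Q exprSr.
have Es : q ^+ s = S / q by rewrite /S exprSr mulfK.
have E1 : q ^+ (k.+1 + 2 * s.+1) = Q * S * S by rewrite /Q /S -!exprD; congr (_ ^+ _); lia.
have E2 : q ^+ (k.+1 + 2 * s).+1 = Q * S * S / q by apply: (mulIf q0); rewrite divfK // -exprSr -E1; congr (_ ^+ _); lia.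
have E3 : q ^+ (k.+1 + 2 * s) = Q * S * S / q / q by rewrite -E2 exprSr mulfK.
have E4 : q ^+ (k + s).+1 = Q * S / q by apply: (mulIf q0); rewrite divfK // -exprSr /Q /S -exprD; congr (_ ^+ _); lia.
have E5 : q ^+ (k + s).+2 = Q * S by rewrite /Q /S -exprD; congr (_ ^+ _); lia.
rewrite (qpS A (k + s).+1) (qpS t (k + s).+2) (qpS _ s) (qpS q s) -exprS -/S E1 E2 E3 E4 E5 Ek Ek2 Es exprS.
have hS : 1 - S != 0 by exact: q1.
have tk := tqn1 k; have tk1 := tqn1 k.+1; have tk2 := tqn1 k.+2; have tks := tqn1 (k + s).+2.
rewrite Ek in tk; rewrite -/Q in tk1; rewrite Ek2 in tk2; rewrite E5 in tks.
exact: eps_alg (qpq_neq0 s) (qpt_neq0 _) t0 tk tk2 tk1 tks hS.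
Qed.

Lemma eps_alg0 (S F G H I : K) (c t' : K) : H != 0 -> I != 0 ->
  t' != 0 -> 1 - t' * q != 0 -> 1 - t' != 0 -> 1 - t' * S != 0 -> 1 - S != 0 ->
  (1 - S * S) * (t' * c * (F * (1 - A * (S / q))) * (G * (1 - A / t' * (S / q))) * (1 - t' * 1) / (H * (1 - S) * (I * (1 - t' * S)))) =
  (1 - A * (S * S / q)) *
     ((c * (F * (1 - A * (S / q))) * G * (1 - t' * q) / (H * (I * (1 - t' * S)))) / (1 - t' * q) * (1 - t' ^+ 2 * 1))
  - (1 - A ^+ 2 * (S * S / q / q)) * (c * F * G * (1 - t' * 1) / (H * I)).
Proof.
move=> h1 h2 h3 h4 h5 h6 h7.
by field; rewrite h1 h2 h3 h4 h6 h7 q0.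
Qed.

Lemma epsk_rec00 s : (1 - q ^+ (2 * s.+1)) * epsk 0 s.+1 =
  (1 - A * q ^+ (2 * s).+1) * (epsk 1 s / (1 - t * q ^+ 1) * (1 - t ^+ 2 * q ^+ 0))
  - (1 - A ^+ 2 * q ^+ (2 * s)) * epsk 0 s.
Proof.
rewrite /epsk !add0n add1n; set S := q ^+ s.+1.
have Es : q ^+ s = S / q by rewrite /S exprSr mulfK.
have E1 : q ^+ (2 * s.+1) = S * S by rewrite /S -!exprD; congr (_ ^+ _); lia.
have E2 : q ^+ (2 * s).+1 = S * S / q by apply: (mulIf q0); rewrite divfK // -exprSr -E1; congr (_ ^+ _); lia.
have E3 : q ^+ (2 * s) = S * S / q / q by rewrite -E2 exprSr mulfK.
rewrite (qpS A s) (qpS t s.+1) (qpS _ s) (qpS q s) -exprS -/S E1 E2 E3 Es exprS expr0 expr1.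
have hS : 1 - S != 0 by exact: q1.
have t1 := tqn1 1; have t00 := tqn1 0; have ts := tqn1 s.+1; rewrite expr1 in t1; rewrite expr0 mulr1 in t00.
have := eps_alg0 (qp A s) (qp (A / t) s) (t ^+ s) (qpq_neq0 s) (qpt_neq0 s.+1) t0 t1 t00 ts hS.
exact.
Qed.

Lemma eps00 : eps 0 0 = 1.
Proof.
have h := tqn1 0; rewrite expr0 mulr1 in h.
by rewrite /eps /epsk !expr0 (qpS t 0) !qp0 expr0 !mul1r mulr1 mulfV.
Qed.

Definition EXn M (Z : nat -> K) (a b : int) :=
  \sum_(s < M) Z s * (phi q t (a - s%:Z) * phi q t (b - s%:Z)).

Lemma EXn_wide M M' Z a b d : a + b = d -> (d < (2 * M)%N%:Z) -> (M <= M')%N -> EXn M' Z a b = EXn M Z a b.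
Proof.
move=> ab dM MM'; rewrite /EXn; pose F s := Z s * (phi q t (a - s%:Z) * phi q t (b - s%:Z)).
rewrite -(big_mkord xpredT F) -(big_mkord xpredT F) (@big_cat_nat _ _ _ M) //=.
rewrite [X in _ + X]big_nat_cond [X in _ + X]big1 ?addr0 // => s /andP[/andP[s1 _] _].
by rewrite /F phi2_0 ?mulr0 //; lia.
Qed.

Lemma pieri_fin (w c1 c2 f1 f1' f2 f2' z : K) : w != 0 ->
  c1 * (f1 * f2) = w * (f1' * f2 + f1 * f2') - c2 * (f1' * f2') ->
  z * (f1' * f2) + z * (f1 * f2') = z / w * c1 * (f1 * f2) + z / w * c2 * (f1' * f2').
Proof.
move=> w0 E; rewrite -mulrA E; by field.
Qed.

Lemma EXn_pieri M Z a b d : a + b = d -> d < (2 * M)%N%:Z ->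
  EXn M Z (a - 1) b + EXn M Z a (b - 1) =
  EXn M.+1 (fun s => Z s / (1 - t * q ^ (d - 2 * s%:Z - 1)) * (1 - q ^ (d - 2 * s%:Z))) a b +
  EXn M.+1 (fun s => if s is s'.+1 then Z s' / (1 - t * q ^ (d - 2 * s%:Z + 1)) * (1 - t ^+ 2 * q ^ (d - 2 * s%:Z)) else 0) a b.
Proof.
move=> ab dM; rewrite [X in _ = _ + X]/EXn big_ord_recl mul0r add0r.
rewrite [X in _ = X + _](@EXn_wide M _ _ _ _ _ ab) //.
rewrite /EXn -!big_split; apply: eq_bigr => s _ /=.
have e0 : a - s%:Z + (b - s%:Z) = d - 2 * s%:Z by rewrite -ab; ring.
have {e0} P := phi_pieri1 t e0.
rewrite /bump /= add1n.
have -> : (0 + s)%N = s by [].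
have -> : a - 1 - s%:Z = a - s%:Z - 1 by lia.
have -> : b - 1 - s%:Z = b - s%:Z - 1 by lia.
have -> : a - s.+1%:Z = a - s%:Z - 1 by lia.
have -> : b - s.+1%:Z = b - s%:Z - 1 by lia.
have -> : d - 2 * s.+1%:Z + 1 = d - 2 * s%:Z - 1 by lia.
have -> : d - 2 * s.+1%:Z = d - 2 * s%:Z - 2 by lia.
exact: pieri_fin (tq1 _) P.
Qed.

Lemma EXn_shift M Z (a b : int) : EXn M Z (a - 1) (b - 1) =
  EXn M.+1 (fun s => if s is s'.+1 then Z s' else 0) a b.
Proof.
rewrite /EXn big_ord_recl mul0r add0r; apply: eq_bigr => s _ /=.
by rewrite /bump /= add1n; congr (_ * (phi q t _ * phi q t _)); lia.
Qed.

Lemma eps_rec d s : (2 * s <= d.+1)%N -> (1 - q ^+ d.+1) * eps d.+1 s =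
  (1 - A * q ^ (d.+1%:Z - 1)) * (eps d s / (1 - t * q ^ (d.+1%:Z - 2 * s%:Z - 1)) * (1 - q ^ (d.+1%:Z - 2 * s%:Z))
    + (if s is s'.+1 then eps d s' / (1 - t * q ^ (d.+1%:Z - 2 * s%:Z + 1)) * (1 - t ^+ 2 * q ^ (d.+1%:Z - 2 * s%:Z)) else 0))
  - (1 - A ^+ 2 * q ^ (d.+1%:Z - 2)) * (if s is s'.+1 then eps d.-1 s' else 0).
Proof.
case: s => [|s] sd.
  rewrite mulr0 subr0 addr0 mulr0 !subr0 PoszB1 /eps !subn0 -!exprnP [RHS]mulrA.
  exact: epsk_rec0.
have [k dk] : exists k, d.+1 = (k + 2 * s.+1)%N by exists (d.+1 - 2 * s.+1)%N; rewrite subnK.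
have e1 : d.+1%:Z - 2 * s.+1%:Z = k%:Z by lia.
have e2 : d.+1%:Z - 2 = (k + 2 * s)%N%:Z by lia.
have e3 : k%:Z + 1 = k.+1%:Z by lia.
rewrite e1 e2 e3 PoszB1 /eps.
have -> : (d.+1 - 2 * s.+1 = k)%N by lia.
have -> : (d - 2 * s = k.+1)%N by lia.
have -> : (d.-1 - 2 * s = k)%N by lia.
have -> : (d = (k + 2 * s).+1)%N by lia.
case: k {e1 e2 e3 dk} => [|k].
  rewrite add0n -exprnP expr0z subrr mulr0 add0r -!exprnP.
  have -> : (2 * s).+2 = (2 * s.+1)%N by lia.
  exact: epsk_rec00.
have -> : k.+1%:Z - 1 = k%:Z by lia.
rewrite -!exprnP.
have -> : ((k.+1 + 2 * s).+1 - 2 * s.+1 = k)%N by lia.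
have -> : (k.+1 + 2 * s).+2 = (k.+1 + 2 * s.+1)%N by lia.
exact: epsk_recS.
Qed.

Lemma EXn_eq M Z Z' (a b : int) (d : nat) : a + b = d%:Z ->
  (forall s, (2 * s <= d)%N -> Z s = Z' s) -> EXn M Z a b = EXn M Z' a b.
Proof.
move=> ab E; apply: eq_bigr => s _; have [sd|sd] := leqP (2 * s) d; first by rewrite E.
by rewrite phi2_0 ?mulr0 //; lia.
Qed.

Lemma EXnD M Z Z' (a b : int) : EXn M Z a b + EXn M Z' a b = EXn M (fun s => Z s + Z' s) a b.
Proof. by rewrite /EXn -big_split; apply: eq_bigr => s _; rewrite /= -mulrDl. Qed.
Lemma EXnZ c M Z (a b : int) : c * EXn M Z a b = EXn M (fun s => c * Z s) a b.
Proof. by rewrite /EXn mulr_sumr; apply: eq_bigr => s _; rewrite mulrA. Qed.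
Lemma EXnB M Z Z' (a b : int) : EXn M Z a b - EXn M Z' a b = EXn M (fun s => Z s - Z' s) a b.
Proof. by rewrite -mulN1r EXnZ EXnD; apply: eq_bigr => s _; rewrite mulN1r. Qed.

Lemma eps_exp d (a b : int) : a + b = d%:Z -> phi q A a * phi q A b = EXn d.+1 (eps d) a b.
Proof.
elim/ltn_ind: d a b => -[|d] IH a b ab.
  rewrite /EXn big_ord1 eps00 mul1r !subr0.
  have [a0|a0|a0] := ltrgtP a 0.
  - by rewrite !(@phi_lt0 _ q _ a) // !mul0r.
  - by rewrite !(@phi_lt0 _ q _ b) ?mulr0 //; lia.
  have -> : b = 0 by lia.
  by rewrite a0 !phi_0.
apply: (mulfI (q1 d)); rewrite (phi_pieri1 A ab).
rewrite (IH d) //; last by lia.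
rewrite (IH d _ a) //; last by lia.
have -> : phi q A (a - 1) * phi q A (b - 1) = EXn d.+1 (eps d.-1) (a - 1) (b - 1).
  case: d IH ab => [|d] IH ab.
    by rewrite /EXn big_ord1 !phi2_0 ?mulr0 //; lia.
  by rewrite (IH d) //=; [symmetry; apply: (@EXn_wide _ _ _ _ _ d%:Z); lia | lia].
rewrite (EXn_pieri _ ab) //; last by lia.
rewrite EXn_shift EXnD !EXnZ EXnB.
by apply: (@EXn_eq _ _ _ a b d.+1 ab) => s sd; rewrite -eps_rec.
Qed.

End Eps.

Variable et : K.
Hypothesis eta2 : q = et ^+ 2.
Hypothesis two0 : 2%:R != 0 :> K.
Local Notation ph := (phi q t).

Let et0 : et != 0.
Proof. by apply: contra_neq q0 => E; rewrite eta2 E expr2 mul0r. Qed.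

Let t1 : 1 - t != 0. Proof. by have := tq1 0; rewrite expr0z mulr1. Qed.

Definition phh (b : int) : K^o := (q ^ (- b) - t) * ph b / (1 - t).

Lemma phh_nn : nn phh. Proof. by move=> n; rewrite /phh mulr0 mul0r. Qed.

Lemma phh_prev b : q^-1 * phh (b - 1) = (q ^ (- b) - 1) * ph b / (1 - t).
Proof.
have E := phi_recV t q0 q1 b.
have eb : - (b - 1) = 1 - b by lia.
rewrite /phh eb mulrA; congr (_ / _).
rewrite mulrCA mulrA -[RHS]opprK -mulNr opprB [_ * ph b]mulrC E; ring.
Qed.

Lemma DD_phh b : DD (q^-1 : K^o) phh b = ph b.
Proof.
rewrite /DD -[_ * phh _]/(q^-1 * phh (b - 1) : K) phh_prev /phh.
by move: (q ^ - b) (ph b) => Q f; field.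
Qed.

Lemma DDt_phh b : DD (t *: (q^-1 : K^o)) phh b = q ^ (- b) * ph b.
Proof.
rewrite /DD -[_ * phh _]/(t * q^-1 * phh (b - 1) : K) -mulrA phh_prev /phh.
by move: (q ^ - b) (ph b) => Q f; field.
Qed.

Definition G n : K^o := wsum (2 * n) (wt0 et (2 * n)) (fun a b => ph a * ph b : K^o).

Lemma q_et (b : int) : q ^ b = et ^ (2 * b).
Proof. by rewrite eta2 exprnP exprz_exp. Qed.

Lemma wsum_half n : wsum (2 * n) (wt0 et (2 * n)) (fun a b => q ^ (- b) * (ph a * ph b) : K^o)
  = q ^ (- n%:Z) * G n.
Proof.
set d := (2 * n)%N.
have -> : q ^ (- n%:Z) * G n = wsum d (fun a => q ^ (- n%:Z) * wt0 et d a) (fun a b => ph a * ph b : K^o).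
  by rewrite -wsumZ.
transitivity (wsum d (fun a => q ^ (- (d%:Z - a)) * wt0 et d a) (fun a b => ph a * ph b : K^o)).
  by apply: eq_wsum => a; rewrite /GRing.scale /= mulrA; congr (_ * _); rewrite mulrC.
apply: wsum_symm => // [a b|a]; first by rewrite mulrC.
rewrite /wt0 !signZ2 !q_et ![et ^ _ * (_ * et ^ _)]mulrCA -!mulrDr; congr (_ * _).
rewrite mulrDr -!expfzDr // [RHS]addrC.
by congr (et ^ _ + et ^ _); rewrite /d PoszM; ring.
Qed.

Lemma wsum_lin d w (c c' : K) (F F' : int -> int -> K^o) :
  wsum d w (fun a b => (c : K^o) * F a b + (c' : K^o) * F' a b) = c * wsum d w F + c' * wsum d w F'.
Proof.
rewrite /wsum !mulr_sumr -big_split; apply: eq_bigr => a _ /=.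
rewrite /GRing.scale /=; ring.
Qed.

Lemma G_rec n : (q ^ (- n.+1%:Z) - 1) * G n.+1 = q^-1 * (q ^ (- n%:Z) - t) * G n.
Proof.
have n2 : (2 * n.+1 = (2 * n).+2)%N by lia.
have := sum3 two0 phh_nn (q^-1 : K^o) t et0 n; rewrite -n2.
set l := wsum _ _ _; set r := wsum _ _ _.
have -> : l = (1 - t)^-1 * (q ^ (- n.+1%:Z) * G n.+1) + - (1 - t)^-1 * G n.+1.
  rewrite -wsum_half -wsum_lin; apply: eq_wsum => a; congr (_ *: _).
  rewrite DD_phh -[_ * phh _]/(q^-1 * phh ((2 * n.+1)%N%:Z - a - 1) : K) phh_prev.
  move: (q ^ (- _)) (ph a) (ph (_ - a)) => Q x y.
  by have E : x * ((Q - 1) * y / (1 - t)) = (1 - t)^-1 * (Q * (x * y)) + - (1 - t)^-1 * (x * y) by ring.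
have -> : r = (et ^ (- (4 * n%:Z))) * ((1 - t)^-1 * (q ^ (- n%:Z) * G n) + (- t / (1 - t)) * G n).
  rewrite -wsum_half -wsum_lin.
  have sE (c : K) (x : K^o) : c * x = c *: x by [].
  rewrite sE wsumZ.
  apply: eq_wsum => a; rewrite DDt_phh /phh.
  have -> : et ^ (- (2 * ((2 * n)%N%:Z - a))) = et ^ (- (4 * n%:Z)) * q ^ a.
    by rewrite q_et -expfzDr //; congr (_ ^ _); lia.
  have : q ^ a * q ^ (- a) = 1 by rewrite -expfzDr // subrr.
  rewrite /GRing.scale /=; move: (wt0 _ _ _) (et ^ _) (q ^ (- (_ - a))) (q ^ a) (q ^ - a) (ph a) (ph _).
  move=> w e X Q Q' f g QQ; transitivity (w * (e * (Q * Q')) * ((X - t) * g / (1 - t) * f)); first by ring.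
  rewrite QQ; ring.
rewrite /GRing.scale /=.
have -> : et ^+ (4 * n + 2) = et ^ (4 * n%:Z) * q.
  by rewrite eta2 exprD; congr (_ * _); rewrite exprnP; congr (_ ^ _); lia.
have : et ^ (4 * n%:Z) * et ^ (- (4 * n%:Z)) = 1 by rewrite -expfzDr // subrr.
move=> ee E; exact: (G_fin q0 t1 ee E).
Qed.

Lemma G_phi n : G n = ph n.
Proof.
elim: n => [|n IH].
  by rewrite /G /wsum muln0 big_ord1 /wt0 subr0 !mul0r !expr0z phi_0 !mul1r /GRing.scale /= mul1r.
have E := phi_recV t q0 q1 n.+1%:Z.
have h : q ^ (- n.+1%:Z) - 1 != 0.
  have := q1 n; apply: contra_neq => h; have : q ^ n.+1%:Z * (q ^ (- n.+1%:Z) - 1) = 0 by rewrite h mulr0.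
  by rewrite mulrBr -expfzDr // subrr expr0z mulr1 -exprnP.
apply: (mulfI h); rewrite G_rec IH.
rewrite -[RHS]opprK -mulNr opprB [_ * ph n.+1]mulrC E PoszB1.
have -> : 1 - n.+1%:Z = - n%:Z by lia.
ring.
Qed.

Lemma w_shift n s : (s <= n)%N ->
  wsum (2 * n) (wt0 et (2 * n)) (fun a b => ph (a - s%:Z) * ph (b - s%:Z) : K^o)
  = (-1) ^+ s * et ^+ (s * (2 * (n - s) + 1 + s)) * ph (n - s)%N.
Proof.
move=> sn; have [k nk] : exists k, n = (s + k)%N by exists (n - s)%N; rewrite subnKC.
rewrite nk addKn -G_phi /G /wsum.
pose F (i : nat) : K := wt0 et (2 * (s + k)) i%:Z * (ph (i%:Z - s%:Z) * ph ((2 * (s + k))%N%:Z - i%:Z - s%:Z)).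
transitivity (\sum_(i < (2 * (s + k)).+1) F i) => //.
rewrite -(big_mkord xpredT F) (@big_cat_nat _ _ _ s) //=; last by lia.
rewrite big_nat_cond big1 ?add0r; last first.
  by move=> i /andP[/andP[_ i1] _]; rewrite /F (@phi_lt0 _ q t (i%:Z - _)) ?mul0r ?mulr0 //; lia.
rewrite (@big_cat_nat _ _ _ (s + (2 * k).+1)) //=; try lia.
rewrite [X in _ + X]big_nat_cond [X in _ + X]big1 ?addr0; last first.
  by move=> i /andP[/andP[i1 _] _]; rewrite /F (@phi_lt0 _ q t (_ - _ - s%:Z)) ?mulr0 //; lia.
rewrite -{1}[s]add0n big_addn addnC addnK big_mkord mulr_sumr.
apply: eq_bigr => i _; rewrite /F /GRing.scale /= mulrA.
have -> : (i + s)%N%:Z - s%:Z = i%:Z by lia.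
have -> : (2 * (s + k))%N%:Z - (i + s)%N%:Z - s%:Z = (2 * k)%N%:Z - i%:Z by lia.
rewrite -[\prod_(j < i) _]/(ph i%:Z) !mulrA; congr (_ * _ * _); rewrite /wt0 [(i + s)%N%:Z]PoszD [X in X * _ = _]expfzDr ?oppr_eq0 ?oner_eq0 // -!exprnP.
rewrite -[RHS]mulrA [RHS]mulrACA [(-1) ^+ s * _]mulrC; congr (_ * _).
rewrite [et ^+ _]exprnP -expfzDr //; congr (_ ^ _); rewrite -?nk; nia.
Qed.
End Scalars.
End ScalarSums.

Module SuperFormula.
Import PowerSeries WeightedSums RogersPairing ScalarSums.

Definition superformula (F : fieldType) (qh th a : F) (p m : nat) : F :=
  let q := qh ^+ 2 in let t := th ^+ 2 in
  qpoch q q m / (qpoch (- a) q m * (1 - t)) *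
  \sum_(k < m.+1)
    (-1) ^+ (m - k) * (qh * th) ^+ (m - k) *
    (q ^+ ((m * m.+1)./2 - (k * k.+1)./2) * (th / qh) ^+ (m - k)) ^+ (2 * p + 1) *
    (qpoch t q k * qpoch (- a) q (m + k) * qpoch (- a / t) q (m - k) * (1 - q ^+ (2 * k) * t)
     / (qpoch q q k * qpoch (q * t) q (m + k) * qpoch q q (m - k))).

Section PhiLog.
Variables (K : fieldType) (q A : K).
Hypothesis K0 : forall n : nat, n.+1%:R != 0 :> K.
Hypothesis q0 : q != 0.
Hypothesis q1 : forall n : nat, 1 - q ^+ n.+1 != 0.

Lemma ld_phi : ld (fun j => (1 - A ^+ j) / (1 - q ^+ j) : K^o) (phi q A : int -> K^o).
Proof.
set E : nat -> K^o := fun j : nat => _; have dF := ld_lds K0 E; set F := lds E in dF.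
suff -> : (phi q A : int -> K^o) = F by [].
have EF : DD 1 F = DD (A : K^o) (sc q F).
  apply: (ld_uniq K0 (ld_DD 1 dF) (ld_DD (A : K^o) (ld_sc q0 dF))) => j.
  have E1 (x y z : K) : 1 - x != 0 -> (1 - y) / (1 - x) - 1 = x * ((1 - y) / (1 - x)) - y by move=> h; field.
  rewrite expr1n; exact: (E1 _ _ 0 (q1 j)).
apply: boolp.funext; case=> n; last by rewrite (ld_nn dF).
elim: n => [|n IH]; first by rewrite (ld_0 dF) phi_0.
apply: (mulIf (q1 n)); rewrite [LHS](phi_rec A q1 n.+1%:Z) PoszB1 IH.
have := congr1 (fun f => f n.+1%:Z) EF; rewrite /DD /sc PoszB1 mul1r => E1.
have E2 (f f' x y : K) : f - f' = x * f - A * (y * f') -> f' * (1 - A * y) = f * (1 - x).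
  by move=> h; rewrite !mulrBr [f * x]mulrC mulr1; apply/eqP; rewrite -subr_eq0; apply/eqP;
     transitivity (x * f - A * (y * f') - (f - f')); [ring | rewrite h subrr].
exact: (E2 _ _ _ _ E1).
Qed.

Lemma phi_qpoch n : phi q A n%:Z = qpoch A q n / qpoch q q n.
Proof.
by rewrite /= /qpoch -prodf_div; apply: eq_bigr => i _; rewrite exprS.
Qed.
End PhiLog.

Section Formula.
Variables (K : fieldType) (qh th A : K).
Local Notation q := (qh ^+ 2).
Local Notation t := (th ^+ 2).
Hypothesis q0 : qh != 0.
Hypothesis q1 : forall n : nat, 1 - q ^+ n.+1 != 0.
Hypothesis tq1 : forall k : int, 1 - t * q ^ k != 0.
Hypothesis A1 : forall n, 1 - A * q ^+ n != 0.

Lemma qpochSl (x : K) n : qpoch x q n.+1 = (1 - x) * qpoch (q * x) q n.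
Proof.
rewrite /qpoch big_ord_recl expr0 mulr1; congr (_ * _); apply: eq_bigr => i _.
by rewrite /= /bump /= add1n exprS; congr (1 - _); ring.
Qed.

Lemma half_diff k s : (((k + s) * (k + s).+1)./2 - (k * k.+1)./2).*2 = (s * (2 * k + 1 + s))%N.
Proof.
have E n : (n * n.+1)./2.*2 = (n * n.+1)%N by rewrite even_halfK //= oddM /= andbN.
by rewrite doubleB !E; lia.
Qed.

Lemma pow_part (p k s : nat) :
  (qh * th) ^+ s * (q ^+ (((k + s) * (k + s).+1)./2 - (k * k.+1)./2) * (th / qh) ^+ s) ^+ (2 * p + 1)
  = t ^+ s * qh ^+ (s * (2 * k + 1 + s)) * (t ^+ s * q ^+ (s * (2 * k + s))) ^+ p.
Proof.
rewrite -[q ^+ _]exprM mul2n half_diff.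
have E : (qh ^+ (s * (2 * k + 1 + s)) * (th / qh) ^+ s) ^+ 2 = t ^+ s * q ^+ (s * (2 * k + s)).
  have -> : (s * (2 * k + 1 + s) = s * (2 * k + s) + s)%N by lia.
  rewrite exprD expr_div_n; have h : qh ^+ s != 0 by rewrite expf_neq0.
  rewrite -[t ^+ s]exprM -[q ^+ _]exprM ![(2 * _)%N]mulnC !exprM.
  by move: (qh ^+ s) (th ^+ s) h => a b a0; field.
rewrite exprD exprM E expr1 mulrCA [RHS]mulrC; congr (_ * _).
rewrite exprMn mulrCA expr_div_n -[t ^+ s]exprM (mulnC 2 s) (exprM th).
have h : qh ^+ s != 0 by rewrite expf_neq0.
by move: (qh ^+ s) (th ^+ s) (qh ^+ _) h => a b c a0; field.
Qed.

Lemma formula_term (w E x C F G H P Q R S T V : K) : P != 0 -> Q != 0 -> R != 0 -> S != 0 -> T != 0 -> 1 - t != 0 ->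
  T / (S * (1 - t)) * (w * (V * x * E) * (H * C * F * (1 - G * t) / (R * Q * P))) =
  w * x * (H / R) * E * (V * C * F * (1 - t * G) / (P * ((1 - t) * Q))) / (S / T).
Proof. by move=> h1 h2 h3 h4 h5 h6; field; rewrite h1 h2 h3 h4 h5 h6. Qed.

Lemma qpoch_nz (x : K) n : (forall i : nat, 1 - x * q ^+ i != 0) -> qpoch x q n != 0.
Proof. by move=> h; apply/prodf_neq0 => i _; exact: h. Qed.

Lemma superformulaE p m :
  superformula qh th (- A) p m =
  (\sum_(s < m.+1) ((-1) ^+ s * qh ^+ (s * (2 * (m - s) + 1 + s)) * phi q t (m - s)%N) *
     (t ^+ s * q ^+ (s * (2 * m - s))) ^+ p * eps q t A (2 * m) s) / phi q A m.
Proof.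
rewrite /superformula opprK mulr_sumr mulr_suml [LHS](reindex_inj rev_ord_inj) /=.
apply: eq_bigr => -[s /= sm] _; rewrite subSS.
have [k mk] : exists k, m = (k + s)%N by exists (m - s)%N; rewrite subnK.
have e1 : (m - s = k)%N by lia.
have e2 : (m - k = s)%N by lia.
have e3 : (2 * m - s = 2 * k + s)%N by lia.
have e4 : (2 * m - 2 * s = 2 * k)%N by lia.
have e5 : (2 * k + s = m + k)%N by lia.
have PP := pow_part p k s; rewrite -mk in PP.
have pE T n : \prod_(j < n) ((1 - T * q ^+ j) / (1 - q ^+ j.+1)) = qpoch T q n / qpoch q q n := phi_qpoch q T n.
rewrite !pE e1 e2 e3 /eps e4 /epsk -[(-1) ^+ s * _ * _]mulrA PP.
rewrite e5; rewrite [qpoch t q (m + k).+1]qpochSl.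
have qq n : qpoch q q n != 0 by apply: qpoch_nz => i; rewrite -exprS.
have t1 : 1 - t != 0 by have := tq1 0; rewrite expr0z mulr1.
apply: formula_term => //; apply: qpoch_nz => // i.
by rewrite [q * t]mulrC -mulrA -exprS; exact: (tq1 i.+1%:Z).
Qed.

End Formula.
End SuperFormula.

Module KnotValue.
Import Weights GroupAlgebraTheory MinimalElement ReducedWord Generators DahaRelations BraidWords LaurentOperators PolynomialRep Evaluation ModularAction PowerSeries OneRow WeightedSums KnotVector RogersPairing Symmetrizer TwoRow ScalarSums SuperFormula.

Lemma pow_swap (F : fieldType) (a : F) (j k : nat) : (a ^ (2 * k%:Z)) ^+ j = ((a ^+ 2) ^+ j) ^+ k.
Proof.
have -> : 2 * k%:Z = (2 * k)%N%:Z by [].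
by rewrite -!exprM; congr (_ ^+ _); lia.
Qed.

Lemma lvEg_alg (F : fieldType) (b c d w l : F) : 1 - c != 0 -> 1 - b != 0 -> (1 - b) * l = w * d ->
  (1 - b) / (1 - c) * l = w *: (d / (1 - c) : F^o).
Proof. by move=> h1 h2 E; rewrite mulrAC E -mulrA. Qed.

Lemma Etb_alg (F : fieldType) (x y z w : F) : z != 0 -> y != 0 -> x^-1 = z^-1 * y^-1 ->
  y^-1 * w = x^-1 * (w * z).
Proof. by move=> z0 y0 ->; field; rewrite z0 y0. Qed.

Lemma value_alg (F : fieldType) (C S W w w2 f : F) : w * w = w2 -> w != 0 -> 
  C * (w2 * W * S) / (w * f) = C * W * w * (S / f).
Proof. by move=> <- w0; rewrite -[RHS]mulr1 -(mulfV w0) invfM; ring. Qed.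

Lemma term_alg (F : comPzRingType) (a b c e f g h : F) :
  a * b * c * (e * f * (g * h)) = g * e * (a * b * c * f * h).
Proof. ring. Qed.

Lemma EX_alg (F : fieldType) (a b c : F) : a * (b * c) = c *: (a * b : F^o).
Proof. by rewrite mulrA mulrC. Qed.

Section Value.
Variable N : nat.
Hypothesis N0 : (0 < N)%N.
Variable D : daha N.
Variable L : comAlgType coefField.
Variables (X : wt N -> L) (sv : 'I_N.+1 -> L -> L) (pv : L -> L).
Variables (lv : L -> coefField) (emb : L -> daha_alg D) (act : daha_alg D -> L -> L).
Hypothesis rep : rep_spec X sv pv lv emb act.
Hypothesis Hpi : forall m f, (0 < m)%N -> @symm N L sv f -> eN ^+ (2 * m) *: pv f = f -> f = 0.
Local Notation q := (q N).
Local Notation g := (g X).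
Local Notation tb := (tb emb act).
Local Notation Rds := (Rds X).
Local Notation Etb := (Etb N).
Local Notation A := (t ^+ N.+1).
Local Notation qn1 := (qn_neq1 N0).
Local Notation qn0 := (q_neq0 N).

Lemma lv_pow f j : lv (f ^+ j) = lv f ^+ j.
Proof. by elim: j => [|j IH]; rewrite ?(lv1 rep) // !exprS (lvM rep) IH. Qed.

Lemma lv_sum (I : Type) (r : seq I) (P : pred I) (G : I -> L) :
  lv (\sum_(i <- r | P i) G i) = \sum_(i <- r | P i) lv (G i).
Proof. exact: (big_morph lv (lvD rep) (lv0 rep)). Qed.

Lemma lv_psum j : (1 - t ^+ j.+1) * lv (psum X j.+1) = v ^- N ^+ j.+1 * (1 - A ^+ j.+1).
Proof.
rewrite /psum lv_sum; have E (k : 'I_N.+1) : lv (X (we k) ^+ j.+1) = v ^- N ^+ j.+1 * (t ^+ j.+1) ^+ k.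
  rewrite lv_pow (rlvX rep) lev_we expfzDr ?v_neq0 // exprMn mulrC -exprnN; congr (_ * _).
  exact: pow_swap.
rewrite (eq_bigr _ (fun k _ => E k)) -mulr_sumr mulrCA; congr (_ * _).
by rewrite -subrX1_geom exprAC.
Qed.

Lemma tn_neq1 j : 1 - t ^+ j.+1 != 0.
Proof.
rewrite subr_eq0 eq_sym; have := qt_neq1 N0 (a := 0) (b := j.+1); rewrite expr0z mul1r; apply.
by right.
Qed.

Lemma lv_g a : lv (g a) = (v ^- N) ^ a * phi q A a.
Proof.
have vN : v ^- N != 0 by rewrite invr_neq0 // expf_neq0 ?v_neq0.
have dF := ld_sc vN (ld_phi A coefField_char0 qn0 qn1).
suff dG : ld (fun j => lv (Eg X j) : coefField^o) (fun a => lv (g a) : coefField^o).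
  have := congr1 (fun f => f a) (ld_uniq coefField_char0 dG dF _); apply=> j.
  rewrite /Eg (lvZ rep) /=.
  have := lv_psum j; have := tn_neq1 j; have := qn1 j.
  move: (t ^+ j.+1) (q ^+ j.+1) (A ^+ j.+1) (v ^- N ^+ j.+1) (lv _) => b c d w l.
  exact: lvEg_alg.
have dg := ld_g X; split=> [n||n].
- by rewrite (ld_nn dg) (lv0 rep).
- by rewrite (ld_0 dg) (lv1 rep).
have lvn f k : lv (f *+ k) = lv f *+ k.
  by elim: k => [|k IH]; rewrite ?(lv0 rep) // !mulrS (lvD rep) IH.
by rewrite -lvn (ld_rec dg) lv_sum; apply: eq_bigr => j _; rewrite (lvM rep).
Qed.

Lemma lv_R d s : (2 * s <= d)%N -> lv (Rds d s) = (v ^- N) ^+ d * eps q t A d s.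
Proof.
have vN : v ^- N != 0 by rewrite invr_neq0 // expf_neq0 ?v_neq0.
apply: (@EX_inj coefField q t qn0 qn1 (tq_neq1 N0) coefField^o d (fun s => lv (Rds d s)) (fun s => (v ^- N) ^+ d * eps q t A d s)) => s' sd.
rewrite -[LHS](EX_lin q t (f := lv : L -> coefField^o)); last exact: (rlvL rep).
rewrite -(g_exp N0 X) (lvM rep) !lv_g.
have ab : s'%:Z + (d%:Z - s'%:Z) = d%:Z by lia.
rewrite mulrACA -expfzDr // ab -exprnP (eps_exp qn0 t_neq0 qn1 (tq_neq1 N0) A ab).
by rewrite /EXn mulr_sumr; apply: eq_bigr => i _; exact: EX_alg.
Qed.

Lemma tb_iter p d s : (2 * s <= d)%N -> iter p tb (Rds d s) = Etb d s ^+ p *: Rds d s.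
Proof.
move=> sd; elim: p => [|p IH]; first by rewrite scale1r.
by rewrite iterS IH (tbZ N0 rep) (tb_R N0 rep sd) scalerA -exprSr.
Qed.

Lemma linear_cv (f : L -> coefField) m (z : nat -> coefField) :
  (forall a x y, f (a *: x + y) = a * f x + f y) ->
  (forall s, (s <= m)%N -> f (Rds (2 * m) s) = z s) ->
  f (cv X m) = Cm N m * \sum_(s < m.+1) ((-1) ^+ s * eta N ^+ (s * (2 * (m - s) + 1 + s)) * phi q t (m - s)%N) * z s.
Proof.
move=> fL fR.
have f0 : f 0 = 0 by have := fL (-1) 0 0; rewrite scaler0 addr0 mulN1r addNr.
have fZ a x : f (a *: x) = a * f x by rewrite -[a *: x]addr0 fL f0 addr0.
have fD x y : f (x + y) = f x + f y by rewrite -[x]scale1r fL mul1r scale1r.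
rewrite /cv csE fZ; congr (_ * _).
rewrite /wsum (big_morph f fD f0).
transitivity (\sum_(s < m.+1) \sum_(a < (2 * m).+1) wt0 (eta N) (2 * m) a%:Z *
    (phi q t (a%:Z - s%:Z) * phi q t ((2 * m)%N%:Z - a%:Z - s%:Z)) * z s).
  rewrite exchange_big /=; apply: eq_bigr => a _; rewrite fZ (g_exp N0 X (2 * m) a%:Z).
  have fl : forall a x y, f (a *: x + y) = (a : coefField) *: (f x : coefField^o) + f y by exact: fL.
  rewrite [f _](EX_lin q t (f := f : L -> coefField^o) (2 * m) (Rds (2 * m)) a%:Z fl).
  rewrite /EX mulr_sumr.
  pose G (s : nat) : coefField := wt0 (eta N) (2 * m) a%:Z *
    (phi q t (a%:Z - s%:Z) * phi q t ((2 * m)%N%:Z - a%:Z - s%:Z) * f (Rds (2 * m) s)).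
  transitivity (\sum_(s < (2 * m).+1) G s); first by [].
  rewrite -(big_mkord xpredT G) (@big_cat_nat _ _ _ m.+1) //=; last by lia.
  rewrite [X in _ + X]big_nat_cond [X in _ + X]big1 ?addr0; last first.
    by move=> i /andP[/andP[i1 _] _]; rewrite /G (phi2_0 t qn0) ?mul0r ?mulr0 //; lia.
  by rewrite big_mkord; apply: eq_bigr => s _; rewrite /G fR 1?mulrA //; have := ltn_ord s; lia.
apply: eq_bigr => s _; rewrite -mulr_suml; congr (_ * _).
have sm : (s <= m)%N by have := ltn_ord s; lia.
exact: (w_shift qn0 t_neq0 qn1 (tq_neq1 N0) (q_eta N) (coefField_char0 1) sm).
Qed.

Lemma Etb_rel m s : (s <= m)%N ->
  Etb (2 * m) s = Etb (2 * m) 0 * (t ^+ s * q ^+ (s * (2 * m - s))).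
Proof.
move=> sm; rewrite /Etb expr0 mulr1 subn0 -!mulrA; congr (_ * (_ * _)).
have E : ('C(2 * m, 2) + 'C(0, 2) = s * (2 * m - s) + ('C(2 * m - s, 2) + 'C(s, 2)))%N.
  have [r mr] : exists r, m = (s + r)%N by exists (m - s)%N; rewrite subnKC.
  have -> : (2 * m - s = s + 2 * r)%N by lia.
  have -> : (2 * m = s + (s + 2 * r))%N by lia.
  rewrite !bin2 /= addn0.
  have D2 n : (n * n.-1)./2.*2 = (n * n.-1)%N.
    by case: n => // n; rewrite /= even_halfK //= oddM /= andNb.
  have inj a b : a.*2 = b.*2 -> a = b by lia.
  apply: inj; rewrite !doubleD !D2; case: (s) => [|s']; case: (r) => [|r']; rewrite /=; lia.
have h1 := expf_neq0 (s * (2 * m - s)) qn0.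
have h2 := expf_neq0 ('C(2 * m - s, 2) + 'C(s, 2)) qn0.
by apply: Etb_alg h1 h2 _; rewrite E exprD invfM.
Qed.

Lemma value p m (s : seq letter) : (0 < m)%N ->
  word_mx s 0%R 0%R = (2 * p + 1)%N%:Z -> word_mx s 1%R 0%R = 2%:Z ->
  lv (act (word_map s (emb (g m))) 1) / lv (g m) =
    Cm N m * Etb (2 * m) 0 ^+ p * v ^- N ^+ m * superformula (eta N) v (- A) p m.
Proof.
move=> m0 s0 s1; rewrite (word_value_tb N0 rep (g m) s0 s1).
have -> : act (dtau D ((dphi D \o dtau D \o dphi D) (emb (g m)))) 1 = cv X m.
  have [E _ _] := solution N0 rep Hpi m; by rewrite -E (vvE X emb act).
have tl := tb_lin N0 rep.
have il : forall a x y, lv (iter p tb (a *: x + y)) = a * lv (iter p tb x) + lv (iter p tb y).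
  by move=> a x y; rewrite -(rlvL rep); congr lv; elim: p {s0} => // p IH; rewrite !iterS IH tl.
rewrite (@linear_cv (fun x => lv (iter p tb x)) m (fun s => Etb (2 * m) s ^+ p * (v ^- N ^+ (2 * m) * eps q t A (2 * m) s)) il); last first.
  by move=> s' sm; rewrite tb_iter ?(lvZ rep) ?lv_R //; lia.
have q1' : forall n : nat, 1 - (eta N ^+ 2) ^+ n.+1 != 0 by move=> n; rewrite -(q_eta N); exact: qn1.
have tq1' : forall k : int, 1 - v ^+ 2 * (eta N ^+ 2) ^ k != 0 by move=> k; rewrite -(q_eta N); exact: tq_neq1.
have A1 n : 1 - A * (eta N ^+ 2) ^+ n != 0.
  rewrite -(q_eta N) subr_eq0 eq_sym mulrC; have := qt_neq1 N0 (a := n%:Z) (b := N.+1%:Z).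
  by rewrite -!exprnP; apply; right.
rewrite (superformulaE (eta_neq0 N) q1' tq1' A1) -!(q_eta N) -[v ^+ 2]/t lv_g -exprnP.
rewrite (eq_bigr (fun s : 'I_m.+1 => v ^- N ^+ (2 * m) * Etb (2 * m) 0 ^+ p * (((-1) ^+ s * eta N ^+ (s * (2 * (m - s) + 1 + s)) * phi q t (m - s)%N) *
     (t ^+ s * q ^+ (s * (2 * m - s))) ^+ p * eps q t A (2 * m) s))).
  rewrite -mulr_sumr; apply: value_alg; last by rewrite expf_neq0 // invr_neq0 // expf_neq0 ?v_neq0.
  by rewrite -exprD addnn mul2n.
move=> i _; have im : (i <= m)%N by have := ltn_ord i; lia.
rewrite (Etb_rel im) exprMn.
exact: term_alg.
Qed.

End Value.
End KnotValue.

Module PiFixed.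
Import Weights GroupAlgebraTheory MinimalElement ReducedWord Generators DahaRelations BraidWords LaurentOperators PolynomialRep Evaluation ModularAction PowerSeries OneRow WeightedSums KnotVector.

Section PiOrder.
Variable N : nat.
Hypothesis N0 : (0 < N)%N.
Variable D : daha N.
Variable L : comAlgType coefField.
Variables (X : wt N -> L) (sv : 'I_N.+1 -> L -> L) (pv : L -> L).
Variables (lv : L -> coefField) (emb : L -> daha_alg D) (act : daha_alg D -> L -> L).
Hypothesis rep : rep_spec X sv pv lv emb act.

Lemma iter_pvL n a f g : iter n pv (a *: f + g) = a *: iter n pv f + iter n pv g.
Proof. by elim: n => // n IH; rewrite !iterS IH (rpvL rep). Qed.

Lemma iter_pvM n f g : iter n pv (f * g) = iter n pv f * iter n pv g.
Proof. by elim: n => // n IH; rewrite !iterS IH (rpvM rep). Qed.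

Lemma iter_pv0 n : iter n pv 0 = 0.
Proof. by have := iter_pvL n (-1) 0 0; rewrite scaler0 addr0 scaleN1r addNr. Qed.

Lemma iter_pvZ n a f : iter n pv (a *: f) = a *: iter n pv f.
Proof. by have := iter_pvL n a f 0; rewrite iter_pv0 !addr0. Qed.

Lemma iter_pv1 n : iter n pv 1 = 1.
Proof. by elim: n => // n IH; rewrite iterS IH (rm1 (rm_pv rep)). Qed.

Lemma iter_pv_xn j k : (k + j <= N)%N -> iter j pv (xn X k) = u ^+ (2 * j) *: xn X (k + j).
Proof.
elim: j => [|j IH] kj; first by rewrite muln0 expr0 scale1r addn0.
rewrite iterS IH; last by lia.
rewrite (pvZ rep) (pv_xk N0 rep); last by lia.
by rewrite scalerA -exprD -addnS mulnS addnC.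
Qed.

Lemma iter_pv_we k : iter N.+1 pv (X (we k)) = X (we k).
Proof.
have -> : X (we k) = xn X k by rewrite /xn inord_val.
have kN : (k <= N)%N by have := ltn_ord k; lia.
have -> : iter N.+1 pv (xn X k) = iter (k + (N - k).+1) pv (xn X k) by congr (iter _ pv _); lia.
rewrite iterD iterS iter_pv_xn; last by lia.
have -> : (k + (N - k) = N)%N by lia.
have -> : xn X N = X (we ord_max) by rewrite /xn; congr (X (we _)); apply/val_inj; rewrite /= inordK.
rewrite (pvZ rep) (pv_xmax rep) !iter_pvZ.
have -> : x X = xn X 0 by rewrite /xn /x; congr (X (we _)); apply/val_inj; rewrite /= inordK.
rewrite iter_pv_xn // add0n !scalerA.
have u0 := expf_neq0 (2 * N) u_neq0.
by rewrite mulrAC -exprD -mulnDr subnK // mulfV // scale1r.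
Qed.

Lemma iter_pv_X b : iter N.+1 pv (X b) = X b.
Proof.
pose Q c := iter N.+1 pv (X c) = X c.
have QD c c' : Q c -> Q c' -> Q (c + c') by rewrite /Q => h h'; rewrite (rXD rep) iter_pvM h h'.
have Q0 : Q 0 by rewrite /Q (rX0 rep) iter_pv1.
have QN c : Q c -> Q (- c).
  rewrite /Q => h; have E : X c * iter N.+1 pv (X (- c)) = 1.
    by rewrite -{1}h -iter_pvM -(rXD rep) subrr (rX0 rep) iter_pv1.
  have E' : X (- c) * X c = 1 by rewrite -(rXD rep) addNr (rX0 rep).
  by rewrite -[LHS]mul1r -E' -mulrA E mulr1.
have QZ (c' : wt N) n : Q c' -> Q (c' *+ n).
  by move=> h; elim: n => [|n IH]; [rewrite mulr0n|rewrite mulrS; exact: QD].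
rewrite -(wtE_eps b) wtE_we; elim/big_rec: _ => // k c _; apply: QD.
case: (eps b k) => n; first exact: QZ (iter_pv_we k).
by rewrite NegzE mulrNz; apply: QN; exact: QZ (iter_pv_we k).
Qed.

Lemma pv_order f : iter N.+1 pv f = f.
Proof.
elim/(rLind rep): f => [|f g Ef Eg|a b]; first exact: iter_pv0.
  by have := iter_pvL N.+1 1 f g; rewrite !scale1r Ef Eg.
by rewrite iter_pvZ iter_pv_X.
Qed.

Lemma pv_fixed m f : (0 < m)%N -> eN ^+ (2 * m) *: pv f = f -> f = 0.
Proof.
move=> m0 E.
have En n : eN ^+ (2 * m * n) *: iter n pv f = f.
  elim: n => [|n IH]; first by rewrite muln0 expr0 scale1r.
  by rewrite mulnS exprD -scalerA iterS -(pvZ rep) IH.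
have := En N.+1; rewrite pv_order => EN; apply/eqP.
have : (eN ^+ (2 * m * N.+1) - 1) *: f = 0 by rewrite scalerBl scale1r EN subrr.
move/eqP; rewrite scaler_eq0 subr_eq0 => /orP[/eqP E1|//].
have := @uv_inj (- (4 * m * N.+1)%N%:Z) 0; case=> [|]; last by lia.
rewrite expr0z mulr1 -exprnN -E1 /eN exprVn -exprM; congr (_ ^- _); lia.
Qed.
End PiOrder.
End PiFixed.

Module OriginIdeal.
Import Weights GroupAlgebraTheory.

Local Notation "x %:F" := (@tofrac _ x).

Section Fractions.
Variable R : idomainType.

Lemma frac_denom (x : {fraction R}) : exists2 d : R, d != 0 & exists n : R, d%:F * x = n%:F.
Proof.
elim/generic_quotient.quotW: x => r; exists (frac r).2; first exact: denom_ratioP.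
exists (frac r).1; unlock tofrac; rewrite !piE; apply/generic_quotient.eqmodP.
by rewrite /= FracField.equivfE /FracField.mulf !numden_Ratio ?mulr1 ?mul1r ?oner_eq0 ?mulf_neq0 ?oner_eq0 ?denom_ratioP //= mulrC.
Qed.
End Fractions.

Section LowCoefs.
Variable R : nzRingType.
Lemma low_mul (p q : {poly R}) i k : (forall a, (a < i)%N -> p`_a = 0) ->
  (forall b, (b < k)%N -> q`_b = 0) -> (p * q)`_(i + k) = p`_i * q`_k.
Proof.
move=> pi qk; rewrite poly.coefM; have ik : (i < (i + k).+1)%N by lia.
rewrite (bigD1 (Ordinal ik)) //= addKn big1 ?addr0 // => -[a /= ai]; rewrite -val_eqE /= => ne.
have [l|l] := ltnP a i; first by rewrite pi ?mul0r.
by rewrite qk ?mulr0 //; lia.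
Qed.

Lemma low_exists (p : {poly R}) : p != 0 -> exists2 i, p`_i != 0 & forall a, (a < i)%N -> p`_a = 0.
Proof.
move=> p0; have ex : exists i, p`_i != 0 by exists (size p).-1; rewrite -lead_coefE lead_coef_eq0.
exists (ex_minn ex); first by case: ex_minnP.
case: ex_minnP => i _ mi a ai; apply/eqP; apply: contraTT ai => /mi; lia.
Qed.
End LowCoefs.

Definition lexz (p : coefRing) i j :=
  (forall a, (a < i)%N -> p`_a = 0) /\ (forall b, (b < j)%N -> p`_i`_b = 0).

Lemma lexz00 p : lexz p 0 0. Proof. by []. Qed.

Lemma lex_mul p q i j k l : lexz p i j -> lexz q k l ->
  (p * q)`_(i + k)`_(j + l) = p`_i`_j * q`_k`_l.
Proof. by move=> [h1 h2] [h3 h4]; rewrite low_mul // low_mul. Qed.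

Lemma lex_exists p : p != 0 -> exists i j, lexz p i j /\ p`_i`_j != 0.
Proof. by case/low_exists => i pi hi; case/low_exists: (pi) => j pj hj; exists i, j. Qed.

Definition isint (x : coefField) := exists p : coefRing, x = p%:F.
Definition Jp M k (x : coefField) := exists2 p : coefRing, x = p%:F &
  forall i j, (i < M)%N -> (j < M)%N -> (i + j < k)%N -> p`_i`_j = 0.

Lemma isint1 : isint 1. Proof. by exists 1; rewrite tofrac1. Qed.
Lemma isint0 : isint 0. Proof. by exists 0; rewrite tofrac0. Qed.
Lemma isintD x y : isint x -> isint y -> isint (x + y).
Proof. by move=> [p ->] [p' ->]; exists (p + p'); rewrite tofracD. Qed.
Lemma isintM x y : isint x -> isint y -> isint (x * y).
Proof. by move=> [p ->] [p' ->]; exists (p * p'); rewrite tofracM. Qed.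
Lemma isintN x : isint x -> isint (- x).
Proof. by move=> [p ->]; exists (- p); rewrite tofracN. Qed.
Lemma isintX x n : isint x -> isint (x ^+ n).
Proof. by move=> [p ->]; exists (p ^+ n); rewrite tofracXn. Qed.
Lemma isint_u : isint u. Proof. by exists 'X. Qed.
Lemma isint_v : isint v. Proof. by exists ('X)%:P. Qed.

Section Ideal.
Variable M : nat.
Local Notation J := (Jp M).

Lemma J_int k x : J k x -> isint x. Proof. by case=> p -> _; exists p. Qed.
Lemma int_J0 x : isint x -> J 0 x. Proof. by case=> p ->; exists p. Qed.
Lemma J_mono k l x : (k <= l)%N -> J l x -> J k x.
Proof. by move=> kl [p -> h]; exists p => // i j *; apply: h => //; lia. Qed.
Lemma J_0 k : J k 0.
Proof. by exists 0; rewrite ?tofrac0 // => i j; rewrite !coef0. Qed.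
Lemma J_D k x y : J k x -> J k y -> J k (x + y).
Proof.
move=> [p -> h] [p' -> h']; exists (p + p'); first by rewrite tofracD.
by move=> i j *; rewrite !coefD h // h' // addr0.
Qed.
Lemma J_N k x : J k x -> J k (- x).
Proof.
move=> [p -> h]; exists (- p); first by rewrite tofracN.
by move=> i j *; rewrite !coefN h // oppr0.
Qed.
Lemma J_B k x y : J k x -> J k y -> J k (x - y).
Proof. by move=> h h'; apply: J_D => //; apply: J_N. Qed.
Lemma J_sum k (I : Type) (r : seq I) (P : pred I) (F : I -> coefField) :
  (forall i, P i -> J k (F i)) -> J k (\sum_(i <- r | P i) F i).
Proof. by move=> h; elim/big_rec: _ => [|i x Pi Jx]; [exact: J_0|apply: J_D => //; exact: h]. Qed.
Lemma J_M k l x y : J k x -> J l y -> J (k + l) (x * y).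
Proof.
move=> [p -> h] [p' -> h']; exists (p * p'); first by rewrite tofracM.
move=> i j iM jM ij; rewrite poly.coefM coef_sum big1 // => -[a /= ai] _.
rewrite poly.coefM big1 // => -[b /= bj] _.
have [l1|l1] := ltnP (a + b) k; first by rewrite h ?mul0r //; lia.
by rewrite h' ?mulr0 //; lia.
Qed.
Lemma J_Ml k x y : isint x -> J k y -> J k (x * y).
Proof. by move=> /int_J0 h h'; have := J_M h h'. Qed.
Lemma J_X k x n : J k x -> J (k * n) (x ^+ n).
Proof.
move=> h; elim: n => [|n IH]; first by rewrite muln0; apply: int_J0; exact: isint1.
by rewrite mulnS exprS; apply: J_M.
Qed.
Lemma J_u : J 1 u.
Proof.
exists 'X => // i j _ _; rewrite ltnS leqn0 addn_eq0 => /andP[/eqP-> /eqP->].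
by rewrite coefX /= coef0.
Qed.
Lemma J_v : J 1 v.
Proof.
exists ('X)%:P => // i j _ _; rewrite ltnS leqn0 addn_eq0 => /andP[/eqP-> /eqP->].
by rewrite coefC /= coefX.
Qed.
Lemma J_uM k n : (M <= n)%N -> J k (u ^+ n).
Proof.
move=> Mn; exists ('X^n); first by rewrite tofracXn.
move=> i j iM _ _; rewrite coefXn; have -> : (i == n) = false by lia.
by rewrite coef0.
Qed.
Lemma J_vM k n : (M <= n)%N -> J k (v ^+ n).
Proof.
move=> Mn; exists (('X^n)%:P); first by rewrite rmorphXn /= tofracXn.
move=> i j _ jM _; rewrite coefC; case: eqP => _; last by rewrite coef0.
by rewrite coefXn; have -> : (j == n) = false by lia.
Qed.
Lemma J_t k x : J k x -> J k.+1 (t * x).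
Proof.
move=> h; have := J_M (J_X 2 J_v) h; rewrite mul1n => h'; exact: J_mono h'.
Qed.
Lemma isint_rat (c : rat) : isint (c%:P%:P%:F). Proof. by exists c%:P%:P. Qed.

Lemma half_add : ((2^-1 : rat)%:P%:P : coefRing)%:F * (1 + 1) = 1.
Proof. by rewrite -tofrac1 -tofracD -tofracM; congr (_%:F); rewrite -!polyC1 -!polyCD -!polyCM; congr (_%:P%:P). Qed.

Lemma J_half k x : J k (x + x) -> J k x.
Proof.
move=> /(J_Ml (isint_rat (2^-1 : rat))).
by rewrite -[in x + x](mul1r x) -mulrDl mulrA half_add mul1r.
Qed.

End Ideal.

Section Denominators.
Variables (P : zmodType).
Local Notation A := (galg P coefField).

Lemma den_galg (f : A) : exists2 D : coefRing, D != 0 & forall b, isint (D%:F * f@_b).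
Proof.
elim/galg_ind: f => [|f g [D D0 hD] [E E0 hE]|k b].
- by exists 1; rewrite ?oner_neq0 // => b; rewrite mcoeff0 mulr0; exact: isint0.
- exists (D * E) => [|b]; first by rewrite mulf_neq0.
  rewrite mcoeffD mulrDr tofracM; apply: isintD.
    by rewrite mulrAC mulrC; apply: isintM; [exists E | exact: hD].
  by rewrite -mulrA; apply: isintM; [exists D | exact: hE].
have [d d0 [n E]] := frac_denom k.
exists d => // c; rewrite mcoeffZ gX_coef mulrA E; apply: isintM; first by exists n.
by case: (b == c); [exact: isint1|exact: isint0].
Qed.

Lemma den_seq (F : nat -> A) m : exists2 D : coefRing, D != 0 & forall a b, (a <= m)%N -> isint (D%:F * (F a)@_b).
Proof.
elim: m => [|m [D D0 hD]].
  by have [D D0 hD] := den_galg (F 0%N); exists D => // -[].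
have [E E0 hE] := den_galg (F m.+1); exists (D * E) => [|a b]; first by rewrite mulf_neq0.
rewrite tofracM leq_eqVlt => /orP[/eqP ->|am].
  by rewrite -mulrA; apply: isintM; [exists D | exact: hE].
by rewrite mulrAC mulrC; apply: isintM; [exists E | exact: hD].
Qed.

Definition cJ M k (f : A) := forall b, Jp M k f@_b.

Lemma cJ_M M k l f g : cJ M k f -> cJ M l g -> cJ M (k + l) (f * g).
Proof. by move=> h h' b; rewrite coefM; apply: J_sum => c _; exact: J_M. Qed.
Lemma cJ_M0 M k f g : cJ M 0 f -> cJ M k g -> cJ M k (f * g).
Proof. exact: cJ_M. Qed.
Lemma cJ_0M M k f g : cJ M k f -> cJ M 0 g -> cJ M k (f * g).
Proof. by move=> h h'; have := cJ_M h h'; rewrite addn0. Qed.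
Lemma cJ_D M k f g : cJ M k f -> cJ M k g -> cJ M k (f + g).
Proof. by move=> h h' b; rewrite mcoeffD; apply: J_D. Qed.
Lemma cJ_N M k f : cJ M k f -> cJ M k (- f).
Proof. by move=> h b; rewrite mcoeffN; apply: J_N. Qed.
Lemma cJ_B M k f g : cJ M k f -> cJ M k g -> cJ M k (f - g).
Proof. by move=> h h'; apply: cJ_D => //; apply: cJ_N. Qed.
Lemma cJ_Z M k a f : isint a -> cJ M k f -> cJ M k (a *: f).
Proof. by move=> h h' b; rewrite mcoeffZ; apply: J_Ml. Qed.
Lemma cJ_ZJ M k a f : Jp M k a -> cJ M 0 f -> cJ M k (a *: f).
Proof. by move=> h h' b; rewrite mcoeffZ; have := J_M h (h' b); rewrite addn0. Qed.
Lemma cJ_gX M b : cJ M 0 (gX coefField b : A).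
Proof. by move=> c; apply: int_J0; rewrite gX_coef; case: (b == c); [exact: isint1|exact: isint0]. Qed.
Lemma cJ_1 M : cJ M 0 (1 : A). Proof. exact: cJ_gX 0. Qed.
Lemma cJ_0 M k : cJ M k (0 : A). Proof. by move=> b; rewrite mcoeff0; exact: J_0. Qed.
Lemma cJ_X M k f n : cJ M k f -> cJ M (k * n) (f ^+ n).
Proof. by move=> h; elim: n => [|n IH]; [rewrite muln0; exact: cJ_1|rewrite mulnS exprS; exact: cJ_M]. Qed.
Lemma cJ_sum M k (I : Type) (r : seq I) (Q : pred I) (F : I -> A) :
  (forall i, Q i -> cJ M k (F i)) -> cJ M k (\sum_(i <- r | Q i) F i).
Proof. by move=> h; elim/big_rec: _ => [|i x Pi Jx]; [exact: cJ_0|apply: cJ_D => //; exact: h]. Qed.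
Lemma cJ_prod M (I : Type) (r : seq I) (Q : pred I) (F : I -> A) :
  (forall i, Q i -> cJ M 0 (F i)) -> cJ M 0 (\prod_(i <- r | Q i) F i).
Proof. by move=> h; elim/big_rec: _ => [|i x Pi Jx]; [exact: cJ_1|apply: cJ_M0 => //; exact: h]. Qed.
Lemma cJ_mono M k l f : (k <= l)%N -> cJ M l f -> cJ M k f.
Proof. by move=> kl h b; apply: J_mono (h b). Qed.
End Denominators.
End OriginIdeal.

Module MacdonaldWeight.
Import Weights GroupAlgebraTheory MinimalElement ReducedWord Generators DahaRelations BraidWords LaurentOperators PolynomialRep Evaluation ModularAction PowerSeries OneRow KnotVector OriginIdeal.

Section Pairs.
Variables (n : nat) (s : {perm 'I_n}).
Implicit Types p : 'I_n * 'I_n.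
Definition sortp p := if (p.1 < p.2)%N then p else (p.2, p.1).
Definition permp p := sortp (s p.1, s p.2).

Lemma prod_permp (R : comNzRingType) (G : 'I_n * 'I_n -> R) :
  \prod_(p : 'I_n * 'I_n | (p.1 < p.2)%N) G p = \prod_(p : 'I_n * 'I_n | (p.1 < p.2)%N) G (permp p).
Proof.
pose h' p := sortp ((s^-1)%g p.1, (s^-1)%g p.2).
rewrite (reindex_onto permp h') /=.
  apply: eq_bigl => -[a b]; rewrite /permp /h' /sortp /=.
  have ne (c d : 'I_n) : (c < d)%N || (d < c)%N || (c == d).
    by case: (ltngtP c d) => // /eqP.
  
  case: (ltnP (s a) (s b)) => /= h; rewrite !permK /=.
    rewrite h /=; case: (ltngtP a b) => [//|ba|ab]; rewrite ?eqxx //.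
      by rewrite -pair_eqE /pair_eq /=; apply/negP => /andP[/eqP E _]; move: ba; rewrite E ltnn.
    by move: h; rewrite (val_inj ab) ltnn.
  have [ba|ba|ba] := ltngtP b a.
  - have -> : (s b < s a)%N.
      by rewrite ltn_neqAle h andbT; apply: contraTneq ba => /val_inj/perm_inj ->; rewrite ltnn.
    by rewrite -pair_eqE /pair_eq /= andbC; apply/negP => /andP[/eqP E _]; move: ba; rewrite E ltnn.
  - have -> : (s b < s a)%N.
      by rewrite ltn_neqAle h andbT; apply: contraTneq ba => /val_inj/perm_inj ->; rewrite ltnn.
    by rewrite eqxx.
  by rewrite (val_inj ba) ltnn.
move=> [a b] /= ab; rewrite /permp /h' /sortp /=.
case: (ltnP ((s^-1)%g a) ((s^-1)%g b)) => /= h; rewrite !permKV /= ?ab //.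
by rewrite ltnNge (ltnW ab).
Qed.
End Pairs.

Lemma geo_recl (R : comPzRingType) (z : R) n : (0 < n)%N ->
  \sum_(k < n) z ^+ k = 1 + z * \sum_(k < n.-1) z ^+ k.
Proof.
case: n => // n _; rewrite big_ord_recl expr0; congr (_ + _).
by rewrite mulr_sumr; apply: eq_bigr => i _; rewrite -exprS.
Qed.

Section Congruence.
Variables (K : fieldType) (L : comAlgType K) (int idl : L -> Prop).
Hypothesis int1 : int 1.
Hypothesis intB : forall f g, int f -> int g -> int (f - g).
Hypothesis intM : forall f g, int f -> int g -> int (f * g).
Hypothesis idlD : forall f g, idl f -> idl g -> idl (f + g).
Hypothesis idlN : forall f, idl f -> idl (- f).
Hypothesis idlM : forall f g, int f -> idl g -> idl (f * g).
Implicit Types (f g h : L).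

Definition eqI f g := idl (f - g).
Lemma eqI_sym f g : eqI f g -> eqI g f.
Proof. by move=> h; rewrite /eqI -opprB; apply: idlN. Qed.
Lemma eqI_trans g f h : eqI f g -> eqI g h -> eqI f h.
Proof. by move=> h1 h2; rewrite /eqI -(subrK g f) -addrA; apply: idlD. Qed.
Lemma eqI_M h f g : int h -> eqI f g -> eqI (h * f) (h * g).
Proof. by move=> h0 fg; rewrite /eqI -mulrBr; apply: idlM. Qed.
Lemma eqI_Mr h f g : int h -> eqI f g -> eqI (f * h) (g * h).
Proof. by move=> h0 fg; rewrite ![_ * h]mulrC; apply: eqI_M. Qed.
Lemma eqI_N f g : eqI f g -> eqI (- f) (- g).
Proof. by move=> fg; rewrite /eqI -opprD; apply: idlN. Qed.
Lemma int0 : int 0. Proof. by rewrite -(subrr 1); apply: intB. Qed.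
Lemma intN f : int f -> int (- f). Proof. by move=> h; rewrite -sub0r; apply: intB => //; exact: int0. Qed.
Lemma intD f g : int f -> int g -> int (f + g).
Proof. by move=> h h'; rewrite -[g]opprK; apply: intB => //; exact: intN. Qed.
Lemma intX f n : int f -> int (f ^+ n).
Proof. by move=> h; elim: n => // n IH; rewrite exprS; apply: intM. Qed.
Lemma int_sum n (F : 'I_n -> L) : (forall i, int (F i)) -> int (\sum_i F i).
Proof. by move=> h; elim/big_rec: _ => [|i x _]; [exact: int0|exact: intD]. Qed.
Lemma int_prod (I : Type) (r : seq I) (P : pred I) (F : I -> L) : (forall i, P i -> int (F i)) -> int (\prod_(i <- r | P i) F i).
Proof. by move=> h; elim/big_rec: _ => [|i x Pi ix]; [exact: int1|apply: intM => //; exact: h]. Qed.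

Variables (q t : K) (M : nat).
Hypothesis int_q : forall f, int f -> int (q *: f).
Hypothesis int_t : forall f, int f -> int (t *: f).
Hypothesis idl_qM : forall f, int f -> idl (q ^+ M *: f).
Hypothesis idl_tM : forall f, int f -> idl (t ^+ M *: f).

Lemma int_qX n f : int f -> int (q ^+ n *: f).
Proof. by move=> h; elim: n => [|n IH]; rewrite ?expr0 ?scale1r // exprS -scalerA; apply: int_q. Qed.

Definition gsum f := \sum_(k < M) f ^+ k.
Lemma int_gsum f : int f -> int (gsum f).
Proof. by move=> h; apply: int_sum => i; apply: intX. Qed.
Lemma gsum1 f : (1 - f) * gsum f = 1 - f ^+ M.
Proof. by rewrite subrX1_geom. Qed.

Definition muF f f' : L := \prod_(k < M)
  ((1 - q ^+ k *: f) * (1 - q ^+ k.+1 *: f') * gsum (t * q ^+ k *: f) * gsum (t * q ^+ k.+1 *: f')).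

Definition AA f := \prod_(k < M) (1 - q ^+ k *: f).
Definition BB f := \prod_(k < M) (1 - q ^+ k.+1 *: f).
Definition GA f := \prod_(k < M) gsum (t * q ^+ k *: f).
Definition GB f := \prod_(k < M) gsum (t * q ^+ k.+1 *: f).

Lemma int_1qX n f : int f -> int (1 - q ^+ n *: f).
Proof. by move=> h; apply: intB => //; apply: int_qX. Qed.
Lemma int_gs n f : int f -> int (gsum (t * q ^+ n *: f)).
Proof. by move=> h; apply: int_gsum; rewrite -scalerA; apply/int_t/int_qX. Qed.
Lemma int_AA f : int f -> int (AA f). Proof. by move=> h; apply: int_prod => k _; apply: int_1qX. Qed.
Lemma int_BB f : int f -> int (BB f). Proof. by move=> h; apply: int_prod => k _; apply: int_1qX. Qed.
Lemma int_GA f : int f -> int (GA f). Proof. by move=> h; apply: int_prod => k _; apply: int_gs. Qed.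
Lemma int_GB f : int f -> int (GB f). Proof. by move=> h; apply: int_prod => k _; apply: int_gs. Qed.

Lemma muF_split f f' : muF f f' = AA f * BB f' * GA f * GB f'.
Proof. by rewrite /muF !big_split. Qed.
Lemma int_muF f f' : int f -> int f' -> int (muF f f').
Proof.
move=> h h'; rewrite muF_split; do !apply: intM.
- exact: int_AA. - exact: int_BB. - exact: int_GA. - exact: int_GB.
Qed.

Lemma shift_prod (F : nat -> L) n : (\prod_(k < n) F k) * F n = F 0%N * \prod_(k < n) F k.+1.
Proof. by rewrite -(big_ord_recr n (fun k : 'I_n.+1 => F k)) big_ord_recl. Qed.

Lemma A_B f : int f -> eqI (AA f) ((1 - f) * BB f).
Proof.
move=> h; have := shift_prod (fun k => 1 - q ^+ k *: f) M; rewrite expr0 scale1r => <-.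
rewrite /eqI -[X in X - _]mulr1 -mulrBr opprB addrC subrK.
by apply: idlM; [exact: int_AA|exact: idl_qM].
Qed.

Lemma GA_GB f : int f -> eqI (GA f) (gsum (t *: f) * GB f).
Proof.
move=> h; have := shift_prod (fun k => gsum (t * q ^+ k *: f)) M; rewrite expr0 mulr1 => <-.
rewrite /eqI -[X in X - _]mulr1 -mulrBr.
apply: idlM; first exact: int_GA.
have [M0|M0] := posnP M.
  have /= := idl_qM int1; rewrite /gsum M0 expr0 scale1r big_ord0 subr0; exact.
rewrite /gsum (geo_recl _ M0) opprD addrA subrr add0r; apply: idlN.
rewrite [X in X * _](_ : _ = t *: (q ^+ M *: f)); last by rewrite scalerA.
rewrite mulrC -!scalerAr scalerA mulrC -scalerA; apply: idl_qM; apply: int_t.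
by apply: intM => //; apply: int_sum => i; apply: intX; rewrite -scalerA; apply/int_qX/int_t.
Qed.

Lemma Gt_inv f : int f -> eqI ((1 - t *: f) * gsum (t *: f)) 1.
Proof.
move=> h; rewrite gsum1 /eqI addrAC subrr add0r; apply: idlN.
by rewrite exprZn; apply: idl_tM; apply: intX.
Qed.

Lemma muF_eqI f f' : int f -> int f' ->
  eqI ((1 - t *: f) * muF f f') ((1 - f) * (BB f * BB f' * GB f * GB f')).
Proof.
move=> hf hf'; rewrite muF_split.
have i1 := int_BB hf; have i2 := int_BB hf'; have i3 := int_GB hf; have i4 := int_GB hf'.
have i5 := int_GA hf; have i6 : int (1 - t *: f) by apply: intB => //; apply: int_t.
have i7 : int (1 - f) by apply: intB.
apply: (@eqI_trans ((1 - t *: f) * BB f' * GA f * GB f' * ((1 - f) * BB f))).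
  have -> : (1 - t *: f) * (AA f * BB f' * GA f * GB f') = (1 - t *: f) * BB f' * GA f * GB f' * AA f by ring.
  by apply: eqI_M; [do !apply: intM|exact: A_B].
apply: (@eqI_trans ((1 - t *: f) * BB f' * GB f' * (1 - f) * BB f * (gsum (t *: f) * GB f))).
  rewrite [X in eqI X _](_ : _ = (1 - t *: f) * BB f' * GB f' * (1 - f) * BB f * GA f); last by ring.
  by apply: eqI_M; [do !apply: intM|exact: GA_GB].
rewrite [X in eqI X _](_ : _ = (1 - f) * (BB f * BB f' * GB f * GB f') * ((1 - t *: f) * gsum (t *: f))); last by ring.
by rewrite -[X in eqI _ X]mulr1; apply: eqI_M; [do !apply: intM|exact: Gt_inv].
Qed.

Lemma muF_refl f f' : int f -> int f' -> f * f' = 1 ->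
  eqI ((t%:A - f) * muF f' f) ((1 - t *: f) * muF f f').
Proof.
move=> hf hf' ff; apply: eqI_trans (eqI_sym (muF_eqI hf hf')).
have := eqI_N (eqI_M hf (muF_eqI hf' hf)).
set W := BB f' * _ * _ * _; set W' := BB f * _ * _ * _.
have -> : W' = W by rewrite /W /W'; ring.
have -> : - (f * ((1 - t *: f') * muF f' f)) = (t%:A - f) * muF f' f.
  by rewrite mulrA -mulNr mulrBr mulr1 -scalerAr ff opprB.
have -> : - (f * ((1 - f') * W)) = (1 - f) * W.
  by rewrite mulrA -mulNr mulrBr mulr1 ff opprB.
by [].
Qed.

End Congruence.

Section Mu.
Variables (N M : nat).
Local Notation L := (laurent N).
Local Notation q := (q N).
Implicit Types (f g h : L) (b : wt N).

Lemma sum_alpha (i j : 'I_N.+1) : (i < j)%N -> \sum_(i.+1 <= k < j.+1) alpha N k = we i - we j.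
Proof.
move=> ij; suff H (a b : nat) : (b <= N)%N -> (a <= b)%N ->
    \sum_(a.+1 <= k < b.+1) alpha N k = we (inord a : 'I_N.+1) - we (inord b).
  by have := H i j; rewrite !inord_val; apply; have := ltn_ord j; lia.
move: a b => {ij} {}i {}j; elim: j => [|j IH] jN ij.
  have -> : i = 0%N by lia.
  by rewrite big_geq ?subrr.
move: ij; rewrite leq_eqVlt => /orP[/eqP ->|ij]; first by rewrite big_geq // subrr.
have n0 : (inord j.+1 : 'I_N.+1) != ord0 by rewrite -val_eqE /= inordK.
rewrite big_nat_recr // IH /=; try lia.
have := alpha_we n0; rewrite !inordK //= => ->.
by rewrite addrA subrK.
Qed.

Local Notation muf := (muF q t M).

Lemma muE : mu N M = \prod_(p : 'I_N.+1 * 'I_N.+1 | (p.1 < p.2)%N) muf (LX (we p.1 - we p.2) : L) (LX (we p.2 - we p.1)).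
Proof.
rewrite /mu pair_big_dep /=; apply: eq_bigr => -[i j] /= ij.
rewrite (sum_alpha ij) (opprB (we i) (we j)); exact (erefl _).
Qed.

Definition cI f := forall k, cJ M k f.
Local Notation int := (cJ M 0).
Local Notation eqI := (eqI cI).

Lemma isint_q n : isint (q ^+ n). Proof. by apply/isintX/isintX/isint_u. Qed.
Lemma isint_t : isint t. Proof. exact/isintX/isint_v. Qed.

Lemma cI_D f g : cI f -> cI g -> cI (f + g). Proof. by move=> h h' k; apply: cJ_D. Qed.
Lemma cI_N f : cI f -> cI (- f). Proof. by move=> h k; apply: cJ_N. Qed.
Lemma cI_M f g : int f -> cI g -> cI (f * g). Proof. by move=> h h' k; apply: cJ_M0. Qed.
Lemma int_q f : int f -> int (q *: f). Proof. apply: cJ_Z; exact: isint_q 1%N. Qed.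
Lemma int_t f : int f -> int (t *: f). Proof. apply: cJ_Z; exact: isint_t. Qed.
Lemma cI_qM f : int f -> cI (q ^+ M *: f).
Proof. by move=> h k; apply: cJ_ZJ => //; rewrite /q -exprM; apply: J_uM; lia. Qed.
Lemma cI_tM f : int f -> cI (t ^+ M *: f).
Proof. by move=> h k; apply: cJ_ZJ => //; rewrite /t -exprM; apply: J_vM; lia. Qed.
Lemma int1 : int (1 : L). Proof. exact: cJ_1. Qed.
Lemma intB f g : int f -> int g -> int (f - g). Proof. exact: cJ_B. Qed.
Lemma intM f g : int f -> int g -> int (f * g). Proof. exact: cJ_M0. Qed.

Lemma cJ_muf b b' : int (muf (LX b : L) (LX b')).
Proof.
have := @int_muF _ _ (fun f : L => int f) int1 intB intM q t M int_q int_t (LX b) (LX b').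
by apply; exact: cJ_gX.
Qed.

Lemma cJ_mu : int (mu N M : L).
Proof. by rewrite muE; apply: cJ_prod => p _; exact: cJ_muf. Qed.

Lemma muf_refl b : eqI ((t%:A - LX b) * muf (LX (- b)) (LX b)) ((1 - t *: LX b) * muf (LX b) (LX (- b))).
Proof.
have := @muF_refl _ _ (fun f : L => int f) cI int1 intB intM cI_D cI_N cI_M q t M int_q int_t cI_qM cI_tM (LX b) (LX (- b)).
by apply; [exact: cJ_gX|exact: cJ_gX|rewrite mulrC; exact: LX_VX].
Qed.

End Mu.
End MacdonaldWeight.

Module WeightRelations.
Import Weights GroupAlgebraTheory MinimalElement ReducedWord Generators DahaRelations BraidWords LaurentOperators PolynomialRep Evaluation ModularAction PowerSeries OneRow KnotVector Symmetrizer OriginIdeal MacdonaldWeight.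

Section AbstractMu.
Variables (K : fieldType) (L : comAlgType K) (q t : K) (M : nat).
Implicit Types f : L.

Lemma muF_rm (F : L -> L) f f' : rm F -> (forall c f, F (c *: f) = c *: F f) ->
  F (muF q t M f f') = muF q t M (F f) (F f').
Proof.
move=> hF FZ; rewrite /muF.
rewrite (big_morph F (rmM hF) (rm1 hF)); apply: eq_bigr => k _.
by rewrite !(rmM hF) !(rmB hF) (rm1 hF) !FZ /gsum !(rm_sum hF) !(eq_bigr _ (fun i _ => rmX hF _ _)) !FZ.
Qed.

Lemma muF_qswap f f' : q != 0 -> muF q t M (q *: f) (q^-1 *: f') = muF q t M f' f.
Proof.
move=> q0; rewrite /muF; apply: eq_bigr => k _.
have e1 : q ^+ k *: (q *: f) = q ^+ k.+1 *: f by rewrite scalerA -exprSr.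
have e2 : q ^+ k.+1 *: (q^-1 *: f') = q ^+ k *: f' by rewrite scalerA exprSr mulfK.
have e3 : (t * q ^+ k) *: (q *: f) = (t * q ^+ k.+1) *: f by rewrite scalerA -mulrA -exprSr.
have e4 : (t * q ^+ k.+1) *: (q^-1 *: f') = (t * q ^+ k) *: f' by rewrite scalerA -mulrA exprSr mulfK.
by rewrite e1 e2 e3 e4; ring.
Qed.

Lemma srel_alg (d : K) (g s X : L) : (t%:A - X) * (d *: (g * s)) = (d *: g) * ((t%:A - X) * s).
Proof. by rewrite !scaleE; ring. Qed.
Lemma srel_alg2 (d : K) (g s X : L) : (d *: g) * ((1 - t *: X) * s) = (1 - t *: X) * (d *: (g * s)).
Proof. by rewrite !scaleE; ring. Qed.

Lemma pirel_alg (d e1 e2 : K) (m P P' g g' x0 : L) :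
  e1 *: P - x0 * (e2 *: P') = g - (t *: x0) * g' ->
  e1 *: (d *: (P * m)) - x0 * (e2 *: (d *: (P' * m))) = d *: (g * m) - (t *: x0) * (d *: (g' * m)).
Proof.
move=> E; transitivity (d *: (m * (e1 *: P - x0 * (e2 *: P')))); first by rewrite !scaleE; ring.
by rewrite E !scaleE; ring.
Qed.
End AbstractMu.

Section Coefs.
Variables (P : zmodType) (K : fieldType).
Local Notation A := (galg P K).
Lemma galg_coefB (f g : A) c : (f - g)@_c = f@_c - g@_c. Proof. exact: mcoeffB. Qed.
Lemma galg_coefZ a (f : A) c : (a *: f)@_c = a * f@_c. Proof. exact: mcoeffZ. Qed.
Lemma gev_coef (h : P -> P) (k : P -> K) (f : A) c : injective h ->
  (gev (fun b => k b *: (gX K (h b) : A)) f)@_(h c) = k c * f@_c.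
Proof.
move=> hi; elim/galg_ind: f => [|f g Ef Eg|a b].
- by rewrite gev0 !mcoeff0 mulr0.
- by rewrite gevD !mcoeffD Ef Eg mulrDr.
rewrite gevZ gevX !mcoeffZ !gX_coef (inj_eq hi).
by case: (b =P c) => [->|_]; rewrite ?mulr0 ?mulr1 // mulrC.
Qed.
Lemma gev_coef1 (h : P -> P) (f : A) c : injective h ->
  (gev (fun b => gX K (h b) : A) f)@_(h c) = f@_c.
Proof.
move=> hi; elim/galg_ind: f => [|f g Ef Eg|a b].
- by rewrite gev0 !mcoeff0.
- by rewrite gevD !mcoeffD Ef Eg.
by rewrite gevZ gevX !mcoeffZ !gX_coef (inj_eq hi).
Qed.
End Coefs.

Lemma wact_weB N (w : {perm 'I_N.+1}) (j k : 'I_N.+1) : wact w (we j - we k) = we (w j) - we (w k).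
Proof.
have E : wact w (we j - we k) + wact w (we k) = wact w (we j) by rewrite -wactD subrK.
by rewrite !wact_we in E; rewrite -E addrK.
Qed.

Lemma wact_inj N (w : {perm 'I_N.+1}) : injective (wact w).
Proof.
apply: (can_inj (g := wact w^-1%g)) => c.
by rewrite -(wtE_eps c) !wact_wtE; apply: wtE_ext => k; rewrite invgK permK.
Qed.

Lemma tperm_lt n (l i a b : 'I_n) : l.+1 = i :> nat -> (a < b)%N ->
  ~~ ((a == l) && (b == i)) -> (tperm l i a < tperm l i b)%N.
Proof.
move=> li ab; rewrite !permE /= -!val_eqE /= => ne.
by case: ifP => h1; case: ifP => h2; rewrite ?h1 ?h2 /=; try (case: ifP => h3); try (case: ifP => h4); lia.
Qed.

Section Lin.
Variables (P : zmodType) (K : fieldType).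
Local Notation A := (galg P K).
End Lin.

Lemma pi_scal (F : fieldType) (a : F) (m n : nat) (z : int) : a != 0 ->
  (a ^- 2) ^+ m * a ^ (2 * m%:Z - (2 * n + 2)%N%:Z * z) = (a ^+ (2 * n + 2)) ^ (- z).
Proof.
move=> a0; rewrite exprVn -exprM exprnN -expfzDr // (exprnP a (2 * n + 2)) exprz_exp.
by congr (a ^ _); rewrite PoszM; ring.
Qed.

Lemma pirel_scal (F : fieldType) (Q T a b c f : F) (z : int) : Q != 0 ->
  Q ^ (- z) * a - Q^-1 * (Q ^ (- (z - 1)) * b) = c - T * (Q^-1 * f) ->
  a = b + Q ^ z * c - T * Q ^ (z - 1) * f.
Proof.
move=> Q0; have Z0 : Q ^ z != 0 by rewrite expfz_neq0.
have -> : Q ^ (- (z - 1)) = Q / Q ^ z by rewrite opprB expfzDr // expr1z invr_expz.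
rewrite expfzDr // exprN1 -invr_expz.
move: (Q ^ z) Z0 => Z Z0 E.
have -> : a = Z * (Z^-1 * a - Q^-1 * (Q / Z * b)) + b by field; rewrite Z0 Q0.
by rewrite E; field.
Qed.

Section Relations.
Variable N : nat.
Hypothesis N0 : (0 < N)%N.
Variable D : daha N.
Local Notation L := (laurent N).
Local Notation q := (q N).
Local Notation X := (@LX N : wt N -> L).
Local Notation g := (OneRow.g X).
Let rep := laurent_rep D N0.
Implicit Types (f : L) (nu : 'I_N.+1 -> int).

Lemma sv_coef i f c : (sv i f)@_(wact (swp i) c) = f@_c.
Proof. exact: (gev_coef1 (K := coefField) (h := wact (swp i)) f c (@wact_inj N (swp i))). Qed.

Lemma pv_coef f c : (pv f)@_(wact (cyc N)^-1%g c) = qpi c * f@_c.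
Proof. exact: (gev_coef (K := coefField) (h := wact (cyc N)^-1%g) (@qpi N) f c (@wact_inj N (cyc N)^-1%g)). Qed.

Lemma qpi_wtE nu s : \sum_k nu k = s -> qpi (wtE nu) = u ^ (2 * s - (2 * N + 2)%N%:Z * nu ord_max).
Proof.
move=> ss.
rewrite /qpi wact_wtE ip_we invgK cyc0.
have -> : \sum_j nu (cyc N j) = \sum_k nu k by rewrite [RHS](reindex_inj (@perm_inj _ (cyc N))).
rewrite ss; apply: qpowE.
rewrite -[(2 * N + 2)%N]/((2 * N + 2)%N) (_ : (2 * N + 2 = 2 * N.+1)%N); last by lia.
have K (a s' n : rat) : n != 0 -> - (a - s' / n) * (2%:R * n) = 2%:R * s' - (2%:R * n) * a.
  by move=> n0; field.
by rewrite natrM K ?n1_neq0 // rmorphB /= !rmorphM /= PoszM rmorphM.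
Qed.

Variable M : nat.
Local Notation mu := (Defs.mu N M : L).
Local Notation muf := (muF q t M).

Lemma pv_mu : pv mu = mu.
Proof.
rewrite muE [RHS](prod_permp (cyc N)^-1%g (fun p : 'I_N.+1 * 'I_N.+1 => muf (X (we p.1 - we p.2)) (X (we p.2 - we p.1)))).
rewrite (big_morph (@pv N) (rmM (rm_pv rep)) (rm1 (rm_pv rep))).
apply: eq_bigr => -[a b] /= ab; rewrite (muF_rm _ _ _ _ _ (rm_pv rep) (@LaurentOperators.pvZ N)) !LaurentOperators.pvX.
have qN (i j : 'I_N.+1) : qpi (we i - we j) = u ^ ((2 * N + 2)%N%:Z * ((j == ord_max)%:Z - (i == ord_max)%:Z)).
  rewrite /we wtEB (@qpi_wtE _ 0); last by rewrite sumrB !sum_ee1.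
  congr (u ^ _).
  rewrite /ee ![ord_max == _]eq_sym; lia.
have wA (i j : 'I_N.+1) : wact (cyc N)^-1%g (we i - we j) = we ((cyc N)^-1%g i) - we ((cyc N)^-1%g j).
  exact: wact_weB.
have aN : a != ord_max by rewrite -val_eqE /= ltn_eqF //; have := ltn_ord b; lia.
rewrite !wA !qN (negPf aN) /permp /sortp /=.
have vlt (i : 'I_N.+1) : i != ord_max -> (cyc N)^-1%g i = inord i.+1.
  move=> iN; have lt : (i < N)%N by have := ltn_ord i; rewrite ltnS leq_eqVlt => /orP[/eqP E|//]; case/eqP: iN; exact: val_inj.
  by rewrite -(cycV_lt N0 lt) inord_val.
have aN' : (a < N)%N by have := ltn_ord b; lia.
have [bN|bN] := eqVneq b ord_max.
  rewrite bN cycV_max (vlt a aN) /=.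
  have -> : (2 * N + 2)%N%:Z * (true%:Z - 0%:Z) = (2 * N + 2)%N%:Z by lia.
  have -> : (2 * N + 2)%N%:Z * (0%:Z - true%:Z) = - (2 * N + 2)%N%:Z by lia.
  rewrite -exprnN -exprnP -/q.
  exact: muF_qswap (q_neq0 N).
have bN' : (b < N)%N by have := ltn_ord b; rewrite ltnS leq_eqVlt => /orP[/eqP E|//]; case/eqP: bN; exact: val_inj.
have clt : ((cyc N)^-1%g a < (cyc N)^-1%g b)%N by rewrite (vlt a aN) (vlt b bN) !inordK ?ltnS.
rewrite clt.
have -> : (2 * N + 2)%N%:Z * (false%:Z - 0%:Z) = 0 by lia.
rewrite expr0z; do 2 rewrite [1 *: _]scale1r.
exact (erefl _).
Qed.

Lemma sv_mu i : i != ord0 ->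
  eqI (cI M) ((t%:A - X (alpha N i)) * sv i mu) ((1 - t *: X (alpha N i)) * mu).
Proof.
move=> i0; have iN := n0_bnd i0; set l : 'I_N.+1 := inord i.-1.
have lv' : l = i.-1 :> nat by rewrite /l inordK; lia.
pose G (p : 'I_N.+1 * 'I_N.+1) := muf (X (we p.1 - we p.2)) (X (we p.2 - we p.1)).
pose R := \prod_(p : 'I_N.+1 * 'I_N.+1 | (p.1 < p.2)%N && (p != (l, i))) G (permp (swp i) p).
have li : (l < i)%N by rewrite lv'; lia.
have aE : alpha N i = we l - we i by exact: alpha_we.
have iR : cJ M 0 R by apply: cJ_prod => p _; exact: cJ_muf.
have Gp : G (permp (swp i) (l, i)) = muf (X (alpha N i)) (X (- alpha N i)).
  rewrite /permp /sortp /= /swp tpermL tpermR ltnNge (ltnW li) /=.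
  rewrite /G /= aE opprB; exact (erefl _).
have E1 : mu = muf (X (alpha N i)) (X (- alpha N i)) * R.
  rewrite -Gp muE [LHS](prod_permp (swp i) G) /R.
  exact: (@bigD1 _ _ _ _ (l, i) (fun p : 'I_N.+1 * 'I_N.+1 => (p.1 < p.2)%N) _ li).
have wA (j k : 'I_N.+1) : wact (swp i) (we j - we k) = we (swp i j) - we (swp i k).
  exact: wact_weB.
have sG p : sv i (G p) = muf (X (we (swp i p.1) - we (swp i p.2))) (X (we (swp i p.2) - we (swp i p.1))).
  rewrite /G (muF_rm _ _ _ _ _ (rm_sv rep i) (@LaurentOperators.svZ N i)) !LaurentOperators.svX !wA; exact (erefl _).
have sGp : sv i (G (l, i)) = muf (X (- alpha N i)) (X (alpha N i)).
  rewrite sG /= /swp tpermL tpermR aE opprB; exact (erefl _).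
have sGR (p : 'I_N.+1 * 'I_N.+1) : (p.1 < p.2)%N && (p != (l, i)) -> sv i (G p) = G (permp (swp i) p).
  move: p => [a b] /= /andP[ab ne]; rewrite sG /permp /sortp /=.
  suff -> : (swp i a < swp i b)%N by exact (erefl _).
  have li1 : l.+1 = i :> nat by rewrite lv'; lia.
  exact: (@tperm_lt _ l i a b li1 ab ne).
have E2 : sv i mu = muf (X (- alpha N i)) (X (alpha N i)) * R.
  rewrite muE (big_morph (sv i) (rmM (rm_sv rep i)) (rm1 (rm_sv rep i))).
  apply: etrans (@bigD1 _ _ _ _ (l, i) (fun p : 'I_N.+1 * 'I_N.+1 => (p.1 < p.2)%N) (fun p => sv i (G p)) li) _.
  apply: (congr2 (@GRing.mul L)); first exact: sGp.
  by apply: eq_bigr => p hp; exact: sGR.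
have h := @eqI_Mr _ _ (fun f : L => cJ M 0 f) (cI M) (@cI_M N M) R _ _ iR (muf_refl M (alpha N i)).
have E2' := etrans (congr1 (fun z : L => (t%:A - X (alpha N i)) * z) E2) (mulrA _ _ _).
have E1' := etrans (congr1 (fun z : L => (1 - t *: X (alpha N i)) * z) E1) (mulrA _ _ _).
refine (eq_ind_r (fun z => eqI (cI M) z _) _ E2').
exact (eq_ind_r (fun z => eqI (cI M) _ z) h E1').
Qed.

Variables (d : coefField) (m0 : nat).
Hypothesis hd : forall a b, (a <= m0)%N -> isint (d * (g a)@_b).
Local Notation e := eN.
Local Notation x0 := (OneRow.x0 X).

Definition fm (m : nat) : L := d *: (g m * mu).
Definition av (m : nat) nu := (fm m)@_(wtE nu).

Lemma fmE m : fm m = d *: (g m * mu). Proof. by []. Qed.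

Lemma cJ_dg m : (m <= m0)%N -> cJ M 0 (d *: g m).
Proof. by move=> mm b; apply: int_J0; rewrite (galg_coefZ d (g m)); exact: hd. Qed.

Lemma cJ_fm m : (m <= m0)%N -> cJ M 0 (fm m).
Proof.
move=> mm; rewrite fmE scalerAl; apply: cJ_M0; first exact: cJ_dg.
exact: cJ_mu.
Qed.

Lemma sv_fm m i : sv i (fm m) = d *: (g m * sv i mu).
Proof. by rewrite fmE LaurentOperators.svZ (rmM (rm_sv rep i)) (sv_g rep). Qed.

Lemma srel_fm m i : (m <= m0)%N -> i != ord0 ->
  eqI (cI M) ((t%:A - X (alpha N i)) * sv i (fm m)) ((1 - t *: X (alpha N i)) * fm m).
Proof.
move=> mm i0; have h := @eqI_M _ _ (fun f : L => cJ M 0 f) (cI M) (@cI_M N M) _ _ _ (cJ_dg mm) (sv_mu i0).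
rewrite sv_fm fmE srel_alg -srel_alg2; exact: h.
Qed.

End Relations.

Section AbstractRelations.
Variable N : nat.
Hypothesis N0 : (0 < N)%N.
Variable D : daha N.
Variable L : comAlgType coefField.
Variables (X : wt N -> L) (sv : 'I_N.+1 -> L -> L) (pv : L -> L).
Variables (lv : L -> coefField) (emb : L -> daha_alg D) (act : daha_alg D -> L -> L).
Hypothesis rep : rep_spec X sv pv lv emb act.
Local Notation q := (q N).
Local Notation g := (OneRow.g X).
Local Notation e := eN.
Local Notation x0 := (OneRow.x0 X).
Variable cf : L -> wt N -> coefField.
Hypothesis cfB : forall f h c, cf (f - h) c = cf f c - cf h c.
Hypothesis cfZ : forall a f c, cf (a *: f) c = a * cf f c.
Hypothesis cfX : forall b f c, cf (X b * f) c = cf f (c - b).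
Hypothesis sv_coef : forall i f c, cf (sv i f) (wact (swp i) c) = cf f c.
Hypothesis pv_coef : forall f c, cf (pv f) (wact (cyc N)^-1%g c) = qpi c * cf f c.
Variables (M : nat) (mu : L) (d : coefField) (m0 : nat).
Hypothesis pv_mu : pv mu = mu.
Definition fma (m : nat) : L := d *: (g m * mu).
Local Notation fm := fma.
Hypothesis srel_fm : forall m i, (m <= m0)%N -> i != ord0 -> forall k c,
  Jp M k (cf ((t%:A - X (alpha N i)) * sv i (fm m) - (1 - t *: X (alpha N i)) * fm m) c).
Definition ava (m : nat) nu := cf (fm m) (wtE nu).
Local Notation av := ava.
Implicit Types (f : L) (nu : 'I_N.+1 -> int).

Lemma srel m i nu k : (m <= m0)%N -> i != ord0 -> let l := inord i.-1 in
  Jp M k (t * av m (nu \o swp i) - av m ((fun j => nu j - (ee l j - ee i j)) \o swp i)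
    - av m nu + t * av m (fun j => nu j - (ee l j - ee i j))).
Proof.
move=> mm i0 l; have := srel_fm mm i0 k (wtE nu); rewrite cfB.
have aE : alpha N i = wtE (fun j => ee l j - ee i j) by rewrite alpha_we // /we wtEB.
have svE nu' : cf (sv i (fm m)) (wtE nu') = av m (nu' \o swp i).
  rewrite /av -(sv_coef i (fm m) (wtE (nu' \o swp i))) wact_wtE; congr (cf _ _).
  by apply: wtE_ext => j /=; rewrite /swp tpermV tpermK.
have wB nu' : wtE nu' - alpha N i = wtE (fun j => nu' j - (ee l j - ee i j)) by rewrite aE wtEB.
have E1 f c : cf ((t%:A - X (alpha N i)) * f) c = t * cf f c - cf f (c - alpha N i).
  by rewrite mulrBl cfB cfX -scalerAl mul1r cfZ.
have E2 f c : cf ((1 - t *: X (alpha N i)) * f) c = cf f c - t * cf f (c - alpha N i).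
  by rewrite mulrBl cfB -scalerAl mul1r cfZ cfX.
rewrite E1 E2 wB !svE -/(av m _) -/(av m _).
rewrite opprB addrA; congr Jp.
by rewrite -!addrA; congr (_ + (_ + _)); exact: addrC.
Qed.

Lemma pirel_fm m : e ^ m.+1%:Z *: pv (fm m.+1) - x0 * (e ^ m%:Z *: pv (fm m)) = fm m.+1 - (t *: x0) * fm m.
Proof.
have E := congr1 (fun f : int -> L => f m.+1%:Z) (gh_star N0 rep).
rewrite /DD (_ : m.+1%:Z - 1 = m%:Z) in E; last by lia.
have pE a : pv (fm a) = d *: (pv (g a) * mu).
  by rewrite /fma (pvZ rep) (rmM (rm_pv rep)) pv_mu.
rewrite !pE /fma; exact: pirel_alg.
Qed.

Lemma pi_coef m nu : \sum_j nu j = m%:Z ->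
  e ^ m%:Z * cf (pv (fm m)) (wtE (nu \o cyc N)) = q ^ (- nu ord_max) * av m nu.
Proof.
move=> sm; have -> : wtE (nu \o cyc N) = wact (cyc N)^-1%g (wtE nu).
  by rewrite wact_wtE; apply: wtE_ext => j /=; rewrite invgK.
rewrite pv_coef mulrA (qpi_wtE N0 sm); congr (_ * _).
rewrite /eN -exprN1 -exprnP; exact: pi_scal u_neq0.
Qed.

Lemma pirel m nu : \sum_j nu j = m.+1%:Z ->
  av m.+1 nu = av m (fun j => nu j - ee ord_max j) + q ^ (nu ord_max) * av m.+1 (nu \o cyc N)
    - t * q ^ (nu ord_max - 1) * av m ((fun j => nu j - ee ord_max j) \o cyc N).
Proof.
move=> sm; set nu' := fun j => nu j - ee ord_max j.
have sm' : \sum_j nu' j = m%:Z by rewrite sumrB sm sum_ee1; lia.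
have E := congr1 (fun f : L => cf f (wtE (nu \o cyc N))) (pirel_fm m).
have xc f c : cf (x0 * f) c = q^-1 * cf f (c - we ord0).
  by rewrite (x0E X) -scalerAl cfZ cfX.
have xc' f c : cf ((t *: x0) * f) c = t * (q^-1 * cf f (c - we ord0)).
  by rewrite -scalerAl cfZ xc.
have wB : wtE (nu \o cyc N) - we ord0 = wtE (nu' \o cyc N).
  rewrite /we wtEB; apply: wtE_ext => j /=; rewrite /nu' /ee; congr (_ - _%:Z).
  by rewrite -(inj_eq (@perm_inj _ (cyc N)) j ord0) cyc0.
rewrite !cfB xc xc' wB (cfZ (e ^ m.+1%:Z)) (cfZ (e ^ m%:Z)) (pi_coef sm) (pi_coef sm') in E.
have nm : nu' ord_max = nu ord_max - 1 by rewrite /nu' /ee eqxx.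
rewrite nm in E.
exact: pirel_scal (q_neq0 N) E.
Qed.

End AbstractRelations.
End WeightRelations.

Module Orthogonal.
Import Weights MinimalElement OneRow OriginIdeal.

Section Reflection.
Variables (M : nat) (b : int -> coefField) (s : int).
Hypothesis E : forall k j, Jp M k (t * b (s - j) - b (s - j + 1) - b j + t * b (j - 1)).

Lemma reflection_alg (F : comPzRingType) (T B hi lo : F) :
  - (T * (lo + B) - (B + hi) - (B + hi) + T * (lo + B)) =
  (hi - T * lo + (1 - T) * B) + (hi - T * lo + (1 - T) * B).
Proof. ring. Qed.

Lemma reflection k (lo hi : int) : lo < hi -> lo + hi = s ->
  (forall j, lo < j -> j < hi -> Jp M k (b j)) -> Jp M k (b hi - t * b lo).
Proof.
move=> lh lhs mid; have [h hE] : exists h : nat, hi = lo + h.+1%:Z.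
  by exists (`|hi - lo|.-1)%N; lia.
pose B := \sum_(i < h) b (lo + i.+1%:Z).
have S1 : \sum_(i < h.+1) b (lo + i.+1%:Z) = B + b hi.
  by rewrite big_ord_recr /= hE.
have S0 : \sum_(i < h.+1) b (lo + i%:Z) = b lo + B.
  by rewrite big_ord_recl /= addr0; congr (_ + _); apply: eq_bigr => i _; congr b; rewrite /bump /=; lia.
have S1' : \sum_(i < h.+1) b (s - (lo + i.+1%:Z) + 1) = B + b hi.
  rewrite -S1 (reindex_inj rev_ord_inj) /=; apply: eq_bigr => i _; congr b.
  by have := ltn_ord i; lia.
have S0' : \sum_(i < h.+1) b (s - (lo + i.+1%:Z)) = b lo + B.
  rewrite -S0 (reindex_inj rev_ord_inj) /=; apply: eq_bigr => i _; congr b.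
  by have := ltn_ord i; lia.
have S0'' : \sum_(i < h.+1) b (lo + i.+1%:Z - 1) = b lo + B.
  by rewrite -S0; apply: eq_bigr => i _; congr b; lia.
have JS : Jp M k (\sum_(i < h.+1) (t * b (s - (lo + i.+1%:Z)) - b (s - (lo + i.+1%:Z) + 1)
   - b (lo + i.+1%:Z) + t * b (lo + i.+1%:Z - 1))) by apply: J_sum => i _; exact: E.
rewrite big_split sumrB sumrB /= -!mulr_sumr S0' S1' S1 S0'' in JS.
have JB : Jp M k B.
  by apply: J_sum => i _; apply: mid; have := ltn_ord i; lia.
have JtB : Jp M k ((1 - t) * B).
  by apply: J_Ml => //; apply: isintD; [exact: isint1|apply: isintN; apply/isintX/isint_v].
have := J_N JS; rewrite reflection_alg => /J_half H.
by have := J_B H JtB; rewrite addrK.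
Qed.
End Reflection.

Section Orthogonality.
Variable N : nat.
Hypothesis N0 : (0 < N)%N.
Local Notation q := (q N).
Variables (M m0 : nat) (av : nat -> ('I_N.+1 -> int) -> coefField).
Implicit Types (nu : 'I_N.+1 -> int).
Hypothesis av_ext : forall m nu nu', nu =1 nu' -> av m nu = av m nu'.
Hypothesis av_int : forall m nu, (m <= m0)%N -> isint (av m nu).
Hypothesis srel : forall m i nu k, (m <= m0)%N -> i != ord0 -> let l := inord i.-1 in
  Jp M k (t * av m (nu \o swp i) - av m ((fun j => nu j - (ee l j - ee i j)) \o swp i)
    - av m nu + t * av m (fun j => nu j - (ee l j - ee i j))).
Hypothesis pirel : forall m nu, \sum_j nu j = m.+1%:Z ->
  av m.+1 nu = av m (fun j => nu j - ee ord_max j) + q ^ (nu ord_max) * av m.+1 (nu \o cyc N)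
    - t * q ^ (nu ord_max - 1) * av m ((fun j => nu j - ee ord_max j) \o cyc N).

Definition good (m : nat) nu := [/\ forall k, 0 <= nu k, \sum_k nu k = m%:Z &
  exists i j, [/\ i != j, nu i != 0 & nu j != 0]].

Lemma good_perm m nu (w : {perm 'I_N.+1}) : good m nu -> good m (nu \o w).
Proof.
move=> [h1 h2 [i [j [ij hi hj]]]]; split=> [k|//|].
- exact: h1.
- by rewrite -h2 [RHS](reindex_inj (@perm_inj _ w)).
by exists (w^-1 i)%g, (w^-1 j)%g; split; rewrite /= ?permKV // (inj_eq perm_inj).
Qed.

Definition setv nu (l i : 'I_N.+1) (s j : int) := fun k => if k == l then j else if k == i then s - j else nu k.

Lemma sum_setv (F : int -> int) nu l i s j : l != i ->
  \sum_k F (setv nu l i s j k) = F j + F (s - j) + \sum_(k | (k != l) && (k != i)) F (nu k).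
Proof.
move=> li; rewrite (bigD1 l) //= (bigD1 i) /=; last by rewrite eq_sym.
rewrite /setv eqxx eq_sym (negPf li) eqxx addrA; congr (_ + _).
by apply: eq_bigr => k /andP[/negPf -> /negPf ->].
Qed.

Lemma sum_split2 (F : int -> int) nu l i : l != i ->
  \sum_k F (nu k) = F (nu l) + F (nu i) + \sum_(k | (k != l) && (k != i)) F (nu k).
Proof.
by move=> li; rewrite (bigD1 l) //= (bigD1 i) /= ?addrA // eq_sym.
Qed.

Lemma setv_swp nu i s j : i != ord0 ->
  setv nu (inord i.-1) i s j \o swp i =1 setv nu (inord i.-1) i s (s - j).
Proof.
move=> i0 k; have := inordm1_neq i0; rewrite /swp /setv /=; set l := inord i.-1 => li.
have li' : (i == l) = false by rewrite eq_sym; apply/negbTE.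
case: tpermP => [->|->|/eqP/negPf kl /eqP/negPf ki]; rewrite ?eqxx ?kl ?ki ?li' //.
by rewrite subKr.
Qed.

Lemma setv_sub nu i s j : i != ord0 -> let l := inord i.-1 in
  (fun k => setv nu l i s j k - (ee l k - ee i k)) =1 setv nu l i s (j - 1).
Proof.
move=> i0 l k; have li : (l == i) = false by apply/negbTE/inordm1_neq.
rewrite /setv /ee; case: (k =P l) => [->|kl]; first by rewrite li; lia.
by case: (k =P i) => [_|_] /=; lia.
Qed.

Lemma setv_id nu l i : setv nu l i (nu l + nu i) (nu l) =1 nu.
Proof.
by move=> k; rewrite /setv; case: (k =P l) => [-> //|_]; case: (k =P i) => [->|//]; rewrite addrC addKr.
Qed.

Lemma swap_rel m i nu k (lo : int) : (m <= m0)%N -> i != ord0 -> let l := inord i.-1 in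
  lo = nu i -> lo < nu l ->
  (forall j, lo < j -> j < nu l -> Jp M k (av m (setv nu l i (nu l + nu i) j))) ->
  Jp M k (av m nu - t * av m (nu \o swp i)).
Proof.
move=> mm i0 l -> lh mid; set s := nu l + nu i; pose b j := av m (setv nu l i s j).
have E k' j : Jp M k' (t * b (s - j) - b (s - j + 1) - b j + t * b (j - 1)).
  have := srel (setv nu l i s j) k' mm i0; rewrite -/l /=.
  rewrite (av_ext m (setv_swp nu s j i0)) (av_ext m (setv_sub nu s j i0)) -/l.
  suff -> : av m ((fun k => setv nu l i s j k - (ee l k - ee i k)) \o swp i) = b (s - j + 1) by [].
  rewrite /b; apply: av_ext => x /=; rewrite (setv_sub nu s j i0 (swp i x)) -/l.
  by rewrite -[LHS]/((setv nu l i s (j - 1) \o swp i) x) (setv_swp nu s (j - 1) i0) -/l; congr setv; lia.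
have := reflection E lh _ mid.
have -> : b (nu l) = av m nu by apply: av_ext; exact: setv_id.
suff -> : b (nu i) = av m (nu \o swp i) by apply; rewrite /s addrC.
apply: av_ext => x; have := setv_swp nu s (nu l) i0 x; rewrite -/l /= (setv_id nu l i).
by move=> ->; congr setv; rewrite /s; lia.
Qed.

Lemma sq_drop (x y lo hi : int) : x + y = lo + hi -> lo < x -> x < hi -> 0 <= lo -> x * x + y * y < hi * hi + lo * lo.
Proof. nia. Qed.

Lemma orthogonal m nu k : (m <= m0)%N -> good m nu -> Jp M k (av m nu).
Proof.
elim: m nu k => [|m IHm] nu k mm gd.
  case: gd => [h1 h2 [i [j [_ hi _]]]]; exfalso.
  have : nu i = 0 by apply/eqP; move/eqP: h2; rewrite psumr_eq0 // => /allP/(_ i); rewrite mem_index_enum; apply.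
  by move/eqP; rewrite (negPf hi).
elim: k nu gd => [|k IHk] nu gd; first exact/int_J0/av_int.
suff H n : forall nu, good m.+1 nu -> \sum_j nu j * nu j < n%:Z -> Jp M k.+1 (av m.+1 nu).
  have [n hn] : exists n : nat, \sum_j nu j * nu j < n%:Z by exists (absz (\sum_j nu j * nu j)).+1; lia.
  exact: (H n).
elim: n {nu gd} => [|n IHn] nu gd sq.
  by exfalso; move: sq; apply/negP; rewrite -leNgt sumr_ge0 // => j _; apply: mulr_ge0; case: gd.
have [h1 h2 h3] := gd.
case: (boolP [exists i : 'I_N.+1, (i != ord0) && (nu i < nu (inord i.-1))]) => [/existsP[i /andP[i0 lt]]|].
  have li := inordm1_neq i0; set l := inord i.-1 in lt li.
  have H : Jp M k.+1 (av m.+1 nu - t * av m.+1 (nu \o swp i)).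
    apply: (swap_rel mm i0 erefl lt) => j j1; rewrite -/l => j2; apply: IHn.
      split=> [x||].
      - by rewrite /setv -/l; case: eqP => _; [|case: eqP => _]; have := h1 i; have := h1 x; lia.
      - by rewrite (sum_setv id) // -h2 (sum_split2 id nu li); lia.
      exists l, i; split=> //; rewrite /setv -/l ?eqxx; first by have := h1 i; lia.
      by rewrite [i == l]eq_sym (negPf li); have := h1 i; lia.
    rewrite (sum_setv (fun x => x * x)) //.
    have := sq; rewrite (sum_split2 (fun x => x * x) nu li).
    have := sq_drop (x := j) (y := nu l + nu i - j) (lo := nu i) (hi := nu l).
    by have := h1 i; rewrite -/l; lia.
  rewrite -[av m.+1 nu](subrK (t * av m.+1 (nu \o swp i))); apply: J_D => //.
  by apply: J_t; apply: IHk; exact: good_perm.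
rewrite negb_exists => /forallP mono.
have mon (i : 'I_N.+1) : i != ord0 -> nu (inord i.-1) <= nu i.
  by move=> i0; have := mono i; rewrite i0 /= -leNgt.
have monN (a b : nat) : (a <= b)%N -> (b <= N)%N -> nu (inord a) <= nu (inord b).
  elim: b => [|b IH]; first by rewrite leqn0 => /eqP ->.
  rewrite leq_eqVlt => /orP[/eqP -> //|ab] bN; apply: le_trans (IH _ _) _; try lia.
  have := mon (inord b.+1); rewrite inordK //=; apply.
  by rewrite -val_eqE /= inordK.
have maxE : inord N = ord_max :> 'I_N.+1 by apply/val_inj; rewrite /= inordK.
have monO (i j : 'I_N.+1) : (i <= j)%N -> nu i <= nu j.
  by move=> ij; have := monN i j ij; rewrite !inord_val; apply; have := ltn_ord j; lia.
have leM i : nu i <= nu ord_max by apply: monO; have := ltn_ord i; rewrite /=; lia.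
have nM : 1 <= nu ord_max.
  by case: h3 => i [_ [_ hi _]]; have := leM i; have := h1 i; lia.
have [n0 n0E] : exists n0 : nat, nu ord_max = n0.+1%:Z by exists (`|nu ord_max|.-1)%N; lia.
set nu' := fun j => nu j - ee ord_max j.
have sm' : \sum_j nu' j = m%:Z by rewrite sumrB h2 sum_ee1; lia.
have ge' j : 0 <= nu' j by rewrite /nu' /ee; case: (j =P ord_max) => [->|_] /=; have := h1 j; lia.
have Jq x : Jp M k x -> Jp M k.+1 (q ^+ n0.+1 * x).
  move=> hx; have h := J_M (J_X (n0.+1 * (2 * N + 2)) (J_u M)) hx.
  rewrite [(2 * N + 2)%N * n0.+1 = _]mulnC in h || idtac.
  have -> : q ^+ n0.+1 = u ^+ (n0.+1 * (2 * N + 2)) by rewrite /q -exprM mulnC.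
  by apply: J_mono h; lia.
have it : isint t by apply/isintX/isint_v.
have iq n' : isint (q ^+ n') by apply/isintX/isintX/isint_u.
rewrite (pirel h2) -/nu' n0E (_ : n0.+1%:Z - 1 = n0%:Z); last by lia.
rewrite -!exprnP addrAC; apply: J_D; last by apply: Jq; apply: IHk; exact: good_perm.
have mm' : (m <= m0)%N by lia.
have [g'|ng] := boolp.pselect (good m nu').
  apply: J_B; first exact: IHm.
  by apply: J_Ml; [exact: isintM|apply: IHm => //; exact: good_perm].
pose r : 'I_N.+1 := inord N.-1.
have rN : r = N.-1 :> nat by rewrite /r inordK; lia.
have rM : r != ord_max by rewrite -val_eqE /= rN; lia.
have nuE j : j != ord_max -> nu' j = nu j by move=> jM; rewrite /nu' /ee (negPf jM) subr0.
have nr : 1 <= nu r.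
  have [j jM hj] : exists2 j, j != ord_max & nu j != 0.
    case: h3 => i [j [ij hi hj]]; have [E|] := eqVneq i ord_max; last by exists i.
    by exists j => //; rewrite -E eq_sym.
  have jr : (j <= r)%N by rewrite rN; move: jM; rewrite -val_eqE /=; have := ltn_ord j; lia.
  by have := monO j r jr; have := h1 j; lia.
have oth j : j != r -> nu' j = 0.
  move=> jr; apply/eqP; apply/negPn/negP => hj; apply: ng; split=> //.
  by exists j, r; split=> //; rewrite nuE //; lia.
have nM1 : nu ord_max = 1 by have := oth ord_max; rewrite eq_sym => /(_ rM); rewrite /nu' /ee eqxx; lia.
have nr1 : nu r = 1 by have := leM r; lia.
have nuee : nu' =1 ee r.
  by move=> j; rewrite /ee; case: (j =P r) => [->|/eqP jr]; [rewrite nuE|rewrite oth].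
have m1 : m = 1%N.
  by have := sm'; rewrite (eq_bigr _ (fun j _ => nuee j)) sum_ee1; lia.
have -> : n0 = 0%N by lia.
rewrite expr0 mulr1.
have M0 : (ord_max : 'I_N.+1) != ord0 by rewrite -val_eqE /=; lia.
have swE : ee r \o swp ord_max =1 nu' \o cyc N.
  move=> j; rewrite /= nuee /ee /swp /= -/r; congr (_%:Z).
  have -> : (tperm r ord_max j == r) = (j == ord_max) by rewrite -{2}(tpermR r ord_max) (inj_eq perm_inj).
  have : cyc N (inord N.-1.+1) = inord N.-1 by apply: cycS => //; lia.
  rewrite prednK // maxE -/r => E; by rewrite -{1}E (inj_eq perm_inj).
rewrite (av_ext m nuee) -(av_ext m swE).
apply: (swap_rel mm' M0 (lo := 0)); rewrite /= -/r /ee ?eqxx ?(negPf rM) //.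
  by rewrite eq_sym (negPf rM).
by move=> j; lia.
Qed.
End Orthogonality.
End Orthogonal.

Module TriangularUniqueness.
Import GroupAlgebraTheory PowerSeries OneRow OriginIdeal MacdonaldWeight.

Local Notation "x %:F" := (@tofrac _ x).

Lemma frac_num_neq0 (R : idomainType) (d n : R) (x : {fraction R}) :
  d%:F * x = n%:F -> d != 0 -> x != 0 -> n != 0.
Proof.
move=> E d0 x0; apply/negP => /eqP n0; move/eqP: E; rewrite n0 tofrac0 mulf_eq0 (negPf x0) orbF.
by rewrite tofrac_eq0 (negPf d0).
Qed.

Lemma frac_cancel (R : idomainType) (D S d p : R) (x : {fraction R}) :
  d%:F * x = S%:F -> D%:F * x = p%:F -> D * S = d * p.
Proof.
by move=> h1 h2; apply/eqP; rewrite -tofrac_eq !tofracM -h1 -h2 mulrCA.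
Qed.

Lemma frac_inj (R : idomainType) (x y : R) : x%:F = y%:F -> x = y.
Proof. by move/eqP; rewrite tofrac_eq => /eqP. Qed.

Lemma lexz_mulr (p r : coefRing) i j : lexz p i j -> lexz (p * r) i j.
Proof.
move=> [h1 h2]; split=> [a ai|b bj].
  by rewrite poly.coefM big1 // => -[x /= xa] _; rewrite h1 ?mul0r //; lia.
rewrite poly.coefM coef_sum big1 // => -[x /= xa] _.
have [xi|xi] := ltnP x i; first by rewrite h1 // mul0r coef0.
have -> : x = i by lia.
rewrite poly.coefM big1 // => -[y /= yb] _; rewrite h2 ?mul0r //; lia.
Qed.

Lemma lexz_sum (I : Type) (r : seq I) (F : I -> coefRing) i j : (forall k, lexz (F k) i j) ->
  lexz (\sum_(k <- r) F k) i j.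
Proof.
move=> h; split=> [a ai|b bj].
  by rewrite coef_sum big1 // => k _; case: (h k) => h1 _; exact: h1.
by rewrite coef_sum coef_sum big1 // => k _; case: (h k) => _ h2; exact: h2.
Qed.

Lemma seq_argmin (T : eqType) (f : T -> rat) (s : seq T) : s != [::] ->
  exists2 c, c \in s & forall b, b \in s -> f c <= f b.
Proof.
elim: s => // x s IH _; have [->|s0] := eqVneq s [::].
  by exists x; rewrite ?mem_head // => b; rewrite inE => /eqP ->.
have [c cs hc] := IH s0; have [xc|cx] := lerP (f x) (f c).
  exists x; rewrite ?mem_head // => b; rewrite inE => /orP[/eqP -> //|bs].
  exact: le_trans xc (hc b bs).
exists c; rewrite ?inE ?cs ?orbT // => b; rewrite inE => /orP[/eqP ->|]; [exact: ltW|exact: hc].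
Qed.

Section Triangular.
Variables (P : zmodType) (ht : P -> rat).
Hypothesis htB : forall b c, ht (b - c) = ht b - ht c.
Local Notation A := (galg P coefField).
Implicit Types f g : A.

Lemma ht0 : ht 0 = 0. Proof. by rewrite -(subrr (0 : P)) htB subrr. Qed.

Section FixedM.
Variable M : nat.

Definition tri f := [/\ cJ M 0 f, forall b, ht b <= 0 -> b != 0 -> Jp M 1 f@_b & Jp M 1 (f@_0 - 1)].

Lemma one_coef b : (1 : A)@_b = (b == 0)%:R.
Proof. by rewrite -[1]/(gX coefField (0 : P)) gX_coef eq_sym. Qed.

Lemma tri_J1 h : cJ M 1 h -> tri (1 + h).
Proof.
move=> hh; split.
- by apply: cJ_D; [exact: cJ_1|apply: cJ_mono hh].
- by move=> b _ b0; rewrite mcoeffD one_coef (negPf b0) add0r.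
by rewrite mcoeffD one_coef eqxx addrAC subrr add0r.
Qed.

Lemma tri_lin a b : isint a -> 0 < ht b -> tri (1 - a *: gX coefField b).
Proof.
move=> ia hb; have b0 : b != 0 by apply: contraTneq hb => ->; rewrite ht0.
split.
- by apply: cJ_B; [exact: cJ_1|apply: cJ_Z => //; exact: cJ_gX].
- move=> c hc c0; rewrite mcoeffB one_coef (negPf c0) mcoeffZ gX_coef.
  have -> : (b == c) = false by apply: contraTF hb => /eqP ->; rewrite -leNgt.
  by rewrite mulr0 subrr; exact: J_0.
have E : (1 - a *: gX coefField b : A)@_0 = 1.
  by rewrite mcoeffB one_coef eqxx mcoeffZ gX_coef (negPf b0) mulr0 subr0.
rewrite E subrr; exact: J_0.
Qed.

Lemma triM f g : tri f -> tri g -> tri (f * g).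
Proof.
move=> [f1 f2 f3] [g1 g2 g3].
have bad (F G : A) b c : (forall b, ht b <= 0 -> b != 0 -> Jp M 1 F@_b) -> cJ M 0 F ->
    (forall b, ht b <= 0 -> b != 0 -> Jp M 1 G@_b) -> cJ M 0 G ->
    ht c <= 0 -> b != 0 -> Jp M 1 (F@_b * G@_(c - b)).
  move=> F2 F1 G2 G1 hc b0; have [hb|hb] := lerP (ht b) 0.
    by have := J_M (F2 b hb b0) (G1 (c - b)); rewrite addn0.
  have hcb : ht (c - b) < 0 by rewrite htB subr_lt0 (le_lt_trans hc hb).
  apply: (J_M (F1 b)); apply: G2; first exact: ltW.
  by apply: contraTneq hcb => ->; rewrite ht0 ltxx.
split; first exact: cJ_M0.
- move=> c hc c0; rewrite coefM; apply: J_sum => b _.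
  have [->|b0] := eqVneq b 0; last exact: bad.
  by rewrite subr0; apply: (J_M (f1 0)); exact: g2.
pose f' := f - f@_0 *: (1 : A).
have f'0 : f'@_0 = 0 by rewrite mcoeffB mcoeffZ one_coef eqxx mulr1 subrr.
have f'b b : b != 0 -> f'@_b = f@_b by move=> b0; rewrite mcoeffB mcoeffZ one_coef (negPf b0) mulr0 subr0.
have f'1 : cJ M 0 f'.
  by move=> b; have [->|b0] := eqVneq b 0; [rewrite f'0; exact: J_0|rewrite f'b].
have f'2 b : ht b <= 0 -> b != 0 -> Jp M 1 f'@_b by move=> hb b0; rewrite f'b //; exact: f2.
have E : (f * g)@_0 = f@_0 * g@_0 + (f' * g)@_0.
  have -> : f = f@_0 *: 1 + f' by rewrite /f' addrC subrK.
  by rewrite mulrDl mcoeffD -scalerAl mul1r mcoeffZ mcoeffD f'0 addr0 mcoeffZ one_coef eqxx mulr1.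
rewrite E; have -> : f@_0 * g@_0 + (f' * g)@_0 - 1 = f@_0 * (g@_0 - 1) + (f@_0 - 1) + (f' * g)@_0 by ring.
apply: J_D; first by apply: J_D => //; exact: (J_M (f1 0) g3).
rewrite coefM; apply: J_sum => b _; have [->|b0] := eqVneq b 0; first by rewrite f'0 mul0r; exact: J_0.
by apply: bad; rewrite // ht0.
Qed.

Lemma tri1 : tri 1.
Proof. by have := tri_J1 (@cJ_0 P M 1); rewrite addr0. Qed.

Lemma tri_prod (I : Type) (r : seq I) (Q : pred I) (F : I -> A) : (forall i, Q i -> tri (F i)) ->
  tri (\prod_(i <- r | Q i) F i).
Proof. by move=> h; elim/big_rec: _ => [|i x Qi tx]; [exact: tri1|apply: triM => //; exact: h]. Qed.

Lemma tri_muF (qq tt : coefField) b : (0 < M)%N -> Jp M 1 qq -> Jp M 1 tt -> 0 < ht b ->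
  tri (muF qq tt M (gX coefField b : A) (gX coefField (- b))).
Proof.
move=> M0 Jq Jt hb.
have iq n : isint (qq ^+ n) by apply/isintX/(J_int Jq).
have it := J_int Jt.
have tg (c : P) n : tri (gsum M ((tt * qq ^+ n) *: (gX coefField c : A))).
  rewrite /gsum geo_recl //; apply: tri_J1; apply: cJ_0M.
    apply: cJ_ZJ; last exact: cJ_gX.
    by rewrite mulrC; apply: J_Ml.
  apply: cJ_sum => i _; rewrite -[0%N]/(0 * i)%N; apply: (@cJ_X _ _ 0); apply: cJ_Z; last exact: cJ_gX.
  exact: isintM.
apply: tri_prod => k _; apply: triM => //; apply: triM => //; apply: triM; first exact: tri_lin.
rewrite -scaleNr; apply: tri_J1; apply: cJ_ZJ; last exact: cJ_gX.
by apply: J_N; rewrite exprSr; apply: J_Ml.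
Qed.
End FixedM.

Variable mu : nat -> A.
Hypothesis tri_mu : forall M, (0 < M)%N -> tri M (mu M).
Variable B : P -> Prop.

Lemma orthogonal_unique f : (forall c, f@_c != 0 -> B c) ->
  (forall c, B c -> exists2 D : coefRing, D != 0 & forall M, exists2 p : coefRing,
      D%:F * (f * mu M)@_c = p%:F & forall i j, (i < M)%N -> (j < M)%N -> p`_i`_j = 0) ->
  forall c, f@_c = 0.
Proof.
move=> supp ct c0; apply/eqP/negPn/negP => fc0.
have [d d0 hd] := den_galg f.
have [pb pbE] := boolp.choice hd.
have pb0 b : b \notin msupp f -> pb b = 0.
  move=> bf; have := pbE b; rewrite mcoeff_outdom // mulr0 => /esym/eqP.
  by rewrite tofrac_eq0 => /eqP.
have pbn b : f@_b != 0 -> pb b != 0.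
  by move=> fb; exact: frac_num_neq0 (pbE b) d0 fb.
have supp_in b : pb b != 0 -> b \in msupp f by apply: contraNT => /pb0 ->.
have exi : exists i, has (fun b => (pb b)`_i != 0) (msupp f).
  have := pbn _ fc0 => /low_exists[i hi _]; exists i; apply/hasP; exists c0 => //.
  by rewrite -mcoeff_neq0.
pose i := ex_minn exi.
have [hi mini] : has (fun b => (pb b)`_i != 0) (msupp f) /\ forall a b, (a < i)%N -> (pb b)`_a = 0.
  rewrite /i; case: ex_minnP => i' h1 h2; split=> // a b ai; apply/eqP/negPn/negP => h.
  have : (i' <= a)%N; last by lia.
  apply: h2; apply/hasP; exists b => //; apply: supp_in; apply: contraNneq h => ->; by rewrite coef0.
have exj : exists j, has (fun b => (pb b)`_i`_j != 0) (msupp f).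
  case/hasP: hi => b bf /low_exists[j hj _]; exists j; apply/hasP; by exists b.
pose j := ex_minn exj.
have [hj minj] : has (fun b => (pb b)`_i`_j != 0) (msupp f) /\ forall a b, (a < j)%N -> (pb b)`_i`_a = 0.
  rewrite /j; case: ex_minnP => j' h1 h2; split=> // a b aj; apply/eqP/negPn/negP => h.
  have : (j' <= a)%N; last by lia.
  apply: h2; apply/hasP; exists b => //; apply: supp_in; apply: contraNneq h => ->; by rewrite !coef0.
have lexb b : lexz (pb b) i j by split=> a *; [exact: mini|exact: minj].
have [c] : exists2 c, c \in filter (fun b => (pb b)`_i`_j != 0) (msupp f) &
    forall b, b \in filter (fun b => (pb b)`_i`_j != 0) (msupp f) -> ht c <= ht b.
  by apply: seq_argmin; rewrite -has_filter.
rewrite mem_filter => /andP[hc cf] cmin.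
have fc : f@_c != 0 by rewrite mcoeff_neq0.
have [D D0 hD] := ct c (supp c fc).
have [i0 [j0 [lexD hD0]]] := lex_exists D0.
pose M := (i0 + i + (j0 + j)).+1.
have [p pE p0] := hD M; have [mu1 mu2 mu3] := tri_mu (isT : (0 < M)%N).
have mint b : exists x : coefRing, (mu M)@_b = x%:F by have [x Ex _] := mu1 b; exists x.
have [mm mmE] := boolp.choice mint.
pose S := \sum_(b <- msupp f) pb b * mm (c - b).
have SE : d%:F * (f * mu M)@_c = S%:F.
  rewrite coefM mulr_sumr /S (big_morph (@tofrac coefRing) (@tofracD coefRing) (tofrac0 _)).
  by apply: eq_bigr => b _; rewrite mulrA pbE mmE tofracM.
have DS : D * S = d * p.
  exact: frac_cancel SE pE.
have lexS : lexz S i j by apply: lexz_sum => b; exact: lexz_mulr.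
have := congr1 (fun r : coefRing => r`_(i0 + i)`_(j0 + j)) DS; rewrite lex_mul //.
have -> : (d * p)`_(i0 + i)`_(j0 + j) = 0.
  rewrite poly.coefM coef_sum big1 // => -[a /= ha] _; rewrite poly.coefM big1 // => -[b /= hb] _.
  rewrite p0 ?mulr0 // ltnS; apply: leq_trans (leq_subr _ _) _; first exact: leq_addr.
  exact: leq_addl.
have -> : S`_i`_j = (pb c)`_i`_j.
  rewrite /S !coef_sum.
  have T b : (pb b * mm (c - b))`_i`_j = (pb b)`_i`_j * (mm (c - b))`_0`_0.
    by have := lex_mul (lexb b) (lexz00 (mm (c - b))); rewrite !addn0.
  rewrite (bigD1_seq c) //= ?fset_uniq // T subrr big_seq_cond big1 ?addr0.
    have [x Ex x0] := mu3; have : mm 0 - 1 = x.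
      by apply: frac_inj; rewrite tofracB tofrac1 -mmE Ex.
    move=> /(congr1 (fun r : coefRing => r`_0`_0)); rewrite !coefB x0 // => /eqP.
    by rewrite subr_eq0 !coefC /= => /eqP ->; rewrite mulr1.
  move=> b /andP[bf bc]; rewrite T; have [->|hb] := eqVneq (pb b)`_i`_j 0; first by rewrite mul0r.
  have hcb : ht (c - b) <= 0 by rewrite htB subr_le0; apply: cmin; rewrite mem_filter hb.
  have cb : c - b != 0 by rewrite subr_eq0 eq_sym.
  have [x Ex x0] := mu2 _ hcb cb.
  have -> : mm (c - b) = x by apply: frac_inj; rewrite -mmE Ex.
  by rewrite x0 ?mulr0.
by move/eqP; rewrite mulf_eq0 (negPf hD0) (negPf hc).
Qed.
End Triangular.
End TriangularUniqueness.

Module DominanceOrder.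
Import Weights GroupAlgebraTheory MinimalElement ReducedWord Generators DahaRelations BraidWords LaurentOperators PolynomialRep Evaluation ModularAction PowerSeries OneRow KnotVector RogersPairing Symmetrizer TwoRow SuperFormula KnotValue PiFixed OriginIdeal MacdonaldWeight WeightRelations Orthogonal TriangularUniqueness.

Local Notation "x %:F" := (@tofrac _ x).

Section Weights.
Variable N : nat.
Hypothesis N0 : (0 < N)%N.
Implicit Types (nu : 'I_N.+1 -> int) (b c : wt N).
Local Notation mw m := (omega N 1 *+ m).

Lemma mwE m : mw m = we ord0 *+ m. Proof. by rewrite omega1. Qed.
Lemma we_mulrn k m : we k *+ m = wtE (fun j => ee k j *+ m) :> wt N.
Proof. by rewrite /we wtEMn. Qed.
Lemma wactMn (w : {perm 'I_N.+1}) b m : wact w (b *+ m) = wact w b *+ m.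
Proof. by elim: m => [|m IH]; rewrite ?mulr0n ?wact0 // !mulrS wactD IH. Qed.

Lemma good_not_extremal m nu k : good m nu -> wtE nu != we k *+ m.
Proof.
move=> [h1 h2 [i [j [ij hi hj]]]]; apply/negP => /eqP; rewrite we_mulrn => E.
have sm : \sum_j nu j = \sum_j ee k j *+ m.
  by rewrite h2 sumrMnl sum_ee1; lia.
have E' := wtE_inj sm E.
have [ik|ik] := eqVneq i k.
  by move: hj; rewrite E' /ee -ik [j == i]eq_sym (negPf ij) mul0rn eqxx.
by move: hi; rewrite E' /ee (negPf ik) mul0rn eqxx.
Qed.

Lemma alpha_sum (k : 'I_N -> nat) : \sum_(i < N) alpha N i.+1 *+ k i =
  wtE (fun j => \sum_(i < N) ((j == i :> nat)%:Z - (j == i.+1 :> nat)%:Z) *+ k i).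
Proof.
rewrite -wtE_sum; apply: eq_bigr => i _; rewrite alphaE; last by have := ltn_ord i; lia.
by rewrite wtEMn.
Qed.

Lemma below_good m c : below c (mw m) -> exists2 nu, c = wtE nu & good m nu.
Proof.
move=> [w [dom ne [k kE]]].
pose mu (j : 'I_N.+1) : int := ee ord0 j *+ m - \sum_(i < N) ((j == i :> nat)%:Z - (j == i.+1 :> nat)%:Z) *+ k i.
have muE : wact w c = wtE mu.
  by rewrite -[LHS](subKr (mw m)) kE mwE we_mulrn alpha_sum wtEB.
have sumk (j : 'I_N) : \sum_j0 (((j0 : 'I_N.+1) == j :> nat)%:Z - (j0 == j.+1 :> nat)%:Z) *+ k j = 0.
  rewrite sumrMnl sumrB.
  rewrite (bigD1 (widen_ord (leqnSn N) j)) //= eqxx big1 ?addr0; last first.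
    by move=> i; rewrite -val_eqE /= => /negPf ->.
  rewrite (bigD1 (lift ord0 j)) //= /bump /= add1n eqxx big1 ?addr0 ?subrr ?mul0rn //.
  by move=> i; rewrite -val_eqE /= /bump /= add1n => /negPf ->.
have sum_mu : \sum_j mu j = m%:Z.
  rewrite sumrB sumrMnl sum_ee1 exchange_big /= big1 ?subr0; last by move=> j _; exact: sumk.
  lia.
have step (i : 'I_N) : mu (lift ord0 i) <= mu (widen_ord (leqnSn N) i).
  by have := dom i; rewrite muE mxE; lia.
have mono (a b : nat) : (a <= b)%N -> (b <= N)%N -> mu (inord b) <= mu (inord a).
  elim: b => [|b IH]; first by rewrite leqn0 => /eqP ->.
  rewrite leq_eqVlt => /orP[/eqP -> //|ab] bN.
  apply: le_trans (IH _ _); try lia.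
  have := step (Ordinal bN); congr (mu _ <= mu _); apply/val_inj; rewrite /= ?inordK //; try lia.
have last0 : 0 <= mu (inord N).
  rewrite /mu /ee -val_eqE /= inordK //.
  have -> : (N == 0%N) = false by lia.
  rewrite mul0rn sub0r oppr_ge0; apply: sumr_le0 => i _.
  have := ltn_ord i => iN; have -> : (N == i :> nat) = false by lia.
  by rewrite sub0r mulNrn oppr_le0 mulrn_wge0.
have ge0 j : 0 <= mu j.
  by apply: le_trans last0 _; have := mono j N; rewrite inord_val; apply => //; have := ltn_ord j; lia.
have two : exists i j, [/\ i != j, mu i != 0 & mu j != 0].
  apply: boolp.contrapT => no; move/negP: ne; apply; rewrite muE mwE we_mulrn.
  have oth j : j != ord0 -> mu j = 0.
    move=> j0; apply/eqP/negPn/negP => hj; apply: no; exists ord0, j; split=> //; first by rewrite eq_sym.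
    have := mono 0%N j; rewrite inord_val (_ : inord 0 = ord0); last by apply/val_inj; rewrite /= inordK.
    by move=> /(_ isT); have := ltn_ord j; have := ge0 j; lia.
  have m0 : mu ord0 = m%:Z.
    by rewrite -sum_mu (bigD1 ord0) //= big1 ?addr0 // => j j0; exact: oth.
  apply/eqP/wtE_ext => j; rewrite /ee; have [->|j0] := eqVneq j ord0; first by rewrite m0; lia.
  by rewrite oth // mul0rn.
exists (mu \o w).
  apply: (@wact_inj N w); rewrite muE wact_wtE; apply: wtE_ext => x /=.
  by rewrite permKV.
exact: good_perm.
Qed.

Lemma good_below m nu : good m nu -> below (wtE nu) (mw m).
Proof.
move=> gd; pose W (w : {perm 'I_N.+1}) := \sum_(k : 'I_N.+1) (N - k)%N%:Z * nu (w^-1 k)%g.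
have [w _ wmax] := @Order.TotalTheory.arg_maxP _ _ _ (1%g : {perm 'I_N.+1}) xpredT W isT.
pose mu k := nu (w^-1 k)%g.
have gmu : good m mu by have := good_perm w^-1%g gd.
have [mu0 summu _] := gmu.
exists w; rewrite wact_wtE -/mu; split.
- move=> i; rewrite mxE.
  pose a := widen_ord (leqnSn N) i; pose b := lift ord0 i.
  suff : mu b <= mu a by rewrite /a /b; lia.
  rewrite leNgt; apply/negP => lt.
  have ab : a != b by rewrite -val_eqE /= /bump /= add1n; lia.
  have := wmax (w * tperm a b)%g isT; apply/negP; rewrite -ltNge.
  have Ws (w' : {perm 'I_N.+1}) : W w' = (N - a)%N%:Z * nu (w'^-1 a)%g + (N - b)%N%:Z * nu (w'^-1 b)%g
     + \sum_(k : 'I_N.+1 | (k != a) && (k != b)) (N - k)%N%:Z * nu (w'^-1 k)%g.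
    rewrite /W (bigD1 a) //= (bigD1 b) /=; last by rewrite eq_sym.
    by rewrite addrA.
  rewrite !Ws invMg !permM tpermV tpermL tpermR -/(mu a) -/(mu b).
  rewrite [X in _ < _ + X](eq_bigr (fun k : 'I_N.+1 => (N - k)%N%:Z * nu (w^-1 k)%g)); last first.
    by move=> k /andP[ka kb]; rewrite permM tpermD // eq_sym.
  rewrite ltrD2r; have -> : (N - a)%N%:Z = (N - b)%N%:Z + 1.
    by rewrite /a /b /= /bump /= add1n; have := ltn_ord i; lia.
  move: lt; lia.
- by rewrite mwE; exact: good_not_extremal.
exists (fun i : 'I_N => absz (\sum_(j : 'I_N.+1 | (i < j)%N) mu j)).
rewrite mwE we_mulrn alpha_sum wtEB; apply: wtE_ext => j.
have kE (i : nat) : (absz (\sum_(j : 'I_N.+1 | (i < j)%N) mu j))%:Z = \sum_(j : 'I_N.+1 | (i < j)%N) mu j.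
  by rewrite gez0_abs // sumr_ge0.
transitivity (\sum_(i < N) (((j == i :> nat)%:Z - (j == i.+1 :> nat)%:Z) * \sum_(j : 'I_N.+1 | (i < j)%N) mu j)); last first.
  by apply: eq_bigr => i _; rewrite -kE; lia.
pose K (i : nat) := \sum_(j : 'I_N.+1 | (i < j)%N) mu j.
have KN : K N = 0 by rewrite /K big1 // => x; have := ltn_ord x; lia.
have Kj (x : 'I_N.+1) : (0 < x)%N -> K x.-1 = mu x + K x.
  move=> x0; rewrite /K (bigD1 x) /=; last by lia.
  by congr (_ + _); apply: eq_bigl => y; rewrite -val_eqE /=; lia.
have K0 : K 0%N = m%:Z - mu ord0.
  rewrite -summu (bigD1 ord0) //= [mu ord0 + _]addrC addrK; apply: eq_bigl => y; rewrite -val_eqE /=; lia.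
have -> : \sum_(i < N) ((j == i :> nat)%:Z - (j == i.+1 :> nat)%:Z) * K i =
   (if (j < N)%N then K j else 0) - (if (0 < j)%N then K j.-1 else 0).
  rewrite (eq_bigr (fun i : 'I_N => (j == i :> nat)%:Z * K i - (j == i.+1 :> nat)%:Z * K i)); last by move=> i _; rewrite mulrBl.
  rewrite sumrB; congr (_ - _).
    case: ifP => jN; last first.
      rewrite big1 // => i _; have -> : (j == i :> nat) = false by have := ltn_ord i; lia.
      by rewrite mul0r.
    rewrite (bigD1 (Ordinal jN)) //= eqxx mul1r big1 ?addr0 // => i.
    by rewrite -val_eqE /= eq_sym => /negPf ->; rewrite mul0r.
  case: ifP => j0; last first.
    rewrite big1 // => i _; have -> : (j == i.+1 :> nat) = false by lia.
    by rewrite mul0r.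
  have jN : (j.-1 < N)%N by have := ltn_ord j; lia.
  rewrite (bigD1 (Ordinal jN)) //= prednK // eqxx mul1r big1 ?addr0 // => i.
  rewrite -val_eqE /= => ne; have -> : (j == i.+1 :> nat) = false by lia.
  by rewrite mul0r.
rewrite /ee; have [->|j0] := eqVneq j ord0; first by rewrite /= N0 K0; lia.
have jp : (0 < j)%N by move: j0; rewrite -val_eqE /=; lia.
rewrite jp (Kj j jp) mul0rn; case: ifP => jN; first by lia.
by have -> : K j = 0; [rewrite -KN; congr K; have := ltn_ord j; lia|lia].
Qed.
End Weights.
End DominanceOrder.

Module MacdonaldOneRow.
Import Weights GroupAlgebraTheory MinimalElement ReducedWord Generators DahaRelations BraidWords LaurentOperators PolynomialRep Evaluation ModularAction PowerSeries OneRow KnotVector RogersPairing Symmetrizer TwoRow SuperFormula KnotValue PiFixed OriginIdeal MacdonaldWeight WeightRelations Orthogonal TriangularUniqueness DominanceOrder.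

Local Notation "x %:F" := (@tofrac _ x).

Lemma mulrn_neq0 (F : fieldType) (x : F) n : n%:R != 0 :> F -> x != 0 -> x *+ n != 0.
Proof. by move=> n0 x0; rewrite -mulr_natr mulf_neq0. Qed.

Section Shift.
Variables (P : zmodType) (K : fieldType).
Local Notation A := (galg P K).
Lemma galg_shift (f h : A) c : (f * h)@_c = (f * gX K (- c) * h)@_0.
Proof. by rewrite -mulrA mulrCA coef_gXl sub0r opprK. Qed.
Lemma galg_comb (k : K) (f g h : A) c : ((k *: f - g) * h)@_c = k * (f * h)@_c - (g * h)@_c.
Proof. by rewrite mulrBl mcoeffB -scalerAl mcoeffZ. Qed.
End Shift.

Lemma comb_alg (F : fieldType) (D d e k x y : F) :
  D * d * e * (k * x - y) = d * (e * k) * (D * x) - D * e * (d * y).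
Proof. ring. Qed.

Lemma ratio_alg (F : fieldType) (k x y b c : F) : k != 0 -> y != 0 -> b = k * x -> c = k * y ->
  y^-1 * x = b / c.
Proof. by move=> k0 y0 -> ->; field; rewrite k0 y0. Qed.

Lemma comb_frac (R : idomainType) (D1 d e n : R) (k x y z : {fraction R}) :
  e%:F * k = n%:F -> z = k * x - y ->
  (D1 * d * e)%:F * z = d%:F * n%:F * (D1%:F * x) - D1%:F * e%:F * (d%:F * y).
Proof. by move=> <- ->; rewrite !tofracM; exact: comb_alg. Qed.

Section SupportAlgebra.
Variable N : nat.
Hypothesis N0 : (0 < N)%N.
Local Notation A := (galg (wt N) coefField).
Implicit Types (f g : A) (nu : 'I_N.+1 -> int).

Definition homsupp (m : nat) f := forall b, f@_b != 0 ->
  exists nu, [/\ b = wtE nu, forall k, 0 <= nu k & \sum_k nu k = m%:Z].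

Lemma homsuppD m f g : homsupp m f -> homsupp m g -> homsupp m (f + g).
Proof.
move=> hf hg b; rewrite mcoeffD => h; have [f0|] := eqVneq f@_b 0; last exact: hf.
by apply: hg; apply: contra_neq h => ->; rewrite f0 addr0.
Qed.
Lemma homsupp0 m : homsupp m 0. Proof. by move=> b; rewrite mcoeff0 eqxx. Qed.
Lemma homsuppZ m a f : homsupp m f -> homsupp m (a *: f).
Proof. by move=> hf b; rewrite mcoeffZ mulf_eq0 negb_or => /andP[_]; exact: hf. Qed.
Lemma homsuppX nu m : (forall k, 0 <= nu k) -> \sum_k nu k = m%:Z -> homsupp m (gX coefField (wtE nu)).
Proof.
move=> h1 h2 b; rewrite gX_coef; case: (wtE nu =P b) => [<- _|_]; last by rewrite eqxx.
by exists nu.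
Qed.
Lemma homsuppM m n f g : homsupp m f -> homsupp n g -> homsupp (m + n) (f * g).
Proof.
move=> hf hg b; rewrite coefM; set s := msupp f => h.
have [c] : exists c, f@_c * g@_(b - c) != 0.
  apply: boolp.contrapT => no; move/negP: h; apply; apply/eqP; apply: big1 => c _.
  by apply/eqP/negPn/negP => hc; apply: no; exists c.
rewrite mulf_eq0 negb_or => /andP[/hf[nu [E h1 h2]] /hg[nu' [E' h1' h2']]].
exists (fun k => nu k + nu' k); split=> [|k|].
- by rewrite -wtED -E -E' addrC subrK.
- exact: addr_ge0.
by rewrite big_split /= h2 h2' PoszD.
Qed.
Lemma homsupp1 : homsupp 0 1.
Proof.
have -> : (1 : A) = gX coefField (wtE (fun=> 0) : wt N) by rewrite wtE0.
by apply: homsuppX => //; rewrite big1.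
Qed.
Lemma homsupp_exp m f n : homsupp m f -> homsupp (m * n) (f ^+ n).
Proof.
by move=> hf; elim: n => [|n IH]; [rewrite muln0; exact: homsupp1|rewrite mulnS exprS; exact: homsuppM].
Qed.
Lemma homsupp_sum m (I : Type) (r : seq I) (F : I -> A) : (forall i, homsupp m (F i)) ->
  homsupp m (\sum_(i <- r) F i).
Proof. move=> h; elim: r => [|i r IH]; first by rewrite big_nil; exact: homsupp0.
rewrite big_cons; exact: homsuppD (h i) IH. Qed.

Lemma homsupp_mulrn m n f : homsupp m (f *+ n.+1) -> homsupp m f.
Proof.
by move=> hf b h; apply: hf; rewrite mcoeffMn; apply: mulrn_neq0 h; exact: coefField_char0.
Qed.

Lemma homsupp_ld (F E : nat -> A) :
  F 0%N = 1 -> (forall j, homsupp j.+1 (E j.+1)) ->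
  (forall n, F n *+ n = \sum_(j < n) E j.+1 * F (n - j.+1)%N) -> forall m, homsupp m (F m).
Proof.
move=> F0 hE rec m; elim/ltn_ind: m => -[|m] IH; first by rewrite F0; exact: homsupp1.
apply: (@homsupp_mulrn _ m); rewrite rec; apply: homsupp_sum => j.
have h := homsuppM (hE j) (IH (m.+1 - j.+1)%N _).
by rewrite subnKC in h; [apply: h; lia | have := ltn_ord j; lia].
Qed.

Lemma sum_gX_coef (s : seq (wt N)) b : uniq s -> (\sum_(c <- s) gX coefField c : A)@_b = (b \in s)%:R.
Proof.
elim: s => [|c s IH] /=; first by rewrite big_nil mcoeff0.
move=> /andP[cs us]; rewrite big_cons mcoeffD gX_coef IH // inE eq_sym.
by case: eqP => [->|_]; rewrite ?(negPf cs) ?addr0 ?add0r.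
Qed.

End SupportAlgebra.

Section Macdonald.
Variable N : nat.
Hypothesis N0 : (0 < N)%N.
Variable D : daha N.
Local Notation L := (laurent N).
Local Notation q := (q N).
Local Notation X := (@LX N : wt N -> L).
Local Notation g := (OneRow.g X).
Local Notation mw m := (omega N 1 *+ m).
Let rep := laurent_rep D N0.

Lemma g_homsupp m : homsupp m (g m%:Z).
Proof.
have dg := ld_g X.
have H := @homsupp_ld N N0 (fun a : nat => g a%:Z) (Eg X).
apply: H => [|j|n].
- exact: (ld_0 dg).
- rewrite /Eg; apply: homsuppZ; apply: homsupp_sum => k.
  have h : homsupp 1 (X (we k)) by apply: homsuppX; [move=> i; rewrite /ee; case: (_ == _)|rewrite sum_ee1].
  by have H1 := homsupp_exp h; have := H1 j.+1; rewrite mul1n.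
apply: etrans (ld_rec dg n) _; apply: eq_bigr => j _; congr (_ * g _).
by have := ltn_ord j; lia.
Qed.

Lemma g_extremal (m : nat) k : (g m)@_(we k *+ m) = (g m)@_(we ord0 *+ m).
Proof.
have H (n : nat) : (n <= N)%N -> (g m)@_(we (inord n) *+ m) = (g m)@_(we ord0 *+ m).
  elim: n => [|n IH] nN.
    by congr (_@_(we _ *+ _)); apply/val_inj; rewrite /= inordK.
  have n0 : (inord n.+1 : 'I_N.+1) != ord0 by rewrite -val_eqE /= inordK.
  rewrite -IH; last by lia.
  rewrite -(sv_coef (inord n.+1) (g m) (we (inord n) *+ m)) (sv_g rep) wactMn wact_we.
  by congr (_@_(we _ *+ _)); rewrite /swp inordK //= tpermL.
by have := H k; rewrite inord_val; apply; have := ltn_ord k; lia.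
Qed.

Lemma orbit_coef (m : nat) b : (orbit_sum (mw m))@_b = (b \in [seq wact w (mw m) | w : {perm 'I_N.+1}])%:R.
Proof. by rewrite -mem_undup; exact: (sum_gX_coef b (undup_uniq _)). Qed.

Lemma orbitP (m : nat) b : reflect (exists k, b = we k *+ m) (b \in [seq wact w (mw m) | w : {perm 'I_N.+1}]).
Proof.
apply: (iffP imageP) => [[w _ ->]|[k ->]].
  by exists (w ord0); rewrite mwE wactMn wact_we.
by exists (tperm ord0 k) => //; rewrite mwE wactMn wact_we tpermL.
Qed.

Lemma ht_alpha (i j : 'I_N.+1) : (i < j)%N -> 0 < ip (rho N) (we i - we j).
Proof.
move=> ij; have : ip (rho N) (we i - we j) + ip (rho N) (we j) = ip (rho N) (we i).
  by rewrite ipC [ip (rho N) (we j)]ipC -ipDl subrK ipC.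
rewrite !rho_we => E; have -> : ip (rho N) (we i - we j) = j%:R - i%:R by lra.
by rewrite subr_gt0 ltr_nat.
Qed.

Lemma ip_rhoB b c : ip (rho N) (b - c) = ip (rho N) b - ip (rho N) c.
Proof. by apply/eqP; rewrite -subr_eq opprK ipC [ip (rho N) c]ipC -ipDl subrK ipC. Qed.

Lemma J_q M : Jp M 1 q.
Proof. by apply: J_mono (J_X (2 * N + 2) (J_u M)); lia. Qed.
Lemma J_t1 M : Jp M 1 t.
Proof. by apply: J_mono (J_X 2 (J_v M)). Qed.

Lemma tri_mu M : (0 < M)%N -> tri (ip (rho N)) M (mu N M).
Proof.
move=> M0; rewrite muE; apply: (tri_prod ip_rhoB) => -[i j] /= ij.
rewrite -(opprB (we i)); apply: (tri_muF ip_rhoB M0 (J_q M) (J_t1 M)).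
exact: ht_alpha.
Qed.

Lemma g_orthogonal (m : nat) (d : coefRing) : (forall a b, (a <= m)%N -> isint (d%:F * (g a)@_b)) ->
  forall M nu k, good m nu -> Jp M k (d%:F * (g m * mu N M)@_(wtE nu)).
Proof.
move=> hd M nu k gd.
pose cf (f : L) (c : wt N) := f@_c.
have cfB f h c : cf (f - h) c = cf f c - cf h c by exact: galg_coefB.
have cfZ a f c : cf (a *: f) c = a * cf f c by exact: galg_coefZ.
have cfX b f c : cf (X b * f) c = cf f (c - b) by exact: coef_gXl.
have sfm : forall a i, (a <= m)%N -> i != ord0 -> forall k c,
    Jp M k (cf ((t%:A - X (alpha N i)) * sv i (fma X (mu N M) d%:F a) - (1 - t *: X (alpha N i)) * fma X (mu N M) d%:F a) c).
  move=> a i am i0 k' c; exact: (srel_fm N0 D M hd am i0 k' c).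
have S := srel cfB cfZ cfX (@sv_coef N) sfm.
have R := pirel N0 rep cfB cfZ cfX (@pv_coef N) d%:F (pv_mu N0 D M).
have : Jp M k (ava X cf (mu N M) d%:F m nu).
  apply: (orthogonal N0 _ _ S R k (leqnn m) gd) => [a nu1 nu2 E|a nu' am].
    by congr (cf _ _); exact: wtE_ext.
  exact: J_int (cJ_fm M hd am (wtE nu')).
by rewrite /ava /fma cfZ.
Qed.

Lemma macdonald_g (m : nat) (P : L) : is_macdonald (mw m) P -> exists k : coefField, g m = k *: P.
Proof.
move=> [_ P2 P3]; set k := (g m)@_(we ord0 *+ m); exists k.
pose f := k *: P - g m.
have fc c : f@_c = k * P@_c - (g m)@_c by rewrite (galg_coefB (k *: P)) (galg_coefZ k P).
have Pc c : c \notin [seq wact w (mw m) | w : {perm 'I_N.+1}] -> P@_c != 0 -> below c (mw m).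
  move=> no Pc0; apply: P2; rewrite -mcoeff_neq0 (galg_coefB P) orbit_coef (negPf no) subr0; exact: Pc0.
have supp c : f@_c != 0 -> below c (mw m).
  rewrite fc; case: (orbitP m c) => [[j cE]|no].
    have P1 : P@_c = 1.
      apply/eqP; rewrite -subr_eq0; apply/negPn/negP => h.
      have : below c (mw m).
        apply: P2; rewrite -mcoeff_neq0 (galg_coefB P) orbit_coef.
        by have -> : c \in [seq wact w (mw m) | w : {perm 'I_N.+1}] by apply/orbitP; exists j.
      case/(below_good N0) => nu E gd; have := good_not_extremal N0 j gd.
      by rewrite -E cE eqxx.
    by rewrite P1 mulr1 cE g_extremal subrr eqxx.
  move=> h; have [P0|] := eqVneq P@_c 0; last by apply: Pc; apply/orbitP.
  have : (g m)@_c != 0 by apply: contra_neq h => ->; rewrite P0 mulr0 subrr.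
  case/g_homsupp => nu [E h1 h2]; rewrite E; apply: (good_below N0); split=> //.
  apply: boolp.contrapT => no2; apply: no.
  have [j hj] : exists j, nu j != 0 \/ (forall i, nu i = 0).
    have [/existsP[j hj]|/existsPn h0] := boolP [exists j, nu j != 0]; first by exists j; left.
    by exists ord0; right=> i; apply/eqP; have := h0 i; rewrite negbK.
  exists j; rewrite E we_mulrn; apply: wtE_ext => i.
  have oth i' : i' != j -> nu i' = 0.
    move=> ij; case: hj => [hj|//]; apply/eqP/negPn/negP => hi; apply: no2.
    by exists i', j.
  rewrite /ee; have [->|ij] := eqVneq i j; last by rewrite oth ?mul0rn.
  by rewrite (_ : nu j = m%:Z); [lia|rewrite -h2 (bigD1 j) //= big1 ?addr0].
have ct c : below c (mw m) -> exists2 D0 : coefRing, D0 != 0 & forall M, exists2 p : coefRing,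
      D0%:F * (f * mu N M)@_c = p%:F & forall i j, (i < M)%N -> (j < M)%N -> p`_i`_j = 0.
  move=> bc; have [D1 [D10 _ D1P]] := P3 c bc.
  have [d d0 hd] := den_seq (fun a : nat => g a) m.
  have [e e0 [n en]] := frac_denom k.
  exists (D1 * d * e) => [|M]; first by rewrite !mulf_neq0.
  have [nu cE gd] := below_good N0 bc.
  have J2 := g_orthogonal hd M (2 * M) gd; rewrite -cE in J2.
  have J1 : Jp M (2 * M) (D1%:F * (P * mu N M)@_c).
    have [p1 E1 h1] := D1P M; exists p1 => [|i j iM jM _]; last exact: h1.
    exact: etrans (congr1 (fun z => D1%:F * z) (galg_shift P (mu N M) c)) E1.
  have E : (f * mu N M)@_c = k * (P * mu N M)@_c - (g m * mu N M)@_c.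
    exact: (galg_comb k P (g m) (mu N M) c).
  have : Jp M (2 * M) ((d%:F * n%:F) * (D1%:F * (P * mu N M)@_c) - (D1%:F * e%:F) * (d%:F * (g m * mu N M)@_c)).
    apply: J_B; apply: J_Ml => //.
      by exists (d * n); rewrite tofracM.
    by exists (D1 * e); rewrite tofracM.
  case=> p pE hp; exists p => [|i j iM jM]; last by apply: hp => //; lia.
  exact: etrans (comb_frac D1 d en E) pE.
have f0 := orthogonal_unique ip_rhoB tri_mu supp ct.
apply/malgP => c; have := f0 c; rewrite fc => /eqP; rewrite subr_eq0 => /eqP <-.
by rewrite -(galg_coefZ k P).
Qed.

Lemma lev_g_neq0 (m : nat) : lev (g m) != 0.
Proof.
rewrite (lv_g N0 rep); have vN : v ^- N != 0 by rewrite invr_neq0 // expf_neq0 ?v_neq0.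
apply: mulf_neq0 (expfz_neq0 m%:Z vN) _.
apply: phi_neq0; first exact: qn_neq1.
move=> k; rewrite subr_eq0 eq_sym mulrC; have := qt_neq1 N0 (a := k) (b := N.+1%:Z).
by rewrite -exprnP; apply; right.
Qed.

Lemma word_mapZ s a (h : daha_alg D) : word_map s (a *: h) = a *: word_map s h.
Proof.
elim: s => //= l s ->; case: l; rewrite /= ?linearZ //.
all: by rewrite /= !linearZ.
Qed.

Lemma jones_value (m p : nat) (P : L) (s : seq letter) : (0 < m)%N -> is_macdonald (mw m) P ->
  word_mx s 0%R 0%R = (2 * p + 1)%N%:Z -> word_mx s 1%R 0%R = 2%:Z ->
  lev (dact (word_map s ((lev P)^-1 *: \sum_(b <- msupp P) P@_b *: dX D b)) 1) =
    Cm N m * Etb N (2 * m) 0 ^+ p * v ^- N ^+ m * superformula (eta N) v (- t ^+ N.+1) p m.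
Proof.
move=> m0 mP s0 s1; have [k gE] := macdonald_g mP.
have lgE : lev (g m) = k * lev P by rewrite gE levZ.
have := lev_g_neq0 m; rewrite lgE mulf_eq0 negb_or => /andP[k0 P0].
have eE : gev (dX D) (g m) = k *: gev (dX D) P by rewrite gE gevZ.
have Hpi : forall (m : nat) (f : L), (0 < m)%N -> @symm N L (@LaurentOperators.sv N) f -> eN ^+ (2 * m) *: LaurentOperators.pv f = f -> f = 0.
  by move=> m' f h _; exact: (pv_fixed N0 rep h).
pose W (h : daha_alg D) := lev (dact (word_map s h) 1).
have WZ a h : W (a *: h) = a * W h.
  rewrite /W (word_mapZ s a h) (act_lZ rep a _ 1); exact: levZ.
apply: etrans (WZ (lev P)^-1 (gev (dX D) P)) _.
apply: etrans _ (value N0 rep Hpi m0 s0 s1).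
have E2 : W (gev (dX D) (g m)) = k * W (gev (dX D) P) by rewrite eE; exact: WZ.
exact (ratio_alg k0 P0 E2 lgE).
Qed.
End Macdonald.
End MacdonaldOneRow.

Module Normalize.
Import Generators PowerSeries OneRow WeightedSums KnotVector RogersPairing TwoRow ScalarSums SuperFormula KnotValue OriginIdeal TriangularUniqueness MacdonaldOneRow.

Local Notation "x %:F" := (@FracField.tofrac _ x).

Section ValueAtOrigin.
Variables (R : idomainType) (K : fieldType) (ev0 : {rmorphism R -> K}).
Local Notation F := {fraction R}.

Definition valued (x : F) (c : K) := exists n d : R, [/\ ev0 d != 0, x * d%:F = n%:F & ev0 n = c * ev0 d].

Lemma valued_frac p : valued p%:F (ev0 p).
Proof. by exists p, 1; rewrite rmorph1 tofrac1 !mulr1 oner_neq0. Qed.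

Lemma valued1 : valued 1 1.
Proof. by have := valued_frac 1; rewrite tofrac1 rmorph1. Qed.

Lemma valued_add (x y a b : F) : (x + y) * (a * b) = x * a * b + y * b * a.
Proof. ring. Qed.

Lemma valuedD x y a b : valued x a -> valued y b -> valued (x + y) (a + b).
Proof.
case=> n [d [d0 h1 h2]] [n' [d' [d0' h1' h2']]]; exists (n * d' + n' * d), (d * d').
rewrite tofracM tofracD !tofracM valued_add h1 h1' rmorphD !rmorphM /= h2 h2'.
by split=> //; [rewrite mulf_neq0 | ring].
Qed.

Lemma valuedN x a : valued x a -> valued (- x) (- a).
Proof.
by case=> n [d [d0 h1 h2]]; exists (- n), d; rewrite tofracN mulNr h1 rmorphN h2 mulNr.
Qed.

Lemma valuedB x y a b : valued x a -> valued y b -> valued (x - y) (a - b).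
Proof. by move=> hx hy; apply: valuedD hx (valuedN hy). Qed.

Lemma valuedM x y a b : valued x a -> valued y b -> valued (x * y) (a * b).
Proof.
case=> n [d [d0 h1 h2]] [n' [d' [d0' h1' h2']]]; exists (n * n'), (d * d').
by rewrite !tofracM mulrACA h1 h1' !rmorphM /= h2 h2' mulrACA mulf_neq0.
Qed.

Lemma valuedV x a : a != 0 -> valued x a -> valued x^-1 a^-1.
Proof.
move=> a0 [n [d [d0 h1 h2]]]; exists d, n.
have n0 : ev0 n != 0 by rewrite h2 mulf_neq0.
have x0 : x != 0.
  apply: contraNneq n0 => x0; move/esym/eqP: h1; rewrite x0 mul0r tofrac_eq0 => /eqP ->.
  by rewrite rmorph0.
by split=> //; [rewrite -h1 mulKf | rewrite h2 mulKf].
Qed.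

Lemma valuedX x a n : valued x a -> valued (x ^+ n) (a ^+ n).
Proof. by move=> h; elim: n => [|n IH]; rewrite ?exprS; [exact: valued1 | exact: valuedM]. Qed.

Lemma valued_prod1 n (f : 'I_n -> F) : (forall i, valued (f i) 1) -> valued (\prod_(i < n) f i) 1.
Proof.
move=> h; apply: (big_ind (fun x => valued x 1)) => //; first exact: valued1.
by move=> x y hx hy; rewrite -[1]mulr1; exact: valuedM.
Qed.

Lemma valued_sum0 n (f : 'I_n -> F) : (forall i, valued (f i) 0) -> valued (\sum_(i < n) f i) 0.
Proof.
move=> h; apply: (big_ind (fun x => valued x 0)) => //; first by have := valued_frac 0; rewrite tofrac0 rmorph0.
by move=> x y hx hy; rewrite -[0]addr0; exact: valuedD.
Qed.

Section Super.
Variables (qh th A : F).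
Local Notation q := (qh ^+ 2).
Local Notation t := (th ^+ 2).
Hypothesis q0 : qh != 0.
Hypothesis q1 : forall n : nat, 1 - q ^+ n.+1 != 0.
Hypothesis tq1 : forall k : int, 1 - t * q ^ k != 0.
Hypothesis A1 : forall n, 1 - A * q ^+ n != 0.
Hypothesis vq : valued qh 0.
Hypothesis vt : valued th 0.
Hypothesis vA : valued A 0.
Hypothesis vAt : valued (A / t) 0.

Let vX (x : F) n : valued x 0 -> (0 < n)%N -> valued (x ^+ n) 0.
Proof. by move=> h n0; have := valuedX n h; rewrite expr0n eqn0Ngt n0. Qed.

Let v1M (x y : F) : valued x 1 -> valued y 1 -> valued (x * y) 1.
Proof. by move=> hx hy; rewrite -[1]mulr1; exact: valuedM. Qed.

Let v1V (x : F) : valued x 1 -> valued x^-1 1.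
Proof. by move=> h; have := valuedV (oner_neq0 K) h; rewrite invr1. Qed.

Let v1B (x y : F) a : valued x 0 -> valued y a -> valued (1 - x * y) 1.
Proof. by move=> hx hy; rewrite -[X in valued _ X]subr0 -(mul0r a); apply: valuedB valued1 (valuedM hx hy). Qed.

Let v_qpoch (x : F) n : valued x 0 -> valued (qpoch x q n) 1.
Proof. by move=> h; apply: valued_prod1 => i; apply: v1B h (valuedX i (valuedX 2 vq)). Qed.

Let v_phi (x : F) n : valued x 0 -> valued (phi q x n%:Z) 1.
Proof. by move=> h; rewrite phi_qpoch; apply: v1M (v_qpoch n h) (v1V (v_qpoch n (vX vq _))). Qed.

Let v_eps d s : exists2 c : K, valued (eps q t A d s) c & s = 0%N -> c = 1.
Proof.
have v1 := v1M (v1M (v_qpoch (d - 2 * s + s) vA) (v_qpoch s vAt)) (v1B (vX vt (isT : (0 < 2)%N)) (valuedX (d - 2 * s) (valuedX 2 vq))).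
have v2 := v1V (v1M (v_qpoch s (vX vq (isT : (0 < 2)%N))) (v_qpoch (d - 2 * s + s).+1 (vX vt (isT : (0 < 2)%N)))).
exists ((0 ^+ 2) ^+ s * 1); last by move=> ->; rewrite expr0 mulr1.
have h := valuedM (valuedX s (valuedX 2 vt)) (v1M v1 v2).
by rewrite /eps /epsk; move: h; rewrite !mulrA.
Qed.

Lemma superformula_valued p m : valued (superformula qh th (- A) p m) 1.
Proof.
rewrite (superformulaE q0 q1 tq1 A1); apply: v1M; last exact: v1V (v_phi m vA).
rewrite big_ord_recl -[X in valued _ X]addr0; apply: valuedD.
  have [c hc c1] := v_eps (2 * m) 0; rewrite c1 // in hc.
  rewrite /= !mul0n !expr0 !mulr1 expr1n mulr1 mul1r subn0.
  exact: v1M (v_phi m (vX vt (isT : (0 < 2)%N))) hc.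
apply: valued_sum0 => s; have [c hc _] := v_eps (2 * m) (lift ord0 s).
have v1 := valuedX (lift ord0 s) (valuedN valued1).
have pos : (0 < lift ord0 s * (2 * (m - lift ord0 s) + 1 + lift ord0 s))%N.
  by rewrite muln_gt0 lift0 /= addn_gt0 orbT.
have v2 := vX vq pos.
have v3 := v_phi (m - lift ord0 s) (vX vt (isT : (0 < 2)%N)).
have v4 := valuedX p (valuedM (valuedX (lift ord0 s) (valuedX 2 vt)) (valuedX (lift ord0 s * (2 * m - lift ord0 s)) (valuedX 2 vq))).
by have := valuedM (valuedM (valuedM (valuedM v1 v2) v3) v4) hc; rewrite mulr0 !mul0r.
Qed.
End Super.
End ValueAtOrigin.

Definition origin : {rmorphism coefRing -> rat} := horner_eval 0 \o horner_eval 0.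

Lemma originE p : origin p = p`_0`_0.
Proof. by rewrite /= /horner_eval !horner_coef0. Qed.

Lemma valued_u : valued origin u 0.
Proof. by have := valued_frac origin 'X; rewrite originE coefX coef0. Qed.

Lemma valued_v : valued origin v 0.
Proof. by have := valued_frac origin ('X)%:P; rewrite originE coefC coefX. Qed.

Lemma monomial_coef (p : coefRing) c d i j :
  ('X^c * (('X^d)%:P * p))`_i`_j = if (i < c)%N || (j < d)%N then 0 else p`_(i - c)`_(j - d).
Proof.
by rewrite coefXnM; case: ltnP => //= _; [rewrite coef0 | rewrite coefCM coefXnM].
Qed.

Lemma monomial_cancel (p1 p2 : coefRing) a b c d : origin p1 != 0 -> origin p2 != 0 ->
  'X^a * (('X^b)%:P * p1) = 'X^c * (('X^d)%:P * p2) -> a = c /\ b = d.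
Proof.
rewrite !originE => h1 h2 E.
have := congr1 (fun p : coefRing => p`_a`_b) E; rewrite /= !monomial_coef !ltnn /= !subnn.
case: ifP => [_ e|/negbT]; first by rewrite e eqxx in h1.
rewrite negb_or -!leqNgt => /andP[ca db] _.
have := congr1 (fun p : coefRing => p`_c`_d) E; rewrite /= !monomial_coef !ltnn /= !subnn.
case: ifP => [_ e|/negbT]; first by rewrite -e eqxx in h2.
by rewrite negb_or -!leqNgt => /andP[ac bd] _; split; apply/eqP; rewrite eqn_leq ?ca ?db ?ac ?bd.
Qed.

Lemma nat_diff (x : int) : exists a b : nat, x = a%:Z - b%:Z.
Proof. by case: x => n; [exists n, 0%N; rewrite subr0 | exists 0%N, n.+1; rewrite sub0r NegzE]. Qed.

Section Cancel.
Variables (F : fieldType) (x y : F).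
Hypothesis x0 : x != 0.
Hypothesis y0 : y != 0.

Lemma expz_diff (z : F) (a b : nat) : z != 0 -> z ^ (a%:Z - b%:Z) = z ^+ a / z ^+ b.
Proof. by move=> z0; rewrite expfzDr // -exprnN -!exprnP. Qed.

Lemma clear_monomials (J f n d p : F) (a b c e a' b' c' e' : nat) :
  x ^ (a%:Z - b%:Z) * y ^ (c%:Z - e%:Z) * J = x ^ (a'%:Z - b'%:Z) * y ^ (c'%:Z - e'%:Z) * f ->
  f * d = n -> J = p ->
  x ^+ (a + b') * (y ^+ (c + e') * (p * d)) = x ^+ (a' + b) * (y ^+ (c' + e) * n).
Proof.
rewrite !expz_diff // => E <- <-; rewrite !exprD.
have := expf_neq0 b x0; have := expf_neq0 e y0; have := expf_neq0 b' x0; have := expf_neq0 e' y0.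
move: E; move: (x ^+ _) (x ^+ _) (x ^+ _) (x ^+ _) (y ^+ _) (y ^+ _) (y ^+ _) (y ^+ _) => a1 a2 a3 a4 b1 b2 b3 b4 E h1 h2 h3 h4.
move/(congr1 (fun z => z * (a3 * a1 * b3 * b1) * d)): E.
rewrite (_ : _ * J * _ * d = a4 * a1 * (b4 * b1 * (J * d))); last by field; rewrite ?h1 ?h2 ?h3 ?h4.
by move=> ->; field; rewrite ?h1 ?h2 ?h3 ?h4.
Qed.

Lemma monomial_inj i j J f : x ^ i * y ^ j * J = x ^ i * y ^ j * f -> J = f.
Proof. by apply: mulfI; rewrite mulf_neq0 ?expfz_neq0. Qed.

Definition monomial (z : F) := exists i j : int, z = x ^ i * y ^ j.

Lemma monomialM z w : monomial z -> monomial w -> monomial (z * w).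
Proof. by move=> [i [j ->]] [i' [j' ->]]; exists (i + i'), (j + j'); rewrite !expfzDr // mulrACA. Qed.

Lemma monomialV z : monomial z -> monomial z^-1.
Proof. by move=> [i [j ->]]; exists (- i), (- j); rewrite invfM !invr_expz. Qed.

Lemma monomial1 : monomial 1.
Proof. by exists 0, 0; rewrite !expr0z mulr1. Qed.

Lemma monomialX z n : monomial z -> monomial (z ^+ n).
Proof. by move=> h; elim: n => [|n IH]; rewrite ?exprS; [exact: monomial1 | exact: monomialM]. Qed.

Lemma monomial_x : monomial x. Proof. by exists 1, 0; rewrite expr1z expr0z mulr1. Qed.
Lemma monomial_y : monomial y. Proof. by exists 0, 1; rewrite expr1z expr0z mul1r. Qed.
End Cancel.

Lemma normalized_unique (E J f w : coefField) : tilde_normalized E J -> E = w * f ->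
  monomial u v w -> valued origin f 1 -> J = f.
Proof.
case=> [i [j [p [EJ Jp p0]]]] Ef [i' [j' wE]] [n [d [d0 fd nd]]].
rewrite Ef wE in EJ; rewrite mul1r in nd.
have [a [b ab]] := nat_diff i; have [c [e ce]] := nat_diff j.
have [a' [b' ab']] := nat_diff i'; have [c' [e' ce']] := nat_diff j'.
have EJ2 := esym EJ; rewrite ab ce ab' ce' in EJ2.
have H := clear_monomials u_neq0 v_neq0 EJ2 fd Jp.
have X (k l : nat) (r : coefRing) : u ^+ k * (v ^+ l * r%:F) = ('X^k * (('X^l)%:P * r))%:F.
  rewrite !tofracM; congr (_ * (_ * _)); first by rewrite tofracXn.
  by rewrite -tofracXn -polyC_exp.
have H2 : ('X^(a + b') * (('X^(c + e'))%:P * (p * d)))%:F = ('X^(a' + b) * (('X^(c' + e))%:P * n))%:F.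
  apply: etrans (esym (X _ _ _)) (etrans _ (X _ _ _)).
  by apply: etrans _ H; rewrite tofracM.
have pd0 : origin (p * d) != 0 by rewrite rmorphM /= mulf_neq0 // -?[_ (_ p)]/(origin p) ?originE.
have n0 : origin n != 0 by rewrite nd.
have [e1 e2] := monomial_cancel pd0 n0 (frac_inj H2).
have ii : i = i' by rewrite ab ab'; lia.
have jj : j = j' by rewrite ce ce'; lia.
by rewrite ii jj in EJ; exact: (monomial_inj u_neq0 v_neq0 (esym EJ)).
Qed.

Lemma monomial_prefactor N m p : monomial u v (Cm N m * Etb N (2 * m) 0 ^+ p * v ^- N ^+ m).
Proof.
have U := monomial_x u v; have V := monomial_y u v.
have M := monomialM u_neq0 v_neq0; have X := monomialX u_neq0 v_neq0; have I := @monomialV _ u v.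
have Q : monomial u v (q N) by apply: X.
have E : monomial u v eN by apply: I; apply: X.
apply: (M _ _ (M _ _ _ (X _ _ _)) (X _ _ (I _ (X _ _ V)))).
  exact: (M _ _ (X _ _ (I _ (X _ _ V))) (X _ _ (I _ (M _ _ E Q)))).
apply: (M _ _ (M _ _ (M _ _ _ _) (I _ (X _ _ Q))) (X _ _ (X _ _ V))); last exact: (I _ (X _ _ E)).
exact: (X _ _ (M _ _ (I _ (X _ _ V)) (I _ (X _ _ U)))).
Qed.

Lemma jones_superformula N p m J : (0 < N)%N -> (0 < m)%N -> is_JD N (2 * p + 1) 2 m J ->
  J = superformula (eta N) v (- t ^+ N.+1) p m.
Proof.
move=> N0 m0; rewrite /is_JD; case: eqP N0 => [-> //|_ N0] [D [s [P [[s0 s1] mP nJ]]]].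
have E := jones_value N0 D m0 mP s0 s1.
apply: (normalized_unique nJ E (monomial_prefactor N m p)).
have q1' : forall n : nat, 1 - (eta N ^+ 2) ^+ n.+1 != 0 by move=> n; rewrite -(q_eta N); exact: (qn_neq1 N0).
have tq1' : forall k : int, 1 - v ^+ 2 * (eta N ^+ 2) ^ k != 0.
  by move=> k; rewrite -(q_eta N) subr_eq0 eq_sym mulrC; have := qt_neq1 N0 (a := k) (b := 1); rewrite expr1z; apply; right.
have A1 n : 1 - t ^+ N.+1 * (eta N ^+ 2) ^+ n != 0.
  rewrite -(q_eta N) subr_eq0 eq_sym mulrC; have := qt_neq1 N0 (a := n%:Z) (b := N.+1%:Z).
  by rewrite -!exprnP; apply; right.
have vp x k : (0 < k)%N -> valued origin x 0 -> valued origin (x ^+ k) 0.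
  by move=> k0 h; have := valuedX k h; rewrite expr0n eqn0Ngt k0.
apply: (superformula_valued (eta_neq0 N) q1' tq1' A1).
- exact: (vp _ _ _ valued_u).
- exact: valued_v.
- exact: (vp _ _ _ (vp _ _ _ valued_v)).
have C (F : fieldType) (x : F) : x != 0 -> (x ^+ 2) ^+ N.+1 / x ^+ 2 = (x ^+ 2) ^+ N.
  by move=> x0; rewrite exprSr mulfK ?expf_neq0.
by rewrite (C _ v v_neq0); apply: (vp _ _ N0 (vp _ _ _ valued_v)).
Qed.
End Normalize.

Module TrefoilFormula.
Import PowerSeries WeightedSums RogersPairing ScalarSums SuperFormula.

Lemma sum_triangle (V : zmodType) m (F : nat -> nat -> V) :
  \sum_(k < m.+1) \sum_(r < k.+1) F k r = \sum_(r < m.+1) \sum_(i < (m - r).+1) F (r + i)%N r.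
Proof.
elim: m => [|m IH].
  by rewrite !big_ord1.
rewrite big_ord_recr IH /= [RHS]big_ord_recr /= subnn [in RHS]big_ord1 addn0.
rewrite [X in _ + X]big_ord_recr /= addrA; congr (_ + _); rewrite -big_split /=; apply: eq_bigr => r _.
by rewrite subSn; [rewrite [RHS]big_ord_recr /=; congr (_ + F _ _); have := ltn_ord r; lia | have := ltn_ord r; lia].
Qed.

Definition trefoil_sum (F : fieldType) (q t a : F) (m : nat) : F :=
  \sum_(k < m.+1) q ^+ (m * k) * t ^+ k *
    (qpoch q q m * qpoch (- a / t) q k / (qpoch q q k * qpoch q q (m - k))).

Section QBinomial.
Variables (K : fieldType) (q : K).
Hypothesis q1 : forall n : nat, 1 - q ^+ n.+1 != 0.
Local Notation qp := (fun x => qpoch x q).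

Lemma qpochS (x : K) n : qpoch x q n.+1 = qpoch x q n * (1 - x * q ^+ n).
Proof. by rewrite /qpoch big_ord_recr. Qed.

Lemma qpoch0 (x : K) : qpoch x q 0 = 1. Proof. by rewrite /qpoch big_ord0. Qed.

Lemma qpochD (x : K) m n : qpoch x q (m + n) = qpoch x q m * qpoch (x * q ^+ m) q n.
Proof.
elim: n => [|n IH]; first by rewrite addn0 qpoch0 mulr1.
by rewrite addnS !qpochS IH -!mulrA exprD !mulrA.
Qed.

Lemma qfac_neq0 n : qpoch q q n != 0.
Proof. by apply/prodf_neq0 => i _; rewrite -exprS. Qed.

(* [qw n j] is the q-binomial coefficient divided by [(q; q)_n]; the next two
   lemmas are the two halves of the q-Pascal rule. *)
Definition qw n j : K := (qpoch q q (n - j) * qpoch q q j)^-1.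

Lemma qw_sum1 n (G : nat -> K) :
  \sum_(j < n.+2) qw n.+1 j * (1 - q ^+ (n.+1 - j)) * G j = \sum_(j < n.+1) qw n j * G j.
Proof.
rewrite big_ord_recr /= subnn expr0 subrr mulr0 mul0r addr0; apply: eq_bigr => j _.
congr (_ * _); rewrite /qw subSn; last by have := ltn_ord j; lia.
rewrite qpochS -exprS; move: (qfac_neq0 (n - j)) (qfac_neq0 j) (q1 (n - j)).
by move: (qpoch _ _ _) (qpoch _ _ _) (1 - _) => x y z x0 y0 z0; field; rewrite x0 y0 z0.
Qed.

Lemma qw_sum2 n (G : nat -> K) :
  \sum_(j < n.+2) qw n.+1 j * (1 - q ^+ j) * G j = \sum_(j < n.+1) qw n j * G j.+1.
Proof.
rewrite big_ord_recl /= expr0 subrr mulr0 mul0r add0r; apply: eq_bigr => j _.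
rewrite /bump /= add1n; congr (_ * _); rewrite /qw subSS qpochS -exprS.
move: (qfac_neq0 (n - j)) (qfac_neq0 j) (q1 j).
by move: (qpoch _ _ _) (qpoch _ _ _) (1 - _) => x y z x0 y0 z0; field; rewrite x0 y0 z0.
Qed.

Lemma qw_split n (G1 G2 G : nat -> K) :
  (forall j, (j <= n.+1)%N -> (1 - q ^+ n.+1) * G j = (1 - q ^+ (n.+1 - j)) * G1 j + (1 - q ^+ j) * G2 j) ->
  (1 - q ^+ n.+1) * (\sum_(j < n.+2) qw n.+1 j * G j) = \sum_(j < n.+1) qw n j * (G1 j + G2 j.+1).
Proof.
move=> H; under [RHS]eq_bigr => j _ do rewrite mulrDr.
rewrite big_split /=; apply: etrans (congr2 +%R (qw_sum1 n G1) (qw_sum2 n G2)).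
rewrite -big_split /= mulr_sumr; apply: eq_bigr => j _ /=.
by rewrite mulrCA H; [rewrite mulrDr !mulrA | have := ltn_ord j; lia].
Qed.

Lemma q_vandermonde n (a b : K) :
  qpoch (a * b) q n = qpoch q q n * \sum_(j < n.+1) qw n j * (b ^+ (n - j) * qpoch a q (n - j) * qpoch b q j).
Proof.
elim: n => [|n IH].
  by rewrite big_ord1 /qw /= subnn !qpoch0 expr0 !mulr1 invr1 ?mul1r.
rewrite [qpoch q q n.+1]qpochS -exprS -mulrA
  (@qw_split n (fun j => b * q ^+ j * (1 - a * q ^+ (n - j)) * (b ^+ (n - j) * qpoch a q (n - j) * qpoch b q j))
     (fun j => b ^+ (n.+1 - j) * qpoch a q (n.+1 - j) * qpoch b q j)
     (fun j => b ^+ (n.+1 - j) * qpoch a q (n.+1 - j) * qpoch b q j)).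
  rewrite qpochS IH -mulrA mulr_suml; congr (_ * _); apply: eq_bigr => j _.
  rewrite subSS -mulrA; congr (_ * _); rewrite (qpochS b).
  have -> : q ^+ n = q ^+ (n - j) * q ^+ j by rewrite -exprD subnK // -ltnS.
  by move: (qpoch _ _ _) (qpoch _ _ _) (q ^+ _) (q ^+ _) (b ^+ _) => x y z w s; ring.
move=> j; rewrite leq_eqVlt => /orP[/eqP ->|].
  by rewrite subnn expr0 subrr mul0r add0r.
rewrite ltnS => jn; rewrite subSn // qpochS !exprS.
have -> : q ^+ n = q ^+ (n - j) * q ^+ j by rewrite -exprD subnK.
move: (qpoch _ _ _) (qpoch _ _ _) (q ^+ _) (q ^+ _) (b ^+ _) => x y z w s; ring.
Qed.

Definition wpc (T h : K) s i := (- T) ^+ s * q ^+ (s * i) * h ^+ (s * s.+1).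

Lemma very_well_poised_sum (h : K) M (T : K) : q = h ^+ 2 -> (forall n : nat, 1 - T * q ^+ n != 0) ->
  \sum_(i < M.+1) qw M i * (wpc T h (M - i) i * (1 - T * q ^+ (2 * i)) / qpoch (T * q ^+ i) q M.+1) =
  (qpoch q q M)^-1.
Proof.
move=> qh; elim: M T => [|M IH] T T1.
  have := T1 0; rewrite big_ord_recl big_ord0 /qw /wpc subnn qpochS !qpoch0 !expr0 !mulr1 invr1 !mul1r addr0 => h0.
  by rewrite divff ?invr1.
have T1' n i : 1 - T * q ^+ i * q ^+ n != 0 by rewrite -mulrA -exprD.
have TP n i : qpoch (T * q ^+ i) q n != 0 by apply/prodf_neq0 => j _; exact: T1'.
apply: (mulfI (q1 M)); rewrite qpochS -exprS invfM mulrCA mulfV // mulr1.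
rewrite (@qw_split M (fun i => wpc T h (M.+1 - i) i * q ^+ i / qpoch (T * q ^+ i.+1) q M.+1)
    (fun i => wpc T h (M.+1 - i) i / qpoch (T * q ^+ i) q M.+1)
    (fun i => wpc T h (M.+1 - i) i * (1 - T * q ^+ (2 * i)) / qpoch (T * q ^+ i) q M.+2)).
  have Tq1 n : 1 - (T * q) * q ^+ n != 0 by rewrite -mulrA -exprS.
  rewrite -(IH (T * q) Tq1); apply: eq_bigr => i _; congr (_ * _).
  have iM := ltn_ord i; rewrite -!(mulrA T q) -!exprS subSS -mulrDl; congr (_ / _).
  rewrite subSn; last by lia.
  move: (M - i)%N => s; rewrite /wpc.
  have -> : q ^+ (s * i.+1) = q ^+ (s * i) * q ^+ s by rewrite -exprD; congr (_ ^+ _); lia.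
  have -> : q ^+ (s.+1 * i) = q ^+ (s * i) * q ^+ i by rewrite -exprD; congr (_ ^+ _); lia.
  have -> : h ^+ (s.+1 * s.+2) = h ^+ (s * s.+1) * (q * q ^+ s).
    by rewrite -exprS qh -exprM -exprD; congr (_ ^+ _); lia.
  have -> : (- (T * q)) ^+ s = (- T) ^+ s * q ^+ s by rewrite -mulNr exprMn.
  have -> : q ^+ (2 * i).+1 = q * (q ^+ i * q ^+ i) by rewrite -exprD -exprS; congr (_ ^+ _); lia.
  rewrite exprS; move: (q ^+ s) (q ^+ _) (h ^+ _) (_ ^+ s) (q ^+ i) => a b c d x; ring.
move=> i iM.
have e1 : qpoch (T * q ^+ i) q M.+2 = (1 - T * q ^+ i) * qpoch (T * q ^+ i.+1) q M.+1.
  by rewrite -add1n qpochD qpochS qpoch0 mul1r expr0 mulr1 expr1 -mulrA -exprSr.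
have e2 : qpoch (T * q ^+ i) q M.+2 = qpoch (T * q ^+ i) q M.+1 * (1 - T * q ^+ i * q ^+ M.+1) := qpochS _ _.
have n1 := T1 i; have n2 := T1' M.+1 i.
have p1 := TP M.+1 i.+1; have p2 := TP M.+1 i; have p3 := TP M.+2 i.
have E1 : (qpoch (T * q ^+ i.+1) q M.+1)^-1 = (1 - T * q ^+ i) / qpoch (T * q ^+ i) q M.+2.
  by rewrite e1; move: p1 n1; move: (qpoch _ _ _) => z z0 n1; field; rewrite z0 n1.
have E2 : (qpoch (T * q ^+ i) q M.+1)^-1 = (1 - T * q ^+ i * q ^+ M.+1) / qpoch (T * q ^+ i) q M.+2.
  by rewrite e2; move: p2 n2; move: (qpoch _ _ _) (1 - _ * _ * _) => z w z0 n2'; field; rewrite z0 n2'.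
rewrite E1 E2.
have -> : q ^+ (2 * i) = q ^+ i * q ^+ i by rewrite -exprD; congr (_ ^+ _); lia.
have -> : q ^+ M.+1 = q ^+ (M.+1 - i) * q ^+ i by rewrite -exprD; congr (_ ^+ _); lia.
move: ((qpoch (T * q ^+ i) q M.+2)^-1) (wpc T h (M.+1 - i) i) => z w.
move: (q ^+ i) (q ^+ (M.+1 - i)) => x y; ring.
Qed.
End QBinomial.

Section Trefoil.
Variables (K : fieldType) (qh th A : K).
Local Notation q := (qh ^+ 2).
Local Notation t := (th ^+ 2).
Hypothesis qh0 : qh != 0.
Hypothesis th0 : th != 0.
Hypothesis q1 : forall n : nat, 1 - q ^+ n.+1 != 0.
Hypothesis t1 : forall n : nat, 1 - t * q ^+ n != 0.
Hypothesis A1 : forall n : nat, 1 - A * q ^+ n != 0.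

Lemma trefoil_exponents r i s : let m := (r + i + s)%N in let k := (r + i)%N in
  (-1) ^+ s * (t ^+ s * qh ^+ (s * (2 * k + 1 + s)) * (t ^+ s * q ^+ (s * (2 * k + s))) ^+ 1) * (t * q ^+ k) ^+ i =
  q ^+ (m * (i + s)) * t ^+ (i + s) * wpc q (t * q ^+ (2 * r)) qh s i.
Proof.
move=> m k; rewrite /wpc expr1 [(- (t * _)) ^+ s]exprNn.
have e1 : (t * q ^+ k) ^+ i = t ^+ i * qh ^+ (2 * k * i) by rewrite exprMn -!exprM.
have e2 : (t * q ^+ (2 * r)) ^+ s = t ^+ s * qh ^+ (2 * (2 * r) * s) by rewrite exprMn -!exprM.
rewrite e1 e2 exprD -[q ^+ (s * (2 * k + s))]exprM -[q ^+ (m * _)]exprM -[q ^+ (s * i)]exprM.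
have : qh ^+ (s * (2 * k + 1 + s)) * qh ^+ (2 * (s * (2 * k + s))) * qh ^+ (2 * k * i) =
   qh ^+ (2 * (m * (i + s))) * qh ^+ (2 * (2 * r) * s) * qh ^+ (2 * (s * i)) * qh ^+ (s * s.+1).
  by rewrite -!exprD; congr (_ ^+ _); rewrite /m /k; lia.
move: (qh ^+ (s * (2 * k + 1 + s))) (qh ^+ (2 * (s * (2 * k + s)))) (qh ^+ (2 * k * i)) (qh ^+ (2 * (m * (i + s))))
  (qh ^+ (2 * (2 * r) * s)) (qh ^+ (2 * (s * i))) (qh ^+ (s * s.+1)) => a b c d e f g E.
move: (t ^+ i) (t ^+ s) ((-1) ^+ s) => x y z.
transitivity (z * x * y * y * (a * b * c)); first ring.
by rewrite E; ring.
Qed.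

Lemma superformula_trefoil m : superformula qh th (- A) 1 m = trefoil_sum q t (- A) m.
Proof.
rewrite /superformula /trefoil_sum opprK mulr_sumr.
pose F k r := qpoch q q m / (1 - t) * ((-1) ^+ (m - k) *
    (t ^+ (m - k) * qh ^+ ((m - k) * (2 * k + 1 + (m - k))) * (t ^+ (m - k) * q ^+ ((m - k) * (2 * k + (m - k)))) ^+ 1)) *
    (qpoch t q k * qpoch (A / t) q (m - k) * (1 - q ^+ (2 * k) * t) / (qpoch (q * t) q (m + k) * qpoch q q (m - k))) *
    (qw q k r * ((t * q ^+ k) ^+ (k - r) * qpoch (A / t * q ^+ (m - k)) q (k - r) * qpoch (t * q ^+ k) q r)).
have t0 : t != 0 by rewrite expf_neq0.
have t10 : 1 - t != 0 by have := t1 0; rewrite expr0 mulr1.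
have qq n := qfac_neq0 q1 n.
have tt j n : qpoch (t * q ^+ j) q n != 0 by apply/prodf_neq0 => i _; rewrite -mulrA -exprD.
have tqq n : qpoch (q * t) q n != 0 by have := tt 1 n; rewrite expr1 mulrC.
have AA n : qpoch A q n != 0 by apply/prodf_neq0.
transitivity (\sum_(k < m.+1) \sum_(r < k.+1) F k r).
  apply: eq_bigr => -[k /= km] _; rewrite -mulr_sumr.
  have [s ms] : exists s, m = (k + s)%N by exists (m - k)%N; rewrite subnKC.
  have e : (m - k = s)%N by lia.
  have PP := pow_part th qh0 1 k s.
  rewrite -[(-1) ^+ (m - k) * _ * _]mulrA e -PP -ms.
  have eA : A * q ^+ m = (A / t * q ^+ s) * (t * q ^+ k).
    by rewrite ms exprD; move: (q ^+ _) (q ^+ _) t0 => a b c; field.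
  rewrite (qpochD q A m k) eA (q_vandermonde q1); move: (\sum_(_ < _) _) => S.
  move: (qq k) (qq m) (qq s) (tqq (m + k)%N) (AA m).
  move: (qpoch _ _ _) (qpoch _ _ _) (qpoch _ _ _) (qpoch _ _ _) (qpoch _ _ _) (qpoch _ _ _) (qpoch _ _ _).
  move: ((qh * th) ^+ s * _) ((-1) ^+ s) (q ^+ (2 * k)) => x1 x2 x3 y1 y2 y3 y4 y5 y6 y7.
  by move=> ? ? ? ? ?; field; do ?[apply/andP; split].
rewrite sum_triangle [RHS](reindex_inj rev_ord_inj) /=; apply: eq_bigr => -[r /= rm] _.
rewrite subSS; set M := (m - r)%N; have mr : (m - M = r)%N by rewrite /M; lia.
pose T := t * q ^+ (2 * r).
have T1 n : 1 - T * q ^+ n != 0 by rewrite /T -mulrA -exprD.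
transitivity (qpoch q q m / qpoch q q r * qpoch (A / t) q M * (q ^+ (m * M) * t ^+ M) *
  \sum_(i < M.+1) qw q M i * (wpc q T qh (M - i) i * (1 - T * q ^+ (2 * i)) / qpoch (T * q ^+ i) q M.+1)).
  rewrite mulr_sumr; apply: eq_bigr => -[i /= iM] _.
  have [s Ms] : exists s, M = (i + s)%N by exists (M - i)%N; rewrite subnKC.
  have e1 : (m - (r + i) = s)%N by rewrite /M in Ms; lia.
  have e2 : (r + i - r = i)%N by lia.
  have e3 : (M - i = s)%N by lia.
  have ms : m = (r + i + s)%N by rewrite /M in Ms; lia.
  rewrite /F e1 e2 e3.
  have EX := trefoil_exponents r i s; rewrite /= -ms -Ms in EX.
  rewrite /qw e2 e3.
  have eB : qpoch (A / t) q M = qpoch (A / t) q s * qpoch (A / t * q ^+ s) q i by rewrite -qpochD addnC -Ms.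
  have eT : qpoch t q (r + i) * qpoch (t * q ^+ (r + i)) q r = qpoch t q (2 * r + i).
    by rewrite -qpochD; congr qpoch; lia.
  have eD : (1 - t) * qpoch (q * t) q (m + (r + i)) = qpoch t q (2 * r + i) * qpoch (T * q ^+ i) q M.+1.
    rewrite /T -mulrA -exprD -qpochD [q * t]mulrC.
    have := qpochD q t 1 (m + (r + i)); rewrite qpochS qpoch0 mul1r expr0 mulr1 expr1 => <-.
    by congr qpoch; rewrite ms Ms; lia.
  have eQ : q ^+ (2 * (r + i)) * t = T * q ^+ (2 * i) by rewrite /T mulnDr exprD; ring.
  have d0 : qpoch t q (2 * r + i) != 0 by have := tt 0 (2 * r + i)%N; rewrite expr0 mulr1.
  have d1 : qpoch (T * q ^+ i) q M.+1 != 0 by rewrite /T -mulrA -exprD.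
  rewrite eQ eB; move: EX eT eD d0 d1 (tqq (m + (r + i))%N) (qq r) (qq i) (qq s).
  move: (q ^+ (m * M)) (t ^+ M) (wpc _ _ _ _ _) ((t * q ^+ (r + i)) ^+ i) => x1 x2 x3 x4.
  move: ((-1) ^+ s * _) (1 - T * _) => x5 x6.
  move: (qpoch t q (r + i)) (qpoch (t * _) q r) (qpoch t q (2 * r + i)) (qpoch (q * t) q _) (qpoch (T * _) _ _) => y1 y2 y3 y4 y5.
  move: (qpoch q q r) (qpoch q q i) (qpoch q q s) (qpoch q q m) (qpoch (A / t) q s) (qpoch (A / t * _) q i) => z1 z2 z3 z4 z5 z6.
  move=> EX eT eD d0 d1 n4 n1 n2 n3.
  have E4 : y4^-1 = (1 - t) * (y1 * y2)^-1 * y5^-1.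
    by rewrite -mulrA -invfM eT -eD invfM mulVKf // mulKf.
  have y12 : y1 * y2 != 0 by rewrite eT.
  move: y12; rewrite mulf_eq0 negb_or => /andP[y10 y20].
  transitivity (z4 / (1 - t) * z5 * z6 * (x5 * x4) * x6 * (y1 * y2 * y4^-1) / (z1 * z2 * z3)).
    by field; do ?[apply/andP; split].
  rewrite EX E4; field; do ?[apply/andP; split]; done.
rewrite very_well_poised_sum // mr.
by move: (qq r) (qq M); move: (qpoch _ _ _) (qpoch _ _ _) (qpoch _ _ _) (qpoch _ _ _) => a b c d a0 b0; field; do ?[apply/andP; split].
Qed.
End Trefoil.
End TrefoilFormula.

Module Specialize.
Import Generators PowerSeries OneRow WeightedSums KnotVector RogersPairing TwoRow ScalarSums SuperFormula KnotValue OriginIdeal TrefoilFormula.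

Local Notation "x %:F" := (@FracField.tofrac _ x).

Definition ev3 (R : comNzRingType) (x y z : R) : {rmorphism {poly {poly {poly int}}} -> R} :=
  horner_eval x \o map_poly (horner_eval y \o map_poly (horner_eval z \o map_poly intr)).

Lemma horner_eval_map (A R S : comNzRingType) (f : {rmorphism R -> S}) (g : {rmorphism A -> R}) (h : {rmorphism A -> S}) (x : R) :
  (forall c, f (g c) = h c) -> forall P : {poly A}, f ((map_poly g P).[x]) = (map_poly h P).[f x].
Proof. by move=> E P; rewrite -horner_map -map_poly_comp; congr (_.[_]); apply: eq_map_poly. Qed.

Lemma ev3_morph (R S : comNzRingType) (f : {rmorphism R -> S}) x y z P :
  f (ev3 x y z P) = ev3 (f x) (f y) (f z) P.
Proof.
apply: horner_eval_map => Q; apply: horner_eval_map => c; apply: horner_eval_map => k.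
exact: rmorph_int.
Qed.

Lemma horner_power_neq0 (f : {poly {poly int}}) : f != 0 -> exists M, forall l, (M <= l)%N ->
  (map_poly (map_poly intr : {poly int} -> {poly rat}) f).[- 'X^(l.+1)] != 0.
Proof.
elim/poly_ind: f => [|f c IH]; first by rewrite eqxx.
have [->|c0] := eqVneq c 0.
  rewrite polyC0 addr0 mulf_eq0 negb_or => /andP[/IH[M h] _]; exists M => l /h hl.
  by rewrite rmorphM /= map_polyX hornerM hornerX mulf_neq0 // oppr_eq0 monic_neq0 // monicXn.
move=> _; pose d : {poly rat} := map_poly intr c.
have dE i : d`_i = (c`_i)%:~R by rewrite coef_map.
exists (size c) => l sl; rewrite rmorphD rmorphM /= map_polyX map_polyC hornerD hornerM hornerX hornerC /=.
apply/eqP => /(congr1 (fun g : {poly rat} => g`_(size c).-1)); rewrite coefD mulrN coefN coefMXn coef0 -/d dE.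
have lc : (size c > 0)%N by rewrite lt0n size_poly_eq0.
rewrite ifT; last by lia.
by rewrite oppr0 add0r; apply/eqP; rewrite intr_eq0 -/(lead_coef c) lead_coef_eq0.
Qed.

Lemma map_poly_intrE (c : {poly int}) : (map_poly intr c : {poly rat}) = (map_poly (intr : int -> {poly rat}) c).['X].
Proof.
rewrite -[LHS]comp_polyXr /comp_poly -map_poly_comp; congr (_.[_]); apply: eq_map_poly => k /=.
exact: (rmorph_int polyC).
Qed.

Lemma ev3_powers_neq0 (P : {poly {poly {poly int}}}) : P != 0 -> exists M, forall n l, (M <= l)%N ->
  ev3 ('X^(n.+1) : coefRing) (- 'X^(l.+1))%:P ('X)%:P P != 0.
Proof.
rewrite -lead_coef_eq0 => /horner_power_neq0[M h]; exists M => n l /h hl.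
pose g : {rmorphism {poly {poly int}} -> {poly rat}} :=
  horner_eval (- 'X^(l.+1)) \o map_poly (map_poly intr : {poly int} -> {poly rat}).
have E : ev3 ('X^(n.+1) : coefRing) (- 'X^(l.+1))%:P ('X)%:P P = (map_poly g P) \Po 'X^(n.+1).
  rewrite /comp_poly /ev3 /= /horner_eval -map_poly_comp; congr (_.[_]); apply: eq_map_poly => Q /=.
  apply: esym; apply: (@horner_eval_map {poly int} {poly rat} coefRing polyC (map_poly intr) (horner_eval ('X)%:P \o map_poly intr)) => c.
  apply: etrans (congr1 polyC (map_poly_intrE c)) _.
  by apply: (@horner_eval_map int {poly rat} coefRing polyC intr intr) => k; exact: (rmorph_int polyC).
rewrite E comp_poly_eq0 ?size_polyXn //.
apply: contraNneq hl => /(congr1 (fun p : coefRing => p`_(size P).-1)).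
by rewrite coef_map coef0 /= /horner_eval -/(lead_coef P) => ->.
Qed.

Section Specialization.
Variables (B : comNzRingType) (F G : fieldType) (e : {rmorphism B -> F}) (en : nat -> {rmorphism B -> G}).
Hypothesis e_neq0 : forall P, P != 0 -> e P != 0.
Hypothesis en_neq0 : forall P, P != 0 -> exists M, forall n, (M <= n)%N -> en n P != 0.

(* [g n] is the value of [f] at the [n]-th point for all large [n], where [f] is
   viewed as a fraction of elements of [B]. *)
Definition spec (f : F) (g : nat -> G) := exists nu d, [/\ d != 0, f * e d = e nu &
  exists M, forall n, (M <= n)%N -> g n * en n d = en n nu].

Lemma spec_base P : spec (e P) (fun n => en n P).
Proof.
exists P, 1; split; [exact: oner_neq0 | by rewrite rmorph1 mulr1|].
by exists 0%N => n _; rewrite rmorph1 mulr1.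
Qed.

Lemma spec_near f g g' : spec f g -> (exists M, forall n, (M <= n)%N -> g n = g' n) -> spec f g'.
Proof.
move=> [nu [d [d0 h [M hM]]]] [M' hM']; exists nu, d; split=> //; exists (maxn M M') => n.
by rewrite geq_max => /andP[/hM E /hM' <-].
Qed.

Lemma B_domain (P Q : B) : P != 0 -> Q != 0 -> P * Q != 0.
Proof.
move=> /e_neq0 p0 /e_neq0 q0; apply: contraTneq (mulf_neq0 p0 q0) => E.
by rewrite -rmorphM E rmorph0 eqxx.
Qed.

Lemma specD f g f' g' : spec f g -> spec f' g' -> spec (f + f') (fun n => g n + g' n).
Proof.
move=> [nu [d [d0 h [M hM]]]] [nu' [d' [d0' h' [M' hM']]]].
exists (nu * d' + nu' * d), (d * d'); split.
- exact: B_domain.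
- by rewrite rmorphD !rmorphM -h -h'; ring.
by exists (maxn M M') => n; rewrite geq_max => /andP[/hM E /hM' E']; rewrite rmorphD !rmorphM -E -E'; ring.
Qed.

Lemma specM f g f' g' : spec f g -> spec f' g' -> spec (f * f') (fun n => g n * g' n).
Proof.
move=> [nu [d [d0 h [M hM]]]] [nu' [d' [d0' h' [M' hM']]]].
exists (nu * nu'), (d * d'); split.
- exact: B_domain.
- by rewrite !rmorphM -h -h'; ring.
by exists (maxn M M') => n; rewrite geq_max => /andP[/hM E /hM' E']; rewrite !rmorphM -E -E'; ring.
Qed.

Lemma specN f g : spec f g -> spec (- f) (fun n => - g n).
Proof.
move=> [nu [d [d0 h [M hM]]]]; exists (- nu), d; rewrite rmorphN -h mulNr; split=> //.
by exists M => n /hM E; rewrite rmorphN -E mulNr.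
Qed.

Lemma specB f g f' g' : spec f g -> spec f' g' -> spec (f - f') (fun n => g n - g' n).
Proof. by move=> h h'; exact: specD h (specN h'). Qed.

Lemma spec0 : spec 0 (fun=> 0).
Proof. by have := spec_base 0; rewrite rmorph0 => /spec_near; apply; exists 0%N => n _; rewrite rmorph0. Qed.

Lemma spec1 : spec 1 (fun=> 1).
Proof. by have := spec_base 1; rewrite rmorph1 => /spec_near; apply; exists 0%N => n _; rewrite rmorph1. Qed.

Lemma spec_int k : spec k%:~R (fun=> k%:~R).
Proof. by have := spec_base k%:~R; rewrite rmorph_int => /spec_near; apply; exists 0%N => n _; rewrite rmorph_int. Qed.

Lemma specX f g k : spec f g -> spec (f ^+ k) (fun n => g n ^+ k).
Proof.
move=> h; elim: k => [|k IH]; first exact: spec1.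
rewrite exprS; apply: spec_near (specM h IH) _; exists 0%N => n _; by rewrite exprS.
Qed.

Lemma spec_sum (I : Type) (s : seq I) (f : I -> F) (g : I -> nat -> G) :
  (forall i, spec (f i) (g i)) -> spec (\sum_(i <- s) f i) (fun n => \sum_(i <- s) g i n).
Proof.
move=> h; elim: s => [|i s IH].
  by rewrite big_nil; apply: spec_near spec0 _; exists 0%N => n _; rewrite big_nil.
by rewrite big_cons; apply: spec_near (specD (h i) IH) _; exists 0%N => n _; rewrite big_cons.
Qed.

Lemma spec_prod (I : Type) (s : seq I) (f : I -> F) (g : I -> nat -> G) :
  (forall i, spec (f i) (g i)) -> spec (\prod_(i <- s) f i) (fun n => \prod_(i <- s) g i n).
Proof.
move=> h; elim: s => [|i s IH].
  by rewrite big_nil; apply: spec_near spec1 _; exists 0%N => n _; rewrite big_nil.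
by rewrite big_cons; apply: spec_near (specM (h i) IH) _; exists 0%N => n _; rewrite big_cons.
Qed.

Lemma spec_eq0 f g : spec f g -> (exists M, forall n, (M <= n)%N -> g n = 0) -> f = 0.
Proof.
move=> [nu [d [d0 h [M hM]]]] [M' hM']; have [nu0|nu0] := eqVneq nu 0.
  by move/eqP: h; rewrite nu0 rmorph0 mulf_eq0 (negbTE (e_neq0 d0)) orbF => /eqP.
have [L hL] := en_neq0 nu0; pose n := maxn L (maxn M M').
have n1 : (M <= n)%N by rewrite /n; lia.
have n2 : (M' <= n)%N by rewrite /n; lia.
have n3 : (L <= n)%N by rewrite /n; lia.
by have := hM _ n1; rewrite hM' // mul0r => /esym/eqP; rewrite (negbTE (hL _ n3)).
Qed.

Lemma specV f g : spec f g -> spec f^-1 (fun n => (g n)^-1).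
Proof.
move=> [nu [d [d0 h [M hM]]]]; have [L hL] := en_neq0 d0.
have [nu0|nu0] := eqVneq nu 0.
  have -> : f = 0 by move/eqP: h; rewrite nu0 rmorph0 mulf_eq0 (negbTE (e_neq0 d0)) orbF => /eqP.
  rewrite invr0; apply: spec_near spec0 _; exists (maxn L M) => n; rewrite geq_max => /andP[/hL dn /hM /eqP].
  by rewrite nu0 rmorph0 mulf_eq0 (negbTE dn) orbF => /eqP ->; rewrite invr0.
have V (K : fieldType) (a b c : K) : c != 0 -> a * b = c -> a^-1 * c = b.
  by move=> c0 E; move: c0; rewrite -E mulf_eq0 negb_or => /andP[a0 _]; rewrite mulKf.
have [L' hL'] := en_neq0 nu0; exists d, nu; split=> //; first exact: V (e_neq0 nu0) h.
by exists (maxn L' M) => n; rewrite geq_max => /andP[/hL' n0 /hM E]; exact: V n0 E.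
Qed.

Lemma spec_div f g f' g' : spec f g -> spec f' g' -> spec (f / f') (fun n => g n / g' n).
Proof. by move=> h /specV; exact: specM. Qed.

Lemma spec_pow_int f g (k : int) : spec f g -> spec (f ^ k) (fun n => g n ^ k).
Proof. by case: k => k h; [exact: specX | exact: specV (specX _ h)]. Qed.

Lemma spec_rat k : spec (ratr k) (fun=> ratr k).
Proof. by rewrite /ratr; apply: specM (specV _); apply: spec_int. Qed.

Lemma spec_sp_eval H a b c a' b' c' : spec a a' -> spec b b' -> spec c c' ->
  spec (sp_eval a b c H) (fun n => sp_eval (a' n) (b' n) (c' n) H).
Proof.
move=> ha hb hc; apply: spec_sum => i; apply: specM; first exact: spec_rat.
exact: specM (specM (specX _ ha) (specX _ hb)) (spec_pow_int _ hc).
Qed.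

Lemma spec_qpoch a b a' b' k : spec a a' -> spec b b' ->
  spec (qpoch a b k) (fun n => qpoch (a' n) (b' n) k).
Proof. by move=> ha hb; apply: spec_prod => i; apply: specB spec1 (specM ha (specX _ hb)). Qed.

Lemma spec_superformula a b c a' b' c' p m : spec a a' -> spec b b' -> spec c c' ->
  spec (superformula a b c p m) (fun n => superformula (a' n) (b' n) (c' n) p m).
Proof.
move=> ha hb hc; have ha2 := specX 2 ha; have hb2 := specX 2 hb; have hN := specN spec1.
apply: specM; first exact: spec_div (spec_qpoch m ha2 ha2) (specM (spec_qpoch m (specN hc) ha2) (specB spec1 hb2)).
apply: spec_sum => k; apply: specM.
  apply: specM; first exact: specM (specX _ hN) (specX _ (specM ha hb)).
  exact: specX (specM (specX _ ha2) (specX _ (spec_div hb ha))).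
apply: spec_div; last exact: specM (specM (spec_qpoch _ ha2 ha2) (spec_qpoch _ (specM ha2 hb2) ha2)) (spec_qpoch _ ha2 ha2).
apply: specM (specB spec1 (specM (specX _ ha2) hb2)).
exact: specM (specM (spec_qpoch _ hb2 ha2) (spec_qpoch _ (specN hc) ha2)) (spec_qpoch _ (spec_div (specN hc) hb2) ha2).
Qed.

Lemma spec_trefoil a b c a' b' c' m : spec a a' -> spec b b' -> spec c c' ->
  spec (trefoil_sum a b c m) (fun n => trefoil_sum (a' n) (b' n) (c' n) m).
Proof.
move=> ha hb hc;
apply: spec_sum => k; apply: specM; first exact: specM (specX _ ha) (specX _ hb).
apply: spec_div; last exact: specM (spec_qpoch _ ha ha) (spec_qpoch _ ha ha).
exact: specM (spec_qpoch _ ha ha) (spec_qpoch _ (spec_div (specN hc) hb) ha).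
Qed.
End Specialization.

Lemma ev3_frac_neq0 (R : idomainType) (x y z : R) P : ev3 x y z P != 0 -> ev3 x%:F y%:F z%:F P != 0.
Proof. by rewrite -(ev3_morph (@FracField.tofrac R)) tofrac_eq0. Qed.

Lemma ev3_coefField_neq0 P : P != 0 -> exists M, forall n l, (M <= l)%N ->
  ev3 (u ^+ n.+1) (- v ^+ l.+1) v P != 0.
Proof.
move=> /ev3_powers_neq0[M h]; exists M => n l /(h n) /ev3_frac_neq0.
by rewrite tofracXn polyCN tofracN polyC_exp tofracXn.
Qed.

Lemma horner_ev3 (R : comNzRingType) (x w z : R) P : (ev3 x%:P 'X z%:P P).[w] = ev3 x w z P.
Proof.
have E := ev3_morph (horner_eval w) x%:P 'X z%:P P.
apply: etrans E _; apply: (congr1 (fun f : {rmorphism _ -> R} => f P)) => /=.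
rewrite (_ : horner_eval w x%:P = x); last exact: hornerC.
rewrite (_ : horner_eval w z%:P = z); last exact: hornerC.
by rewrite (_ : horner_eval w 'X = w); last exact: hornerX.
Qed.

Lemma ev3_spField_neq0 P : P != 0 -> ev3 sp_qh sp_a sp_th P != 0.
Proof.
move=> /ev3_coefField_neq0[M /(_ 0%N M (leqnn M)) h]; apply: ev3_frac_neq0.
apply: contraNneq h => E; have := horner_ev3 u (- v ^+ M.+1) v P.
by rewrite E horner0 expr1 => <-.
Qed.

Section Ev3Generators.
Variables (R : comNzRingType) (x y z : R).

Lemma ev3_X : ev3 x y z 'X = x.
Proof. by rewrite /ev3 /= map_polyX horner_evalE hornerX. Qed.

Lemma ev3_Y : ev3 x y z ('X)%:P = y.
Proof. by rewrite /ev3 /= map_polyC horner_evalE hornerC /= map_polyX horner_evalE hornerX. Qed.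

Lemma ev3_Z : ev3 x y z ('X)%:P%:P = z.
Proof. by rewrite /ev3 /= map_polyC horner_evalE hornerC /= map_polyC horner_evalE hornerC /= map_polyX horner_evalE hornerX. Qed.
End Ev3Generators.
End Specialize.

Import Generators PowerSeries OneRow WeightedSums KnotVector RogersPairing TwoRow ScalarSums SuperFormula KnotValue Normalize Specialize TrefoilFormula.

Section Transfer.
Let e : {rmorphism {poly {poly {poly int}}} -> spField} := ev3 sp_qh sp_a sp_th.
Let en (n : nat) : {rmorphism {poly {poly {poly int}}} -> coefField} := ev3 (u ^+ n.+1) (- t ^+ n.+1) v.

Lemma points_neq0 P : P != 0 -> exists M, forall n, (M <= n)%N -> en n P != 0.
Proof.
move=> /ev3_coefField_neq0[M h]; exists M => n Mn.
have := h n (2 * n).+1 (leq_trans Mn (leq_trans (leq_addr _ _) (leqnSn _))).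
by rewrite (_ : v ^+ (2 * n).+2 = t ^+ n.+1) // /t -exprM; congr (_ ^+ _); lia.
Qed.

Let sX : spec e en sp_qh eta.
Proof.
have := spec_base e en 'X; rewrite [e 'X]ev3_X => h; apply: spec_near h _; exists 0%N => n _.
exact: ev3_X.
Qed.

Let sA : spec e en sp_a (fun n => - t ^+ n.+1).
Proof.
have := spec_base e en ('X)%:P; rewrite [e _]ev3_Y => h; apply: spec_near h _; exists 0%N => n _.
exact: ev3_Y.
Qed.

Let sT : spec e en sp_th (fun=> v).
Proof.
have := spec_base e en ('X)%:P%:P; rewrite [e _]ev3_Z => h; apply: spec_near h _; exists 0%N => n _.
exact: ev3_Z.
Qed.

Lemma transfer (H : superpoly) (f : spField) (g : nat -> coefField) : spec e en f g ->
  (forall n, (0 < n)%N -> sp_eval (- t ^+ n.+1) (q n) t H = g n) ->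
  sp_eval sp_a (sp_qh ^+ 2) (sp_th ^+ 2) H = f.
Proof.
move=> sf E; apply/eqP; rewrite -subr_eq0; apply/eqP.
have sE := spec_sp_eval ev3_spField_neq0 points_neq0 H sA (specX ev3_spField_neq0 2 sX) (specX ev3_spField_neq0 2 sT).
apply: (spec_eq0 ev3_spField_neq0 points_neq0 (specB ev3_spField_neq0 sE sf)).
exists 1%N => n n0; apply/eqP; rewrite subr_eq0; apply/eqP; apply: etrans (E n n0).
by rewrite q_eta.
Qed.

Lemma superpoly_formula p m H : (0 < m)%N -> is_superpoly (2 * p + 1) 2 m H ->
  sp_eval sp_a (sp_qh ^+ 2) (sp_th ^+ 2) H = superformula sp_qh sp_th sp_a p m.
Proof.
move=> m0 [_ _ hJ]; apply: (transfer (spec_superformula ev3_spField_neq0 points_neq0 p m sX sT sA)) => n n0.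
exact: (jones_superformula n0 m0 (hJ n)).
Qed.

Lemma superpoly_trefoil m H : (0 < m)%N -> is_superpoly 3 2 m H ->
  sp_eval sp_a (sp_qh ^+ 2) (sp_th ^+ 2) H = trefoil_sum (sp_qh ^+ 2) (sp_th ^+ 2) sp_a m.
Proof.
move=> m0 [_ _ hJ].
apply: (transfer (spec_trefoil ev3_spField_neq0 points_neq0 m (specX ev3_spField_neq0 2 sX) (specX ev3_spField_neq0 2 sT) sA)) => n n0.
have q1' : forall k : nat, 1 - (eta n ^+ 2) ^+ k.+1 != 0 by move=> k; rewrite -(q_eta n); exact: (qn_neq1 n0).
have tq1' k : 1 - v ^+ 2 * (eta n ^+ 2) ^+ k != 0.
  by rewrite -(q_eta n) subr_eq0 eq_sym mulrC; have := qt_neq1 n0 (a := k%:Z) (b := 1); rewrite expr1z -exprnP; apply; right.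
have A1 k : 1 - t ^+ n.+1 * (eta n ^+ 2) ^+ k != 0.
  rewrite -(q_eta n) subr_eq0 eq_sym mulrC; have := qt_neq1 n0 (a := k%:Z) (b := n.+1%:Z).
  by rewrite -!exprnP; apply; right.
apply: etrans (jones_superformula (p := 1) n0 m0 (hJ n)) _.
exact: (superformula_trefoil (eta_neq0 n) v_neq0 q1' tq1' A1).
Qed.
End Transfer.

Theorem mainTheorem6 (p m : nat) (hm : (0 < m)%N) :
  let a := sp_a in
  let qh := sp_qh in
  let th := sp_th in
  let q := qh ^+ 2 in
  let t := th ^+ 2 in
  (forall H : superpoly, is_superpoly (2 * p + 1) 2 m H ->
     sp_eval a q t H =
       qpoch q q m / (qpoch (- a) q m * (1 - t)) *
       \sum_(k < m.+1)
         (-1) ^+ (m - k) * (qh * th) ^+ (m - k) *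
         (q ^+ ((m * m.+1)./2 - (k * k.+1)./2) * (th / qh) ^+ (m - k))
           ^+ (2 * p + 1) *
         (qpoch t q k * qpoch (- a) q (m + k) * qpoch (- a / t) q (m - k)
            * (1 - q ^+ (2 * k) * t)
          / (qpoch q q k * qpoch (q * t) q (m + k) * qpoch q q (m - k)))) /\
  (forall H : superpoly, is_superpoly 3 2 m H ->
     sp_eval a q t H =
       \sum_(k < m.+1)
         q ^+ (m * k) * t ^+ k *
         (qpoch q q m * qpoch (- a / t) q k / (qpoch q q k * qpoch q q (m - k)))).
Proof.
split=> H hH.
  refine (etrans (superpoly_formula hm hH) _); rewrite /superformula; exact (erefl _).
refine (etrans (superpoly_trefoil hm hH) _); rewrite /trefoil_sum; exact (erefl _).
Qed.
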